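(* Let $n\ge 2$, $\mathbb T^n=\mathbb R^n/\mathbb Z^n$, and let $D\subseteq\mathbb R^n$ be an open domain containing the origin. For $0\le\epsilon<1$ let $$H(p,q)=h(p)+\epsilon f(p,q),\qquad (p,q)\in D\times\mathbb T^n,$$ where $\nabla h(0)=\omega_0=(1,\bar\omega_0)\in\mathbb R^n$ with $\bar\omega_0\in[-1,1]^{n-1}$. Assume that $h$ is non-degenerate at the origin (i.e. $\nabla h:D\to\mathbb R^n$ is a local diffeomorphism at $0$), that $H$ is real-analytic on $\bar D\times\mathbb T^n$ (i.e. $h$ and $f$ are analytic on a neighborhood of $\bar D\times\mathbb T^n$ independent of $\epsilon$), and that $\omega_0$ satisfies the Bruno–Rüssmann condition (BR). Then for all $\epsilon$ small enough there exists a real-analytic torus embedding $\Theta_{\omega_0}:\mathbb T^n\to D\times\mathbb T^n$ such that $\Theta_{\omega_0}(\mathbb T^n)$ is invariant under the Hamiltonian flow of $H$ and the flow restricted to it is quasi-periodic with frequency $\omega_0$, i.e. the flow of $H$ maps $\Theta_{\omega_0}(\theta)$ to $\Theta_{\omega_0}(\theta+t\omega_0)$ at time $t$. Moreover, $\Theta_{\omega_0}$ converges uniformly to $\Theta_0$, $\Theta_0(q)=(0,q)$, as $\epsilon\to0$.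
   Context: The Hamiltonian flow of $H$ is given by $\dot p=-\partial_qH$, $\dot q=\partial_pH$. For $k\in\mathbb Z^n$, $|k|_1=|k_1|+\dots+|k_n|$. For $Q\ge1$ define $\Psi(Q)=\Psi_{\omega_0}(Q)=\sup\{|k\cdot\omega_0|^{-1} : k\in\mathbb Z^n,\ 0<|k|_1\le Q\}\in[1,+\infty]$. The vector $\omega_0$ is non-resonant if $k\cdot\omega_0=0$ with $k\in\mathbb Z^n$ implies $k=0$ (equivalently $\Psi(Q)<\infty$ for all $Q\ge1$). $\omega_0$ satisfies the Bruno–Rüssmann condition (BR) if it is non-resonant and $\int_1^{+\infty}Q^{-2}\ln(\Psi(Q))\,dQ<\infty$. *)

(* Defs.v *)
From Stdlib Require Import Reals ZArith.
From mathcomp Require Import ssreflect ssrfun ssrbool eqtype ssrnat seq fintype finfun bigop.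
Set Implicit Arguments. Unset Strict Implicit.

Local Open Scope R_scope.

Definition vec (n : nat) := 'I_n -> R.

Definition vzero (n : nat) : vec n := fun _ => 0.
Arguments vzero n : clear implicits.
Definition vadd (n : nat) (x y : vec n) : vec n := fun i => x i + y i.
Definition vsub (n : nat) (x y : vec n) : vec n := fun i => x i - y i.
Definition vscal (n : nat) (t : R) (x : vec n) : vec n := fun i => t * x i.
Definition ebasis (n : nat) (i : 'I_n) : vec n :=
  fun j => if j == i then 1 else 0.

Definition rsum (n : nat) (F : 'I_n -> R) : R := \big[Rplus/0]_(i < n) F i.
Definition rprod (n : nat) (F : 'I_n -> R) : R := \big[Rmult/1]_(i < n) F i.

Definition dot (n : nat) (x y : vec n) : R := rsum (fun i => x i * y i).

Definition is_int_vec (n : nat) (k : vec n) : Prop :=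
  forall i, exists z : Z, k i = IZR z.

Definition in_ball (n : nat) (x : vec n) (r : R) (y : vec n) : Prop :=
  forall i, Rabs (y i - x i) < r.

Definition is_open (n : nat) (U : vec n -> Prop) : Prop :=
  forall x, U x -> exists r, 0 < r /\ forall y, in_ball x r y -> U y.

Definition closure (n : nat) (D : vec n -> Prop) (x : vec n) : Prop :=
  forall r, 0 < r -> exists y, D y /\ in_ball x r y.

Definition is_connected (n : nat) (D : vec n -> Prop) : Prop :=
  forall A B : vec n -> Prop, is_open A -> is_open B ->
    (forall x, D x -> A x \/ B x) ->
    (exists x, D x /\ A x) -> (exists x, D x /\ B x) ->
    exists x, D x /\ A x /\ B x.

Definition is_domain (n : nat) (D : vec n -> Prop) : Prop :=
  is_open D /\ is_connected D.

(* Real analyticity at x0: a multivariate power series sum_alpha c_alpha (x-x0)^alpha,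
   grouped by total degree k, with sum |c_alpha| r^|alpha| < oo, converging to g
   on the polydisc of radius r. *)
Definition monomials_deg (n k : nat) (c : ('I_n -> nat) -> R) (y : vec n) : R :=
  \big[Rplus/0]_(a : {ffun 'I_n -> 'I_k.+1} | (\sum_(i < n) nat_of_ord (a i))%N == k)
     (c (fun i => nat_of_ord (a i)) * rprod (fun i => y i ^ nat_of_ord (a i))).

Definition abs_monomials_deg (n k : nat) (c : ('I_n -> nat) -> R) (r : R) : R :=
  \big[Rplus/0]_(a : {ffun 'I_n -> 'I_k.+1} | (\sum_(i < n) nat_of_ord (a i))%N == k)
     (Rabs (c (fun i => nat_of_ord (a i))) * r ^ k).

Definition analytic_at (n : nat) (g : vec n -> R) (x0 : vec n) : Prop :=
  exists (c : ('I_n -> nat) -> R) (r : R), 0 < r /\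
    (exists B, forall N, sum_f_R0 (fun k => abs_monomials_deg k c r) N <= B) /\
    (forall x, in_ball x0 r x ->
       Un_cv (fun N => sum_f_R0 (fun k => monomials_deg k c (vsub x x0)) N) (g x)).

Definition joinv (n : nat) (p q : vec n) : vec (n + n) :=
  fun i => match split i with inl j => p j | inr j => q j end.
Definition lpart (n : nat) (z : vec (n + n)) : vec n := fun j => z (lshift n j).
Definition rpart (n : nat) (z : vec (n + n)) : vec n := fun j => z (rshift n j).

Definition analytic2_at (n : nat) (F : vec n -> vec n -> R) (p q : vec n) : Prop :=
  analytic_at (fun z : vec (n + n) => F (lpart z) (rpart z)) (joinv p q).

Definition analytic_near (n : nat) (g : vec n -> R) (S : vec n -> Prop) : Prop :=
  exists U : vec n -> Prop, is_open U /\ (forall x, S x -> U x) /\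
    (forall x, U x -> analytic_at g x).

(* Analytic on a neighbourhood of S x T^n (T^n lifted to R^n). *)
Definition analytic2_near (n : nat) (F : vec n -> vec n -> R) (S : vec n -> Prop) : Prop :=
  exists U : vec (n + n) -> Prop, is_open U /\
    (forall p q, S p -> U (joinv p q)) /\
    (forall p q, U (joinv p q) -> analytic2_at F p q).

Definition periodic_q (n : nat) (F : vec n -> vec n -> R) : Prop :=
  forall p q k, is_int_vec k -> F p (vadd q k) = F p q.

Definition has_partial (n : nat) (g : vec n -> R) (i : 'I_n) (x : vec n) (l : R) : Prop :=
  derivable_pt_lim (fun t => g (vadd x (vscal t (ebasis i)))) 0 l.

Definition has_dir_deriv (n : nat) (g : vec n -> R) (x v : vec n) (l : R) : Prop :=
  derivable_pt_lim (fun t => g (vadd x (vscal t v))) 0 l.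

(* Non-degeneracy of h at 0: the Hessian of h at 0 is an invertible (injective)
   linear map. *)
Definition nondegenerate_at0 (n : nat) (h : vec n -> R) : Prop :=
  exists (r : R) (dh : 'I_n -> vec n -> R) (M : 'I_n -> 'I_n -> R), 0 < r /\
    (forall i x, in_ball (vzero n) r x -> has_partial h i x (dh i x)) /\
    (forall i j, has_partial (dh i) j (vzero n) (M i j)) /\
    (forall v : vec n, (forall i, rsum (fun j => M i j * v j) = 0) -> forall j, v j = 0).

Definition l1norm (n : nat) (k : vec n) : R := rsum (fun i => Rabs (k i)).

Definition nonresonant (n : nat) (w : vec n) : Prop :=
  forall k, is_int_vec k -> dot k w = 0 -> forall i, k i = 0.

Definition is_Psi (n : nat) (w : vec n) (Q v : R) : Prop :=
  is_lub (fun y => exists k, is_int_vec k /\ 0 < l1norm k /\ l1norm k <= Q /\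
                             y = / Rabs (dot k w)) v.

(* The (nonnegative) integrand Q^-2 ln Psi(Q) has finite improper Riemann
   integral over [1, +oo). *)
Definition BR (n : nat) (w : vec n) : Prop :=
  nonresonant w /\
  exists Psi : R -> R, (forall Q, 1 <= Q -> is_Psi w Q (Psi Q)) /\
    exists L, forall T, 1 <= T ->
      exists pr : Riemann_integrable (fun Q => / (Q * Q) * ln (Psi Q)) 1 T,
        RiemannInt pr <= L.

(* A torus embedding T^n -> D x T^n, given by a lift theta |-> (P theta, Q theta). *)
Definition torus_embedding (n : nat) (D : vec n -> Prop) (P Q : vec n -> vec n) : Prop :=
  (forall th k, is_int_vec k -> P (vadd th k) = P th /\
                                 is_int_vec (vsub (Q (vadd th k)) (Q th))) /\
  (forall th, D (P th)) /\
  (forall th i, analytic_at (fun x => P x i) th /\ analytic_at (fun x => Q x i) th) /\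
  (forall th th', P th = P th' -> is_int_vec (vsub (Q th) (Q th')) ->
                  is_int_vec (vsub th th')) /\
  (forall th v, (forall i, has_dir_deriv (fun x => P x i) th v 0 /\
                           has_dir_deriv (fun x => Q x i) th v 0) ->
                forall i, v i = 0).

Definition hamilton_solution (n : nat) (H : vec n -> vec n -> R) (p q : R -> vec n) : Prop :=
  forall t i, exists a b,
    has_partial (fun x => H x (q t)) i (p t) a /\
    has_partial (fun y => H (p t) y) i (q t) b /\
    derivable_pt_lim (fun s => p s i) t (- b) /\
    derivable_pt_lim (fun s => q s i) t a.

Definition invariant_quasi_periodic (n : nat) (H : vec n -> vec n -> R) (w : vec n)
    (P Q : vec n -> vec n) : Prop :=
  forall th, hamilton_solution H (fun t => P (vadd th (vscal t w)))
                                 (fun t => Q (vadd th (vscal t w))).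

(* Main.v *)
(** Write the torus as [theta |-> (P theta, theta + u theta)] and let [G] be the inverse
    of [1 + Du].  It is invariant with angular velocity [w0] as soon as [H] is constant
    along it, [G d_p H = w0], and the torus is Lagrangian.  A Newton step for the first two
    equations solves [d_w0 V = ...] only for the harmonics [|k| <= Q], where the
    small divisors cost [Psi Q], and leaves the others, of relative size [exp (- delta Q)].
    Nothing else is lost but the width [delta], since every function is controlled by the
    weighted l1 norm of its Fourier series.  With [lam_j = lam0 2^j], [Q_j Psi (Q_j) <= lam_j],
    [delta_j = cc / Q_j] and errors [e_j = e0 / 16^j], the step is consistent with a fixed
    factor [exp (- cc)], and the Bruno-Rüssmann condition is what makes [sum_j 1 / Q_j]
    finite and small.

    The norms are made available for real-analytic data by bounding Fourier coefficients
    without complexification: the mean of [f (p, q + t e_i) cos (2 pi k q)] is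
    [cos (2 pi k_i t)] times a coefficient, plus a sine term, and its Taylor coefficients
    in [t] are those of a convergent power series. *)
Require Import Defs.
From Stdlib Require Import Reals ZArith Lra Lia ClassicalEpsilon FunctionalExtensionality.
From mathcomp Require Import ssreflect ssrfun ssrbool eqtype ssrnat seq fintype finfun bigop.
From mathcomp Require Import Rstruct.
From mathcomp Require ssralg matrix mxalgebra.
From Coquelicot Require Import Coquelicot.
Set Implicit Arguments. Unset Strict Implicit. Unset Printing Implicit Defensive.
Local Open Scope R_scope.

(** * Weighted atomic norms *)

(** The norm is an inductive predicate closed under series, so that in the iteration no Fourier
    series is indexed or rearranged: a linear operator is estimated on single cosines. Gradients are
    then relations [grad K g dg], identified through uniqueness of partial derivatives.

    The energy error is kept smaller than the velocity error [e] by the factor [lam]. The generator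
    [V] solved from it, and its gradient, then have size [e]; the shift [Y] costs one more small
    divisor and has size [lam * e]; composing with it loses [1 / delta <= lam]. Hence the basic
    small quantity [lam ^ 2 * e]. The velocity equation is solvable only if a mean vanishes, which
    is arranged by translating the momentum by a constant covector [eta]: this is where
    non-degeneracy enters.

    The relation between [G] and [1 + Du] and the closedness of the pulled-back form hold exactly at
    every step, so that only two errors are iterated. The equation for the momentum is never solved:
    in the limit it follows from the constancy of the energy, the velocity equation and the symmetry
    of the Lagrangian form. *)

Lemma is_series_0R : is_series (fun _ : nat => 0) 0.
Proof.
apply: (filterlim_ext (fun _ => 0)); last exact: filterlim_const.
by move=> m; rewrite sum_n_const Rmult_0_r.
Qed.

(** * Finite sums of reals *)

Section FiniteSums.
Variable n : nat.
Implicit Types F G : 'I_n -> R.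

Lemma rsum_ext F G : (forall i, F i = G i) -> rsum F = rsum G.
Proof. by move=> H; rewrite /rsum; apply: eq_bigr => i _; apply: H. Qed.

Lemma rsum_plus F G : rsum (fun i => F i + G i) = rsum F + rsum G.
Proof. by rewrite /rsum big_split. Qed.

Lemma rsum_scal c F : rsum (fun i => c * F i) = c * rsum F.
Proof. by rewrite /rsum big_distrr. Qed.

Lemma rsum_scalr c F : rsum (fun i => F i * c) = rsum F * c.
Proof. by rewrite /rsum big_distrl. Qed.

Lemma rsum_opp F : rsum (fun i => - F i) = - rsum F.
Proof.
rewrite (rsum_ext (G := fun i => (-1) * F i)); last by move=> i; ring.
by rewrite rsum_scal; ring.
Qed.

Lemma rsum_minus F G : rsum (fun i => F i - G i) = rsum F - rsum G.
Proof. by rewrite /Rminus rsum_plus rsum_opp. Qed.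

Lemma rsum_le F G : (forall i, F i <= G i) -> rsum F <= rsum G.
Proof.
move=> H; rewrite /rsum; elim/big_ind2: _ => //; first lra.
by move=> *; lra.
Qed.

Lemma rsum_const c : rsum (fun _ : 'I_n => c) = INR n * c.
Proof.
rewrite /rsum big_const_ord; elim: n => [|m IH]; first by rewrite /=; lra.
by rewrite iterS IH S_INR; ring.
Qed.

Lemma rsum_0 F : (forall i, F i = 0) -> rsum F = 0.
Proof. by move=> H; rewrite (rsum_ext H) rsum_const; ring. Qed.

Lemma rsum_ge0 F : (forall i, 0 <= F i) -> 0 <= rsum F.
Proof. by move=> H; have := rsum_le H; rewrite rsum_const Rmult_0_r. Qed.

Lemma rsum_bound F c : (forall i, F i <= c) -> rsum F <= INR n * c.
Proof. by move=> H; rewrite -rsum_const; apply: rsum_le. Qed.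

Lemma rsum_abs F : Rabs (rsum F) <= rsum (fun i => Rabs (F i)).
Proof.
rewrite /rsum; elim/big_ind2: _ => [|x1 x2 y1 y2 H1 H2|i _]; last by lra.
  by rewrite Rabs_R0; lra.
by apply: Rle_trans (Rabs_triang _ _) _; apply: Rplus_le_compat.
Qed.

Lemma rsum_abs_bound F c : (forall i, Rabs (F i) <= c) -> Rabs (rsum F) <= INR n * c.
Proof. by move=> H; apply: Rle_trans (rsum_abs _) _; apply: rsum_bound. Qed.

Lemma rsum_delta F (i : 'I_n) : rsum (fun j => (if j == i then 1 else 0) * F j) = F i.
Proof.
rewrite /rsum (bigD1 i) //= eqxx big1; first by rewrite /=; ring.
by move=> j /negbTE ->; ring.
Qed.

Lemma rsum_ge_term F (i : 'I_n) : (forall j, 0 <= F j) -> F i <= rsum F.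
Proof.
move=> H; rewrite -[X in X <= _](rsum_delta F i); apply: rsum_le => j.
by case: (j == i); have := H j; lra.
Qed.

Lemma rsum_is_series (F : nat -> 'I_n -> R) (l : 'I_n -> R) :
  (forall i, is_series (fun m => F m i) (l i)) -> is_series (fun m => rsum (F m)) (rsum l).
Proof.
move=> H; rewrite /rsum; elim: (index_enum _) => [|i s IH].
  apply: (is_series_ext (fun _ => 0)); first by move=> m; rewrite big_nil.
  by rewrite big_nil; apply: is_series_0R.
apply: (is_series_ext (fun m => plus (F m i) (\big[Rplus/0]_(j <- s) F m j))).
  by move=> m; rewrite big_cons.
by rewrite big_cons; apply: is_series_plus.
Qed.

Lemma rsum_derivable (F : R -> 'I_n -> R) (l : 'I_n -> R) t :
  (forall i, derivable_pt_lim (fun s => F s i) t (l i)) ->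
  derivable_pt_lim (fun s => rsum (F s)) t (rsum l).
Proof.
move=> H; rewrite /rsum; elim: (index_enum _) => [|i s IH].
  have -> : (fun s => \big[Rplus/0]_(i <- [::]) F s i) = fct_cte 0.
    by apply: functional_extensionality => s; rewrite big_nil.
  by rewrite big_nil; apply: derivable_pt_lim_const.
have -> : (fun r => \big[Rplus/0]_(j <- i :: s) F r j)
        = plus_fct (fun r => F r i) (fun r => \big[Rplus/0]_(j <- s) F r j).
  by apply: functional_extensionality => r; rewrite big_cons.
by rewrite big_cons; apply: derivable_pt_lim_plus.
Qed.

End FiniteSums.

Lemma rsum_exch n m (F : 'I_n -> 'I_m -> R) :
  rsum (fun i => rsum (F i)) = rsum (fun j => rsum (fun i => F i j)).
Proof. by rewrite /rsum exchange_big. Qed.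

(** * Dominated series of reals *)

Section Series.

Lemma sum_extR (a b : nat -> R) N : (forall m, a m = b m) -> sum_f_R0 a N = sum_f_R0 b N.
Proof. by move=> H; apply: PartSum.sum_eq => m _; apply: H. Qed.

Lemma sum_scalR c (b : nat -> R) N : sum_f_R0 (fun m => c * b m) N = c * sum_f_R0 b N.
Proof. by elim: N => [//|N IH]; rewrite !tech5 IH; ring. Qed.

Lemma is_series_lim (a : nat -> R) l : is_series a l <-> is_lim_seq (sum_f_R0 a) l.
Proof.
split=> H; move: H; apply: filterlim_ext => m; last by rewrite -sum_n_Reals.
by rewrite sum_n_Reals.
Qed.

Lemma ex_series_bounded (a : nat -> R) B :
  (forall m, 0 <= a m) -> (forall N, sum_f_R0 a N <= B) -> ex_series a.
Proof.
move=> Ha HB.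
have [l Hl] : ex_finite_lim_seq (sum_f_R0 a).
  by apply: (ex_finite_lim_seq_incr _ B) => // N /=; have := Ha N.+1; lra.
by exists l; apply/is_series_lim.
Qed.

Lemma is_series_ub (a : nat -> R) l B :
  is_series a l -> (forall N, sum_f_R0 a N <= B) -> l <= B.
Proof.
move=> /is_series_lim H HB.
exact: (is_lim_seq_le _ (fun _ => B) l B HB H (is_lim_seq_const B)).
Qed.

Lemma sum_abs_le (a b : nat -> R) N :
  (forall m, Rabs (a m) <= b m) -> Rabs (sum_f_R0 a N) <= sum_f_R0 b N.
Proof.
move=> H; apply: Rle_trans (sum_f_R0_triangle _ _) _.
by apply: sum_Rle.
Qed.

Lemma is_series_abs_ub (a b : nat -> R) l B : is_series a l ->
  (forall m, Rabs (a m) <= b m) -> (forall N, sum_f_R0 b N <= B) -> Rabs l <= B.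
Proof.
move=> /is_series_lim H Hab HB.
have H1 : forall N, - B <= sum_f_R0 a N <= B.
  move=> N; have := sum_abs_le N Hab; have := HB N => h1 h2.
  by have := Rabs_le_between (sum_f_R0 a N) B; case=> h _; apply: h; lra.
apply/Rabs_le_between; split.
  exact: (is_lim_seq_le (fun _ => - B) _ (- B) l (fun N => proj1 (H1 N)) (is_lim_seq_const _) H).
exact: (is_lim_seq_le _ (fun _ => B) l B (fun N => proj2 (H1 N)) H (is_lim_seq_const _)).
Qed.

Lemma dominated_series (a b : nat -> R) B :
  (forall m, Rabs (a m) <= b m) -> (forall N, sum_f_R0 b N <= B) ->
  is_series a (Series a) /\ Rabs (Series a) <= B.
Proof.
move=> Hab HB.
have Hb : forall m, 0 <= b m by move=> m; have := Rabs_pos (a m); have := Hab m; lra.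
have [l Hl] : ex_series a.
  apply: (ex_series_le a b); first exact: Hab.
  exact: ex_series_bounded Hb HB.
rewrite (is_series_unique _ _ Hl); split=> //.
exact: is_series_abs_ub Hl Hab HB.
Qed.

Lemma is_series_pair (x y : R) :
  is_series (fun m => match m with 0%N => x | 1%N => y | _ => 0 end) (x + y).
Proof.
apply/is_series_lim; apply: (is_lim_seq_ext (fun m => if m is 0%N then x else x + y)).
  by case=> [|m] //; elim: m => [//|m IH]; rewrite tech5 -IH; ring.
by apply/is_lim_seq_incr_1; apply: is_lim_seq_const.
Qed.

#[global] Arguments is_series_pair : clear implicits.

Lemma is_series_scalR (c : R) (a : nat -> R) (l : R) :
  is_series a l -> is_series (fun m => c * a m) (c * l).
Proof. exact: is_series_scal. Qed.

Lemma is_series_scalrR (c : R) (a : nat -> R) (l : R) :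
  is_series a l -> is_series (fun m => a m * c) (l * c).
Proof. exact: is_series_scal_r. Qed.

Lemma is_series_minusR (a b : nat -> R) (l l' : R) :
  is_series a l -> is_series b l' -> is_series (fun m => a m - b m) (l - l').
Proof. exact: is_series_minus. Qed.

Lemma is_series_plusR (a b : nat -> R) (l l' : R) :
  is_series a l -> is_series b l' -> is_series (fun m => a m + b m) (l + l').
Proof. exact: is_series_plus. Qed.

End Series.

Section Atomic.
Variables (X At : Type) (dom : X -> Prop) (ev : At -> X -> R) (wt : At -> R).

(* [AN g B]: [g] is, on [dom], a (possibly iterated) absolutely convergent
   combination of atoms with weighted l1-norm at most [B]. *)
Inductive AN : (X -> R) -> R -> Prop :=
| AN_atom c a g B : (forall x, dom x -> g x = c * ev a x) -> Rabs c * wt a <= B -> AN g B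
| AN_series (G : nat -> X -> R) (b : nat -> R) g B :
    (forall m, AN (G m) (b m)) -> (forall N, sum_f_R0 b N <= B) ->
    (forall x, dom x -> is_series (fun m => G m x) (g x)) -> AN g B.

Hypothesis wt0 : forall a, 0 <= wt a.
Hypothesis evwt : forall a x, dom x -> Rabs (ev a x) <= wt a.

Lemma AN_ge0 g B : AN g B -> 0 <= B.
Proof.
elim=> [c a g0 B0 _ H|G b g0 B0 _ IH H _].
  by have := wt0 a; have := Rabs_pos c; nra.
by have := H 0%N; have := IH 0%N; rewrite /=; lra.
Qed.

Lemma AN_sup g B : AN g B -> forall x, dom x -> Rabs (g x) <= B.
Proof.
elim=> [c a g0 B0 Hg H x Hx|G b g0 B0 _ IH H Hs x Hx].
  rewrite Hg // Rabs_mult.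
  by have := evwt a Hx; have := Rabs_pos c; nra.
by apply: is_series_abs_ub (Hs x Hx) _ H => m; apply: IH.
Qed.

Lemma AN_ext g g' B : (forall x, dom x -> g' x = g x) -> AN g B -> AN g' B.
Proof.
move=> E HA; case: HA E => [c a g0 B0 Hg H|G b g0 B0 HG H Hs] E.
  by apply: AN_atom H => x Hx; rewrite E // Hg.
by apply: AN_series HG H _ => x Hx; rewrite E //; apply: Hs.
Qed.

Lemma AN_le g B B' : AN g B -> B <= B' -> AN g B'.
Proof.
case=> [c a g0 B0 Hg H|G b g0 B0 HG H Hs] HB.
  by apply: AN_atom Hg _; lra.
by apply: AN_series HG _ Hs => N; have := H N; lra.
Qed.

Variable a0 : At.

(** An atom with coefficient 0; the predicate would be empty without some atom [a0]. *)
Lemma AN_zero : AN (fun _ => 0) 0.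
Proof. by apply: (AN_atom (c := 0) (a := a0)) => [x _|]; rewrite ?Rabs_R0; lra. Qed.

Lemma AN_scal g B c : AN g B -> AN (fun x => c * g x) (Rabs c * B).
Proof.
elim=> [d a g0 B0 Hg H|G b g0 B0 _ IH H Hs].
  apply: (AN_atom (c := c * d) (a := a)) => [x Hx|]; first by rewrite Hg //; ring.
  by rewrite Rabs_mult; have := Rabs_pos c; nra.
apply: (AN_series (G := fun m x => c * G m x) (b := fun m => Rabs c * b m)) => //.
  move=> N; rewrite (_ : sum_f_R0 _ N = Rabs c * sum_f_R0 b N); last exact: sum_scalR.
  by have := Rabs_pos c; have := H N; nra.
by move=> x Hx; apply: is_series_scalR; apply: Hs.
Qed.

Lemma AN_add g h B B' : AN g B -> AN h B' -> AN (fun x => g x + h x) (B + B').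
Proof.
move=> Hg Hh; have B0 := AN_ge0 Hg; have B0' := AN_ge0 Hh.
(* A sum of two functions is a series with two nonzero terms: [AN] has no constructor for finite
   sums. *)
pose G m := match m with 0%N => g | 1%N => h | _ => fun _ => 0 end.
pose b m := match m with 0%N => B | 1%N => B' | _ => 0 end.
apply: (AN_series (G := G) (b := b)) => [m|N|x _].
- by case: m => [|[|m]] //=; apply: AN_zero.
- have -> : sum_f_R0 b N = if N is 0%N then B else B + B'.
    by case: N => [//|N]; elim: N => [//|N IH]; rewrite tech5 IH /=; ring.
  by case: N => [|N]; lra.
- move: (is_series_pair (g x) (h x)); apply: is_series_ext.
  by case=> [|[|m]].
Qed.

Lemma AN_opp g B : AN g B -> AN (fun x => - g x) B.
Proof.
move=> /(AN_scal (-1)); rewrite Rabs_Ropp Rabs_R1 Rmult_1_l.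
by apply: AN_ext => x _; ring.
Qed.

Lemma AN_sub g h B B' : AN g B -> AN h B' -> AN (fun x => g x - h x) (B + B').
Proof. by move=> Hg /AN_opp; apply: AN_add. Qed.

Lemma AN_rsum n (F : 'I_n -> X -> R) b :
  (forall i, AN (F i) (b i)) -> AN (fun x => rsum (fun i => F i x)) (rsum b).
Proof.
move=> H; rewrite /rsum; elim: (index_enum _) => [|i s IH].
  by rewrite big_nil; apply: AN_ext AN_zero => x _; rewrite big_nil.
by rewrite big_cons; apply: AN_ext (AN_add (H i) IH) => x _; rewrite big_cons.
Qed.

Lemma AN_rsumc n (F : 'I_n -> X -> R) c :
  (forall i, AN (F i) c) -> AN (fun x => rsum (fun i => F i x)) (INR n * c).
Proof. by move=> H; rewrite -rsum_const; apply: AN_rsum. Qed.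

Lemma AN_Series (G : nat -> X -> R) b B :
  (forall m, AN (G m) (b m)) -> (forall N, sum_f_R0 b N <= B) ->
  AN (fun x => Series (fun m => G m x)) B /\ (forall x, dom x -> is_series (fun m => G m x) (Series (fun m => G m x))).
Proof.
move=> H HB.
have Hs x : dom x -> is_series (fun m => G m x) (Series (fun m => G m x)).
  move=> Hx; apply: (proj1 (dominated_series (b := b) _ HB)) => m.
  exact: AN_sup (H m) _ Hx.
by split=> //; apply: AN_series H HB Hs.
Qed.

End Atomic.

(** Induction on [AN]: an operator compatible with pointwise series and with multiples of atoms
    inherits its bound on atoms. Products, composition, substitution and change of radius are all
    instances. Differentiation and the small-divisor problem are not, since there the output
    functions are only known to exist, and they repeat the induction. *)
Lemma AN_map (X At : Type) (dom : X -> Prop) (ev : At -> X -> R) (wt : At -> R)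
  (X' At' : Type) (dom' : X' -> Prop) (ev' : At' -> X' -> R) (wt' : At' -> R)
  (T : (X -> R) -> X' -> R) C :
  (forall a, 0 <= wt a) -> 0 <= C ->
  (forall G g, (forall x, dom x -> is_series (fun m => G m x) (g x)) ->
     forall x, dom' x -> is_series (fun m : nat => T (G m) x) (T g x)) ->
  (forall c g a, (forall x, dom x -> g x = c * ev a x) ->
     forall x, dom' x -> T g x = c * T (ev a) x) ->
  (forall a, AN dom' ev' wt' (T (ev a)) (C * wt a)) ->
  forall g B, AN dom ev wt g B -> AN dom' ev' wt' (T g) (C * B).
Proof.
move=> wt0 C0 Hser Hscal Hat g B; elim=> [c a g0 B0 Hg H|G b g0 B0 _ IH H Hs].
  apply: (@AN_le _ _ _ _ _ _ (Rabs c * (C * wt a))); last nra.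
  by apply: AN_ext (AN_scal c (Hat a)) => x Hx; rewrite -(Hscal c _ _ Hg).
apply: (AN_series (G := fun m => T (G m)) (b := fun m => C * b m)) => //.
  by move=> N; rewrite sum_scalR; have := H N; nra.
by move=> x Hx; apply: Hser.
Qed.

Section AtomicAlgebra.
Variables (X At : Type) (dom : X -> Prop) (ev : At -> X -> R) (wt : At -> R).
Hypothesis wt0 : forall a, 0 <= wt a.
Hypothesis evwt : forall a x, dom x -> Rabs (ev a x) <= wt a.
Hypothesis evM : forall a b, AN dom ev wt (fun x => ev a x * ev b x) (wt a * wt b).
Variable a1 : At.
Hypothesis ev1 : forall x, dom x -> ev a1 x = 1.
Hypothesis wt1 : wt a1 = 1.
Notation AN := (AN dom ev wt).

Lemma AN_const c : AN (fun _ => c) (Rabs c).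
Proof.
by apply: (AN_atom (c := c) (a := a1)) => [x Hx|]; rewrite ?ev1 ?wt1 //; lra.
Qed.

Lemma AN_mul g h B B' : AN g B -> AN h B' -> AN (fun x => g x * h x) (B * B').
Proof.
move=> Hg Hh; rewrite Rmult_comm.
(* Bilinearity: each factor is reduced to atoms in turn, the other one being frozen. *)
apply: (AN_map (T := fun g x => g x * h x)) (Hg) => //.
- exact: AN_ge0 Hh.
- by move=> G f H x Hx; apply: is_series_scalrR; apply: H.
- by move=> c f a H x Hx; rewrite H //; ring.
move=> a; rewrite Rmult_comm.
apply: (AN_map (T := fun h x => ev a x * h x)) (Hh) => //.
- by move=> G f H x Hx; apply: is_series_scalR; apply: H.
- by move=> c f b H x Hx; rewrite H //; ring.
Qed.

Lemma AN_pow g B m : AN g B -> AN (fun x => g x ^ m) (B ^ m).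
Proof.
move=> H; elim: m => [|m IH] /=; last exact: AN_mul.
by have := AN_const 1; rewrite Rabs_R1.
Qed.

End AtomicAlgebra.

(** * Taylor expansion of the cosine *)

Section CosTaylor.

(** The [m]-th derivative of the cosine at [a]. Written with a phase, each Taylor coefficient of an
    atom is a multiple of an atom of the same frequency. *)
Definition cosT (a : R) (m : nat) : R := cos (a + INR m * (PI / 2)).

Lemma cos_add_PI2 a : cos (a + PI / 2) = - sin a.
Proof. by rewrite cos_plus cos_PI2 sin_PI2; ring. Qed.

Lemma cosT_bound a m : Rabs (cosT a m) <= 1.
Proof. by apply/Rabs_le; apply: COS_bound. Qed.

Lemma cosT0 a : cosT a 0 = cos a.
Proof. by rewrite /cosT /= Rmult_0_l Rplus_0_r. Qed.

Lemma cosT1 a : cosT a 1 = - sin a.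
Proof. by rewrite /cosT /= Rmult_1_l cos_add_PI2. Qed.

Lemma cosT_derive a m t :
  is_derive (fun t => cosT (a + t) m) t (cosT (a + t) m.+1).
Proof.
rewrite /cosT S_INR; have -> : a + t + (INR m + 1) * (PI / 2) = a + t + INR m * (PI/2) + PI/2 by ring.
by rewrite cos_add_PI2; auto_derive => //; ring.
Qed.

Lemma cos_Derive_n a k : Derive_n (fun t => cos (a + t)) k = (fun t => cosT (a + t) k).
Proof.
elim: k => [|k IH]; apply: functional_extensionality => t; first by rewrite /= cosT0.
by rewrite /= IH; apply: is_derive_unique; apply: cosT_derive.
Qed.

Lemma cos_Taylor_pos a b N : 0 < b ->
  Rabs (cos (a + b) - sum_f_R0 (fun m => cosT a m * (b ^ m / INR (fact m))) N)
    <= b ^ N.+1 / INR (fact N.+1).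
Proof.
move=> b0.
have [|z [_]] := @Taylor_Lagrange (fun t => cos (a + t)) N 0 b b0.
  move=> t _ [|k] _ //=; rewrite cos_Derive_n; exists (cosT (a + t) k.+1).
  exact: cosT_derive.
move=> ->; rewrite cos_Derive_n Rminus_0_r.
have -> : sum_f_R0 (fun m => b ^ m / INR (fact m) * Derive_n (fun t => cos (a + t)) m 0) N
        = sum_f_R0 (fun m => cosT a m * (b ^ m / INR (fact m))) N.
  by apply: sum_extR => m; rewrite cos_Derive_n Rplus_0_r; ring.
set S := sum_f_R0 _ _; set q := _ / _.
have q0 : 0 <= q.
  apply: Rdiv_le_0_compat; first by apply: pow_le; lra.
  exact: INR_fact_lt_0.
have -> : S + q * cosT (a + z) N.+1 - S = q * cosT (a + z) N.+1 by ring.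
rewrite Rabs_mult (Rabs_pos_eq q) //.
by have := cosT_bound (a + z) N.+1; nra.
Qed.

(** Reflection [b -> - b]: it reduces the Taylor remainder to [b > 0], the case given by the
    Lagrange form. *)
Lemma cosT_opp a m : cosT (- a) m * (-1) ^ m = cosT a m.
Proof.
rewrite /cosT.
have -> : a + INR m * (PI / 2) = - (- a + INR m * (PI / 2)) + INR m * PI by field.
move: (INR m * (PI / 2)) => x; elim: m => [|m IH]; first by rewrite /= Rmult_0_l Rplus_0_r cos_neg; ring.
rewrite S_INR /=.
have -> : - (- a + x) + (INR m + 1) * PI = - (- a + x) + INR m * PI + PI by ring.
by rewrite neg_cos -IH; ring.
Qed.

Lemma cos_Taylor a b N :
  Rabs (cos (a + b) - sum_f_R0 (fun m => cosT a m * (b ^ m / INR (fact m))) N)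
    <= Rabs b ^ N.+1 / INR (fact N.+1).
Proof.
have [b0|[->|b0]] := Rtotal_order b 0; last first.
- by rewrite (Rabs_pos_eq b); [exact: cos_Taylor_pos | lra].
- have -> : sum_f_R0 (fun m => cosT a m * (0 ^ m / INR (fact m))) N = cos a.
    elim: N => [|N IH]; first by rewrite /= cosT0; field.
    by rewrite tech5 IH pow_i; [rewrite /Rdiv; ring | lia].
  rewrite Rplus_0_r Rminus_diag Rabs_R0; apply: Rdiv_le_0_compat; last exact: INR_fact_lt_0.
  by apply: pow_le; lra.
rewrite (Rabs_left b) //.
have := @cos_Taylor_pos (- a) (- b) N; rewrite -Ropp_plus_distr cos_neg.
have -> : sum_f_R0 (fun m => cosT (- a) m * ((- b) ^ m / INR (fact m))) N
        = sum_f_R0 (fun m => cosT a m * (b ^ m / INR (fact m))) N.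
  apply: sum_extR => m; rewrite -(cosT_opp a m).
  have -> : - b = (-1) * b by ring.
  by rewrite Rpow_mult_distr /Rdiv; ring.
by apply; lra.
Qed.

Lemma exp_series z : is_series (fun m => z ^ m / INR (fact m)) (exp z).
Proof.
have := is_exp_Reals z; rewrite /is_pseries; apply: is_series_ext => m.
by rewrite /scal /= /mult /= pow_n_pow.
Qed.

#[global] Arguments exp_series : clear implicits.

Lemma exp_sum_le z N : 0 <= z -> sum_f_R0 (fun m => z ^ m / INR (fact m)) N <= exp z.
Proof.
move=> z0; have t0 m : 0 <= z ^ m / INR (fact m).
  by apply: Rdiv_le_0_compat; [apply: pow_le | apply: INR_fact_lt_0].
have /is_series_lim H := exp_series z.
have := is_lim_seq_incr_compare _ _ H; apply => m; rewrite tech5.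
by have := t0 m.+1; lra.
Qed.

Lemma pow_fact_le_exp z N : 0 <= z -> z ^ N / INR (fact N) <= exp z.
Proof.
move=> z0; apply: Rle_trans (exp_sum_le N z0).
have t0 m : 0 <= z ^ m / INR (fact m).
  by apply: Rdiv_le_0_compat; [apply: pow_le | apply: INR_fact_lt_0].
case: N => [|N]; first by rewrite /=; lra.
rewrite tech5; have : 0 <= sum_f_R0 (fun m => z ^ m / INR (fact m)) N by apply: cond_pos_sum.
lra.
Qed.

(** [(2 z)^N / N! <= exp (2 z)]: doubling the argument trades the factorial for a geometric rate,
    which is uniform over the harmonics once [exp (2 z)] is absorbed by the weight. *)
Lemma pow_fact_half z N : 0 <= z -> z ^ N / INR (fact N) <= (/ 2) ^ N * exp (2 * z).
Proof.
move=> z0; have := @pow_fact_le_exp (2 * z) N; rewrite Rpow_mult_distr.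
have p2 : 0 < 2 ^ N by apply: pow_lt; lra.
rewrite pow_inv => /(_ ltac:(lra)) H.
apply: (Rmult_le_reg_l (2 ^ N)) => //; rewrite -Rmult_assoc Rinv_r ?Rmult_1_l; last lra.
by rewrite /Rdiv in H *; rewrite -Rmult_assoc.
Qed.

(** The inequality [exp z - 1 <= z * exp z] on partial sums, from [1 / (m + 1)! <= 1 / m!]. *)
Lemma exp_minus1_sum_le z N : 0 <= z ->
  sum_f_R0 (fun m => z ^ m.+1 / INR (fact m.+1)) N <= z * exp z.
Proof.
move=> z0.
apply: (Rle_trans _ (z * sum_f_R0 (fun m => z ^ m / INR (fact m)) N)); last first.
  by apply: Rmult_le_compat_l => //; apply: exp_sum_le.
rewrite -sum_scalR; apply: sum_Rle => m _.
rewrite -tech_pow_Rmult /Rdiv Rmult_assoc; apply: Rmult_le_compat_l => //.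
apply: Rmult_le_compat_l; first exact: pow_le.
apply: Rinv_le_contravar; first exact: INR_fact_lt_0.
by apply: le_INR; rewrite /=; have := fact_neq_0 m; lia.
Qed.

Lemma cos_series a b :
  is_series (fun m => cosT a m * (b ^ m / INR (fact m))) (cos (a + b)).
Proof.
apply/is_series_lim.
apply: (is_lim_seq_le_le (fun N => cos (a + b) - (/ 2) ^ N * exp (2 * Rabs b)) _
          (fun N => cos (a + b) + (/ 2) ^ N * exp (2 * Rabs b))).
- move=> N; have H1 := cos_Taylor a b N.
  have H2 := pow_fact_half N.+1 (Rabs_pos b).
  have H3 : (/ 2) ^ N.+1 * exp (2 * Rabs b) <= (/ 2) ^ N * exp (2 * Rabs b).
    have p : 0 < (/ 2) ^ N by apply: pow_lt; lra.
    by have := exp_pos (2 * Rabs b); rewrite /=; nra.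
  have H4 := Rle_trans _ _ _ (Rle_trans _ _ _ H1 H2) H3.
  by have := proj1 (Rabs_le_between _ _) H4; split; lra.
- have -> : Finite (cos (a + b)) = Finite (cos (a + b) - 0 * exp (2 * Rabs b)) by f_equal; ring.
  apply: is_lim_seq_minus'; first exact: is_lim_seq_const.
  by apply: (is_lim_seq_scal_r _ (exp (2 * Rabs b)) 0); apply: is_lim_seq_geom; rewrite Rabs_pos_eq; lra.
- have -> : Finite (cos (a + b)) = Finite (cos (a + b) + 0 * exp (2 * Rabs b)) by f_equal; ring.
  apply: is_lim_seq_plus'; first exact: is_lim_seq_const.
  by apply: (is_lim_seq_scal_r _ (exp (2 * Rabs b)) 0); apply: is_lim_seq_geom; rewrite Rabs_pos_eq; lra.
Qed.

#[global] Arguments cos_series : clear implicits.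

Lemma cos_series_minus a b :
  is_series (fun m => cosT a m.+1 * (b ^ m.+1 / INR (fact m.+1))) (cos (a + b) - cos a).
Proof.
apply: (is_series_incr_1 (fun m => cosT a m * (b ^ m / INR (fact m)))).
have -> : plus (cos (a + b) - cos a) (cosT a 0 * (b ^ 0 / INR (fact 0))) = cos (a + b).
  by rewrite /plus /= cosT0; field.
exact: cos_series.
Qed.

#[global] Arguments cos_series_minus : clear implicits.

Lemma cos_lip a b : Rabs (cos (a + b) - cos a) <= Rabs b.
Proof. by have := cos_Taylor a b 0; rewrite /= cosT0 !Rdiv_1_r !Rmult_1_r. Qed.

Lemma cos_C11 a b : Rabs (cos (a + b) - cos a - cos (a + PI / 2) * b) <= b ^ 2.
Proof.
have := cos_Taylor a b 1; rewrite /= cosT0 cosT1 cos_add_PI2 => H.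
have E : cos (a + b) - cos a - - sin a * b = cos (a + b) - (cos a * (1 / 1) + - sin a * (b * 1 / 1)) by field.
rewrite E; apply: Rle_trans H _.
have -> : Rabs b * (Rabs b * 1) = b * b by rewrite Rmult_1_r -Rabs_mult Rabs_pos_eq //; nra.
by nra.
Qed.

End CosTaylor.

(** * Trigonometric series *)

Lemma choiceE (A B : Type) (P : A -> B -> Prop) :
  (forall a, exists b, P a b) -> exists f, forall a, P a (f a).
Proof.
move=> H; exists (fun a => proj1_sig (constructive_indefinite_description _ (H a))) => a.
exact: proj2_sig.
Qed.

Lemma exp_le x y : x <= y -> exp x <= exp y.
Proof. by case=> [H|->]; [apply: Rlt_le; apply: exp_increasing | lra]. Qed.

Section Trig.
Variable n : nat.
Implicit Types (k : 'I_n -> Z) (x y v : vec n) (g : vec n -> R).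

Definition knorm k := rsum (fun i => Rabs (IZR (k i))).
Definition kdot k x := rsum (fun i => IZR (k i) * x i).

Lemma knorm_ge0 k : 0 <= knorm k.
Proof. by apply: rsum_ge0 => i; apply: Rabs_pos. Qed.

Lemma knorm_coord k i : Rabs (IZR (k i)) <= knorm k.
Proof. by apply: (rsum_ge_term (F := fun i => Rabs (IZR (k i)))) => j; apply: Rabs_pos. Qed.

Lemma kdot_addr k x y : kdot k (fun i => x i + y i) = kdot k x + kdot k y.
Proof. by rewrite /kdot -rsum_plus; apply: rsum_ext => i; ring. Qed.

Lemma kdot_addl k l x : kdot (fun i => k i + l i)%Z x = kdot k x + kdot l x.
Proof. by rewrite /kdot -rsum_plus; apply: rsum_ext => i; rewrite plus_IZR; ring. Qed.

Lemma kdot_subl k l x : kdot (fun i => k i - l i)%Z x = kdot k x - kdot l x.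
Proof. by rewrite /kdot -rsum_minus; apply: rsum_ext => i; rewrite minus_IZR; ring. Qed.

Lemma kdot_bound k x d : (forall i, Rabs (x i) <= d) -> Rabs (kdot k x) <= knorm k * d.
Proof.
move=> H; apply: Rle_trans (rsum_abs _) _; rewrite /knorm -rsum_scalr; apply: rsum_le => i.
by rewrite Rabs_mult; apply: Rmult_le_compat_l; [apply: Rabs_pos | apply: H].
Qed.

Lemma knorm_add k l : knorm (fun i => k i + l i)%Z <= knorm k + knorm l.
Proof.
rewrite /knorm -rsum_plus; apply: rsum_le => i; rewrite plus_IZR; exact: Rabs_triang.
Qed.

Lemma knorm_sub k l : knorm (fun i => k i - l i)%Z <= knorm k + knorm l.
Proof.
rewrite /knorm -rsum_plus; apply: rsum_le => i; rewrite minus_IZR /Rminus.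
by apply: Rle_trans (Rabs_triang _ _) _; rewrite Rabs_Ropp; lra.
Qed.

(** Cauchy's estimate: [N] derivatives multiply a harmonic by [|k|^N], and
    [(s |k|)^N / N! <= exp (s |k|)] absorbs this factor at the cost of the width [s]. *)
Lemma knorm_pow_exp k s N : 0 < s ->
  knorm k ^ N <= INR (fact N) / s ^ N * exp (s * knorm k).
Proof.
move=> s0; have k0 := knorm_ge0 k.
have := @pow_fact_le_exp (s * knorm k) N; rewrite Rpow_mult_distr => /(_ ltac:(nra)) H.
have p := pow_lt s N s0; have f := INR_fact_lt_0 N.
have -> : knorm k ^ N = INR (fact N) / s ^ N * (s ^ N * knorm k ^ N / INR (fact N)).
  by field; split; lra.
by apply: Rmult_le_compat_l => //; apply: Rlt_le; apply: Rdiv_lt_0_compat.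
Qed.

Lemma knorm_exp1 k s : 0 < s -> knorm k <= / s * exp (s * knorm k).
Proof. by move=> s0; have := knorm_pow_exp k 1 s0; rewrite /= !Rmult_1_r /Rdiv Rmult_1_l. Qed.

(** The free phase makes sines atoms as well and keeps the family stable under translation and
    differentiation. *)
Definition tev (a : ('I_n -> Z) * R) x := cos (2 * PI * kdot a.1 x + a.2).
Definition twt s (a : ('I_n -> Z) * R) := exp (s * knorm a.1).
Definition TA s := AN (fun _ : vec n => True) tev (twt s).

Lemma twt0 s a : 0 <= twt s a. Proof. exact: Rlt_le (exp_pos _). Qed.

Lemma twt_ge1 s a : 0 <= s -> 1 <= twt s a.
Proof.
move=> s0; rewrite -exp_0; apply: exp_le; have := knorm_ge0 a.1; nra.
Qed.

Lemma tev_twt s a x : 0 <= s -> True -> Rabs (tev a x) <= twt s a.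
Proof.
move=> s0 _; apply: Rle_trans (twt_ge1 a s0).
by apply/Rabs_le; apply: COS_bound.
Qed.

Definition a0 : ('I_n -> Z) * R := (fun _ => 0%Z, 0).

Lemma kdot0 x : kdot (fun _ => 0%Z) x = 0.
Proof. by apply: rsum_0 => i; ring. Qed.

Lemma knorm0 : knorm (fun _ => 0%Z) = 0.
Proof. by apply: rsum_0 => i; rewrite Rabs_R0. Qed.

Lemma tev0 x : tev a0 x = 1.
Proof. by rewrite /tev /= kdot0 Rmult_0_r Rplus_0_r cos_0. Qed.

Lemma twt_a0 s : twt s a0 = 1.
Proof. by rewrite /twt knorm0 Rmult_0_r exp_0. Qed.

Lemma TA_atom s c k phi : TA s (fun x => c * cos (2 * PI * kdot k x + phi)) (Rabs c * exp (s * knorm k)).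
Proof. by apply: (AN_atom (c := c) (a := (k, phi))) => [x _|]; rewrite /twt //=; lra. Qed.

(** Product-to-sum formula: [k + l] and [k - l] get weight 1/2 each and have norm at most
    [|k| + |l|], so the norm is submultiplicative with constant 1. *)
Lemma tevM s a b : 0 <= s -> TA s (fun x => tev a x * tev b x) (twt s a * twt s b).
Proof.
move=> s0; case: a => k p; case: b => l q; rewrite /tev /twt /=.
pose k1 := (fun i => k i + l i)%Z; pose k2 := (fun i => k i - l i)%Z.
have H := AN_add (twt0 s) a0 (TA_atom s (/2) k1 (p + q)) (TA_atom s (/2) k2 (p - q)).
apply: (AN_le (B := Rabs (/2) * exp (s * knorm k1) + Rabs (/2) * exp (s * knorm k2))).
  apply: AN_ext H => x _; rewrite kdot_addl kdot_subl.
  set A := kdot k x; set B := kdot l x.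
  have -> : 2 * PI * (A + B) + (p + q) = (2 * PI * A + p) + (2 * PI * B + q) by ring.
  have -> : 2 * PI * (A - B) + (p - q) = (2 * PI * A + p) - (2 * PI * B + q) by ring.
  move: (2 * PI * A + p) (2 * PI * B + q) => u w.
  by rewrite cos_plus cos_minus; field.
rewrite Rabs_pos_eq; last lra.
have E : exp (s * knorm k) * exp (s * knorm l) = exp (s * (knorm k + knorm l)).
  by rewrite -exp_plus; congr exp; ring.
have H1 : exp (s * knorm k1) <= exp (s * (knorm k + knorm l)).
  by apply: exp_le; apply: Rmult_le_compat_l => //; apply: knorm_add.
have H2 : exp (s * knorm k2) <= exp (s * (knorm k + knorm l)).
  by apply: exp_le; apply: Rmult_le_compat_l => //; apply: knorm_sub.
by rewrite E; lra.
Qed.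

Section Rules.
Variable s : R.
Hypothesis s0 : 0 <= s.

Lemma TA_ge0 g B : TA s g B -> 0 <= B. Proof. exact: AN_ge0 (twt0 s) _ _. Qed.
Lemma TA_sup g B x : TA s g B -> Rabs (g x) <= B.
Proof. by move=> H; apply: (AN_sup (fun a x => @tev_twt s a x s0) H). Qed.
Lemma TA_ext g g' B : (forall x, g' x = g x) -> TA s g B -> TA s g' B.
Proof. by move=> H; apply: AN_ext => x _; apply: H. Qed.
Lemma TA_le g B B' : TA s g B -> B <= B' -> TA s g B'. Proof. exact: AN_le. Qed.
Lemma TA_zero : TA s (fun _ => 0) 0. Proof. exact: AN_zero a0. Qed.
Lemma TA_scal g B c : TA s g B -> TA s (fun x => c * g x) (Rabs c * B).
Proof. exact: AN_scal. Qed.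
Lemma TA_add g h B B' : TA s g B -> TA s h B' -> TA s (fun x => g x + h x) (B + B').
Proof. exact: AN_add (twt0 s) a0 _ _ _ _. Qed.
Lemma TA_sub g h B B' : TA s g B -> TA s h B' -> TA s (fun x => g x - h x) (B + B').
Proof. exact: AN_sub (twt0 s) a0 _ _ _ _. Qed.
Lemma TA_opp g B : TA s g B -> TA s (fun x => - g x) B.
Proof. exact: AN_opp. Qed.
Lemma TA_rsum m (F : 'I_m -> vec n -> R) b :
  (forall i, TA s (F i) (b i)) -> TA s (fun x => rsum (fun i => F i x)) (rsum b).
Proof. exact: AN_rsum (twt0 s) a0 _ _ _. Qed.
Lemma TA_rsumc m (F : 'I_m -> vec n -> R) c :
  (forall i, TA s (F i) c) -> TA s (fun x => rsum (fun i => F i x)) (INR m * c).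
Proof. exact: AN_rsumc (twt0 s) a0 _ _ _. Qed.
Lemma TA_const c : TA s (fun _ => c) (Rabs c).
Proof. by apply: (AN_const (a1 := a0)) => [x _|]; [apply: tev0 | apply: twt_a0]. Qed.
Lemma TA_mul g h B B' : TA s g B -> TA s h B' -> TA s (fun x => g x * h x) (B * B').
Proof. apply: (AN_mul (twt0 s)) => a b; exact: tevM. Qed.
Lemma TA_pow g B m : TA s g B -> TA s (fun x => g x ^ m) (B ^ m).
Proof.
apply: (AN_pow (twt0 s) _ (a1 := a0)) => [a b|x _|]; first exact: tevM.
  exact: tev0.
exact: twt_a0.
Qed.
Lemma TA_series (G : nat -> vec n -> R) b g B :
  (forall m, TA s (G m) (b m)) -> (forall N, sum_f_R0 b N <= B) ->
  (forall x, is_series (fun m => G m x) (g x)) -> TA s g B.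
Proof. by move=> H1 H2 H3; apply: AN_series H1 H2 _ => x _; apply: H3. Qed.
Lemma TA_Series (G : nat -> vec n -> R) b B :
  (forall m, TA s (G m) (b m)) -> (forall N, sum_f_R0 b N <= B) ->
  TA s (fun x => Series (fun m => G m x)) B /\
  (forall x, is_series (fun m => G m x) (Series (fun m => G m x))).
Proof.
move=> H1 H2; have [H3 H4] := AN_Series (fun a x => @tev_twt s a x s0) H1 H2.
by split=> // x; apply: H4.
Qed.
End Rules.

Lemma TA_mono s s' g B : s' <= s -> TA s g B -> TA s' g B.
Proof.
move=> Hs; elim=> [c a g0 B0 Hg H|G b g0 B0 _ IH H Hser]; last exact: AN_series IH H Hser.
apply: (AN_atom (c := c) (a := a)) => //; apply: Rle_trans H.
apply: Rmult_le_compat_l; first exact: Rabs_pos.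
apply: exp_le; have := knorm_ge0 a.1; nra.
Qed.

Lemma kdot_int k (z : vec n) : is_int_vec z -> exists m, kdot k z = IZR m.
Proof.
move=> Hz; rewrite /kdot /rsum; elim/big_ind: _ => [|_ _ [m1 ->] [m2 ->]|i _].
- by exists 0%Z.
- by exists (m1 + m2)%Z; rewrite plus_IZR.
- by case: (Hz i) => m ->; exists (k i * m)%Z; rewrite mult_IZR.
Qed.

Lemma cos_2PI_Z (t : R) (m : Z) : cos (t + 2 * PI * IZR m) = cos t.
Proof.
have [Hm|Hm] := Z_lt_le_dec m 0.
  have -> : m = (- Z.of_nat (Z.to_nat (- m)))%Z by lia.
  rewrite opp_IZR -INR_IZR_INZ; set N := Z.to_nat _.
  rewrite -(cos_period _ N); congr cos; ring.
have -> : m = Z.of_nat (Z.to_nat m) by lia.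
rewrite -INR_IZR_INZ -(cos_period t (Z.to_nat m)); congr cos; ring.
Qed.

Lemma tev_per a x z : is_int_vec z -> tev a (vadd x z) = tev a x.
Proof.
move=> /(kdot_int a.1) [m Hm]; rewrite /tev /vadd kdot_addr Hm.
by rewrite -[RHS](cos_2PI_Z _ m); congr cos; ring.
Qed.

Lemma TA_per s g B x z : TA s g B -> is_int_vec z -> g (vadd x z) = g x.
Proof.
move=> H Hz; elim: H => [c a g0 B0 Hg _|G b g0 B0 _ IH _ Hs].
  by rewrite !Hg // tev_per.
have E1 := is_series_unique _ _ (Hs x I).
have E2 := is_series_unique _ _ (Hs (vadd x z) I).
by rewrite -E1 -E2; apply: Series_ext => m; apply: IH.
Qed.

Lemma tev_shift a x v :
  tev a (fun i => x i + v i) = cos (2 * PI * kdot a.1 x + a.2 + 2 * PI * kdot a.1 v).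
Proof. by rewrite /tev kdot_addr; congr cos; ring. Qed.

Lemma TA_lip s g B x v d : 0 < s -> TA s g B -> 0 <= d -> (forall i, Rabs (v i) <= d) ->
  Rabs (g (fun i => x i + v i) - g x) <= 2 * PI / s * B * d.
Proof.
move=> s0 H d0 Hd; have pi0 := PI_RGT_0.
have q0 : 0 < / s by apply: Rinv_0_lt_compat.
elim: H => [c a g0 B0 Hg H|G b g0 B0 HG IH H Hs].
  rewrite !Hg // -Rmult_minus_distr_l Rabs_mult tev_shift /tev.
  have H1 := cos_lip (2 * PI * kdot a.1 x + a.2) (2 * PI * kdot a.1 v).
  have H2 := kdot_bound a.1 Hd.
  rewrite Rabs_mult (Rabs_pos_eq (2 * PI)) in H1; last lra.
  have H3 := knorm_exp1 a.1 s0; have H4 := Rabs_pos c; rewrite /twt in H.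
  set K := knorm a.1 in H2 H3 H; set E := exp _ in H3 H.
  apply: (Rle_trans _ (Rabs c * (2 * PI * (/ s * E * d)))).
    apply: Rmult_le_compat_l => //; apply: Rle_trans H1 _.
    apply: Rmult_le_compat_l; first lra.
    by apply: Rle_trans H2 _; apply: Rmult_le_compat_r.
  have -> : Rabs c * (2 * PI * (/ s * E * d)) = 2 * PI / s * d * (Rabs c * E) by rewrite /Rdiv; ring.
  have -> : 2 * PI / s * B0 * d = 2 * PI / s * d * B0 by ring.
  apply: Rmult_le_compat_l => //; rewrite /Rdiv; apply: Rmult_le_pos => //.
  by apply: Rmult_le_pos; lra.
apply: (is_series_abs_ub (is_series_minusR (Hs _ I) (Hs x I)) (b := fun m => 2 * PI / s * d * b m)).
  by move=> m; apply: Rle_trans (IH m) _; lra.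
move=> N; rewrite sum_scalR.
have -> : 2 * PI / s * B0 * d = 2 * PI / s * d * B0 by ring.
apply: Rmult_le_compat_l => //; rewrite /Rdiv; apply: Rmult_le_pos => //.
by apply: Rmult_le_pos; lra.
Qed.

(* Uniform quadratic Taylor remainder: [dg] is the gradient of [g]. *)
Definition grad (K : R) g (dg : 'I_n -> vec n -> R) :=
  forall x v d, 0 <= d -> (forall i, Rabs (v i) <= d) ->
    Rabs (g (fun i => x i + v i) - g x - rsum (fun i => dg i x * v i)) <= K * d ^ 2.

Lemma grad_le K K' g dg : K <= K' -> grad K g dg -> grad K' g dg.
Proof.
move=> HK H x v d d0 Hd; apply: Rle_trans (H x v d d0 Hd) _.
by apply: Rmult_le_compat_r => //; apply: pow_le.
Qed.

Lemma grad_series K (G : nat -> vec n -> R) (dG : nat -> 'I_n -> vec n -> R) b g dg B :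
  0 <= K ->
  (forall m, grad (K * b m) (G m) (dG m)) -> (forall N, sum_f_R0 b N <= B) ->
  (forall x, is_series (fun m => G m x) (g x)) ->
  (forall i x, is_series (fun m => dG m i x) (dg i x)) -> grad (K * B) g dg.
Proof.
move=> K0 HG HB Hg Hdg x v d d0 Hd.
apply: (is_series_abs_ub (a := fun m => G m (fun i => x i + v i) - G m x - rsum (fun i => dG m i x * v i))
   (b := fun m => K * d ^ 2 * b m)).
- apply: is_series_minusR; first exact: is_series_minusR.
  by apply: rsum_is_series => i; apply: is_series_scalrR.
- by move=> m; apply: Rle_trans (HG m x v d d0 Hd) _; lra.
move=> N; rewrite sum_scalR.
have := HB N; have : 0 <= K * d ^ 2 by apply: Rmult_le_pos => //; apply: pow_le.
by move=> h1 h2; have := Rmult_le_compat_l _ _ _ h1 h2; lra.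
Qed.

Lemma grad_atom c k p :
  grad (Rabs c * (2 * PI * knorm k) ^ 2) (fun x => c * cos (2 * PI * kdot k x + p))
    (fun i x => c * (2 * PI * IZR (k i)) * cos (2 * PI * kdot k x + (p + PI / 2))).
Proof.
move=> x v d d0 Hd; have pi0 := PI_RGT_0.
have -> : rsum (fun i => c * (2 * PI * IZR (k i)) * cos (2 * PI * kdot k x + (p + PI / 2)) * v i)
   = c * (cos (2 * PI * kdot k x + p + PI / 2) * (2 * PI * kdot k v)).
  rewrite (rsum_ext (G := fun i => c * (cos (2 * PI * kdot k x + (p + PI / 2)) * (2 * PI)) * (IZR (k i) * v i))).
    by rewrite rsum_scal /kdot Rplus_assoc; ring.
  by move=> i; ring.
rewrite -!Rmult_minus_distr_l Rabs_mult (Rmult_assoc (Rabs c)) kdot_addr.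
apply: Rmult_le_compat_l; first exact: Rabs_pos.
have -> : 2 * PI * (kdot k x + kdot k v) + p = 2 * PI * kdot k x + p + 2 * PI * kdot k v by ring.
apply: Rle_trans (cos_C11 _ _) _.
have H := kdot_bound k Hd.
rewrite -Rpow_mult_distr -(pow2_abs (2 * PI * _)); apply: pow_incr; split; first exact: Rabs_pos.
rewrite Rabs_mult (Rabs_pos_eq (2 * PI)); last lra.
by rewrite (Rmult_assoc (2 * PI) (knorm k)); apply: Rmult_le_compat_l; lra.
Qed.

(** The gradient is kept in the weighted norm, with width loss [dl]; second derivatives only in the
    sup norm, which is enough to differentiate along curves and to use the symmetry of Hessians. The
    two terms of [K] are the Cauchy estimates, with the whole width [s], of second and third
    derivatives. *)
Lemma TA_hess s dl : 0 < dl -> dl <= s -> exists K, 0 <= K /\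
  forall g B, TA s g B -> exists (dg : 'I_n -> vec n -> R) (ddg : 'I_n -> 'I_n -> vec n -> R),
    [/\ forall i, TA (s - dl) (dg i) (2 * PI / dl * B),
        forall i j x, Rabs (ddg i j x) <= K * B,
        grad (K * B) g dg,
        forall i, grad (K * B) (dg i) (ddg i) &
        forall i j x, ddg i j x = ddg j i x].
Proof.
move=> dl0 Hs; have pi0 := PI_RGT_0; have s0 : 0 < s by lra.
pose K := (2 * PI) ^ 2 * (2 / s ^ 2) + (2 * PI) ^ 3 * (6 / s ^ 3).
have p2 : 0 < (2 * PI) ^ 2 by apply: pow_lt; lra.
have p3 : 0 < (2 * PI) ^ 3 by apply: pow_lt; lra.
have q2 : 0 < 2 / s ^ 2 by apply: Rdiv_lt_0_compat; [lra | apply: pow_lt].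
have q3 : 0 < 6 / s ^ 3 by apply: Rdiv_lt_0_compat; [lra | apply: pow_lt].
have K2 : (2 * PI) ^ 2 * (2 / s ^ 2) <= K by rewrite /K; nra.
have K3 : (2 * PI) ^ 3 * (6 / s ^ 3) <= K by rewrite /K; nra.
have K0 : 0 <= K by rewrite /K; nra.
have r2pi t : Rabs (2 * PI * t) = 2 * PI * Rabs t by rewrite Rabs_mult (Rabs_pos_eq (2 * PI)) //; lra.
exists K; split=> // g B; elim=> [c a g0 B0 Hg H|G b g0 B0 HG IH H Hser].
  case: a Hg H => k p /= Hg H; have c0 := Rabs_pos c; have k0 := knorm_ge0 k.
  have E2 : (2 * PI * knorm k) ^ 2 <= K * exp (s * knorm k).
    rewrite Rpow_mult_distr; have := knorm_pow_exp k 2 s0; have -> : INR (fact 2) = 2 by rewrite /=; lra.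
    move=> h; have e0 := exp_pos (s * knorm k).
    have := Rmult_le_compat_l _ _ _ (Rlt_le _ _ p2) h.
    by have := Rmult_le_compat_r _ _ _ (Rlt_le _ _ e0) K2; lra.
  have E3 : (2 * PI * knorm k) ^ 3 <= K * exp (s * knorm k).
    rewrite Rpow_mult_distr; have := knorm_pow_exp k 3 s0; have -> : INR (fact 3) = 6 by rewrite /=; lra.
    move=> h; have e0 := exp_pos (s * knorm k).
    have := Rmult_le_compat_l _ _ _ (Rlt_le _ _ p3) h.
    by have := Rmult_le_compat_r _ _ _ (Rlt_le _ _ e0) K3; lra.
  have HK t : t <= K * exp (s * knorm k) -> Rabs c * t <= K * B0.
    move=> Ht; rewrite /twt /= in H.
    have h1 := Rmult_le_compat_l _ _ _ c0 Ht; have h2 := Rmult_le_compat_l _ _ _ K0 H.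
    lra.
  exists (fun i x => c * (2 * PI * IZR (k i)) * cos (2 * PI * kdot k x + (p + PI / 2))).
  exists (fun i j x => c * (2 * PI * IZR (k i)) * (2 * PI * IZR (k j)) * cos (2 * PI * kdot k x + (p + PI / 2 + PI / 2))).
  have ki i := knorm_coord k i.
  split=> [i|i j x||i|i j x]; last by ring.
  - apply: TA_le (TA_atom _ _ _ _) _.
    rewrite (Rabs_mult c) r2pi.
    have h3 := knorm_exp1 k dl0; rewrite /twt /= in H.
    have E : exp (s * knorm k) = exp (dl * knorm k) * exp ((s - dl) * knorm k).
      by rewrite -exp_plus; congr exp; ring.
    rewrite E in H; have e1 := exp_pos ((s - dl) * knorm k).
    apply: (Rle_trans _ (Rabs c * (2 * PI * (/ dl * exp (dl * knorm k))) * exp ((s - dl) * knorm k))).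
      apply: Rmult_le_compat_r; first lra.
      apply: Rmult_le_compat_l => //; apply: Rmult_le_compat_l; first lra.
      by apply: Rle_trans (ki i) _.
    have -> : Rabs c * (2 * PI * (/ dl * exp (dl * knorm k))) * exp ((s - dl) * knorm k)
       = 2 * PI / dl * (Rabs c * (exp (dl * knorm k) * exp ((s - dl) * knorm k))) by field; lra.
    apply: Rmult_le_compat_l => //; apply: Rlt_le; apply: Rdiv_lt_0_compat; lra.
  - apply: Rle_trans (HK _ E2); rewrite (Rabs_mult (c * _ * _)) (Rabs_mult (c * _)) (Rabs_mult c) !r2pi.
    have := Rabs_le _ _ (COS_bound (2 * PI * kdot k x + (p + PI / 2 + PI / 2))) => hc.
    have := ki i; have := ki j; have := Rabs_pos (IZR (k i)); have := Rabs_pos (IZR (k j)).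
    move: hc; set ci := Rabs (IZR (k i)); set cj := Rabs (IZR (k j)); set C := Rabs (cos _) => hc h1 h2 h3 h4.
    have hC : 0 <= C by apply: Rabs_pos.
    have h : ci * cj * C <= knorm k * knorm k * 1.
      apply: Rmult_le_compat => //; first nra.
      by apply: Rmult_le_compat.
    have -> : Rabs c * (2 * PI * ci) * (2 * PI * cj) * C = Rabs c * ((2 * PI) ^ 2 * (ci * cj * C)) by ring.
    have -> : (2 * PI * knorm k) ^ 2 = (2 * PI) ^ 2 * (knorm k * knorm k * 1) by ring.
    by apply: Rmult_le_compat_l => //; apply: Rmult_le_compat_l => //; lra.
  - have := grad_atom c k p; move/(grad_le (HK _ E2)) => h x v d d0 Hd.
    by rewrite !Hg //; apply: h.
  - have := grad_atom (c * (2 * PI * IZR (k i))) k (p + PI / 2); apply: grad_le.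
    apply: Rle_trans (HK _ E3); rewrite (Rabs_mult c) r2pi.
    rewrite Rmult_assoc; apply: Rmult_le_compat_l => //.
    have -> : (2 * PI * knorm k) ^ 3 = 2 * PI * knorm k * (2 * PI * knorm k) ^ 2 by ring.
    apply: Rmult_le_compat_r; first by apply: pow_le; nra.
    by apply: Rmult_le_compat_l; [lra | apply: ki].
have [F HF] := choiceE (P := fun m (q : ('I_n -> vec n -> R) * ('I_n -> 'I_n -> vec n -> R)) =>
   [/\ forall i, TA (s - dl) (q.1 i) (2 * PI / dl * b m),
        forall i j x, Rabs (q.2 i j x) <= K * b m,
        grad (K * b m) (G m) q.1,
        forall i, grad (K * b m) (q.1 i) (q.2 i) &
        forall i j x, q.2 i j x = q.2 j i x]) ltac:(by move=> m; case: (IH m) => dg [ddg h]; exists (dg, ddg)).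
have c0 : 0 < 2 * PI / dl by apply: Rdiv_lt_0_compat; lra.
have B1 N : sum_f_R0 (fun m => 2 * PI / dl * b m) N <= 2 * PI / dl * B0.
  by rewrite sum_scalR; apply: Rmult_le_compat_l; [lra | apply: H].
have B2 N : sum_f_R0 (fun m => K * b m) N <= K * B0.
  by rewrite sum_scalR; apply: Rmult_le_compat_l; [lra | apply: H].
have S1 i : TA (s - dl) (fun x => Series (fun m => (F m).1 i x)) (2 * PI / dl * B0) /\
  (forall x, is_series (fun m => (F m).1 i x) (Series (fun m => (F m).1 i x))).
  by apply: TA_Series B1; [lra | move=> m; case: (HF m)].
have S2 i j x : is_series (fun m => (F m).2 i j x) (Series (fun m => (F m).2 i j x)) /\
   Rabs (Series (fun m => (F m).2 i j x)) <= K * B0.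
  by apply: dominated_series B2 => m; case: (HF m).
exists (fun i x => Series (fun m => (F m).1 i x)), (fun i j x => Series (fun m => (F m).2 i j x)).
split=> [i|i j x||i|i j x].
- exact: (proj1 (S1 i)).
- exact: (proj2 (S2 i j x)).
- apply: (grad_series (G := G) (dG := fun m => (F m).1) (b := b)) => //.
  + by move=> m; case: (HF m).
  + by move=> x; apply: Hser.
  + by move=> i; exact: (proj2 (S1 i)).
- apply: (grad_series (G := fun m => (F m).1 i) (dG := fun m => (F m).2 i) (b := b)) => //.
  + by move=> m; case: (HF m).
  + exact: (proj2 (S1 i)).
  + by move=> j x; exact: (proj1 (S2 i j x)).
- by apply: Series_ext => m; case: (HF m).
Qed.

End Trig.

(** * Composition with a near-identity map, small divisors *)

Section Composition.
Variable n : nat.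
Implicit Types (k : 'I_n -> Z) (x v w : vec n) (g : vec n -> R).

Lemma TA_kdot s (Y : 'I_n -> vec n -> R) y k : 0 <= s ->
  (forall i, TA s (Y i) y) -> TA s (fun x => kdot k (fun i => Y i x)) (knorm k * y).
Proof.
move=> s0 HY; rewrite /knorm -rsum_scalr; apply: TA_rsum => // i.
exact: TA_scal.
Qed.

(** For an atom the cosine is expanded in [Z = 2 PI k . Y], of norm [z = 2 PI |k| y]; without its
    constant term the series is at most [z * exp z]. The exponential costs the width [2 PI y], the
    factor [|k|] costs the width [dl]. *)
Lemma TA_comp_sub s1 s2 dl g B (Y : 'I_n -> vec n -> R) y :
  0 <= s2 -> 0 < dl -> TA s1 g B -> (forall i, TA s2 (Y i) y) -> 0 <= y ->
  s2 + 2 * PI * y + dl <= s1 ->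
  TA s2 (fun x => g (fun i => x i + Y i x) - g x) (2 * PI * y / dl * B).
Proof.
move=> s20 dl0 Hg HY y0 Hs; have pi0 := PI_RGT_0.
have q0 : 0 < / dl by apply: Rinv_0_lt_compat.
apply: (AN_map (T := fun g x => g (fun i => x i + Y i x) - g x)) (Hg).
- exact: twt0.
- by rewrite /Rdiv; apply: Rmult_le_pos; [nra | lra].
- by move=> G f H x _; apply: is_series_minusR; apply: H.
- by move=> c f a H x _; rewrite !H //; ring.
case=> k p; rewrite /twt /=.
set z := 2 * PI * knorm k * y.
have k0 := knorm_ge0 k.
have z0 : 0 <= z by apply: Rmult_le_pos => //; nra.
pose Z x := 2 * PI * kdot k (fun i => Y i x).
have HZ : TA s2 Z z.
  apply: TA_le (TA_scal (2 * PI) (TA_kdot k s20 HY)) _.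
  by rewrite Rabs_pos_eq; rewrite /z; lra.
apply: (@AN_le _ _ _ _ _ _ (exp (s2 * knorm k) * (z * exp z))).
  apply: (TA_series (G := fun m x => cosT (2 * PI * kdot k x + p) m.+1 * (Z x ^ m.+1 / INR (fact m.+1)))
     (b := fun m => exp (s2 * knorm k) * (z ^ m.+1 / INR (fact m.+1)))).
  - move=> m; apply: TA_mul => //.
      have := TA_atom s2 1 k (p + INR m.+1 * (PI / 2)); rewrite Rabs_R1 Rmult_1_l.
      by apply: TA_ext => x; rewrite /cosT Rmult_1_l; congr cos; ring.
    have := TA_scal (/ INR (fact m.+1)) (TA_pow s20 m.+1 HZ).
    rewrite Rabs_pos_eq; last by apply: Rlt_le; apply: Rinv_0_lt_compat; apply: INR_fact_lt_0.
    move=> H; apply: TA_le (TA_ext _ H) _; last by rewrite /Rdiv; lra.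
    by move=> x; rewrite /Rdiv; ring.
  - move=> N; rewrite sum_scalR; apply: Rmult_le_compat_l; first by have := exp_pos (s2 * knorm k); lra.
    exact: exp_minus1_sum_le.
  - move=> x; rewrite tev_shift /tev /=; exact: cos_series_minus.
have H3 := knorm_exp1 k dl0.
have -> : exp (s2 * knorm k) * (z * exp z) = 2 * PI * y * (knorm k * exp (s2 * knorm k + z)).
  by rewrite exp_plus /z; ring.
have -> : 2 * PI * y / dl * exp (s1 * knorm k) = 2 * PI * y * (/ dl * exp (s1 * knorm k)) by rewrite /Rdiv; ring.
apply: Rmult_le_compat_l; first nra.
apply: (Rle_trans _ (/ dl * exp (dl * knorm k) * exp (s2 * knorm k + z))).
  by apply: Rmult_le_compat_r => //; have := exp_pos (s2 * knorm k + z); lra.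
rewrite Rmult_assoc -exp_plus; apply: Rmult_le_compat_l; first lra.
apply: exp_le; rewrite /z.
have := Rmult_le_compat_r _ _ _ k0 Hs; lra.
Qed.

Lemma TA_comp s1 s2 dl g B (Y : 'I_n -> vec n -> R) y :
  0 <= s2 -> 0 < dl -> TA s1 g B -> (forall i, TA s2 (Y i) y) -> 0 <= y ->
  s2 + 2 * PI * y + dl <= s1 -> 2 * PI * y <= dl ->
  TA s2 (fun x => g (fun i => x i + Y i x)) (2 * B).
Proof.
move=> s20 dl0 Hg HY y0 Hs Hy; have pi0 := PI_RGT_0.
have B0 := TA_ge0 Hg.
have t0 : 0 <= 2 * PI * y by apply: Rmult_le_pos; lra.
have s21 : s2 <= s1 by lra.
have H := TA_add (TA_mono s21 Hg) (TA_comp_sub s20 dl0 Hg HY y0 Hs).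
apply: TA_le (TA_ext _ H) _ => [x|]; first by ring.
have : 2 * PI * y / dl <= 1.
  apply: (Rmult_le_reg_r dl) => //; rewrite /Rdiv Rmult_assoc Rinv_l; lra.
nra.
Qed.

End Composition.

(** * The truncated cohomological equation along [w] *)

Section Cohomology.
Variables (n : nat) (w : vec n).

(** Harmonic by harmonic: the zero one goes to [m], those with [|k| <= Q] are divided by
    [2 PI (k . w)], the others form [r], where the width loss yields [exp (- dl Q)]. The gradient
    costs [|k| / |k . w| <= Q Psi], which is why [lam] dominates both [Psi] and [Q * Psi]. No width
    is lost in [V] and [dV]. *)
Lemma TA_split s dl Q lam Psi : 0 < dl -> dl <= s -> 0 <= Psi -> Psi <= lam -> Q * Psi <= lam ->
  (forall k, 0 < knorm k -> kdot k w <> 0) ->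
  (forall k, 0 < knorm k -> knorm k <= Q -> / Rabs (kdot k w) <= Psi) ->
  exists K, 0 <= K /\ forall g B, TA s g B ->
  exists (m : R) (V : vec n -> R) (dV : 'I_n -> vec n -> R) (r : vec n -> R),
   [/\ Rabs m <= B, TA s V (lam * B), forall i, TA s (dV i) (lam * B),
       TA (s - dl) r (exp (- (dl * Q)) * B) &
       grad (K * B) V dV /\
       forall x, g x = m + rsum (fun i => w i * dV i x) + r x].
Proof.
move=> dl0 Hs Psi0 HPsi HQ Hnr Hk; have pi0 := PI_RGT_0; have pi1 : 1 <= PI by have := PI2_1; lra.
(* Second derivatives cost [2 PI |k|^2 / |k . w| <= 2 PI Q lam]. The absolute value covers a
   negative [Q], for which no harmonic is divided. *)
exists (Rabs (2 * PI * Q * lam)); split; first exact: Rabs_pos.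
have s0 : 0 <= s by lra. have sd : 0 <= s - dl by lra.
have lam0 : 0 <= lam by lra.
set K := Rabs _; have K0 : 0 <= K by apply: Rabs_pos.
have Z0 : grad 0 (fun _ : vec n => 0) (fun _ _ => 0).
  move=> x v d d0 _; rewrite rsum_0; last by move=> i; ring.
  by rewrite !Rminus_0_r Rabs_R0; lra.
have Zle t g dg : 0 <= t -> grad 0 g dg -> grad (n := n) t g dg by exact: grad_le.
have TZ t b : 0 <= t -> 0 <= b -> TA (n := n) t (fun _ => 0) b.
  by move=> t0 b0; apply: TA_le (TA_zero n t) b0.
move=> g B; elim=> [c [k p] g0 B0 Hg H|G b g0 B0 HG IH H Hser].
  rewrite /twt /= in H; have c0 := Rabs_pos c; have k0 := knorm_ge0 k.
  have e1 : 1 <= exp (s * knorm k) by rewrite -exp_0; apply: exp_le; nra.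
  have e2 := exp_pos (- (dl * Q)).
  have B00 : 0 <= B0 by apply: Rle_trans H; apply: Rmult_le_pos; lra.
  have cB : Rabs c <= B0 by nra.
  have lB : 0 <= lam * B0 by apply: Rmult_le_pos.
  have KB : 0 <= K * B0 by apply: Rmult_le_pos.
  have [kz|kp] := Req_dec (knorm k) 0.
    have kd x : kdot k x = 0.
      apply: rsum_0 => i; have := knorm_coord k i; rewrite kz => h.
      have -> : IZR (k i) = 0 by have := Rabs_pos (IZR (k i)) => ?; apply: Rabs_eq_0; lra.
      ring.
    exists (c * cos p), (fun _ => 0), (fun _ _ => 0), (fun _ => 0).
    split=> //; try by [apply: TZ]; try by [move=> i; apply: TZ].
    - rewrite Rabs_mult; apply: Rle_trans cB; rewrite -[X in _ <= X]Rmult_1_r.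
      by apply: Rmult_le_compat_l => //; apply: Rabs_le; apply: COS_bound.
    - by apply: TZ => //; apply: Rmult_le_pos; lra.
    - split; first exact: Zle.
      by move=> x; rewrite Hg // /tev /= kd rsum_0 ?Rmult_0_r ?Rplus_0_l; [ring|move=> i; ring].
  have kp' : 0 < knorm k by lra.
  have [kQ|kQ] := Rle_lt_dec (knorm k) Q; last first.
    exists 0, (fun _ => 0), (fun _ _ => 0), g0.
    split=> //; try by [apply: TZ]; try by [move=> i; apply: TZ].
    - by rewrite Rabs_R0.
    - apply: (AN_atom (c := c) (a := (k, p))) => //; rewrite /twt /=.
      have E : exp ((s - dl) * knorm k) = exp (- (dl * knorm k)) * exp (s * knorm k).
        by rewrite -exp_plus; congr exp; ring.
      have h : exp (- (dl * knorm k)) <= exp (- (dl * Q)) by apply: exp_le; nra.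
      rewrite E; have -> : Rabs c * (exp (- (dl * knorm k)) * exp (s * knorm k)) =
         exp (- (dl * knorm k)) * (Rabs c * exp (s * knorm k)) by ring.
      by apply: Rmult_le_compat => //; [have := exp_pos (- (dl * knorm k)); lra | nra].
    - split; first exact: Zle.
      by move=> x; rewrite rsum_0 => [|i]; ring.
  have kw := Hnr k kp'; have Hkk := Hk k kp' kQ.
  have akw : 0 < Rabs (kdot k w) by apply: Rabs_pos_lt.
  have iakw : 0 < / Rabs (kdot k w) by apply: Rinv_0_lt_compat.
  pose c' := c / (2 * PI * kdot k w).
  have ac' : Rabs c' = Rabs c * (/ (2 * PI) * / Rabs (kdot k w)).
    rewrite /c' /Rdiv Rabs_mult Rabs_inv Rabs_mult (Rabs_pos_eq (2 * PI)); last lra.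
    by rewrite Rinv_mult.
  have i2 : 0 < / (2 * PI) <= 1.
    split; first by apply: Rinv_0_lt_compat; lra.
    by rewrite -Rinv_1; apply: Rinv_le_contravar; lra.
  (* The phase shift by [- PI / 2] integrates the cosine along [w]. *)
  exists 0, (fun x => c' * cos (2 * PI * kdot k x + (p - PI / 2))),
    (fun i x => c' * (2 * PI * IZR (k i)) * cos (2 * PI * kdot k x + (p - PI / 2 + PI / 2))), (fun _ => 0).
  split=> //.
  - by rewrite Rabs_R0.
  - apply: TA_le (TA_atom _ _ _ _) _; rewrite ac'.
    have -> : Rabs c * (/ (2 * PI) * / Rabs (kdot k w)) * exp (s * knorm k) =
       (/ (2 * PI) * / Rabs (kdot k w)) * (Rabs c * exp (s * knorm k)) by ring.
    apply: Rmult_le_compat => //; [nra | apply: Rmult_le_pos; lra | nra].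
  - move=> i; apply: TA_le (TA_atom _ _ _ _) _.
    rewrite Rabs_mult Rabs_mult (Rabs_pos_eq (2 * PI)); last lra.
    have -> : Rabs c' * (2 * PI * Rabs (IZR (k i))) * exp (s * knorm k)
       = Rabs (IZR (k i)) * / Rabs (kdot k w) * (Rabs c * exp (s * knorm k)).
      by rewrite ac'; field; split; lra.
    have ki := knorm_coord k i; have ki0 := Rabs_pos (IZR (k i)).
    apply: Rmult_le_compat => //; [nra | apply: Rmult_le_pos; lra |].
    apply: Rle_trans HQ; apply: Rmult_le_compat; lra.
  - by apply: TZ => //; apply: Rmult_le_pos; lra.
  - split; last first.
      move=> x; rewrite Hg // /tev /= Rplus_0_l Rplus_0_r.
      have -> : p - PI / 2 + PI / 2 = p by ring.
      rewrite (rsum_ext (G := fun i => (c' * (2 * PI) * cos (2 * PI * kdot k x + p)) * (IZR (k i) * w i))).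
        by rewrite rsum_scal -/(kdot k w) /c'; field; split; lra.
      by move=> i; ring.
    apply: grad_le (grad_atom c' k (p - PI / 2)).
    have -> : Rabs c' * (2 * PI * knorm k) ^ 2 = (2 * PI * (knorm k * (knorm k * / Rabs (kdot k w)))) * Rabs c.
      by rewrite ac'; field; split; lra.
    apply: Rmult_le_compat => //; first by apply: Rmult_le_pos; nra.
    apply: Rle_trans (Rle_abs _); rewrite (Rmult_assoc (2 * PI)); apply: Rmult_le_compat_l; first lra.
    apply: Rmult_le_compat; [lra|nra|lra|].
    by apply: Rle_trans HQ; apply: Rmult_le_compat; lra.
have [F HF] := choiceE (P := fun m (q : R * (vec n -> R) * ('I_n -> vec n -> R) * (vec n -> R)) =>
   [/\ Rabs q.1.1.1 <= b m, TA s q.1.1.2 (lam * b m), forall i, TA s (q.1.2 i) (lam * b m),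
       TA (s - dl) q.2 (exp (- (dl * Q)) * b m) &
       grad (K * b m) q.1.1.2 q.1.2 /\
       forall x, G m x = q.1.1.1 + rsum (fun i => w i * q.1.2 i x) + q.2 x])
  ltac:(by move=> m; case: (IH m) => a [V [dV [r h]]]; exists (a, V, dV, r)).
have bnd t : 0 <= t -> forall N, sum_f_R0 (fun m => t * b m) N <= t * B0.
  by move=> t0 N; rewrite sum_scalR; apply: Rmult_le_compat_l.
have [S1 S1'] := dominated_series (a := fun m => (F m).1.1.1) (b := b) (fun m => ltac:(by case: (HF m))) H.
have [S2 S2'] := TA_Series s0 (G := fun m => (F m).1.1.2) (fun m => ltac:(by case: (HF m) => _ h _ _ _; exact: h)) (bnd _ lam0).
have S3 i := TA_Series s0 (G := fun m => (F m).1.2 i) (fun m => ltac:(by case: (HF m) => _ _ h _ _; exact: (h i))) (bnd _ lam0).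
have [S4 S4'] := TA_Series sd (G := fun m => (F m).2) (fun m => ltac:(by case: (HF m) => _ _ _ h _; exact: h)) (bnd _ (Rlt_le _ _ (exp_pos _))).
exists (Series (fun m => (F m).1.1.1)), (fun x => Series (fun m => (F m).1.1.2 x)),
  (fun i x => Series (fun m => (F m).1.2 i x)), (fun x => Series (fun m => (F m).2 x)).
split=> //; first by move=> i; exact: (proj1 (S3 i)).
split.
  apply: (grad_series (G := fun m => (F m).1.1.2) (dG := fun m => (F m).1.2) (b := b)) => //.
    by move=> m; case: (HF m) => _ _ _ _ [].
  by move=> i; exact: (proj2 (S3 i)).
move=> x; rewrite -(is_series_unique _ _ (Hser x I)).
apply: is_series_unique.
apply: (is_series_ext (fun m => (F m).1.1.1 + rsum (fun i => w i * (F m).1.2 i x) + (F m).2 x)).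
  by move=> m; case: (HF m) => _ _ _ _ [_ ->].
apply: is_series_plusR => //; apply: is_series_plusR => //.
by apply: rsum_is_series => i; apply: is_series_scalR; apply: (proj2 (S3 i)).
Qed.

End Cohomology.

(** * Inversion of matrices of functions near the identity *)

Section Neumann.
Variable n : nat.

(** This is [(-N)^(m + 1)]: the index is off by one so that the series has no identity term. *)
Fixpoint negpow (N : 'I_n -> 'I_n -> R) (m : nat) (i j : 'I_n) : R :=
  if m is m'.+1 then rsum (fun l => - N i l * negpow N m' l j) else - N i j.

(** The factor [N] split off on the right, for the second of the two inverse relations. *)
Lemma negpowSr (N : 'I_n -> 'I_n -> R) m i j :
  negpow N m.+1 i j = rsum (fun l => negpow N m i l * - N l j).
Proof.
elim: m i j => [//|m IH] i j.
rewrite /= -/(negpow N m.+1) (rsum_ext (G := fun l => rsum (fun l' => - N i l * (negpow N m l l' * - N l' j)))); last first.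
  by move=> l; rewrite rsum_scal -IH.
rewrite rsum_exch; apply: rsum_ext => l.
by rewrite -rsum_scalr; apply: rsum_ext => l'; ring.
Qed.

(* [K = (1+N)^-1 - 1] by the Neumann series. *)
Lemma Neumann s (N : 'I_n -> 'I_n -> vec n -> R) y : 0 <= s ->
  (forall i j, TA s (N i j) y) -> INR n * y <= / 2 ->
  exists K : 'I_n -> 'I_n -> vec n -> R,
    [/\ forall i j, TA s (K i j) (2 * y),
        forall i j x, N i j x + K i j x + rsum (fun l => N i l x * K l j x) = 0 &
        forall i j x, N i j x + K i j x + rsum (fun l => K i l x * N l j x) = 0].
Proof.
move=> s0 HN Hy.
(* The sign of [y] is read off from an entry of [N], hence the separate dimension 0. *)
case: (posnP n) => [n0|n0].
  have E (i : 'I_n) : False by case: i => i Hi; rewrite n0 in Hi.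
  by exists N; split=> i; case: (E i).
have i0 : 'I_n by exact: (Ordinal n0).
have y0 : 0 <= y := TA_ge0 (HN i0 i0).
pose P m i j x := negpow (fun i j => N i j x) m i j.
have HP m i j : TA s (P m i j) (y * (/ 2) ^ m).
  elim: m i j => [|m IH] i j; first by rewrite /= Rmult_1_r; apply: TA_opp.
  have := TA_rsumc (F := fun l x => - N i l x * P m l j x) (fun l => TA_mul s0 (TA_opp (HN i l)) (IH l j)).
  move=> h; apply: TA_le h _.
  have p : 0 <= (/ 2) ^ m by apply: pow_le; lra.
  have := Rmult_le_compat_r _ _ _ (Rmult_le_pos _ _ y0 p) Hy => /=; lra.
have HB M : sum_f_R0 (fun m => y * (/ 2) ^ m) M <= 2 * y.
  rewrite sum_scalR tech3; last lra.
  have : 0 <= (/2) ^ M.+1 by apply: pow_le; lra.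
  set q := (/ 2) ^ M.+1; move=> p; have -> : (1 - q) / (1 - / 2) = 2 * (1 - q) by field.
  nra.
have S i j := TA_Series s0 (fun m => HP m i j) HB.
exists (fun i j x => Series (fun m => P m i j x)); split=> [i j|i j x|i j x].
- exact: (proj1 (S i j)).
- have H1 := proj2 (S i j) x.
  have H2 : is_series (fun m => P m.+1 i j x) (Series (fun m => P m i j x) + N i j x).
    apply: (is_series_incr_1 (fun m => P m i j x)).
    by rewrite /plus /=; have -> : Series (fun m => P m i j x) + N i j x + - N i j x = Series (fun m => P m i j x) by ring.
  have H3 : is_series (fun m => P m.+1 i j x) (- rsum (fun l => N i l x * Series (fun m => P m l j x))).
    rewrite -rsum_opp; apply: (rsum_is_series (F := fun m l => - N i l x * P m l j x)).
    move=> l; rewrite -Ropp_mult_distr_l_reverse; apply: is_series_scalR; exact: (proj2 (S l j)).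
  by have := is_series_unique _ _ H2; rewrite (is_series_unique _ _ H3); lra.
- have H1 := proj2 (S i j) x.
  have H2 : is_series (fun m => P m.+1 i j x) (Series (fun m => P m i j x) + N i j x).
    apply: (is_series_incr_1 (fun m => P m i j x)).
    by rewrite /plus /=; have -> : Series (fun m => P m i j x) + N i j x + - N i j x = Series (fun m => P m i j x) by ring.
  have H3 : is_series (fun m => P m.+1 i j x) (- rsum (fun l => Series (fun m => P m i l x) * N l j x)).
    apply: (is_series_ext (fun m => rsum (fun l => P m i l x * - N l j x))).
      by move=> m; rewrite /P negpowSr.
    rewrite -rsum_opp (rsum_ext (G := fun l => Series (fun m => P m i l x) * - N l j x)); last by move=> l; ring.
    apply: (rsum_is_series (F := fun m l => P m i l x * - N l j x)).
    by move=> l; apply: is_series_scalrR; exact: (proj2 (S i l)).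
  by have := is_series_unique _ _ H2; rewrite (is_series_unique _ _ H3); lra.
Qed.

End Neumann.

(** * Derivatives along curves *)

Section Chain.

(** [1 / (1 + sum of 1 / f i)] lies below every radius [f i], and replaces a minimum over a finite
    type. *)
Lemma fin_delta m (P : 'I_m -> R -> Prop) :
  (forall i, exists dl, 0 < dl /\ forall h, Rabs h < dl -> P i h) ->
  exists dl, 0 < dl /\ forall i h, Rabs h < dl -> P i h.
Proof.
move=> /choiceE [f Hf].
have q0 i : 0 < / f i by apply: Rinv_0_lt_compat; exact: (proj1 (Hf i)).
have s0 : 0 <= rsum (fun i => / f i) by apply: rsum_ge0 => i; apply: Rlt_le.
exists (/ (1 + rsum (fun i => / f i))); split.
  by apply: Rinv_0_lt_compat; lra.
move=> i h Hh; apply: (proj2 (Hf i)); apply: Rlt_le_trans Hh _.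
rewrite -[X in _ <= X]Rinv_inv; apply: Rinv_le_contravar; first exact: q0.
have := rsum_ge_term (F := fun i => / f i) i (fun j => Rlt_le _ _ (q0 j)); lra.
Qed.

Lemma derivable_lip f t v : derivable_pt_lim f t v ->
  exists dl, 0 < dl /\ forall h, Rabs h < dl -> Rabs (f (t + h) - f t) <= (Rabs v + 1) * Rabs h.
Proof.
move=> /(_ 1 ltac:(lra)) [[dl dl0] /= H]; exists dl; split=> // h Hh.
have [->|h0] := Req_dec h 0.
  by rewrite Rplus_0_r Rminus_diag Rabs_R0; lra.
have := H h h0 Hh; set q := _ / h => Hq.
have -> : f (t + h) - f t = q * h by rewrite /q; field.
rewrite Rabs_mult; apply: Rmult_le_compat_r; first exact: Rabs_pos.
have -> : q = v + (q - v) by ring.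
by apply: Rle_trans (Rabs_triang _ _) _; lra.
Qed.

Lemma derivable_quadratic f t K dl : 0 < dl -> 0 <= K ->
  (forall h, Rabs h < dl -> Rabs (f (t + h) - f t) <= K * h ^ 2) -> derivable_pt_lim f t 0.
Proof.
move=> dl0 K0 H eps eps0.
have d0 : 0 < Rmin dl (eps / (K + 1)).
  by apply: Rmin_pos => //; apply: Rdiv_lt_0_compat; lra.
exists (mkposreal _ d0) => h h0 /= Hh.
have Hh1 := Rlt_le_trans _ _ _ Hh (Rmin_l _ _); have Hh2 := Rlt_le_trans _ _ _ Hh (Rmin_r _ _).
rewrite Rminus_0_r /Rdiv Rabs_mult Rabs_inv.
have ah : 0 < Rabs h by apply: Rabs_pos_lt.
apply: (Rle_lt_trans _ (K * h ^ 2 * / Rabs h)).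
  by apply: Rmult_le_compat_r; [apply: Rlt_le; apply: Rinv_0_lt_compat | apply: H].
rewrite -pow2_abs; have -> : K * Rabs h ^ 2 * / Rabs h = K * Rabs h by field; lra.
have : (K + 1) * Rabs h < eps.
  have -> : eps = (K + 1) * (eps / (K + 1)) by field; lra.
  by apply: Rmult_lt_compat_l; lra.
lra.
Qed.

(** The difference between [E] and its linearization [L] is quadratic in the increments of the
    curves, which are Lipschitz at [t]; so it has derivative 0. Two curves, because momentum and
    angle have separate gradients. *)
Lemma curve_derivable n1 n2 (E : R -> R) (c1 : R -> 'I_n1 -> R) (c2 : R -> 'I_n2 -> R) a b v1 v2 t K r :
  0 < r -> 0 <= K ->
  (forall i, derivable_pt_lim (fun s => c1 s i) t (v1 i)) ->
  (forall i, derivable_pt_lim (fun s => c2 s i) t (v2 i)) ->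
  (forall s d, 0 <= d < r -> (forall i, Rabs (c1 s i - c1 t i) <= d) ->
     (forall i, Rabs (c2 s i - c2 t i) <= d) ->
     Rabs (E s - E t - rsum (fun i => a i * (c1 s i - c1 t i)) - rsum (fun i => b i * (c2 s i - c2 t i)))
       <= K * d ^ 2) ->
  derivable_pt_lim E t (rsum (fun i => a i * v1 i) + rsum (fun i => b i * v2 i)).
Proof.
move=> r0 K0 H1 H2 HE.
have [d1 [d10 Hd1]] := fin_delta (fun i => derivable_lip (H1 i)).
have [d2 [d20 Hd2]] := fin_delta (fun i => derivable_lip (H2 i)).
pose M := 1 + rsum (fun i => Rabs (v1 i)) + rsum (fun i => Rabs (v2 i)).
have M1 i : Rabs (v1 i) + 1 <= M.
  have := rsum_ge_term (F := fun i => Rabs (v1 i)) i (fun j => Rabs_pos _).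
  have := rsum_ge0 (F := fun i => Rabs (v2 i)) (fun j => Rabs_pos _); rewrite /M; lra.
have M2 i : Rabs (v2 i) + 1 <= M.
  have := rsum_ge_term (F := fun i => Rabs (v2 i)) i (fun j => Rabs_pos _).
  have := rsum_ge0 (F := fun i => Rabs (v1 i)) (fun j => Rabs_pos _); rewrite /M; lra.
have M0 : 1 <= M.
  have := rsum_ge0 (F := fun i => Rabs (v1 i)) (fun j => Rabs_pos _).
  have := rsum_ge0 (F := fun i => Rabs (v2 i)) (fun j => Rabs_pos _); rewrite /M; lra.
pose L s := rsum (fun i => a i * c1 s i) + rsum (fun i => b i * c2 s i).
have HL : derivable_pt_lim L t (rsum (fun i => a i * v1 i) + rsum (fun i => b i * v2 i)).
  apply: derivable_pt_lim_plus; apply: rsum_derivable => i; exact: derivable_pt_lim_scal.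
have HR : derivable_pt_lim (fun s => E s - L s) t 0.
  apply: (@derivable_quadratic _ _ (K * M ^ 2) (Rmin (r / M) (Rmin d1 d2))).
  - apply: Rmin_pos; first by apply: Rdiv_lt_0_compat; lra.
    exact: Rmin_pos.
  - by apply: Rmult_le_pos => //; apply: pow_le; lra.
  move=> h Hh.
  have h1 := Rlt_le_trans _ _ _ Hh (Rmin_l _ _).
  have h2 := Rlt_le_trans _ _ _ Hh (Rle_trans _ _ _ (Rmin_r _ _) (Rmin_l _ _)).
  have h3 := Rlt_le_trans _ _ _ Hh (Rle_trans _ _ _ (Rmin_r _ _) (Rmin_r _ _)).
  have ah := Rabs_pos h.
  have := HE (t + h) (M * Rabs h).
  have -> : K * (M * Rabs h) ^ 2 = K * M ^ 2 * h ^ 2 by rewrite Rpow_mult_distr pow2_abs; ring.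
  have -> : E (t + h) - L (t + h) - (E t - L t) = E (t + h) - E t -
     rsum (fun i => a i * (c1 (t + h) i - c1 t i)) - rsum (fun i => b i * (c2 (t + h) i - c2 t i)).
    rewrite (rsum_ext (G := fun i => a i * c1 (t + h) i - a i * c1 t i)); last by move=> i; ring.
    rewrite (rsum_ext (F := fun i => b i * (_ - _)) (G := fun i => b i * c2 (t + h) i - b i * c2 t i)); last by move=> i; ring.
    by rewrite !rsum_minus /L; ring.
  apply.
  - split; first by apply: Rmult_le_pos; lra.
    have -> : r = M * (r / M) by field; lra.
    by apply: Rmult_lt_compat_l; lra.
  - by move=> i; apply: Rle_trans (Hd1 i h h2) _; apply: Rmult_le_compat_r.
  - by move=> i; apply: Rle_trans (Hd2 i h h3) _; apply: Rmult_le_compat_r.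
have := derivable_pt_lim_plus _ _ _ _ _ HL HR.
rewrite Rplus_0_r; apply: derivable_pt_lim_ext => s; rewrite /plus_fct; ring.
Qed.

Variable n : nat.
Implicit Types (x v : vec n) (g : vec n -> R) (dg : 'I_n -> vec n -> R).

Lemma grad_curve K g dg (c : R -> vec n) t v : 0 <= K -> grad K g dg ->
  (forall i, derivable_pt_lim (fun s => c s i) t (v i)) ->
  derivable_pt_lim (fun s => g (c s)) t (rsum (fun i => dg i (c t) * v i)).
Proof.
move=> K0 Hg Hc.
(* The second curve is put in dimension 0. *)
have := @curve_derivable n 0 (fun s => g (c s)) c (fun _ _ => 0) (fun i => dg i (c t)) (fun _ => 0) v (fun _ => 0) t K 1.
rewrite (rsum_0 (F := fun i : 'I_0 => 0 * 0)) ?Rplus_0_r; last by move=> i; ring.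
apply=> //; try lra.
  by move=> i; apply: derivable_pt_lim_const.
move=> s d [d0 _] H1 _; rewrite (rsum_0 (F := fun i : 'I_0 => 0 * (0 - 0))); last by move=> i; ring.
rewrite Rminus_0_r; have := Hg (c t) (fun i => c s i - c t i) d d0 H1.
have -> : (fun i => c t i + (c s i - c t i)) = c s by apply: functional_extensionality => i; ring.
by [].
Qed.

Lemma line_derivable x v t i : derivable_pt_lim (fun s => vadd x (vscal s v) i) t (v i).
Proof.
have := derivable_pt_lim_plus _ _ t _ _ (derivable_pt_lim_const (x i) t) (derivable_pt_lim_mult _ _ t _ _ (derivable_pt_lim_id t) (derivable_pt_lim_const (v i) t)).
have -> : 0 + (1 * fct_cte (v i) t + id t * 0) = v i by rewrite /fct_cte; ring.
by apply: derivable_pt_lim_ext => s.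
Qed.

Lemma vadd_vscal0 x v : vadd x (vscal 0 v) = x.
Proof. by apply: functional_extensionality => i; rewrite /vadd /vscal; ring. Qed.

Lemma grad_dir K g dg x v : 0 <= K -> grad K g dg ->
  has_dir_deriv g x v (rsum (fun i => dg i x * v i)).
Proof.
move=> K0 Hg; rewrite -{2}(vadd_vscal0 x v).
by apply: (grad_curve (c := fun s => vadd x (vscal s v)) K0 Hg) => i; apply: line_derivable.
Qed.

Lemma rsum_ebasis (F : 'I_n -> R) i : rsum (fun j => F j * ebasis i j) = F i.
Proof. by rewrite -[RHS](rsum_delta F i); apply: rsum_ext => j; rewrite /ebasis Rmult_comm. Qed.

Lemma grad_partial K g dg x i : 0 <= K -> grad K g dg -> has_partial g i x (dg i x).
Proof. by move=> K0 /(grad_dir x (ebasis i) K0); rewrite rsum_ebasis. Qed.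

Lemma grad_unique K K' g dg dg' i x : 0 <= K -> 0 <= K' -> grad K g dg -> grad K' g dg' ->
  dg i x = dg' i x.
Proof.
move=> h1 h2 /(grad_partial x i h1) H1 /(grad_partial x i h2) H2.
exact: uniqueness_limite H1 H2.
Qed.

(** Stated for a given gradient [dG] of the composition: its existence comes from the composition
    having a finite norm, and both sides are then the same partial derivative. *)
Lemma grad_chain K K1 K2 g dg (Y : 'I_n -> vec n -> R) dY dG a x :
  0 <= K -> 0 <= K1 -> 0 <= K2 -> grad K g dg -> (forall l, grad K1 (Y l) (dY l)) ->
  grad K2 (fun x => g (fun i => x i + Y i x)) dG ->
  dG a x = rsum (fun l => dg l (fun i => x i + Y i x) * (ebasis a l + dY l a x)).
Proof.
move=> h h1 h2 Hg HY /(grad_partial x a h2) H2.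
apply: uniqueness_limite H2 _.
pose c s i := vadd x (vscal s (ebasis a)) i + Y i (vadd x (vscal s (ebasis a))).
have Hc i : derivable_pt_lim (fun s => c s i) 0 (ebasis a i + dY i a x).
  by apply: derivable_pt_lim_plus; [apply: line_derivable | apply: grad_partial (HY i)].
have := grad_curve h Hg Hc; rewrite /has_partial.
by have -> : c 0 = (fun i => x i + Y i x) by rewrite /c vadd_vscal0.
Qed.

End Chain.

(** * Analyticity of trigonometric series *)

Section Multinomial.
Variable n : nat.

(** Monomials of degree [N] are handled as words of length [N], and the multi-index of a word counts
    its letters; multinomial coefficients then never appear explicitly. *)
Definition content N (f : {ffun 'I_N -> 'I_n}) (i : 'I_n) : nat := (\sum_(l | f l == i) 1)%N.

Lemma content_sum N (f : {ffun 'I_N -> 'I_n}) : (\sum_i content f i)%N = N.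
Proof.
rewrite -[RHS](card_ord N) -sum1_card.
by rewrite (partition_big f predT).
Qed.

Lemma content_lt N (f : {ffun 'I_N -> 'I_n}) i : (content f i < N.+1)%N.
Proof. by rewrite ltnS -[X in (_ <= X)%N](content_sum f) (bigD1 i) //= leq_addr. Qed.

Lemma rprod_content N (f : {ffun 'I_N -> 'I_n}) (y : 'I_n -> R) :
  rprod (fun l => y (f l)) = rprod (fun i => y i ^ content f i).
Proof.
rewrite /rprod (partition_big f predT) //=; apply: eq_bigr => i _.
rewrite /content sum1_card.
have -> : \big[Rmult/1]_(l | f l == i) y (f l) = \big[Rmult/1]_(l | f l == i) y i.
  by apply: eq_bigr => l /eqP ->.
rewrite big_const; elim: #|_| => [//|m IH]; by rewrite iterS IH.
Qed.

(* Coefficient of [y^alpha] in [(k . y)^N], as a sum over the words with content [alpha]. *)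
Definition mcN N (k : 'I_n -> R) (alpha : 'I_n -> nat) : R :=
  \big[Rplus/0]_(f : {ffun 'I_N -> 'I_n} | [forall i, content f i == alpha i]) rprod (fun l => k (f l)).

Lemma rsum_pow N (k : 'I_n -> R) :
  rsum k ^ N = \big[Rplus/0]_(f : {ffun 'I_N -> 'I_n}) rprod (fun l => k (f l)).
Proof.
rewrite /rprod -(bigA_distr_bigA (fun (_ : 'I_N) i => k i)) /= big_const card_ord.
elim: N => [//|m IH]; by rewrite iterS /= IH.
Qed.

(** Expand the power into words and group the words by content. *)
Lemma multinomial N (k y : 'I_n -> R) :
  \big[Rplus/0]_(a : {ffun 'I_n -> 'I_N.+1} | (\sum_(i < n) nat_of_ord (a i))%N == N)
     (mcN N k (fun i => nat_of_ord (a i)) * rprod (fun i => y i ^ nat_of_ord (a i)))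
  = rsum (fun i => k i * y i) ^ N.
Proof.
pose p (f : {ffun 'I_N -> 'I_n}) : {ffun 'I_n -> 'I_N.+1} := [ffun i => Ordinal (content_lt f i)].
rewrite rsum_pow.
rewrite (partition_big p (fun a : {ffun 'I_n -> 'I_N.+1} => (\sum_(i < n) nat_of_ord (a i))%N == N)) /=; last first.
  move=> f _; rewrite -[X in _ == X](content_sum f); apply/eqP; apply: eq_bigr => i _.
  by rewrite ffunE.
apply: eq_bigr => a _; rewrite /mcN big_distrl /=.
have E f : [forall i, content f i == nat_of_ord (a i)] = (p f == a).
  apply/forallP/eqP => [H|<- i]; last by rewrite ffunE.
  by apply/ffunP => i; apply: val_inj; rewrite ffunE /=; apply/eqP.
rewrite (eq_bigl _ _ E); apply: eq_bigr => f /eqP <-.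
have -> : rprod (fun l => k (f l) * y (f l)) = rprod (fun l => k (f l)) * rprod (fun l => y (f l)).
  by rewrite /rprod big_split.
congr (_ * _); rewrite [RHS]rprod_content /rprod.
by apply: eq_bigr => i _; rewrite ffunE.
Qed.

Lemma big_abs (I : Type) (s : seq I) (P : pred I) (F : I -> R) :
  Rabs (\big[Rplus/0]_(i <- s | P i) F i) <= \big[Rplus/0]_(i <- s | P i) Rabs (F i).
Proof.
elim/big_ind2: _ => [|x1 x2 y1 y2 H1 H2|i _]; last by lra.
  by rewrite Rabs_R0; lra.
by apply: Rle_trans (Rabs_triang _ _) _; apply: Rplus_le_compat.
Qed.

Lemma big_le (I : Type) (s : seq I) (P : pred I) (F G : I -> R) :
  (forall i, P i -> F i <= G i) ->
  \big[Rplus/0]_(i <- s | P i) F i <= \big[Rplus/0]_(i <- s | P i) G i.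
Proof.
move=> H; elim/big_ind2: _ => //; first lra.
by move=> *; apply: Rplus_le_compat.
Qed.

Lemma big_ge0 (I : Type) (s : seq I) (P : pred I) (F : I -> R) :
  (forall i, P i -> 0 <= F i) -> 0 <= \big[Rplus/0]_(i <- s | P i) F i.
Proof.
move=> H; elim/big_ind: _ => //; first lra.
by move=> *; apply: Rplus_le_le_0_compat.
Qed.

Lemma big_is_series (I : Type) (s : seq I) (P : pred I) (F : nat -> I -> R) (l : I -> R) :
  (forall i, is_series (fun m => F m i) (l i)) ->
  is_series (fun m => \big[Rplus/0]_(i <- s | P i) F m i) (\big[Rplus/0]_(i <- s | P i) l i).
Proof.
move=> H; elim: s => [|i s IH].
  apply: (is_series_ext (fun _ => 0)); first by move=> m; rewrite big_nil.
  by rewrite big_nil; apply: is_series_0R.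
rewrite big_cons; case E: (P i).
  apply: (is_series_ext (fun m => F m i + \big[Rplus/0]_(j <- s | P j) F m j)).
    by move=> m; rewrite big_cons E.
  exact: is_series_plusR.
by apply: (is_series_ext (fun m => \big[Rplus/0]_(j <- s | P j) F m j)) => // m; rewrite big_cons E.
Qed.

Lemma rprod_abs N (k : 'I_N -> R) : Rabs (rprod k) = rprod (fun i => Rabs (k i)).
Proof.
rewrite /rprod; elim/big_ind2: _ => [|x1 x2 y1 y2 <- <-|//]; last exact: Rabs_mult.
exact: Rabs_R1.
Qed.

Lemma rprod_ge0 N (k : 'I_N -> R) : (forall i, 0 <= k i) -> 0 <= rprod k.
Proof.
by move=> H; rewrite /rprod; elim/big_ind: _ => //; [lra | move=> *; apply: Rmult_le_pos].
Qed.

Lemma mcN_abs_le N (k : 'I_n -> R) alpha : Rabs (mcN N k alpha) <= mcN N (fun i => Rabs (k i)) alpha.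
Proof.
apply: Rle_trans (big_abs _ _ _) _; apply: big_le => f _.
by rewrite rprod_abs; lra.
Qed.

Lemma mcN_pos_le N (k : 'I_n -> R) alpha : (forall i, 0 <= k i) -> mcN N k alpha <= rsum k ^ N.
Proof.
move=> H; rewrite rsum_pow /mcN [X in _ <= X](bigID (fun f : {ffun 'I_N -> 'I_n} => [forall i, content f i == alpha i])) /=.
have : 0 <= \big[Rplus/0]_(f : {ffun 'I_N -> 'I_n} | ~~ [forall i, content f i == alpha i]) rprod (fun l => k (f l)).
  by apply: big_ge0 => f _; apply: rprod_ge0.
by set X := \big[_/_]_(_ | ~~ _) _ => h; apply: Rle_trans (Rplus_le_compat_l _ _ _ h); rewrite Rplus_0_r; right.
Qed.

Lemma multinomial_abs N (k : 'I_n -> R) :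
  \big[Rplus/0]_(a : {ffun 'I_n -> 'I_N.+1} | (\sum_(i < n) nat_of_ord (a i))%N == N)
     Rabs (mcN N k (fun i => nat_of_ord (a i))) <= rsum (fun i => Rabs (k i)) ^ N.
Proof.
have := multinomial N (fun i => Rabs (k i)) (fun _ => 1).
rewrite (rsum_ext (G := fun i => Rabs (k i))); last by move=> i; ring.
move=> <-; apply: big_le => a _.
have -> : rprod (fun i => 1 ^ nat_of_ord (a i)) = 1.
  rewrite /rprod big1 // => i _; exact: pow1.
by rewrite Rmult_1_r; apply: mcN_abs_le.
Qed.

End Multinomial.

Section TAanalytic.
Variable n : nat.

(** Each bound is linear in [B], hence survives summation over a series of functions; the first one
    makes the series of coefficients converge. *)
Definition taylor_at (g : vec n -> R) (x0 : vec n) (r B : R) (c : ('I_n -> nat) -> R) :=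
  [/\ forall N alpha, N = (\sum_i alpha i)%N -> Rabs (c alpha) * r ^ N <= B,
      forall N, abs_monomials_deg N c r <= B * (/ 2) ^ N &
      forall x N, in_ball x0 r x ->
        Rabs (g x - sum_f_R0 (fun k => monomials_deg k c (vsub x x0)) N) <= B * (/ 2) ^ N].

(** For an atom the part of degree [N] is a derivative of the cosine times [(2 PI k . y)^N / N!].
    The condition [4 PI r <= s] puts [exp (4 PI r |k|)] below the weight, so that [pow_fact_half]
    gives the rate [2^-N]. For series the coefficients are summed termwise. *)
Lemma TA_taylor s g B x0 r : 0 < s -> 0 < r -> 4 * PI * r <= s -> TA s g B ->
  exists c, taylor_at g x0 r B c.
Proof.
move=> s0 r0 Hr; have pi0 := PI_RGT_0.
elim=> [c0 [k p] g0 B0 Hg H|G b g0 B0 HG IH H Hser].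
  rewrite /twt /= in H; set a := 2 * PI * kdot k x0 + p.
  pose kk i := IZR (k i).
  pose t N := c0 * cosT a N * ((2 * PI) ^ N / INR (fact N)).
  have Ek : rsum (fun i => Rabs (kk i)) = knorm k by [].
  have k0 := knorm_ge0 k.
  have tK N : Rabs (t N) * (knorm k ^ N * r ^ N) <= B0 * (/ 2) ^ N.
    have f0 := INR_fact_lt_0 N.
    have p0 : 0 < (2 * PI) ^ N by apply: pow_lt; lra.
    have q0 : 0 < (/ 2) ^ N by apply: pow_lt; lra.
    have -> : Rabs (t N) * (knorm k ^ N * r ^ N) = Rabs c0 * Rabs (cosT a N) * ((2 * PI * r * knorm k) ^ N / INR (fact N)).
      rewrite /t (Rabs_mult (c0 * _)) (Rabs_mult c0) (Rabs_pos_eq (_ / _)); last by apply: Rlt_le; apply: Rdiv_lt_0_compat.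
      by rewrite !Rpow_mult_distr; field; lra.
    have h1 := cosT_bound a N; have h2 := @pow_fact_half (2 * PI * r * knorm k) N.
    have z0 : 0 <= 2 * PI * r * knorm k by apply: Rmult_le_pos => //; nra.
    have h3 : exp (2 * (2 * PI * r * knorm k)) <= exp (s * knorm k) by apply: exp_le; nra.
    have h4 := h2 z0; have c00 := Rabs_pos c0; have := exp_pos (s * knorm k) => e0.
    have h5 : (2 * PI * r * knorm k) ^ N / INR (fact N) <= (/ 2) ^ N * exp (s * knorm k) by nra.
    have h6 : 0 <= (2 * PI * r * knorm k) ^ N / INR (fact N) by apply: Rdiv_le_0_compat => //; apply: pow_le.
    apply: (Rle_trans _ (Rabs c0 * 1 * ((/ 2) ^ N * exp (s * knorm k)))).
      apply: Rmult_le_compat => //; first by apply: Rmult_le_pos => //; apply: Rabs_pos.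
      exact: Rmult_le_compat_l.
    have -> : Rabs c0 * 1 * ((/ 2) ^ N * exp (s * knorm k)) = (Rabs c0 * exp (s * knorm k)) * (/ 2) ^ N by ring.
    by apply: Rmult_le_compat_r => //; lra.
  pose c alpha := t (\sum_i alpha i)%N * mcN (\sum_i alpha i)%N kk alpha.
  have B00 : 0 <= B0 by have := tK 0%N; rewrite /= !Rmult_1_r; have := Rabs_pos (t 0%N); lra.
  exists c; split.
  - move=> N alpha ->; rewrite /c Rabs_mult; set M := (\sum_i alpha i)%N.
    apply: (Rle_trans _ (Rabs (t M) * (knorm k ^ M * r ^ M))).
      rewrite Rmult_assoc; apply: Rmult_le_compat_l; first exact: Rabs_pos.
      apply: Rmult_le_compat_r; first by apply: pow_le; lra.
      apply: Rle_trans (mcN_abs_le _ _ _) _; rewrite -Ek.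
      by apply: mcN_pos_le => i; apply: Rabs_pos.
    apply: Rle_trans (tK M) _; have : (/ 2) ^ M <= 1 by rewrite -(pow1 M); apply: pow_incr; lra.
    by move=> h; have := Rmult_le_compat_l _ _ _ B00 h; lra.
  - move=> N; apply: Rle_trans (tK N); rewrite /abs_monomials_deg.
    rewrite (eq_bigr (fun a : {ffun 'I_n -> 'I_N.+1} => Rabs (t N) * r ^ N * Rabs (mcN N kk (fun i => nat_of_ord (a i))))); last first.
      by move=> e /eqP E; rewrite /c E Rabs_mult; ring.
    rewrite -big_distrr /=.
    have := multinomial_abs N kk; rewrite Ek => h.
    have : 0 <= Rabs (t N) * r ^ N by apply: Rmult_le_pos; [apply: Rabs_pos | apply: pow_le; lra].
    move=> h1; have -> : Rabs (t N) * (knorm k ^ N * r ^ N) = Rabs (t N) * r ^ N * knorm k ^ N by ring.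
    exact: Rmult_le_compat_l.
  - move=> x N Hx.
    have Em M : monomials_deg M c (vsub x x0) = c0 * (cosT a M * ((2 * PI * kdot k (vsub x x0)) ^ M / INR (fact M))).
      rewrite /monomials_deg.
      rewrite (eq_bigr (fun e : {ffun 'I_n -> 'I_M.+1} => t M * (mcN M kk (fun i => nat_of_ord (e i)) * rprod (fun i => vsub x x0 i ^ nat_of_ord (e i))))); last first.
        by move=> e /eqP E; rewrite /c E; ring.
      by rewrite -big_distrr /= multinomial -/(kdot k (vsub x x0)) /t (Rpow_mult_distr (2 * PI) (kdot _ _)) /Rdiv; ring.
    rewrite (sum_extR N Em) sum_scalR Hg // -Rmult_minus_distr_l Rabs_mult.
    have -> : tev (k, p) x = cos (a + 2 * PI * kdot k (vsub x x0)).
      transitivity (tev (k, p) (fun i => x0 i + vsub x x0 i)); last exact: tev_shift.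
      by congr (tev _ _); apply: functional_extensionality => i; rewrite /vsub; ring.
    have h1 := cos_Taylor a (2 * PI * kdot k (vsub x x0)) N.
    have h2 := pow_fact_half N.+1 (Rabs_pos (2 * PI * kdot k (vsub x x0))).
    have h3 : 2 * Rabs (2 * PI * kdot k (vsub x x0)) <= s * knorm k.
      rewrite Rabs_mult (Rabs_pos_eq (2 * PI)); last lra.
      have := kdot_bound k (x := vsub x x0) (d := r) (fun i => Rlt_le _ _ (Hx i)); nra.
    have q0 : 0 < (/ 2) ^ N by apply: pow_lt; lra.
    have h4 := exp_le h3; have c00 := Rabs_pos c0.
    have -> : B0 * (/ 2) ^ N = (/ 2) ^ N * B0 by ring.
    apply: (Rle_trans _ (Rabs c0 * ((/ 2) ^ N * exp (s * knorm k)))); last by nra.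
    apply: Rmult_le_compat_l => //; apply: Rle_trans h1 _; apply: Rle_trans h2 _.
    rewrite /=; have := exp_pos (2 * Rabs (2 * PI * kdot k (vsub x x0))); nra.
have [C HC] := choiceE IH.
have rN N : 0 < r ^ N by apply: pow_lt.
have bnd t : 0 <= t -> forall N, sum_f_R0 (fun m => t * b m) N <= t * B0.
  by move=> t0 N; rewrite sum_scalR; apply: Rmult_le_compat_l.
have S alpha : is_series (fun m => C m alpha) (Series (fun m => C m alpha)) /\
   Rabs (Series (fun m => C m alpha)) <= / r ^ (\sum_i alpha i)%N * B0.
  set M := (\sum_i alpha i)%N.
  apply: (dominated_series (b := fun m => / r ^ M * b m)).
    move=> m; case: (HC m) => h _ _; have := h M alpha erefl => h'.
    apply: (Rmult_le_reg_l (r ^ M)) => //; rewrite -Rmult_assoc Rinv_r; last by have := rN M; lra.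
    by rewrite Rmult_comm; lra.
  by apply: bnd; apply: Rlt_le; apply: Rinv_0_lt_compat.
pose c alpha := Series (fun m => C m alpha).
exists c; split.
- move=> N alpha ->; set M := (\sum_i alpha i)%N.
  have := proj2 (S alpha); rewrite -/M => h.
  apply: (Rle_trans _ (/ r ^ M * B0 * r ^ M)); first by apply: Rmult_le_compat_r => //; apply: Rlt_le.
  by right; field; have := rN M; lra.
- move=> N.
  have q0 : 0 < (/ 2) ^ N by apply: pow_lt; lra.
  have E : is_series (fun m => abs_monomials_deg N (C m) r)
     (\big[Rplus/0]_(a : {ffun 'I_n -> 'I_N.+1} | (\sum_(i < n) nat_of_ord (a i))%N == N)
       (Series (fun m => Rabs (C m (fun i => nat_of_ord (a i)))) * r ^ N)).
    apply: big_is_series => a; apply: is_series_scalrR.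
    set al := fun i => nat_of_ord (a i); set M := (\sum_i al i)%N.
    apply: (proj1 (dominated_series (b := fun m => / r ^ M * b m) (B := / r ^ M * B0) _ _)).
      move=> m; rewrite Rabs_Rabsolu; case: (HC m) => h _ _; have := h M al erefl => h'.
      apply: (Rmult_le_reg_l (r ^ M)) => //; rewrite -Rmult_assoc Rinv_r; last by have := rN M; lra.
      by rewrite Rmult_comm; lra.
    by apply: bnd; apply: Rlt_le; apply: Rinv_0_lt_compat.
  apply: (Rle_trans _ (\big[Rplus/0]_(a : {ffun 'I_n -> 'I_N.+1} | (\sum_(i < n) nat_of_ord (a i))%N == N)
       (Series (fun m => Rabs (C m (fun i => nat_of_ord (a i)))) * r ^ N))).
    apply: big_le => a _; apply: Rmult_le_compat_r; first by apply: Rlt_le.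
    apply: Series_Rabs; set al := fun i => nat_of_ord (a i); set M := (\sum_i al i)%N.
    exists (Series (fun m => Rabs (C m al))).
    apply: (proj1 (dominated_series (b := fun m => / r ^ M * b m) (B := / r ^ M * B0) _ _)).
      move=> m; rewrite Rabs_Rabsolu; case: (HC m) => h _ _; have := h M al erefl => h'.
      apply: (Rmult_le_reg_l (r ^ M)) => //; rewrite -Rmult_assoc Rinv_r; last by have := rN M; lra.
      by rewrite Rmult_comm; lra.
    by apply: bnd; apply: Rlt_le; apply: Rinv_0_lt_compat.
  apply: is_series_ub E _ => K; rewrite Rmult_comm; apply: Rle_trans (bnd _ (Rlt_le _ _ q0) K).
  by apply: sum_Rle => m _; case: (HC m) => _ h _; rewrite Rmult_comm; apply: h.
- move=> x N Hx.
  have q0 : 0 < (/ 2) ^ N by apply: pow_lt; lra.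
  rewrite Rmult_comm.
  apply: (is_series_abs_ub (a := fun m => G m x - sum_f_R0 (fun k => monomials_deg k (C m) (vsub x x0)) N) (b := fun m => (/ 2) ^ N * b m)).
  + apply: is_series_minusR; first exact: Hser.
    have E k : is_series (fun m => monomials_deg k (C m) (vsub x x0)) (monomials_deg k c (vsub x x0)).
      by apply: big_is_series => a; apply: is_series_scalrR; apply: (proj1 (S _)).
    elim: N {q0} => [|N IHN]; first exact: E.
    by rewrite tech5; apply: (is_series_ext _ _ _ (fun m => esym (tech5 _ _))); apply: is_series_plusR.
  + by move=> m; case: (HC m) => _ _ h; rewrite Rmult_comm; apply: h.
  + by apply: bnd; lra.
Qed.

Lemma TA_analytic s (g : vec n -> R) B (x0 : vec n) : 0 < s -> TA s g B -> analytic_at g x0.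
Proof.
move=> s0 HT; have pi0 := PI_RGT_0.
have r0 : 0 < s / (4 * PI) by apply: Rdiv_lt_0_compat; lra.
have [|c [_ H2 H3]] := TA_taylor x0 s0 r0 _ HT; first by right; field; lra.
exists c, (s / (4 * PI)); split=> //.
have B0 := TA_ge0 HT.
have bnd N : sum_f_R0 (fun m => (/ 2) ^ m) N <= 2.
  rewrite tech3; last lra.
  have : 0 <= (/ 2) ^ N.+1 by apply: pow_le; lra.
  by lra.
split.
  exists (B * 2) => N; apply: (Rle_trans _ (B * sum_f_R0 (fun m => (/ 2) ^ m) N)).
    by rewrite -sum_scalR; apply: sum_Rle => m _; apply: H2.
  exact: Rmult_le_compat_l.
move=> x Hx; apply/is_lim_seq_Reals.
have L : is_lim_seq (fun N => B * (/ 2) ^ N) 0.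
  have -> : Finite 0 = Rbar_mult B 0 by rewrite /= Rmult_0_r.
  apply: is_lim_seq_scal_l; apply: is_lim_seq_geom; rewrite Rabs_pos_eq; lra.
apply: (is_lim_seq_le_le (fun N => g x - B * (/ 2) ^ N) _ (fun N => g x + B * (/ 2) ^ N)).
- move=> N; have := proj1 (Rabs_le_between _ _) (H3 x N Hx); split; lra.
- have -> : Finite (g x) = Finite (g x - 0) by f_equal; ring.
  by apply: is_lim_seq_minus' => //; apply: is_lim_seq_const.
- have -> : Finite (g x) = Finite (g x + 0) by f_equal; ring.
  by apply: is_lim_seq_plus' => //; apply: is_lim_seq_const.
Qed.

End TAanalytic.

(** * Fourier-Taylor series *)

Section FourierTaylor.
Variable n : nat.

(** Monomials are words: products are concatenations, and estimates are inductions on the word. *)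
Fixpoint pw (I : Type) (w : seq I) (p : I -> R) : R := if w is l :: w' then p l * pw w' p else 1.

Fixpoint dpw (w : seq 'I_n) (i : 'I_n) (p : vec n) : R :=
  if w is l :: w' then (if l == i then 1 else 0) * pw w' p + p l * dpw w' i p else 0.

Definition hdom (r : R) (x : vec n * vec n) := forall i, Rabs (x.1 i) <= r.
Definition hev (a : seq 'I_n * (('I_n -> Z) * R)) (x : vec n * vec n) := pw a.1 x.1 * tev a.2 x.2.
Definition hwt (r s : R) (a : seq 'I_n * (('I_n -> Z) * R)) := r ^ size a.1 * twt s a.2.
(** Power series in the momentum on a polydisc of radius [r], whose coefficients are trigonometric
    series of width [s] in the angle. *)
Definition HF r s := AN (hdom r) hev (hwt r s).

Lemma hwt0 r s a : 0 <= r -> 0 <= hwt r s a.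
Proof. by move=> r0; apply: Rmult_le_pos; [apply: pow_le | apply: twt0]. Qed.

Lemma pw_bound (I : Type) (w : seq I) (p : I -> R) r : (forall i, Rabs (p i) <= r) -> Rabs (pw w p) <= r ^ size w.
Proof.
move=> H; elim: w => [|l w IH] /=; first by rewrite Rabs_R1; lra.
by rewrite Rabs_mult; apply: Rmult_le_compat => //; apply: Rabs_pos.
Qed.

Lemma hev_hwt r s a x : 0 <= s -> hdom r x -> Rabs (hev a x) <= hwt r s a.
Proof.
move=> s0 Hx; rewrite /hev Rabs_mult.
apply: Rmult_le_compat; [apply: Rabs_pos | apply: Rabs_pos | exact: pw_bound | exact: tev_twt].
Qed.

Lemma TA_tev_comp s s' (k : 'I_n -> Z) p (u : 'I_n -> vec n -> R) y : 0 <= s' -> 0 <= y ->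
  (forall i, TA s' (u i) y) -> s' + 2 * PI * y <= s ->
  TA s' (fun x => tev (k, p) (fun i => x i + u i x)) (exp (s * knorm k)).
Proof.
move=> s0 y0 Hu Hs; have pi0 := PI_RGT_0; have k0 := knorm_ge0 k.
set z := 2 * PI * knorm k * y.
have z0 : 0 <= z by apply: Rmult_le_pos => //; nra.
pose Z x := 2 * PI * kdot k (fun i => u i x).
have HZ : TA s' Z z.
  apply: TA_le (TA_scal (2 * PI) (TA_kdot k s0 Hu)) _.
  by rewrite Rabs_pos_eq; rewrite /z; lra.
apply: (@AN_le _ _ _ _ _ _ (exp (s' * knorm k) * exp z)); last first.
  by rewrite -exp_plus; apply: exp_le; rewrite /z; nra.
apply: (TA_series (G := fun m x => cosT (2 * PI * kdot k x + p) m * (Z x ^ m / INR (fact m)))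
   (b := fun m => exp (s' * knorm k) * (z ^ m / INR (fact m)))).
- move=> m; apply: TA_mul => //.
    have := TA_atom s' 1 k (p + INR m * (PI / 2)); rewrite Rabs_R1 Rmult_1_l.
    by apply: TA_ext => x; rewrite /cosT Rmult_1_l; congr cos; ring.
  have := TA_scal (/ INR (fact m)) (TA_pow s0 m HZ).
  rewrite Rabs_pos_eq; last by apply: Rlt_le; apply: Rinv_0_lt_compat; apply: INR_fact_lt_0.
  move=> H; apply: TA_le (TA_ext _ H) _; last by rewrite /Rdiv; lra.
  by move=> x; rewrite /Rdiv; ring.
- move=> N; rewrite sum_scalR; apply: Rmult_le_compat_l; first by have := exp_pos (s' * knorm k); lra.
  exact: exp_sum_le.
- move=> x; rewrite tev_shift /=; exact: cos_series.
Qed.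

Lemma TA_pw s (w : seq 'I_n) (P : 'I_n -> vec n -> R) a : 0 <= s ->
  (forall i, TA s (P i) a) -> TA s (fun x => pw w (fun i => P i x)) (a ^ size w).
Proof.
move=> s0 H; elim: w => [|l w IH] /=; last exact: TA_mul.
by have := TA_const n s 1; rewrite Rabs_R1.
Qed.

(** On atoms: the monomial becomes a product of the [P i], each of norm at most [r], and the
    perturbation [u] of the angle costs the width [2 PI y]. *)
Lemma HF_subst r s s' F B (P u : 'I_n -> vec n -> R) y : 0 <= s' -> 0 <= r -> 0 <= y ->
  HF r s F B -> (forall i, TA s' (P i) r) -> (forall i, TA s' (u i) y) -> s' + 2 * PI * y <= s ->
  TA s' (fun x => F (fun i => P i x, fun i => x i + u i x)) B.
Proof.
move=> s0 r0 y0 HFF HP Hu Hs; rewrite -[B]Rmult_1_l.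
apply: (AN_map (T := fun F x => F (fun i => P i x, fun i => x i + u i x)) _ _ _ _ _ HFF).
- by move=> a; apply: hwt0.
- lra.
- by move=> G g H x _; apply: H => i /=; apply: TA_sup (HP i).
- by move=> c g a H x _; apply: H => i /=; apply: TA_sup (HP i).
case=> w [k p]; rewrite Rmult_1_l; apply: TA_mul => //; first exact: TA_pw.
exact: TA_tev_comp Hu Hs.
Qed.

Section WordTaylor.
Variables (s r dl : R) (P d : 'I_n -> vec n -> R).
Hypotheses (s0 : 0 <= s) (r0 : 0 < r) (dl0 : 0 <= dl).
Hypotheses (HP : forall i, TA s (P i) (r / 2)) (HPd : forall i, TA s (fun x => P i x + d i x) (r / 2)).
Hypothesis Hd : forall i, TA s (d i) dl.

Lemma pw_half m : (r / 2) ^ m <= r ^ m.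
Proof. by apply: pow_incr; lra. Qed.

(** Half the radius absorbs the length of the word: the first letter contributes
    [dl (r/2)^m <= dl r^m] and the others [(r/2) (dl (2/r) r^m) = dl r^m], which add up to the bound
    for length [m + 1]. *)
Lemma TA_pw_diff w : TA s (fun x => pw w (fun i => P i x + d i x) - pw w (fun i => P i x)) (dl * (2 / r) * r ^ size w).
Proof.
elim: w => [|l w IH] /=.
  apply: TA_le (TA_ext _ (TA_zero n s)) _ => [x|]; first by ring.
  by rewrite Rmult_1_r; apply: Rmult_le_pos => //; apply: Rlt_le; apply: Rdiv_lt_0_compat; lra.
have H := TA_add (TA_mul s0 (Hd l) (TA_pw w s0 HPd)) (TA_mul s0 (HP l) IH).
apply: TA_le (TA_ext _ H) _ => [x|]; first by ring.
have h := pw_half (size w).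
have -> : dl * (2 / r) * (r * r ^ size w) = dl * (r ^ size w) + dl * (r ^ size w) by field; lra.
have -> : r / 2 * (dl * (2 / r) * r ^ size w) = dl * r ^ size w by field; lra.
by apply: Rplus_le_compat_r; apply: Rmult_le_compat_l.
Qed.

Lemma TA_pw_taylor w : TA s (fun x => pw w (fun i => P i x + d i x) - pw w (fun i => P i x)
    - rsum (fun i => dpw w i (fun i => P i x) * d i x)) (dl ^ 2 * (4 / r ^ 2) * r ^ size w).
Proof.
elim: w => [|l w IH] /=.
  apply: TA_le (TA_ext _ (TA_zero n s)) _ => [x|]; first by rewrite rsum_0 => [|i]; ring.
  rewrite !Rmult_1_r; apply: Rmult_le_pos; first by nra.
  by apply: Rlt_le; apply: Rdiv_lt_0_compat; nra.
have H := TA_add (TA_mul s0 (HP l) IH) (TA_mul s0 (Hd l) (TA_pw_diff w)).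
apply: TA_le (TA_ext _ H) _ => [x|]; last by right; field; lra.
have -> : rsum (fun i => ((if l == i then 1 else 0) * pw w (fun i0 => P i0 x) + P l x * dpw w i (fun i0 => P i0 x)) * d i x)
  = d l x * pw w (fun i0 => P i0 x) + P l x * rsum (fun i => dpw w i (fun i => P i x) * d i x).
  rewrite -rsum_scal -(rsum_delta (fun i => d i x) l) -rsum_scalr -rsum_plus.
  by apply: rsum_ext => i; rewrite (eq_sym i l); ring.
ring.
Qed.

End WordTaylor.

Lemma HF_coord_mul r s F B l : 0 < r -> HF r s F B -> HF r s (fun x : vec n * vec n => x.1 l * F x) (r * B).
Proof.
move=> r0 H; apply: (AN_map (T := fun F x => x.1 l * F x) _ _ _ _ _ H).
- by move=> a; apply: hwt0; lra.
- lra.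
- by move=> G g HG x Hx; apply: is_series_scalR; apply: HG.
- by move=> c g a Hg x Hx; rewrite Hg //; ring.
case=> w a; apply: (AN_atom (c := 1) (a := (l :: w, a))) => [x _|].
  by rewrite /hev /= Rmult_1_l Rmult_assoc.
by rewrite Rabs_R1 /hwt /=; lra.
Qed.

Definition h0 : seq 'I_n * (('I_n -> Z) * R) := ([::], (fun _ => 0%Z, 0)).

Lemma HF_add r s F G B B' : 0 <= r -> HF r s F B -> HF r s G B' -> HF r s (fun x => F x + G x) (B + B').
Proof. by move=> r0; apply: AN_add h0 _ _ _ _ => a; apply: hwt0. Qed.

Lemma HF_dpw r s w i a : 0 < r ->
  HF (r / 2) s (fun x => dpw w i x.1 * tev a x.2) (2 / r * (r ^ size w * twt s a)).
Proof.
move=> r0; have t0 := twt0 s a; have q0 : 0 < 2 / r by apply: Rdiv_lt_0_compat; lra.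
have r20 : 0 < r / 2 by lra.
elim: w => [|l w IH] /=.
  apply: AN_le (AN_ext _ (AN_zero _ _ _ h0)) _ => [x _|]; first by ring.
  by apply: Rmult_le_pos; lra.
have H1 : HF (r / 2) s (fun x => (if l == i then 1 else 0) * pw w x.1 * tev a x.2) ((r / 2) ^ size w * twt s a).
  apply: (AN_atom (c := if l == i then 1 else 0) (a := (w, a))) => [x _|]; first by rewrite /hev /=; ring.
  rewrite -[X in _ <= X]Rmult_1_l; apply: Rmult_le_compat_r; first by apply: (hwt0 s (w, a)); lra.
  by case: (l == i); rewrite ?Rabs_R1 ?Rabs_R0; lra.
have H := HF_add (Rlt_le _ _ r20) H1 (HF_coord_mul l r20 IH).
apply: AN_le (AN_ext _ H) _ => [x _|]; first by ring.
have h := @pw_half r r0 (size w).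
have -> : r / 2 * (2 / r * (r ^ size w * twt s a)) = r ^ size w * twt s a by field; lra.
have -> : 2 / r * (r * r ^ size w * twt s a) = r ^ size w * twt s a + r ^ size w * twt s a by field; lra.
by apply: Rplus_le_compat_r; apply: Rmult_le_compat_r.
Qed.

(** The numerical case is the functional one for constant functions, in width 0. *)
Lemma pw_taylor_num r dl w (p v : vec n) : 0 < r -> 0 <= dl -> dl <= r / 4 ->
  (forall i, Rabs (p i) <= r / 4) -> (forall i, Rabs (v i) <= dl) ->
  Rabs (pw w (fun i => p i + v i) - pw w p) <= dl * (2 / r) * r ^ size w /\
  Rabs (pw w (fun i => p i + v i) - pw w p - rsum (fun i => dpw w i p * v i)) <= dl ^ 2 * (4 / r ^ 2) * r ^ size w.
Proof.
move=> r0 d0 dr Hp Hv.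
have C c b : Rabs c <= b -> TA 0 (fun _ : vec n => c) b by move=> h; apply: TA_le (TA_const n 0 c) h.
have h0' : 0 <= 0 by lra.
have H1 i : TA 0 (fun _ : vec n => p i) (r / 2) by apply: C; have := Hp i; lra.
have H2 i : TA 0 (fun _ : vec n => p i + v i) (r / 2).
  by apply: C; have := Hp i; have := Hv i; have := Rabs_triang (p i) (v i); lra.
have H3 i : TA 0 (fun _ : vec n => v i) dl by apply: C.
split.
  by have := TA_sup h0' (fun _ => 0) (TA_pw_diff h0' r0 d0 H1 H2 H3 w); apply.
by have := TA_sup h0' (fun _ => 0) (TA_pw_taylor h0' r0 d0 H1 H2 H3 w); apply.
Qed.

(** Momentum derivatives are again Fourier-Taylor series, on half the polydisc; the angle derivative
    [dq] is kept in the sup norm only, since it serves to differentiate along curves. [C] depends on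
    [r] and [s] alone, so that the bounds can be summed. *)
Lemma HF_taylor r s : 0 < r -> 0 < s -> exists C, 0 <= C /\ forall F B, HF r s F B ->
  exists dF dq : 'I_n -> vec n * vec n -> R,
  [/\ forall i, HF (r / 2) s (dF i) (2 / r * B),
      forall s' (P d u : 'I_n -> vec n -> R) y dl, 0 <= s' -> 0 <= y -> 0 <= dl <= r / 4 ->
        (forall i, TA s' (P i) (r / 4)) -> (forall i, TA s' (d i) dl) -> (forall i, TA s' (u i) y) ->
        s' + 2 * PI * y <= s ->
        TA s' (fun x => F (fun i => P i x + d i x, fun i => x i + u i x) - F (fun i => P i x, fun i => x i + u i x)
          - rsum (fun i => dF i (fun i => P i x, fun i => x i + u i x) * d i x)) (4 / r ^ 2 * dl ^ 2 * B),
      forall (p q v w : vec n) dl, 0 <= dl <= r / 4 -> (forall i, Rabs (p i) <= r / 4) ->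
        (forall i, Rabs (v i) <= dl) -> (forall i, Rabs (w i) <= dl) ->
        Rabs (F (fun i => p i + v i, fun i => q i + w i) - F (p, q) - rsum (fun i => dF i (p, q) * v i)
           - rsum (fun i => dq i (p, q) * w i)) <= C * dl ^ 2 * B &
      forall i x, hdom (r / 4) x -> Rabs (dq i x) <= C * B].
Proof.
move=> r0 s0; have pi0 := PI_RGT_0.
pose C1 := 4 / r ^ 2 + 3 / r * (2 * PI / s) + (2 * PI) ^ 2 * (2 / s ^ 2); pose C := C1 + 2 * PI / s.
have t1 : 0 < 4 / r ^ 2 by apply: Rdiv_lt_0_compat; [lra | apply: pow_lt].
have t2 : 0 < 3 / r by apply: Rdiv_lt_0_compat; lra.
have t3 : 0 < 2 * PI / s by apply: Rdiv_lt_0_compat; lra.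
have t4 : 0 < 2 / s ^ 2 by apply: Rdiv_lt_0_compat; [lra | apply: pow_lt].
have t5 : 0 < (2 * PI) ^ 2 by apply: pow_lt; lra.
have t6 : 0 < 2 / r by apply: Rdiv_lt_0_compat; lra.
have C1p : 0 < C1 by rewrite /C1; nra.
have CC : C1 <= C /\ 2 * PI / s <= C by rewrite /C; split; lra.
have Cp : 0 < C by lra.
exists C; split; first lra.
move=> F B; elim=> [c [w [k p]] g0 B0 Hg H|G b g0 B0 HG IH H Hser].
  rewrite /hwt /twt /= in H; have c0 := Rabs_pos c; have k0 := knorm_ge0 k.
  set E := exp _ in H; have E0 : 0 < E by apply: exp_pos.
  have rm : 0 < r ^ size w by apply: pow_lt.
  have e1 : 1 <= E by rewrite /E -exp_0; apply: exp_le; nra.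
  have k1 : 2 * PI * knorm k <= 2 * PI / s * E.
    have h := knorm_exp1 k s0; rewrite /Rdiv (Rmult_assoc (2 * PI)); apply: Rmult_le_compat_l; [lra | exact: h].
  have k2 : (2 * PI * knorm k) ^ 2 <= (2 * PI) ^ 2 * (2 / s ^ 2) * E.
    have := knorm_pow_exp k 2 s0; have -> : INR (fact 2) = 2 by rewrite /=; lra.
    move=> h; rewrite Rpow_mult_distr (Rmult_assoc ((2 * PI) ^ 2)); apply: Rmult_le_compat_l; [lra | exact: h].
  pose dF i (x : vec n * vec n) := c * (dpw w i x.1 * tev (k, p) x.2).
  pose dq i (x : vec n * vec n) := c * (pw w x.1 * (1 * (2 * PI * IZR (k i)) * cos (2 * PI * kdot k x.2 + (p + PI / 2)))).
  have r40 : 0 <= r / 4 by lra.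
  exists dF, dq; split.
  - move=> i; apply: AN_le (AN_scal c (HF_dpw s w i (k, p) r0)) _.
    rewrite /twt /= -/E.
    have -> : Rabs c * (2 / r * (r ^ size w * E)) = 2 / r * (Rabs c * (r ^ size w * E)) by ring.
    by apply: Rmult_le_compat_l; lra.
  - move=> s' P d u y dl s'0 y0 [d0 dr] HP Hd Hu Hs.
    have HP2 i : TA s' (P i) (r / 2) by apply: TA_le (HP i) _; lra.
    have HP3 i : TA s' (fun x => P i x + d i x) (r / 2) by apply: TA_le (TA_add (HP i) (Hd i)) _; lra.
    have H1 := TA_pw_taylor s'0 r0 d0 HP2 HP3 Hd w.
    have H2 := TA_tev_comp k p s'0 y0 Hu Hs.
    have H3 := TA_scal c (TA_mul s'0 H1 H2); rewrite -/E in H3.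
    apply: TA_le (TA_ext _ H3) _ => [x|].
      have D1 : hdom r (fun i => P i x, fun i => x i + u i x).
        by move=> i /=; have := TA_sup s'0 x (HP2 i); lra.
      have D2 : hdom r (fun i => P i x + d i x, fun i => x i + u i x).
        by move=> i /=; have := TA_sup s'0 x (HP3 i); lra.
      rewrite !Hg //.
      rewrite /hev /dF /=.
      have -> : rsum (fun i => c * (dpw w i (fun i0 => P i0 x) * tev (k, p) (fun i0 => x i0 + u i0 x)) * d i x)
        = c * (tev (k, p) (fun i0 => x i0 + u i0 x) * rsum (fun i => dpw w i (fun i0 => P i0 x) * d i x)).
        by rewrite -!rsum_scal; apply: rsum_ext => i; ring.
      ring.
    have -> : Rabs c * (dl ^ 2 * (4 / r ^ 2) * r ^ size w * E) = 4 / r ^ 2 * dl ^ 2 * (Rabs c * (r ^ size w * E)) by ring.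
    by apply: Rmult_le_compat_l => //; apply: Rmult_le_pos; [lra | apply: pow_le].
  - move=> p' q v w' dl [d0 dr] Hp Hv Hw.
    have [P1 P2] := pw_taylor_num w r0 d0 dr Hp Hv.
    have Hd1 i : Rabs (p' i) <= r by have := Hp i; lra.
    have Hd2 i : Rabs (p' i + v i) <= r.
      by have := Hp i; have := Hv i; have := Rabs_triang (p' i) (v i); lra.
    have P0 := pw_bound w Hd1.
    rewrite !Hg // /hev /dF /dq /=.
    have Eq : rsum (fun i => c * (pw w p' * (1 * (2 * PI * IZR (k i)) * cos (2 * PI * kdot k q + (p + PI / 2)))) * w' i)
      = c * (pw w p' * rsum (fun i => 1 * (2 * PI * IZR (k i)) * cos (2 * PI * kdot k q + (p + PI / 2)) * w' i)).
      by rewrite -!rsum_scal; apply: rsum_ext => i; ring.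
    have Ep : rsum (fun i => c * (dpw w i p' * tev (k, p) q) * v i)
      = c * (tev (k, p) q * rsum (fun i => dpw w i p' * v i)).
      by rewrite -!rsum_scal; apply: rsum_ext => i; ring.
    have G2 := @grad_atom n 1 k p q w' dl d0 Hw.
    rewrite Rabs_R1 !Rmult_1_l in G2.
    have G1 := @grad_atom n 1 k p q w' dl d0 Hw.
    rewrite Eq Ep.
    set S1 := rsum (fun i => dpw w i p' * v i) in P2 *.
    set S2 := rsum (fun i => 1 * _ * _ * _).
    have G3 : Rabs (tev (k, p) (fun i => q i + w' i) - tev (k, p) q - S2) <= (2 * PI * knorm k) ^ 2 * dl ^ 2.
      by move: G1; rewrite !Rmult_1_l Rabs_R1 Rmult_1_l.
    have G4 : Rabs (tev (k, p) (fun i => q i + w' i) - tev (k, p) q) <= 2 * PI * knorm k * dl.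
      rewrite tev_shift; apply: Rle_trans (cos_lip _ _) _.
      rewrite Rabs_mult (Rabs_pos_eq (2 * PI)); last lra.
      by rewrite (Rmult_assoc (2 * PI) (knorm k)); apply: Rmult_le_compat_l; [lra | apply: kdot_bound].
    have G5 : Rabs (tev (k, p) (fun i => q i + w' i)) <= 1 by apply/Rabs_le; apply: COS_bound.
    move: (tev (k, p) (fun i => q i + w' i)) (tev (k, p) q) G3 G4 G5 => c' c1 G3 G4 G5.
    move: (pw w (fun i => p' i + v i)) (pw w p') P0 P1 P2 => pw' pw1 P0 P1 P2.
    (* Discrete product rule: momentum remainder, mixed term quadratic in [dl], angle remainder. *)
    have -> : c * (pw' * c') - c * (pw1 * c1) - c * (c1 * S1) - c * (pw1 * S2)
      = c * ((pw' - pw1 - S1) * c' + S1 * (c' - c1) + pw1 * (c' - c1 - S2)) by ring.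
    have PS1 : Rabs S1 <= 3 / r * dl * r ^ size w.
      have -> : S1 = (pw' - pw1) - (pw' - pw1 - S1) by ring.
      apply: Rle_trans (Rabs_triang _ _) _; rewrite Rabs_Ropp.
      have : dl ^ 2 * (4 / r ^ 2) * r ^ size w <= / r * dl * r ^ size w.
        apply: Rmult_le_compat_r; first lra.
        have -> : dl ^ 2 * (4 / r ^ 2) = (/ r * dl) * (4 * dl / r) by field; lra.
        rewrite -[X in _ <= X]Rmult_1_r; apply: Rmult_le_compat_l.
          by apply: Rmult_le_pos => //; apply: Rlt_le; apply: Rinv_0_lt_compat.
        apply: (Rmult_le_reg_r r) => //; rewrite /Rdiv Rmult_assoc Rinv_l; lra.
      have -> : 3 / r * dl * r ^ size w = dl * (2 / r) * r ^ size w + / r * dl * r ^ size w by field; lra.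
      lra.
    rewrite Rabs_mult.
    apply: (Rle_trans _ (Rabs c * (C1 * dl ^ 2 * (r ^ size w * E)))); last first.
      have -> : Rabs c * (C1 * dl ^ 2 * (r ^ size w * E)) = C1 * dl ^ 2 * (Rabs c * (r ^ size w * E)) by ring.
      have d2 : 0 <= dl ^ 2 by apply: pow_le.
      apply: Rmult_le_compat => //; [by apply: Rmult_le_pos; lra | apply: Rmult_le_pos => //; nra |].
      by apply: Rmult_le_compat_r => //; case: CC.
    apply: Rmult_le_compat_l => //.
    apply: (Rle_trans _ (dl ^ 2 * (4 / r ^ 2) * r ^ size w * 1 + 3 / r * dl * r ^ size w * (2 * PI / s * E * dl)
       + r ^ size w * ((2 * PI) ^ 2 * (2 / s ^ 2) * E * dl ^ 2))).
      apply: Rle_trans (Rabs_triang _ _) _; apply: Rplus_le_compat.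
        apply: Rle_trans (Rabs_triang _ _) _; rewrite !Rabs_mult; apply: Rplus_le_compat.
          by apply: Rmult_le_compat => //; apply: Rabs_pos.
        apply: Rmult_le_compat => //; try exact: Rabs_pos.
        by apply: Rle_trans G4 _; apply: Rmult_le_compat_r.
      rewrite Rabs_mult; apply: Rmult_le_compat => //; try exact: Rabs_pos.
      by apply: Rle_trans G3 _; apply: Rmult_le_compat_r => //; apply: pow_le.
    have -> : C1 * dl ^ 2 * (r ^ size w * E) = dl ^ 2 * (4 / r ^ 2) * r ^ size w * E +
       3 / r * dl * r ^ size w * (2 * PI / s * E * dl) + r ^ size w * ((2 * PI) ^ 2 * (2 / s ^ 2) * E * dl ^ 2).
      by rewrite /C1; ring.
    do 2 apply: Rplus_le_compat_r; apply: Rmult_le_compat_l => //.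
    apply: Rmult_le_pos; last lra.
    by apply: Rmult_le_pos; [apply: pow_le | lra].
  - move=> i x Hx; rewrite /dq Rabs_mult Rabs_mult.
    have Hx' j : Rabs (x.1 j) <= r by have := Hx j; lra.
    have P0 := pw_bound w Hx'.
    have P1 : Rabs (1 * (2 * PI * IZR (k i)) * cos (2 * PI * kdot k x.2 + (p + PI / 2))) <= 2 * PI / s * E.
      rewrite Rmult_1_l Rabs_mult -[X in _ <= X]Rmult_1_r; apply: Rmult_le_compat; try exact: Rabs_pos; last first.
        by apply/Rabs_le; apply: COS_bound.
      rewrite Rabs_mult (Rabs_pos_eq (2 * PI)); last lra.
      by apply: Rle_trans k1; apply: Rmult_le_compat_l; [lra | apply: knorm_coord].
    apply: (Rle_trans _ (2 * PI / s * (Rabs c * (r ^ size w * E)))).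
      have -> : 2 * PI / s * (Rabs c * (r ^ size w * E)) = Rabs c * (r ^ size w * (2 * PI / s * E)) by ring.
      by apply: Rmult_le_compat_l => //; apply: Rmult_le_compat => //; apply: Rabs_pos.
    apply: Rmult_le_compat => //; [lra | apply: Rmult_le_pos => //; nra | by case: CC].
have [D HD] := choiceE (P := fun m (z : ('I_n -> vec n * vec n -> R) * ('I_n -> vec n * vec n -> R)) => 
  [/\ forall i, HF (r / 2) s (z.1 i) (2 / r * b m),
      forall s' (P d u : 'I_n -> vec n -> R) y dl, 0 <= s' -> 0 <= y -> 0 <= dl <= r / 4 ->
        (forall i, TA s' (P i) (r / 4)) -> (forall i, TA s' (d i) dl) -> (forall i, TA s' (u i) y) ->
        s' + 2 * PI * y <= s ->
        TA s' (fun x => G m (fun i => P i x + d i x, fun i => x i + u i x) - G m (fun i => P i x, fun i => x i + u i x)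
          - rsum (fun i => z.1 i (fun i => P i x, fun i => x i + u i x) * d i x)) (4 / r ^ 2 * dl ^ 2 * b m),
      forall (p q v w : vec n) dl, 0 <= dl <= r / 4 -> (forall i, Rabs (p i) <= r / 4) ->
        (forall i, Rabs (v i) <= dl) -> (forall i, Rabs (w i) <= dl) ->
        Rabs (G m (fun i => p i + v i, fun i => q i + w i) - G m (p, q) - rsum (fun i => z.1 i (p, q) * v i)
           - rsum (fun i => z.2 i (p, q) * w i)) <= C * dl ^ 2 * b m &
      forall i x, hdom (r / 4) x -> Rabs (z.2 i x) <= C * b m]) ltac:(by move=> m; case: (IH m) => dF [dq h]; exists (dF, dq)).
have bnd t : 0 <= t -> forall N, sum_f_R0 (fun m => t * b m) N <= t * B0.
  by move=> t0 N; rewrite sum_scalR; apply: Rmult_le_compat_l.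
have S1 (i : 'I_n) : HF (r / 2) s (fun x => Series (fun m => (D m).1 i x)) (2 / r * B0) /\
  (forall x, hdom (r / 2) x -> is_series (fun m => (D m).1 i x) (Series (fun m => (D m).1 i x))).
  have Hm m : HF (r / 2) s ((D m).1 i) (2 / r * b m) by case: (HD m) => h _ _ _; exact: (h i).
  apply: (AN_Series _ Hm); last by apply: bnd; lra.
  by move=> a x; apply: hev_hwt; lra.
have S2 i x : hdom (r / 4) x -> is_series (fun m => (D m).2 i x) (Series (fun m => (D m).2 i x)) /\ Rabs (Series (fun m => (D m).2 i x)) <= C * B0.
  move=> Hx; apply: (dominated_series (b := fun m => C * b m)); last by apply: bnd; lra.
  by move=> m; case: (HD m) => _ _ _; apply.
exists (fun i x => Series (fun m => (D m).1 i x)), (fun i x => Series (fun m => (D m).2 i x)); split.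
- by move=> i; exact: (proj1 (S1 i)).
- move=> s' P d u y dl s'0 y0 [d0 dr] HP Hd Hu Hs.
  apply: (TA_series (b := fun m => 4 / r ^ 2 * dl ^ 2 * b m)).
  + by move=> m; case: (HD m) => _ h _ _; apply: (h s' P d u y dl).
  + by apply: bnd; apply: Rmult_le_pos; [lra | apply: pow_le].
  + move=> x.
    have HPx i : Rabs (P i x) <= r / 4 := TA_sup s'0 x (HP i).
    have Hdx i : Rabs (d i x) <= dl := TA_sup s'0 x (Hd i).
    apply: is_series_minusR; first apply: is_series_minusR.
    * by apply: Hser => i /=; have := HPx i; have := Hdx i; have := Rabs_triang (P i x) (d i x); lra.
    * by apply: Hser => i /=; have := HPx i; lra.
    * by apply: rsum_is_series => i; apply: is_series_scalrR; apply: (proj2 (S1 i)) => j /=; have := HPx j; lra.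
- move=> p q v w dl [d0 dr] Hp Hv Hw.
  apply: (is_series_abs_ub (a := fun m => G m (fun i => p i + v i, fun i => q i + w i) - G m (p, q) - rsum (fun i => (D m).1 i (p, q) * v i)
           - rsum (fun i => (D m).2 i (p, q) * w i)) (b := fun m => C * dl ^ 2 * b m)).
  + apply: is_series_minusR; first apply: is_series_minusR; first apply: is_series_minusR.
    * by apply: Hser => i /=; have := Hp i; have := Hv i; have := Rabs_triang (p i) (v i); lra.
    * by apply: Hser => i /=; have := Hp i; lra.
    * by apply: rsum_is_series => i; apply: is_series_scalrR; apply: (proj2 (S1 i)) => j /=; have := Hp j; lra.
    * by apply: rsum_is_series => i; apply: is_series_scalrR; apply: (proj1 (S2 i _ _)) => j /=.
  + by move=> m; case: (HD m) => _ _ h _; apply: h.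
  + by apply: bnd; apply: Rmult_le_pos; [lra | apply: pow_le].
- by move=> i x Hx; exact: (proj2 (S2 i x Hx)).
Qed.

End FourierTaylor.

(** * Matrices *)

Section MatrixAlgebra.
Variable n : nat.
Implicit Types (A B C : 'I_n -> 'I_n -> R) (v : 'I_n -> R).

Definition del (i j : 'I_n) : R := if i == j then 1 else 0.
Definition mmul A B i j := rsum (fun l => A i l * B l j).
Definition mvec A v i := rsum (fun l => A i l * v l).

Lemma rsum_dell v i : rsum (fun l => del i l * v l) = v i.
Proof. by rewrite -[RHS](rsum_delta v i); apply: rsum_ext => l; rewrite /del eq_sym. Qed.

Lemma rsum_delr v i : rsum (fun l => v l * del l i) = v i.
Proof. by rewrite -[RHS](rsum_delta v i); apply: rsum_ext => l; rewrite /del Rmult_comm. Qed.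

Lemma delC i j : del i j = del j i. Proof. by rewrite /del eq_sym. Qed.

Lemma mmul_mvec A B v i : mvec (mmul A B) v i = mvec A (mvec B v) i.
Proof.
rewrite /mvec /mmul; transitivity (rsum (fun l => rsum (fun k => A i k * B k l * v l))).
  by apply: rsum_ext => l; rewrite rsum_scalr.
by rewrite rsum_exch; apply: rsum_ext => k; rewrite -rsum_scal; apply: rsum_ext => l; ring.
Qed.

Lemma mmulA A B C i j : mmul (mmul A B) C i j = mmul A (mmul B C) i j.
Proof. exact: (mmul_mvec A B (fun l => C l j)). Qed.

Lemma mvec_ext A B v u i : (forall i j, A i j = B i j) -> (forall j, v j = u j) -> mvec A v i = mvec B u i.
Proof. by move=> H1 H2; apply: rsum_ext => l; rewrite H1 H2. Qed.

Lemma mmul_ext A A' B B' i j : (forall i j, A i j = A' i j) -> (forall i j, B i j = B' i j) ->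
  mmul A B i j = mmul A' B' i j.
Proof. by move=> H1 H2; apply: rsum_ext => l; rewrite H1 H2. Qed.

Lemma mvec_del v i : mvec del v i = v i. Proof. exact: rsum_dell. Qed.
Lemma mmul_dell A i j : mmul del A i j = A i j. Proof. exact: (rsum_dell (fun l => A l j)). Qed.
Lemma mmul_delr A i j : mmul A del i j = A i j. Proof. exact: (rsum_delr (fun l => A i l)). Qed.

Lemma mmul_1D A B i j : mmul (fun i j => del i j + A i j) (fun i j => del i j + B i j) i j =
  del i j + (A i j + B i j + rsum (fun l => A i l * B l j)).
Proof.
rewrite /mmul (rsum_ext (G := fun l => del i l * del l j + (del i l * B l j + (A i l * del l j + A i l * B l j)))).
  rewrite !rsum_plus !(rsum_dell (fun l => _)) !(rsum_delr (fun l => _)); ring.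
by move=> l; ring.
Qed.

(** Expansion of a bilinear form at rows [g], [h] near the basis rows [i], [m]; both will be rows of
    [G]. *)
Lemma bilin_expand A (g h : 'I_n -> R) i m :
  rsum (fun j => rsum (fun a => g j * A j a * h a)) - A i m =
  rsum (fun a => A i a * (h a - del m a)) + rsum (fun j => (g j - del i j) * A j m) +
  rsum (fun j => rsum (fun a => (g j - del i j) * A j a * (h a - del m a))).
Proof.
pose S j := rsum (fun a => A j a * h a).
have E1 j : rsum (fun a => g j * A j a * h a) = g j * S j.
  by rewrite /S -rsum_scal; apply: rsum_ext => a; ring.
have E2 j : rsum (fun a => A j a * (h a - del m a)) = S j - A j m.
  rewrite (rsum_ext (G := fun a => A j a * h a - A j a * del a m)).
    by rewrite rsum_minus (rsum_delr (fun a => A j a)).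
  by move=> a; rewrite (delC a m); ring.
have E3 j : rsum (fun a => (g j - del i j) * A j a * (h a - del m a)) = g j * S j - del i j * S j - g j * A j m + del i j * A j m.
  rewrite (rsum_ext (G := fun a => (g j - del i j) * (A j a * (h a - del m a)))); last by move=> a; ring.
  by rewrite rsum_scal E2; ring.
rewrite (rsum_ext E1) E2 (rsum_ext E3) rsum_plus !rsum_minus (rsum_dell S) (rsum_dell (fun j => A j m)).
rewrite (rsum_ext (F := fun j => (g j - del i j) * A j m) (G := fun j => g j * A j m - del i j * A j m)); last by move=> j; ring.
by rewrite rsum_minus (rsum_dell (fun j => A j m)); ring.
Qed.

(** The l1 norm [S] of a vector of the kernel satisfies [S <= S / 2]. *)
Lemma near_id_inj A v : (forall i j, Rabs (A i j - del i j) <= / (2 * INR n)) ->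
  (forall i, mvec A v i = 0) -> forall i, v i = 0.
Proof.
move=> HA Hv i.
have n0 : (0 < n)%N by apply: leq_ltn_trans (ltn_ord i).
have N0 : 0 < INR n by apply: lt_0_INR; apply/ltP.
pose S := rsum (fun i => Rabs (v i)).
have Hi j : Rabs (v j) <= / (2 * INR n) * S.
  have -> : v j = - rsum (fun l => (A j l - del j l) * v l).
    rewrite (rsum_ext (G := fun l => A j l * v l - del j l * v l)); last by move=> l; ring.
    by rewrite rsum_minus rsum_dell -/(mvec A v j) Hv; ring.
  rewrite Rabs_Ropp; apply: Rle_trans (rsum_abs _) _; rewrite /S -rsum_scal; apply: rsum_le => l.
  by rewrite Rabs_mult; apply: Rmult_le_compat_r; [apply: Rabs_pos | apply: HA].
have S0 : S <= / 2 * S.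
  have := rsum_bound Hi; rewrite -/S.
  by have -> : INR n * (/ (2 * INR n) * S) = / 2 * S by field; lra.
have h : 0 <= S by apply: rsum_ge0 => j; apply: Rabs_pos.
have h2 : Rabs (v i) <= S by apply: (rsum_ge_term (F := fun i => Rabs (v i))) => j; apply: Rabs_pos.
have h3 := Rabs_pos (v i).
by apply: Rabs_eq_0; lra.
Qed.

(** [Ms + m = Ms (1 + L m)], and [1 + L m] is inverted by the Neumann series, used for constant
    functions in width 0. *)
Lemma solve_perturbed (Ms L m : 'I_n -> 'I_n -> R) (C0 kap z0 : R) (z : 'I_n -> R) :
  0 <= C0 -> 0 <= kap -> (forall i j, Rabs (L i j) <= C0) -> (forall i j, mmul Ms L i j = del i j) ->
  (forall i j, Rabs (m i j) <= kap) -> INR n * (INR n * C0 * kap) <= / 2 -> (forall i, Rabs (z i) <= z0) ->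
  exists eta : 'I_n -> R, (forall i, Rabs (eta i) <= 2 * INR n ^ 2 * C0 * z0) /\
    forall i, mvec (fun i j => Ms i j + m i j) eta i = z i.
Proof.
move=> C00 k0 HL HML Hm Hs Hz.
case: (posnP n) => [n0|n0].
  have E (i : 'I_n) : False by case: i => i Hi; rewrite n0 in Hi.
  by exists (fun _ => 0); split=> i; case: (E i).
have i0 : 'I_n by exact: (Ordinal n0).
have N0 : 0 <= INR n by apply: pos_INR.
have N1 : 1 <= INR n by apply: (le_INR 1); apply/leP.
have z00 : 0 <= z0 by apply: Rle_trans (Hz i0); apply: Rabs_pos.
have z' : 0 <= 0 by lra.
pose NN := mmul L m.
have HN i j : TA 0 (fun _ : vec n => NN i j) (INR n * C0 * kap).
  apply: TA_le (TA_const n 0 _) _; rewrite Rmult_assoc; apply: rsum_abs_bound => l.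
  by rewrite Rabs_mult; apply: Rmult_le_compat => //; apply: Rabs_pos.
have [K [HK K1 K2]] := Neumann z' HN Hs.
pose x0 := vzero n; pose K0 i j := K i j x0.
have HK0 i j : Rabs (K0 i j) <= 1.
  apply: Rle_trans (TA_sup z' x0 (HK i j)) _.
  have : 0 <= INR n * C0 * kap by apply: Rmult_le_pos => //; apply: Rmult_le_pos.
  by nra.
pose I1 A := fun i j => del i j + A i j.
pose Lz := mvec L z.
have HLz i : Rabs (Lz i) <= INR n * (C0 * z0).
  by apply: rsum_abs_bound => l; rewrite Rabs_mult; apply: Rmult_le_compat => //; apply: Rabs_pos.
exists (mvec (I1 K0) Lz); split.
  move=> i; apply: Rle_trans (_ : INR n * (2 * (INR n * (C0 * z0))) <= _); last by right; ring.
  apply: rsum_abs_bound => l; rewrite Rabs_mult; apply: Rmult_le_compat => //; try exact: Rabs_pos.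
  rewrite /I1; apply: Rle_trans (Rabs_triang _ _) _; have := HK0 i l.
  by rewrite /del; case: (_ == _); rewrite ?Rabs_R1 ?Rabs_R0; lra.
move=> i; rewrite -mmul_mvec.
have E1 a b : Ms a b + m a b = mmul Ms (I1 NN) a b.
  rewrite /mmul /I1 (rsum_ext (G := fun l => Ms a l * del l b + Ms a l * NN l b)); last by move=> l; ring.
  rewrite rsum_plus rsum_delr; congr (_ + _).
  rewrite -/(mmul Ms NN a b) -mmulA.
  by rewrite (mmul_ext (A' := del) (B' := m)) // mmul_dell.
have E2 a b : mmul (I1 NN) (I1 K0) a b = del a b.
  by rewrite mmul_1D (K1 a b x0); ring.
rewrite (mvec_ext (B := Ms) (u := Lz)) //; last first.
  move=> a b; rewrite (mmul_ext (A' := mmul Ms (I1 NN)) (B' := I1 K0)) // mmulA.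
  by rewrite (mmul_ext (A' := Ms) (B' := del)) // mmul_delr.
rewrite -mmul_mvec (mvec_ext (B := del) (u := z)) //; exact: mvec_del.
Qed.

End MatrixAlgebra.

Section GradRules.
Variable n : nat.
Implicit Types (g : vec n -> R) (dg : 'I_n -> vec n -> R).

Lemma grad_add K K' g dg h dh : grad K g dg -> grad K' h dh ->
  grad (K + K') (fun x => g x + h x) (fun i x => dg i x + dh i x).
Proof.
move=> H1 H2 x v d d0 Hv; have := H1 x v d d0 Hv; have := H2 x v d d0 Hv.
rewrite (rsum_ext (F := fun i => (dg i x + dh i x) * v i) (G := fun i => dg i x * v i + dh i x * v i)); last by move=> i; ring.
rewrite rsum_plus => h2 h1.
set a := _ - _ - _ in h1; set b := _ - _ - _ in h2; set c := _ - _ - (_ + _).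
have -> : c = a + b by rewrite /a /b /c; ring.
by apply: Rle_trans (Rabs_triang _ _) _; lra.
Qed.

Lemma grad_scal K g dg c : grad K g dg -> grad (Rabs c * K) (fun x => c * g x) (fun i x => c * dg i x).
Proof.
move=> H x v d d0 Hv; have := H x v d d0 Hv => h.
rewrite (rsum_ext (F := fun i => c * dg i x * v i) (G := fun i => c * (dg i x * v i))); last by move=> i; ring.
rewrite rsum_scal -!Rmult_minus_distr_l Rabs_mult Rmult_assoc.
by apply: Rmult_le_compat_l; [apply: Rabs_pos | ].
Qed.

Lemma grad_zero : grad (n := n) 0 (fun _ => 0) (fun _ _ => 0).
Proof.
move=> x v d d0 Hv; rewrite rsum_0; last by move=> i; ring.
by rewrite !Rminus_0_r Rabs_R0; lra.
Qed.

Lemma grad_ext K g dg g' dg' : (forall x, g x = g' x) -> (forall i x, dg i x = dg' i x) -> grad K g dg -> grad K g' dg'.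
Proof.
by move=> /functional_extensionality -> H2; have -> : dg = dg' by apply: functional_extensionality => i; apply: functional_extensionality.
Qed.

Lemma grad_rsum m (F : 'I_m -> vec n -> R) dF K : 0 <= K -> (forall l, grad K (F l) (dF l)) ->
  grad (INR m * K) (fun x => rsum (fun l => F l x)) (fun i x => rsum (fun l => dF l i x)).
Proof.
move=> K0 H x v d d0 Hv.
have -> : rsum (fun i => rsum (fun l => dF l i x) * v i) = rsum (fun l => rsum (fun i => dF l i x * v i)).
  by rewrite rsum_exch; apply: rsum_ext => i; rewrite rsum_scalr.
rewrite -!rsum_minus Rmult_assoc; apply: rsum_abs_bound => l; exact: H.
Qed.

End GradRules.

(** * The iteration step *)

Section State.
Variable n : nat.
Implicit Types (u P : 'I_n -> vec n -> R) (G : 'I_n -> 'I_n -> vec n -> R).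

Definition emb P u (x : vec n) : vec n * vec n := (fun i => P i x, fun i => x i + u i x).

Definition bounded_state s U u P G :=
  [/\ forall i, TA s (u i) U, forall i, TA s (P i) U & forall i j, TA s (fun x => G i j x - del i j) U].

(* [a] and [e] bound the defects of the two conjugacy equations: energy constant
   along the torus, and velocity [w0] in the coordinates of the torus. *)
Definition defect (H : vec n * vec n -> R) (dH : 'I_n -> vec n * vec n -> R) (w0 : vec n) s a e u P G :=
  (exists c, TA s (fun x => H (emb P u x) - c) a) /\
  (forall i, TA s (fun x => rsum (fun j => G i j x * dH j (emb P u x)) - w0 i) e).

(* [G] inverts the Jacobian of [id + u], and the pull-back of [P dq] by [id + u]
   is the closed form [zeta + grad W], so that the torus is Lagrangian. *)
Definition lagrangian s u P G :=
  exists (du : 'I_n -> 'I_n -> vec n -> R) (K : R) (zeta : 'I_n -> R) (W : vec n -> R) (dW : 'I_n -> vec n -> R) (B : R),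
  [/\ 0 <= K /\ forall i, grad K (u i) (du i),
      forall i j x, mmul (fun i l => G i l x) (fun l j => del l j + du l j x) i j = del i j,
      TA s W B,
      grad K W dW &
      forall i x, rsum (fun l => (del l i + du l i x) * P l x) = zeta i + dW i x].

End State.

(** Pulled back by [id + u], the momentum correction [G^T (eta - dV)] becomes the closed form
    [eta - dV], because [G] inverts the Jacobian; a further pull-back by [tau] preserves closedness.
    The new constant is [zeta + eta] and the new potential is [(zeta + eta) . Y] plus [W - V]
    composed with [tau], so the Lagrangian property is kept without any error. *)
Lemma lagrangian_step n s s2 (u P : 'I_n -> vec n -> R) G (Y : 'I_n -> vec n -> R) dY V dV eta Kn K U e y :
  let tau x := fun i => x i + Y i x in
  0 < s2 -> 0 <= K ->
  (forall i, TA s (u i) U) -> TA s V e -> (forall i, TA s2 (Y i) y) ->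
  (forall g B, TA s g B -> TA s2 (fun x => g (tau x)) (2 * B)) ->
  (forall i, grad K (Y i) (dY i)) -> grad K V dV ->
  (forall i j x, dY i j x + Kn i j x + rsum (fun l => Kn i l x * dY l j x) = 0) ->
  lagrangian s u P G ->
  lagrangian s2 (fun i x => Y i x + u i (tau x))
    (fun i x => P i (tau x) + rsum (fun l => G l i (tau x) * (eta l - dV l (tau x))))
    (fun i j x => rsum (fun l => (del i l + Kn i l x) * G l j (tau x))).
Proof.
move=> tau s20 K0 Hu HV HY Hcomp GY GV HKn [du [Ku [zeta [W [dW [B [[Ku0 Gu] GJ HW GW Hpot]]]]]]].
have sle : s2 <= s2 by lra.
have [KH [KH0 Hess]] := @TA_hess n s2 s2 s20 sle.
have Hdg i : exists dg : 'I_n -> vec n -> R, grad (KH * (2 * U)) (fun x => u i (tau x)) dg.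
  by have [dg [ddg [_ _ h _ _]]] := Hess _ _ (Hcomp _ _ (Hu i)); exists dg.
have [dgu Hdgu] := choiceE Hdg.
pose WV x := W x - V x; pose dWV i x := dW i x - dV i x.
have HWV := TA_sub HW HV.
have GWV : grad (Ku + K) WV dWV.
  have h := grad_add GW (grad_scal (-1) GV).
  have -> : Ku + K = Ku + Rabs (-1) * K by rewrite Rabs_Ropp Rabs_R1; ring.
  by apply: grad_ext h => [x|i x]; rewrite /WV /dWV; ring.
have [dgw [_ [_ _ Hdgw _ _]]] := Hess _ _ (Hcomp _ _ HWV).
have B0 : 0 <= B + e := TA_ge0 HWV.
pose N := INR n; have N0 : 0 <= N := pos_INR n.
pose U' := Rabs U; have U0 : 0 <= U' by apply: Rabs_pos.
have UU : U <= U' by apply: Rle_abs.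
have chain_u i a x : dgu i a x = rsum (fun l => du i l (tau x) * (ebasis a l + dY l a x)).
  apply: (grad_chain (K2 := KH * (2 * U')) a x Ku0 K0 _ (Gu i) GY).
    by apply: Rmult_le_pos; lra.
  by apply: grad_le (Hdgu i); apply: Rmult_le_compat_l; lra.
have chain_w a x : dgw a x = rsum (fun l => dWV l (tau x) * (ebasis a l + dY l a x)).
  apply: (grad_chain (K := Ku + K) (K2 := KH * (2 * (B + e))) a x _ K0 _ GWV GY) => //.
    lra.
  by apply: Rmult_le_pos; lra.
pose zeta' i := zeta i + eta i.
pose Z := rsum (fun p => Rabs (zeta' p)).
have Z0 : 0 <= Z by apply: rsum_ge0 => i; apply: Rabs_pos.
pose KK := K + KH * (2 * U') + N * (Z * K) + KH * (2 * (B + e)).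
have k1 : 0 <= KH * (2 * U') by apply: Rmult_le_pos; lra.
have k2 : 0 <= N * (Z * K) by apply: Rmult_le_pos => //; apply: Rmult_le_pos.
have k3 : 0 <= KH * (2 * (B + e)) by apply: Rmult_le_pos; lra.
have Jac x i a : del i a + (dY i a x + dgu i a x) =
  mmul (fun i l => del i l + du i l (tau x)) (fun l a => del l a + dY l a x) i a.
  rewrite mmul_1D chain_u (rsum_ext (F := fun l => du i l (tau x) * _) (G := fun l => du i l (tau x) * del l a + du i l (tau x) * dY l a x)); last first.
    by move=> l; rewrite /ebasis /del; ring.
  by rewrite rsum_plus (rsum_delr (fun l => du i l (tau x))); ring.
exists (fun i a x => dY i a x + dgu i a x), KK, zeta', (fun x => rsum (fun p => zeta' p * Y p x) + WV (tau x)),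
  (fun i x => rsum (fun p => zeta' p * dY p i x) + dgw i x), (N * (Z * Rabs y) + 2 * (B + e)); split.
- split; first by rewrite /KK; lra.
  move=> i; apply: grad_le (grad_add (GY i) (Hdgu i)); rewrite /KK.
  have : KH * (2 * U) <= KH * (2 * U') by apply: Rmult_le_compat_l; lra.
  lra.
- move=> i j x; rewrite (mmul_ext (A' := mmul (fun i l => del i l + Kn i l x) (fun l j => G l j (tau x))) (B' := mmul (fun i l => del i l + du i l (tau x)) (fun l a => del l a + dY l a x))) //.
  rewrite mmulA (mmul_ext (A' := fun i l => del i l + Kn i l x) (B' := fun l a => del l a + dY l a x)) //; last first.
    move=> a b; rewrite -mmulA (mmul_ext (A' := del (n := n)) (B' := fun l a => del l a + dY l a x)) //.
    by rewrite mmul_dell.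
  by rewrite mmul_1D; have := HKn i j x; lra.
- apply: TA_add; last exact: Hcomp HWV.
  apply: TA_rsumc => p; apply: TA_le (TA_scal (zeta' p) (HY p)) _.
  apply: Rmult_le_compat; [exact: Rabs_pos | exact: TA_ge0 (HY p) | | exact: Rle_abs].
  by apply: (rsum_ge_term (F := fun p => Rabs (zeta' p))) => j; apply: Rabs_pos.
- apply: (@grad_le _ (N * (Z * K) + KH * (2 * (B + e)))); first by rewrite /KK; lra.
  apply: grad_add; last exact: Hdgw.
  apply: grad_rsum => [|p]; first exact: Rmult_le_pos.
  apply: grad_le (grad_scal (zeta' p) (GY p)); apply: Rmult_le_compat_r => //.
  by apply: (rsum_ge_term (F := fun p => Rabs (zeta' p))) => j; apply: Rabs_pos.
move=> i x.
pose J l p := del l p + du l p (tau x); pose M p i := del p i + dY p i x.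
pose b p := eta p - dV p (tau x).
pose Pd l := P l (tau x) + rsum (fun m => G m l (tau x) * b m).
have E1 p : rsum (fun l => J l p * Pd l) = zeta' p + dWV p (tau x).
  rewrite (rsum_ext (G := fun l => J l p * P l (tau x) + rsum (fun m => b m * (G m l (tau x) * J l p)))).
    rewrite rsum_plus Hpot rsum_exch (rsum_ext (F := fun m => rsum _) (G := fun m => b m * del m p)).
      by rewrite rsum_delr /b /zeta' /dWV; ring.
    by move=> m; rewrite rsum_scal -(GJ m p (tau x)).
  move=> l; rewrite /Pd Rmult_plus_distr_l -rsum_scal; congr (_ + _).
  by apply: rsum_ext => m; ring.
rewrite (rsum_ext (G := fun l => rsum (fun p => M p i * (J l p * Pd l)))); last first.
  move=> l; rewrite Jac /mmul -/(Pd l) -rsum_scalr; apply: rsum_ext => p; rewrite /M /J; ring.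
rewrite rsum_exch (rsum_ext (G := fun p => M p i * (zeta' p + dWV p (tau x)))); last first.
  by move=> p; rewrite rsum_scal E1.
rewrite chain_w.
have -> : zeta' i = rsum (fun p => zeta' p * del p i) by rewrite rsum_delr.
rewrite -!rsum_plus; apply: rsum_ext => p; rewrite /M /ebasis /del; ring.
Qed.

(** * The Newton step *)

Section Step.
Variables (n : nat) (w0 : vec n) (H : vec n * vec n -> R) (dH : 'I_n -> vec n * vec n -> R)
  (ddH : 'I_n -> 'I_n -> vec n * vec n -> R) (kap kap3 s0 C0 : R) (Ms L : 'I_n -> 'I_n -> R).
Let N := INR n.
Hypothesis N1 : 1 <= N.
Hypothesis kap0 : 0 < kap <= 1.
Hypothesis kap30 : 0 <= kap3 <= 1.
Hypothesis C01 : 1 <= C0.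
Hypothesis HT : forall s (P d u : 'I_n -> vec n -> R) dl, 0 <= s <= s0 -> 0 <= dl <= kap ->
  (forall i, TA s (P i) kap) -> (forall i, TA s (d i) dl) -> (forall i, TA s (u i) kap) ->
  TA s (fun x => H (emb (fun i x => P i x + d i x) u x) - H (emb P u x) - rsum (fun i => dH i (emb P u x) * d i x)) (C0 * dl ^ 2).
Hypothesis HT' : forall j s (P d u : 'I_n -> vec n -> R) dl, 0 <= s <= s0 -> 0 <= dl <= kap ->
  (forall i, TA s (P i) kap) -> (forall i, TA s (d i) dl) -> (forall i, TA s (u i) kap) ->
  TA s (fun x => dH j (emb (fun i x => P i x + d i x) u x) - dH j (emb P u x) - rsum (fun i => ddH j i (emb P u x) * d i x)) (C0 * dl ^ 2).
Hypothesis HM : forall i j s (P u : 'I_n -> vec n -> R), 0 <= s <= s0 ->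
  (forall i, TA s (P i) kap) -> (forall i, TA s (u i) kap) ->
  TA s (fun x => ddH i j (emb P u x) - Ms i j) kap3.
Hypothesis HMs : forall i j, Rabs (Ms i j) <= C0.
Hypothesis HL : forall i j, Rabs (L i j) <= C0.
Hypothesis HML : forall i j, mmul Ms L i j = del i j.
Hypothesis Hsmall : kap3 + 3 * N ^ 2 * kap * (C0 + 1) <= / (2 * N ^ 2 * C0).

(** The torsion: the momentum Hessian in the coordinates of the torus, [G ddH G^T]. It gives the
    response of the velocity to a momentum correction [G^T b]. *)
Definition twist (G : 'I_n -> 'I_n -> vec n -> R) (P u : 'I_n -> vec n -> R) i m x :=
  rsum (fun j => rsum (fun a => G i j x * ddH j a (emb P u x) * G m a x)).

(** Chosen so that [N * (N * C0 * kap4) = 1 / 2], the limiting case of [solve_perturbed]. *)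
Let kap4 := / (2 * N ^ 2 * C0).

Lemma kap4_bounds : 0 < kap4 <= 1 /\ N * (N * C0 * kap4) <= / 2.
Proof.
have h' : 1 <= N ^ 2 by nra.
have h : 1 <= 2 * N ^ 2 * C0 by nra.
split; last by rewrite /kap4; right; field; split; lra.
split; first by apply: Rinv_0_lt_compat; lra.
by rewrite /kap4 -Rinv_1; apply: Rinv_le_contravar; lra.
Qed.

Lemma TA_twist s G P u : 0 <= s <= s0 -> bounded_state s kap u P G ->
  forall i m, TA s (fun x => twist G P u i m x - Ms i m) kap4.
Proof.
move=> Hs [Hu HP HG] i m; have s0' : 0 <= s by lra.
have Hdd j a : TA s (fun x => ddH j a (emb P u x)) (C0 + 1).
  have h := TA_add (HM j a Hs HP Hu) (TA_const n s (Ms j a)).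
  by apply: TA_le (TA_ext _ h) _ => [x|]; [ring | have := HMs j a; lra].
have H1 := HM i m Hs HP Hu.
have H2 := TA_rsumc (F := fun a x => ddH i a (emb P u x) * (G m a x - del m a)) (fun a => TA_mul s0' (Hdd i a) (HG m a)).
have H3 := TA_rsumc (F := fun j x => (G i j x - del i j) * ddH j m (emb P u x)) (fun j => TA_mul s0' (HG i j) (Hdd j m)).
have H4 := TA_rsumc (F := fun j x => rsum (fun a => (G i j x - del i j) * ddH j a (emb P u x) * (G m a x - del m a)))
  (fun j => TA_rsumc (F := fun a x => (G i j x - del i j) * ddH j a (emb P u x) * (G m a x - del m a))
     (fun a => TA_mul s0' (TA_mul s0' (HG i j) (Hdd j a)) (HG m a))).
have h := TA_add (TA_add (TA_add H1 H2) H3) H4.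
apply: TA_le (TA_ext _ h) _ => [x|]; last first.
  rewrite -/N; have k1 : 0 <= kap * (C0 + 1) by nra.
  have e1 : N * ((C0 + 1) * kap) <= N ^ 2 * kap * (C0 + 1).
    have h2 : 0 <= N * (N - 1) by nra.
    by have := Rmult_le_pos _ _ k1 h2; lra.
  have e2 : N * (N * (kap * (C0 + 1) * kap)) <= N ^ 2 * kap * (C0 + 1).
    have b : kap * (C0 + 1) * kap <= kap * (C0 + 1) by nra.
    have a : 0 <= N ^ 2 by nra.
    by have := Rmult_le_compat_l _ _ _ a b; lra.
  by apply: Rle_trans Hsmall; lra.
have := bilin_expand (fun j a => ddH j a (emb P u x)) (fun j => G i j x) (fun a => G m a x) i m.
rewrite /twist; set T := rsum (fun j => rsum _); move=> E.
have -> : T - Ms i m = T - ddH i m (emb P u x) + (ddH i m (emb P u x) - Ms i m) by ring.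
by rewrite E; ring.
Qed.

Section OneStep.
Variables (s dl Q lam Psi : R).
Hypothesis Hs : s <= s0.
Hypothesis dl0 : 0 < dl.
Hypothesis dls : 3 * dl < s.
Hypothesis Psi0 : 0 <= Psi.
Hypothesis lam1 : 1 <= lam.
Hypothesis HPsi : Psi <= lam.
Hypothesis HQ : Q * Psi <= lam.
Hypothesis Q0 : 0 <= Q.
Hypothesis Hnr : forall k : 'I_n -> Z, 0 < knorm k -> kdot k w0 <> 0.
Hypothesis Hk : forall k : 'I_n -> Z, 0 < knorm k -> knorm k <= Q -> / Rabs (kdot k w0) <= Psi.
Let xx := exp (- (dl * Q)).

(** [CZ] and [Ceta] bound, in units of [e], the right-hand side of the velocity equation and the
    translation [eta]; [Cy] bounds the shift [Y] in units of [lam * e]. *)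
Definition CZ := 1 + N * (C0 + 1).
Definition Ceta := 2 * N ^ 2 * C0 * CZ.
Definition Cy := CZ + N * Ceta.

Lemma xx_bounds : 0 < xx <= 1.
Proof.
split; first exact: exp_pos.
rewrite -exp_0; apply: exp_le; have := Rmult_le_pos _ _ (Rlt_le _ _ dl0) Q0; lra.
Qed.

Lemma Cs_ge1 : 1 <= CZ /\ 1 <= Ceta /\ 1 <= Cy.
Proof.
have h1 : 1 <= CZ by rewrite /CZ; nra.
have h : 1 <= N ^ 2 by nra.
have h2 : 1 <= 2 * N ^ 2 * C0 by nra.
have h3 : 1 <= Ceta by rewrite /Ceta; nra.
by split=> //; split=> //; rewrite /Cy; nra.
Qed.

(** The energy error has size [e / lam], so [V] and [dV] have size [e]. The velocity equation then
    asks that the error plus [twist (eta - dV)] be a derivative along [w0], up to high harmonics.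
    Its mean must vanish, which determines [eta] because the mean of the torsion is close to the
    invertible [Ms]; solving for [Y] costs a second factor [lam]. *)
Lemma newton_data e u P G : 0 <= e ->
  bounded_state s kap u P G -> defect H dH w0 s (e / lam) e u P G ->
  exists (Y : 'I_n -> vec n -> R) (dY : 'I_n -> 'I_n -> vec n -> R) (V : vec n -> R) (dV : 'I_n -> vec n -> R)
    (eta : 'I_n -> R) (m K : R) (r1 : vec n -> R) (r2 : 'I_n -> vec n -> R),
  [/\ [/\ 0 <= K, grad K V dV & forall i, grad K (Y i) (dY i)],
      [/\ TA s V e, forall i, TA s (dV i) e, forall i, TA s (Y i) (Cy * lam * e),
        forall i l, TA s (dY i l) (Cy * lam * e) & forall i, Rabs (eta i) <= Ceta * e],
      TA (s - dl) r1 (xx * (e / lam)) /\ forall i, TA (s - dl) (r2 i) (Cy * xx * e),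
      (exists c, forall x, H (emb P u x) - c = m + rsum (fun i => w0 i * dV i x) + r1 x) &
      forall i x, rsum (fun j => G i j x * dH j (emb P u x)) - w0 i +
        rsum (fun j => twist G P u i j x * (eta j - dV j x)) = rsum (fun l => w0 l * dY i l x) + r2 i x].
Proof.
move=> e0 Hst [[c He1] He2].
have s00 : 0 <= s by lra. have sd0 : 0 <= s - dl by lra.
have ss : 0 <= s <= s0 by lra.
have [kb1 kb2] := kap4_bounds; have [x0 x1] := xx_bounds.
have [cz1 [ce1 cy1]] := Cs_ge1.
have dls' : dl <= s by lra.
have [K [K0 Split]] := TA_split dl0 dls' Psi0 HPsi HQ Hnr Hk.
have [m1 [V [dV [r1 [_ HV HdV Hr1 [GV EV]]]]]] := Split _ _ He1.
have el : lam * (e / lam) = e by field; lra.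
rewrite el in HV HdV.
have HMM := TA_twist ss Hst.
(* The entries of the torsion are split before [eta] is known: splittings are only known to exist,
   and [eta], determined by the constants [mm] and [mz], has to enter linearly. *)
have [mm Hmm] := choiceE (fun im : 'I_n * 'I_n => Split _ _ (HMM im.1 im.2)).
have [NV HNV] := choiceE Hmm; have {Hmm} [dNV HdNV] := choiceE HNV.
have {HNV} [rN HN] := choiceE HdNV.
pose Zf i x := rsum (fun j => G i j x * dH j (emb P u x)) - w0 i - rsum (fun j => twist G P u i j x * dV j x).
have HMM' i j : TA s (fun x => twist G P u i j x) (C0 + 1).
  have h := TA_add (HMM i j) (TA_const n s (Ms i j)).
  by apply: TA_le (TA_ext _ h) _ => [x|]; [ring | apply: Rle_trans (Rplus_le_compat _ _ _ _ (proj2 kb1) (HMs i j)) _; lra].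
have HZ i : TA s (Zf i) (CZ * e).
  have h := TA_sub (He2 i) (TA_rsumc (F := fun j x => twist G P u i j x * dV j x) (fun j => TA_mul s00 (HMM' i j) (HdV j))).
  by apply: TA_le h _; rewrite /CZ -/N; right; ring.
have [mz Hmz] := choiceE (fun i : 'I_n => Split _ _ (HZ i)).
have [VZ HVZ] := choiceE Hmz; have {Hmz} [dVZ HdVZ] := choiceE HVZ.
have {HVZ} [rZ HZs] := choiceE HdVZ.
have Hm0 i j : Rabs (mm (i, j)) <= kap4 by case: (HN (i, j)).
have Hz0 i : Rabs (- mz i) <= CZ * e by rewrite Rabs_Ropp; case: (HZs i).
(* Cancels the constant part: [(Ms + mm) eta = - mz]. *)
have [eta [Heta Eeta]] := solve_perturbed (Rle_trans _ _ _ Rle_0_1 C01) (Rlt_le _ _ (proj1 kb1)) HL HML Hm0 kb2 Hz0.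
have Heta' i : Rabs (eta i) <= Ceta * e by apply: Rle_trans (Heta i) _; rewrite /Ceta -/N; right; ring.
have Ce0 : 0 <= Ceta * e by nra.
have KN : 0 <= N * (Ceta * e * (K * 1)) by apply: Rmult_le_pos; [lra | apply: Rmult_le_pos; nra].
have KZ : 0 <= K * (CZ * e) by apply: Rmult_le_pos; nra.
have KV : 0 <= K * (e / lam) by apply: Rmult_le_pos => //; apply: Rdiv_le_0_compat; lra.
pose KK := K * (CZ * e) + N * (Ceta * e * (K * 1)) + K * (e / lam).
have le1 : 0 <= lam * e by nra.
exists (fun i x => VZ i x + rsum (fun j => eta j * NV (i, j) x)),
  (fun i l x => dVZ i l x + rsum (fun j => eta j * dNV (i, j) l x)), V, dV, eta, m1, KK, r1,
  (fun i x => rZ i x + rsum (fun j => eta j * rN (i, j) x)).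
have bT t (g : 'I_n -> 'I_n -> vec n -> R) : 0 <= t -> (forall i j : 'I_n, TA t (g i j) (lam * kap4)) -> forall i, TA t (fun x => rsum (fun j => eta j * g i j x)) (N * (Ceta * e * lam)).
  move=> t0 Hg i; apply: TA_rsumc => j; apply: TA_le (TA_scal (eta j) (Hg i j)) _.
  rewrite Rmult_assoc; have l0 : 0 <= lam by lra.
  apply: (Rle_trans _ (Ceta * e * (lam * 1))); last by lra.
  apply: Rmult_le_compat => //; [exact: Rabs_pos | by apply: Rmult_le_pos; lra |].
  by apply: Rmult_le_compat_l; lra.
split.
- split; first by rewrite /KK; lra.
    by apply: grad_le GV; rewrite /KK; lra.
  move=> i; apply: grad_le (grad_add (K' := N * (Ceta * e * (K * 1))) (_ : grad (K * (CZ * e)) _ _) _); first by rewrite /KK; lra.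
    by case: (HZs i) => _ _ _ _ [].
  apply: grad_rsum => [|j]; first by apply: Rmult_le_pos; nra.
  case: (HN (i, j)) => _ _ _ _ [h _]; apply: grad_le (grad_scal (eta j) h).
  apply: Rmult_le_compat => //; [exact: Rabs_pos | by apply: Rmult_le_pos; lra |].
  by apply: Rmult_le_compat_l => //; lra.
- split=> //.
  + move=> i; have h1 : TA s (VZ i) (lam * (CZ * e)) by case: (HZs i).
    have h2 := bT s (fun i j => NV (i, j)) s00 (fun i j => ltac:(by case: (HN (i, j)))) i.
    by apply: TA_le (TA_add h1 h2) _; rewrite /Cy; right; ring.
  + move=> i l; have h1 : TA s (dVZ i l) (lam * (CZ * e)) by case: (HZs i).
    have h2 := bT s (fun i j => dNV (i, j) l) s00 (fun i j => ltac:(by case: (HN (i, j)))) i.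
    by apply: TA_le (TA_add h1 h2) _; rewrite /Cy; right; ring.
- split=> // i; have h1 : TA (s - dl) (rZ i) (xx * (CZ * e)) by case: (HZs i).
  have h2 : TA (s - dl) (fun x => rsum (fun j => eta j * rN (i, j) x)) (N * (Ceta * e * xx)).
    apply: TA_rsumc => j; have h : TA (s - dl) (rN (i, j)) (xx * kap4) by case: (HN (i, j)).
    apply: TA_le (TA_scal (eta j) h) _.
    apply: (Rle_trans _ (Ceta * e * (xx * 1))); last by lra.
    apply: Rmult_le_compat => //; [exact: Rabs_pos | by apply: Rmult_le_pos; lra |].
    by apply: Rmult_le_compat_l; lra.
  by apply: TA_le (TA_add h1 h2) _; rewrite /Cy; right; ring.
- by exists c => x; apply: EV.
move=> i x.
have E1 : rsum (fun j => G i j x * dH j (emb P u x)) - w0 i = Zf i x + rsum (fun j => twist G P u i j x * dV j x).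
  by rewrite /Zf; ring.
have E2 : Zf i x = mz i + rsum (fun l => w0 l * dVZ i l x) + rZ i x by case: (HZs i) => _ _ _ _ [_]; apply.
have E3 j : twist G P u i j x = Ms i j + (mm (i, j) + rsum (fun l => w0 l * dNV (i, j) l x) + rN (i, j) x).
  by case: (HN (i, j)) => _ _ _ _ [_ /(_ x) /= <-]; ring.
rewrite (rsum_ext (F := fun j => twist G P u i j x * (eta j - dV j x)) (G := fun j => twist G P u i j x * eta j - twist G P u i j x * dV j x)); last by move=> j; ring.
rewrite rsum_minus E1 E2.
have -> : rsum (fun j => twist G P u i j x * eta j) = - mz i + rsum (fun j => eta j * rsum (fun l => w0 l * dNV (i, j) l x)) + rsum (fun j => eta j * rN (i, j) x).
  rewrite -(Eeta i) /mvec -!rsum_plus; apply: rsum_ext => j; rewrite E3; ring.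
have -> : rsum (fun l => w0 l * (dVZ i l x + rsum (fun j => eta j * dNV (i, j) l x))) =
  rsum (fun l => w0 l * dVZ i l x) + rsum (fun j => eta j * rsum (fun l => w0 l * dNV (i, j) l x)).
  rewrite (rsum_ext (G := fun l => w0 l * dVZ i l x + rsum (fun j => w0 l * (eta j * dNV (i, j) l x)))).
    rewrite rsum_plus; congr (_ + _); rewrite rsum_exch; apply: rsum_ext => j.
    by rewrite -rsum_scal; apply: rsum_ext => l; ring.
  by move=> l; rewrite rsum_scal; ring.
ring.
Qed.

(** In units of [e]: [Cb] for [eta - dV], [Cd] for the momentum correction, with entries of [G] at
    most 2, and [Cw] for the derivative of [Y] along [w0]. [Cq * lam^2 * e] bounds the relative
    variation under [tau], where 8 stands for [2 PI]. [Cst] dominates every combination that the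
    step produces. *)
Definition Cb := 1 + Ceta.
Definition Cd := 2 * N * Cb.
Definition Cw := 1 + N * (C0 + 1) * Cb + Cy.
Definition Cq := 8 * Cy.
Definition Cst := Cq * (1 + 2 * N * Cw) + 2 * Cd + Cd / kap + 12 * N * Cy + 2 * (N * Cb + C0 * Cd ^ 2) + 8 * N ^ 2 * C0 * Cd ^ 2.

Lemma Cst_bounds : [/\ 1 <= Cst, Cq <= Cst, 2 * N * Cy <= Cst, Cd / kap <= Cst & Cq + 2 * Cd <= Cst] /\
  [/\ Cy + Cq <= Cst, Cq + 8 * N * Cy <= Cst, 2 * (N * Cb + C0 * Cd ^ 2) <= Cst, 4 * N * Cy <= Cst &
   2 * N * Cq * Cw + 8 * N ^ 2 * C0 * Cd ^ 2 <= Cst] /\ [/\ 1 <= Cb, 1 <= Cd, 1 <= Cw, 8 <= Cq & 1 <= Cy].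
Proof.
have [cz1 [ce1 cy1]] := Cs_ge1.
have b1 : 1 <= Cb by rewrite /Cb; lra.
have d1 : 1 <= Cd by rewrite /Cd; nra.
have w0' : 0 <= N * (C0 + 1) * Cb by apply: Rmult_le_pos; nra.
have w1 : 1 <= Cw by rewrite /Cw; lra.
have q7 : 8 <= Cq by rewrite /Cq; lra.
have ny : Cy <= N * Cy by nra.
have k1 : 0 <= Cd / kap by apply: Rdiv_le_0_compat; lra.
have n1 : 0 <= 2 * (N * Cb + C0 * Cd ^ 2) by nra.
have n2 : 0 <= 8 * N ^ 2 * C0 * Cd ^ 2.
  by apply: Rmult_le_pos; [apply: Rmult_le_pos; nra | nra].
have n3 : 0 <= Cq * (2 * N * Cw) by apply: Rmult_le_pos; nra.
have E : Cst = Cq + Cq * (2 * N * Cw) + 2 * Cd + Cd / kap + 12 * (N * Cy) + 2 * (N * Cb + C0 * Cd ^ 2) + 8 * N ^ 2 * C0 * Cd ^ 2.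
  by rewrite /Cst; ring.
split; first by split; rewrite E; lra.
by split; split; rewrite ?E; lra.
Qed.

(** The width [3 dl] pays for the remainder of the splitting, for the displacement [2 PI y <= dl]
    and for the Cauchy estimate in comparing a function with its composition by [tau]. First-order
    terms cancel identically; there remain truncation terms, carrying [xx], and terms of second
    order. *)
Theorem kam_step e U u P G : 0 <= e -> 0 <= U <= kap -> 1 <= dl * lam -> Cst * (lam ^ 2 * e) <= 1 ->
  bounded_state s U u P G -> defect H dH w0 s (e / lam) e u P G -> lagrangian s u P G ->
  exists u' P' G', let D := Cst * (lam ^ 2 * e) in
  [/\ forall i, TA (s - 3 * dl) (fun x => u' i x - u i x) D,
      forall i, TA (s - 3 * dl) (fun x => P' i x - P i x) D,
      forall i j, TA (s - 3 * dl) (fun x => G' i j x - G i j x) D,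
      defect H dH w0 (s - 3 * dl) (2 * xx * (e / lam) + Cst * e ^ 2) (Cst * xx * e + Cst * (lam ^ 2 * e) * e) u' P' G' &
      lagrangian (s - 3 * dl) u' P' G'].
Proof.
move=> e0 [U0 Uk] dlam Hsm HstU Hdef HLag; have pi0 := PI_RGT_0; have pi4 := PI_4.
have s00 : 0 <= s by lra. have sd0 : 0 <= s - dl by lra. have s20 : 0 <= s - 3 * dl by lra.
have ss1 : 0 <= s - dl <= s0 by lra.
have s12 : s - dl <= s by lra. have s23 : s - 3 * dl <= s - dl by lra. have s13 : s - 3 * dl <= s by lra.
have [x0 x1] := xx_bounds.
have Hst : bounded_state s kap u P G.
  by case: HstU => h1 h2 h3; split=> *; apply: TA_le (Uk).
have [[cs1 cs2 cs3 cs4 cs5] [[cs6 cs7 cs8 cs9 cs10] [cb1 cd1 cw1 cq7 cy1]]] := Cst_bounds.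
have [Y [dY [V [dV [eta [m [K [r1 [r2 [[K0 GV GY] [HV HdV HY HdY Heta] [Hr1 Hr2] [c Ee1] Ee2]]]]]]]]]] := newton_data e0 Hst Hdef.
have l2 : lam <= lam ^ 2 by nra.
have le0 : 0 <= lam * e by nra.
have el2 : e <= lam ^ 2 * e by nra.
have lel2 : lam * e <= lam ^ 2 * e by nra.
have l2e0 : 0 <= lam ^ 2 * e by nra.
set q := lam ^ 2 * e in Hsm el2 lel2 l2e0 *.
have Hcst t : 0 <= t -> t <= Cst -> t * q <= 1.
  by move=> t0 ht; apply: Rle_trans Hsm; apply: Rmult_le_compat_r.
set y := Cy * lam * e in HY HdY.
have y0 : 0 <= y by rewrite /y; nra.
have yq : y <= Cy * q by rewrite /y Rmult_assoc; apply: Rmult_le_compat_l; lra.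
(* [1 <= dl * lam] turns the loss [1 / dl] into a second factor [lam]. *)
have Hyd : 2 * PI * y <= Cq * q * dl.
  have h1 : 2 * PI * y <= 8 * y by apply: Rmult_le_compat_r; lra.
  have h2 : lam * e <= q * dl.
    by rewrite /q; have := Rmult_le_compat_l _ _ _ le0 dlam; lra.
  rewrite /Cq; have := Rmult_le_compat_l _ _ _ (Rle_trans _ _ _ Rle_0_1 cy1) h2.
  by rewrite /y in h1 *; lra.
have Hq : 2 * PI * y / dl <= Cq * q.
  by apply: (Rmult_le_reg_r dl) => //; rewrite /Rdiv Rmult_assoc Rinv_l; lra.
have Cq1 : Cq * q <= 1 by apply: Hcst; lra.
have Hyd1 : 2 * PI * y <= dl.
  by apply: Rle_trans Hyd _; have := Rmult_le_compat_r _ _ _ (Rlt_le _ _ dl0) Cq1; lra.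
pose tau x := fun i => x i + Y i x.
have HY2 i : TA (s - 3 * dl) (Y i) y by apply: TA_mono (HY i).
have cond : s - 3 * dl + 2 * PI * y + dl <= s - dl by lra.
have cmp g B : TA (s - dl) g B -> TA (s - 3 * dl) (fun x => g (tau x) - g x) (Cq * q * B).
  move=> Hg; apply: TA_le (TA_comp_sub s20 dl0 Hg HY2 y0 cond) _.
  by apply: Rmult_le_compat_r => //; apply: TA_ge0 Hg.
have cmp2 g B : TA (s - dl) g B -> TA (s - 3 * dl) (fun x => g (tau x)) (2 * B).
  by move=> Hg; apply: TA_comp Hg HY2 y0 cond Hyd1.
have Ny : N * y <= / 2.
  have : 2 * N * Cy * q <= 1 by apply: Hcst => //; nra.
  have : N * y <= N * (Cy * q) by apply: Rmult_le_compat_l; lra.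
  lra.
have y2 : 2 * y <= 1 by nra.
have [Kn [HKn Kn1 Kn2]] := Neumann s20 (fun i l => TA_mono s13 (HdY i l)) Ny.
have [Hu HP HG] := Hst; have [HuU HPU HGU] := HstU.
have HG2 i j : TA s (G i j) 2.
  have h := TA_add (HG i j) (TA_const n s (del i j)).
  apply: TA_le (TA_ext _ h) _ => [x|]; first by ring.
  by rewrite /del; case: (_ == _); rewrite ?Rabs_R1 ?Rabs_R0; lra.
pose b l x := eta l - dV l x.
have Hb l : TA s (b l) (Cb * e).
  have h := TA_sub (TA_const n s (eta l)) (HdV l).
  by apply: TA_le h _; rewrite /Cb; have := Heta l; lra.
pose d i x := rsum (fun l => G l i x * b l x).
have Hd i : TA s (d i) (Cd * e).
  by apply: TA_le (TA_rsumc (F := fun l x => G l i x * b l x) (fun l => TA_mul s00 (HG2 l i) (Hb l))) _; rewrite /Cd -/N; right; ring.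
have Cdk : 0 <= Cd * e <= kap.
  split; first by nra.
  have : Cd / kap * q <= 1 by apply: Hcst => //; apply: Rdiv_le_0_compat; lra.
  move=> h; have h2 := Rmult_le_compat_l _ _ _ (Rlt_le _ _ (proj1 kap0)) h.
  have E : kap * (Cd / kap * q) = Cd * q by field; lra.
  by rewrite E in h2; apply: Rle_trans (Rmult_le_compat_l _ _ _ _ el2) _; lra.
pose u' i x := Y i x + u i (tau x).
pose P' i x := P i (tau x) + d i (tau x).
pose G' i j x := rsum (fun l => (del i l + Kn i l x) * G l j (tau x)).
have mono1 (g : vec n -> R) B : TA s g B -> TA (s - dl) g B by exact: TA_mono.
(* The new torus is the one with corrected momentum, reparametrized by [tau]: errors are estimated
   before the composition. *)
have Hemb x : emb P' u' x = emb (fun i x => P i x + d i x) u (tau x).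
  by rewrite /emb; congr pair; apply: functional_extensionality => i; rewrite /u' /tau; ring.
have R1 := HT ss1 Cdk (fun i => mono1 _ _ (HP i)) (fun i => mono1 _ _ (Hd i)) (fun i => mono1 _ _ (Hu i)).
have R2 j := HT' j ss1 Cdk (fun i => mono1 _ _ (HP i)) (fun i => mono1 _ _ (Hd i)) (fun i => mono1 _ _ (Hu i)).
have [_ He2] := Hdef.
pose e2 i x := rsum (fun j => G i j x * dH j (emb P u x)) - w0 i.
have He2' i : TA s (e2 i) e := He2 i.
exists u', P', G'; split.
- move=> i; have h := TA_add (HY2 i) (cmp _ _ (mono1 _ _ (HuU i))).
  apply: TA_le (TA_ext _ h) _ => [x|]; first by rewrite /u'; ring.
  have : Cq * q * U <= Cq * q * 1 by apply: Rmult_le_compat_l; [nra | lra].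
  have : (Cy + Cq) * q <= Cst * q by apply: Rmult_le_compat_r.
  lra.
- move=> i; have h := TA_add (cmp _ _ (mono1 _ _ (HPU i))) (cmp2 _ _ (mono1 _ _ (Hd i))).
  apply: TA_le (TA_ext _ h) _ => [x|]; first by rewrite /P'; ring.
  have : Cq * q * U <= Cq * q * 1 by apply: Rmult_le_compat_l; [nra | lra].
  have : (Cq + 2 * Cd) * q <= Cst * q by apply: Rmult_le_compat_r.
  have : Cd * e <= Cd * q by apply: Rmult_le_compat_l; lra.
  lra.
- move=> i j.
  have h1 := cmp _ _ (mono1 _ _ (HGU i j)).
  have h2 := TA_rsumc (F := fun l x => Kn i l x * G l j (tau x)) (fun l => TA_mul s20 (HKn i l) (cmp2 _ _ (mono1 _ _ (HG2 l j)))).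
  apply: TA_le (TA_ext _ (TA_add h1 h2)) _ => [x|].
    rewrite /G' (rsum_ext (G := fun l => del i l * G l j (tau x) + Kn i l x * G l j (tau x))); last by move=> l; ring.
    by rewrite rsum_plus (rsum_dell (fun l => G l j (tau x))); ring.
  have : Cq * q * U <= Cq * q * 1 by apply: Rmult_le_compat_l; [nra | lra].
  have : (Cq + 8 * N * Cy) * q <= Cst * q by apply: Rmult_le_compat_r.
  have : N * y <= N * (Cy * q) by apply: Rmult_le_compat_l; lra.
  rewrite -/N; lra.
- split.
    exists (c + m + rsum (fun i => w0 i * eta i)).
    have F1 : TA (s - dl) (fun x => r1 x + rsum (fun l => e2 l x * b l x) +
        (H (emb (fun i x => P i x + d i x) u x) - H (emb P u x) - rsum (fun i => dH i (emb P u x) * d i x)))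
        (xx * (e / lam) + N * (e * (Cb * e)) + C0 * (Cd * e) ^ 2).
      apply: TA_add R1; apply: TA_add Hr1 _; apply: TA_rsumc => l.
      by apply: mono1; apply: TA_mul.
    apply: TA_le (TA_ext _ (cmp2 _ _ F1)) _ => [x|]; last first.
      have : 2 * (N * Cb + C0 * Cd ^ 2) * e ^ 2 <= Cst * e ^ 2 by apply: Rmult_le_compat_r => //; nra.
      rewrite Rpow_mult_distr; lra.
    rewrite Hemb; move: (tau x) => z.
    (* Since [d = G^T b] and [G dH = w0 + e2], the linear change of energy is [w0 . b] up to a
       quadratic term; its part [- w0 . dV] cancels the solved part of the energy error. *)
    have E1 : rsum (fun i => dH i (emb P u z) * d i z) = rsum (fun l => w0 l * b l z) + rsum (fun l => e2 l z * b l z).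
      rewrite -rsum_plus /d.
      rewrite (rsum_ext (G := fun i => rsum (fun l => b l z * (G l i z * dH i (emb P u z))))); last first.
        by move=> i; rewrite -rsum_scal; apply: rsum_ext => l; ring.
      rewrite rsum_exch; apply: rsum_ext => l; rewrite rsum_scal /e2; ring.
    have E2 : rsum (fun l => w0 l * b l z) = rsum (fun i => w0 i * eta i) - rsum (fun i => w0 i * dV i z).
      by rewrite -rsum_minus; apply: rsum_ext => l; rewrite /b; ring.
    by rewrite E1 E2; have := Ee1 z; lra.
  pose Om l x := rsum (fun a => w0 a * dY l a x).
  pose R' l x := rsum (fun j => G l j x * (dH j (emb (fun i x => P i x + d i x) u x) - dH j (emb P u x) - rsum (fun a => ddH j a (emb P u x) * d a x))).
  have HR' l : TA (s - dl) (R' l) (N * (2 * (C0 * (Cd * e) ^ 2))).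
    by apply: TA_rsumc => j; apply: TA_mul => //; apply: mono1.
  (* [Om] is the derivative of [Y] along [w0]. Read from the equation that it solves, it has size
     [e], whereas the bound on [dY] would give [lam * e]. *)
  have HOm l : TA (s - dl) (Om l) (Cw * e).
    have HMM j : TA s (fun x => twist G P u l j x) (C0 + 1).
      have [kb1 _] := kap4_bounds.
      have h := TA_add (TA_twist (conj s00 Hs) Hst l j) (TA_const n s (Ms l j)).
      by apply: TA_le (TA_ext _ h) _ => [x|]; [ring | apply: Rle_trans (Rplus_le_compat _ _ _ _ (proj2 kb1) (HMs l j)) _; lra].
    have h1 := TA_add (He2' l) (TA_rsumc (F := fun j x => twist G P u l j x * b j x) (fun j => TA_mul s00 (HMM j) (Hb j))).
    have h := TA_sub (mono1 _ _ h1) (Hr2 l).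
    apply: TA_le (TA_ext _ h) _ => [x|]; first by rewrite (Ee2 l x) /Om; ring.
    have : Cy * xx * e <= Cy * 1 * e by apply: Rmult_le_compat_r => //; apply: Rmult_le_compat_l; lra.
    by rewrite /Cw -/N; lra.
  have HD l x : rsum (fun j => G l j x * dH j (emb (fun i x => P i x + d i x) u x)) = w0 l + Om l x + (r2 l x + R' l x).
    have E1 : rsum (fun j => G l j x * dH j (emb (fun i x => P i x + d i x) u x)) =
       w0 l + e2 l x + rsum (fun j => G l j x * rsum (fun a => ddH j a (emb P u x) * d a x)) + R' l x.
      rewrite /e2 /R' [X in _ = X + _](_ : _ = rsum (fun j => G l j x * dH j (emb P u x)) + rsum (fun j => G l j x * rsum (fun a => ddH j a (emb P u x) * d a x))); last by ring.
      by rewrite -!rsum_plus; apply: rsum_ext => j; ring.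
    have E2 : rsum (fun j => G l j x * rsum (fun a => ddH j a (emb P u x) * d a x)) = rsum (fun k => twist G P u l k x * b k x).
      rewrite /twist /d.
      transitivity (rsum (fun j => rsum (fun a => rsum (fun k => G l j x * ddH j a (emb P u x) * G k a x * b k x)))).
        apply: rsum_ext => j; rewrite -rsum_scal; apply: rsum_ext => a; rewrite -!rsum_scal.
        by apply: rsum_ext => k; ring.
      transitivity (rsum (fun j => rsum (fun k => rsum (fun a => G l j x * ddH j a (emb P u x) * G k a x * b k x)))).
        by apply: rsum_ext => j; rewrite rsum_exch.
      rewrite rsum_exch; apply: rsum_ext => k; rewrite -rsum_scalr; apply: rsum_ext => j.
      by rewrite -rsum_scalr.
    by rewrite E1 E2; have := Ee2 l x; rewrite /e2 /Om /b; lra.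
  move=> i.
  have F2 l : TA (s - 3 * dl) (fun x => (del i l + Kn i l x) * ((Om l (tau x) - Om l x) + (r2 l (tau x) + R' l (tau x))))
     (2 * (Cq * q * (Cw * e) + 2 * (Cy * xx * e + N * (2 * (C0 * (Cd * e) ^ 2))))).
    apply: TA_mul => //.
      apply: TA_le (TA_add (TA_const n _ (del i l)) (HKn i l)) _.
      by rewrite /del; case: (_ == _); rewrite ?Rabs_R1 ?Rabs_R0; lra.
    by apply: TA_add (cmp _ _ (HOm l)) (cmp2 _ _ (TA_add (Hr2 l) (HR' l))).
  apply: TA_le (TA_ext _ (TA_rsumc F2)) _ => [x|].
    rewrite Hemb /G'.
    (* [w0 = (1 + Kn) (1 + dY) w0 = (1 + Kn) (w0 + Om)]: subtracting this leaves the variation of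
       [Om] under [tau] and the remainders. *)
    transitivity (rsum (fun l => (del i l + Kn i l x) * (w0 l + Om l (tau x) + (r2 l (tau x) + R' l (tau x)))) -
       rsum (fun l => (del i l + Kn i l x) * (w0 l + Om l x))).
      congr (_ - _).
        rewrite (rsum_ext (G := fun j => rsum (fun l => (del i l + Kn i l x) * (G l j (tau x) * dH j (emb (fun i x => P i x + d i x) u (tau x)))))); last first.
          by move=> j; rewrite -rsum_scalr; apply: rsum_ext => l; ring.
        by rewrite rsum_exch; apply: rsum_ext => l; rewrite rsum_scal HD.
      have E l : w0 l + Om l x = mvec (fun a c => del a c + dY a c x) w0 l.
        rewrite /mvec (rsum_ext (G := fun c => del l c * w0 c + w0 c * dY l c x)); last by move=> k; ring.
        by rewrite rsum_plus rsum_dell.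
      rewrite (rsum_ext (F := fun l => _ * (w0 l + Om l x)) (G := fun l => (del i l + Kn i l x) * mvec (fun a c => del a c + dY a c x) w0 l)); last by move=> l; rewrite E.
      rewrite -/(mvec (fun a c => del a c + Kn a c x) (mvec (fun a c => del a c + dY a c x) w0) i) -mmul_mvec.
      rewrite (mvec_ext (B := del (n := n)) (u := w0)) ?mvec_del // => a c'.
      by rewrite mmul_1D; have := Kn2 a c' x; lra.
    by rewrite -rsum_minus; apply: rsum_ext => l; ring.
  rewrite -/N Rpow_mult_distr.
  have t1 : 4 * N * Cy * (xx * e) <= Cst * (xx * e) by apply: Rmult_le_compat_r => //; nra.
  have t2 : (2 * N * Cq * Cw + 8 * N ^ 2 * C0 * Cd ^ 2) * (q * e) <= Cst * (q * e) by apply: Rmult_le_compat_r => //; nra.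
  have t3 : 8 * N ^ 2 * C0 * Cd ^ 2 * e ^ 2 <= 8 * N ^ 2 * C0 * Cd ^ 2 * (q * e).
    apply: Rmult_le_compat_l; last by nra.
    by apply: Rmult_le_pos; [apply: Rmult_le_pos; nra | nra].
  lra.
- apply: (@lagrangian_step n s (s - 3 * dl) u P G Y dY V dV eta Kn K kap e y) => //.
  + lra.
  + by move=> g B Hg; apply: cmp2; apply: mono1.
Qed.

End OneStep.

(** * Iteration of the Newton step *)

Section Iteration.
Variables (Q Psi : nat -> R) (lam0 cc ss e0 : R).
Definition lamj j := lam0 * 2 ^ j.
Definition ej j := e0 / 16 ^ j.
Definition dlj j := cc / Q j.
Fixpoint sj j := if j is j'.+1 then sj j' - 3 * dlj j' else ss.
Definition Asum := Cst * (lam0 ^ 2 * e0).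
(** Starts from 0 and dominates the accumulated displacements [Asum / 4^j]: its increments are
    [Asum / 2^j]. *)
Definition Uj j := 2 * Asum * (1 - (/ 2) ^ j).

Hypothesis lam01 : 1 <= lam0.
Hypothesis e00 : 0 <= e0.
Hypothesis cc1 : 1 <= cc.
Hypothesis Q1 : forall j, 1 <= Q j.
Hypothesis Qlam : forall j, Q j <= lamj j.
Hypothesis Psij0 : forall j, 0 <= Psi j.
Hypothesis QPsi : forall j, Q j * Psi j <= lamj j.
Hypothesis Hnr : forall k : 'I_n -> Z, 0 < knorm k -> kdot k w0 <> 0.
Hypothesis Hkj : forall j (k : 'I_n -> Z), 0 < knorm k -> knorm k <= Q j -> / Rabs (kdot k w0) <= Psi j.
Hypothesis ss0 : 0 < ss <= s0.
Hypothesis Hsum : forall j, ss / 2 <= sj j.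
Hypothesis xc1 : exp (- cc) <= / 128.
Hypothesis xc2 : Cst * exp (- cc) <= / 32.
Hypothesis Asmall : Asum <= / 64.
Hypothesis Asmall2 : 2 * Asum <= kap.

Let state := (('I_n -> vec n -> R) * ('I_n -> vec n -> R) * ('I_n -> 'I_n -> vec n -> R))%type.

Definition inv_at j (S : state) :=
  [/\ bounded_state (sj j) (Uj j) S.1.1 S.1.2 S.2,
      defect H dH w0 (sj j) (ej j / lamj j) (ej j) S.1.1 S.1.2 S.2 &
      lagrangian (sj j) S.1.1 S.1.2 S.2].

Definition close_at j (S S' : state) :=
  [/\ forall i, TA (sj j.+1) (fun x => S'.1.1 i x - S.1.1 i x) (Asum / 4 ^ j),
      forall i, TA (sj j.+1) (fun x => S'.1.2 i x - S.1.2 i x) (Asum / 4 ^ j) &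
      forall i l, TA (sj j.+1) (fun x => S'.2 i l x - S.2 i l x) (Asum / 4 ^ j)].

Lemma lamj_ge1 j : 1 <= lamj j.
Proof. by have := pow_R1_Rle 2 j ltac:(lra); rewrite /lamj; nra. Qed.

Lemma Asum_eq j : Cst * (lamj j ^ 2 * ej j) = Asum / 4 ^ j.
Proof.
rewrite /lamj /ej /Asum Rpow_mult_distr.
have -> : (2 ^ j) ^ 2 = 4 ^ j by rewrite -pow_mult Nat.mul_comm pow_mult; congr (_ ^ _); ring.
have -> : 16 = 4 * 4 by ring.
by rewrite Rpow_mult_distr; field; apply: pow_nonzero; lra.
Qed.

Lemma Asum_ge0 : 0 <= Asum.
Proof.
have [[h _ _ _ _] _] := Cst_bounds.
by apply: Rmult_le_pos; [lra | nra].
Qed.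

(** The rates fit together: [lam_j^2 e_j] decreases like [4^-j]; the velocity error has to gain a
    factor 16, which [1/32 + 1/64] provides, and the energy error a factor 32, which is exactly
    [2/128 + 1/64]. *)
Lemma iteration_step j S : inv_at j S -> exists S', inv_at j.+1 S' /\ close_at j S S'.
Proof.
case: S => [[u P] G]; rewrite /inv_at /= => -[Hb Hd Hl].
have l1 := lamj_ge1 j; have A0 := Asum_ge0.
have [[cst1 _ _ _ _] _] := Cst_bounds.
have q1 := Q1 j; have ql := Qlam j.
have p4 : 1 <= 4 ^ j by apply: pow_R1_Rle; lra.
have p16 : 1 <= 16 ^ j by apply: pow_R1_Rle; lra.
have h2 : 0 < (/ 2) ^ j <= 1 by split; [apply: pow_lt; lra | rewrite -(pow1 j); apply: pow_incr; lra].
have d0 : 0 < dlj j by apply: Rdiv_lt_0_compat; lra.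
have ej0 : 0 <= ej j by apply: Rdiv_le_0_compat; lra.
have Hs1 := Hsum j.+1; rewrite /= in Hs1.
have sle : sj j <= s0.
  apply: Rle_trans (proj2 ss0); elim: (j) => [|i IH] /=; first by lra.
  by have di : 0 < dlj i; [apply: Rdiv_lt_0_compat; have := Q1 i; lra | lra].
have Psile : Psi j <= lamj j.
  by apply: Rle_trans (QPsi j); have := Psij0 j; nra.
have dQ : dlj j * Q j = cc by rewrite /dlj; field; lra.
have dlam : 1 <= dlj j * lamj j.
  have : dlj j * Q j <= dlj j * lamj j by apply: Rmult_le_compat_l; lra.
  by rewrite dQ; lra.
have A4 : 0 <= Asum / 4 ^ j <= Asum.
  split; first by apply: Rdiv_le_0_compat; lra.
  rewrite -[X in _ <= X]Rmult_1_r; apply: Rmult_le_compat_l => //.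
  by rewrite -Rinv_1; apply: Rinv_le_contravar; lra.
have Hsm : Cst * (lamj j ^ 2 * ej j) <= 1 by rewrite Asum_eq; lra.
have U0 : 0 <= Uj j <= kap.
  by rewrite /Uj; split; [apply: Rmult_le_pos; lra | apply: Rle_trans Asmall2; nra].
have d3 : 3 * dlj j < sj j by lra.
have [u' [P' [G' [Hu' HP' HG' Hd' Hl']]]] := kam_step sle d0 d3 (Psij0 j) l1 Psile (QPsi j) ltac:(lra) Hnr (@Hkj j) ej0 U0 dlam Hsm Hb Hd Hl.
exists (u', P', G'); rewrite Asum_eq in Hu' HP' HG'.
split; last by split.
have UU : Uj j + Asum / 4 ^ j <= Uj j.+1.
  have : Asum / 4 ^ j <= Asum * (/ 2) ^ j.
    apply: Rmult_le_compat_l => //; rewrite pow_inv; apply: Rinv_le_contravar; first by apply: pow_lt; lra.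
    by apply: pow_incr; lra.
  by rewrite /Uj /=; lra.
case: Hb => b1 b2 b3; split=> //.
- have mono (g : vec n -> R) B : TA (sj j) g B -> TA (sj j.+1) g B by apply: TA_mono => /=; lra.
  split=> [i|i|i l].
  + by apply: TA_le (TA_ext _ (TA_add (mono _ _ (b1 i)) (Hu' i))) UU => x /=; ring.
  + by apply: TA_le (TA_ext _ (TA_add (mono _ _ (b2 i)) (HP' i))) UU => x /=; ring.
  + by apply: TA_le (TA_ext _ (TA_add (mono _ _ (b3 i l)) (HG' i l))) UU => x /=; ring.
rewrite dQ in Hd'; case: Hd' => [[c Hc] Hw].
have lp : 0 < lamj j by lra.
have l2 : lamj j <= lamj j ^ 2 by nra.
have E1 : 2 * exp (- cc) * (ej j / lamj j) + Cst * ej j ^ 2 <= ej j.+1 / lamj j.+1.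
  have -> : ej j.+1 / lamj j.+1 = / 32 * (ej j / lamj j) by rewrite /ej /lamj /=; field; repeat split; try apply: pow_nonzero; lra.
  have el0 : 0 <= ej j / lamj j by apply: Rdiv_le_0_compat.
  have -> : Cst * ej j ^ 2 = (Cst * (lamj j * ej j)) * (ej j / lamj j) by field; lra.
  have : Cst * (lamj j * ej j) <= / 64.
    apply: Rle_trans (_ : Cst * (lamj j ^ 2 * ej j) <= _); last by rewrite Asum_eq; lra.
    by apply: Rmult_le_compat_l; [lra | apply: Rmult_le_compat_r].
  nra.
have E2 : Cst * exp (- cc) * ej j + Cst * (lamj j ^ 2 * ej j) * ej j <= ej j.+1.
  have -> : ej j.+1 = / 16 * ej j by rewrite /ej /=; field; apply: pow_nonzero; lra.
  rewrite Asum_eq; nra.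
split; first by exists c; apply: TA_le Hc E1.
by move=> i; apply: TA_le (Hw i) E2.
Qed.

Lemma iteration S0 : inv_at 0 S0 ->
  exists Sq : nat -> state, Sq 0%N = S0 /\ forall j, inv_at j (Sq j) /\ close_at j (Sq j) (Sq j.+1).
Proof.
move=> H0.
(* [S0] is a default for states outside the invariant, so that the step becomes a total function. *)
have step (jS : nat * state) : exists S', inv_at jS.1 jS.2 -> inv_at jS.1.+1 S' /\ close_at jS.1 jS.2 S'.
  have [h|h] := excluded_middle_informative (inv_at jS.1 jS.2); last by exists S0.
  by have [S' HS] := iteration_step h; exists S'.
have [f Hf] := choiceE step.
pose Sq := fix Sq j := if j is j'.+1 then f (j', Sq j') else S0.
have Hinv j : inv_at j (Sq j) by elim: j => [//|j IH]; exact: (proj1 (Hf (j, Sq j) IH)).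
exists Sq; split=> // j; split; first exact: Hinv.
exact: (proj2 (Hf (j, Sq j) (Hinv j))).
Qed.

End Iteration.
End Step.

(** * The limit torus *)

Section Limits.

Lemma lim_geom (a : nat -> R) l C : (forall j, Rabs (a j - l) <= C / 4 ^ j) -> is_lim_seq a l.
Proof.
move=> H.
have L : is_lim_seq (fun j => C / 4 ^ j) 0.
  apply: (is_lim_seq_ext (fun j => C * (/ 4) ^ j)); first by move=> j; rewrite pow_inv.
  have -> : Finite 0 = Rbar_mult C 0 by rewrite /= Rmult_0_r.
  apply: is_lim_seq_scal_l; apply: is_lim_seq_geom; rewrite Rabs_pos_eq; lra.
apply: (is_lim_seq_le_le (fun j => l - C / 4 ^ j) _ (fun j => l + C / 4 ^ j)).
- by move=> j; have := proj1 (Rabs_le_between _ _) (H j); split; lra.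
- have -> : Finite l = Finite (l - 0) by f_equal; ring.
  by apply: is_lim_seq_minus' => //; apply: is_lim_seq_const.
- have -> : Finite l = Finite (l + 0) by f_equal; ring.
  by apply: is_lim_seq_plus' => //; apply: is_lim_seq_const.
Qed.

Lemma rsum_is_lim n (F : nat -> 'I_n -> R) (l : 'I_n -> R) :
  (forall i, is_lim_seq (fun j => F j i) (l i)) -> is_lim_seq (fun j => rsum (F j)) (rsum l).
Proof.
move=> H; rewrite /rsum; elim: (index_enum _) => [|i s IH].
  apply: (is_lim_seq_ext (fun _ => 0)); first by move=> m; rewrite big_nil.
  by rewrite big_nil; apply: is_lim_seq_const.
apply: (is_lim_seq_ext (fun j => F j i + \big[Rplus/0]_(k <- s) F j k)); first by move=> j; rewrite big_cons.
by rewrite big_cons; apply: is_lim_seq_plus'.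
Qed.

Lemma is_lim_multR (a b : nat -> R) (l l' : R) : is_lim_seq a l -> is_lim_seq b l' ->
  is_lim_seq (fun j => a j * b j) (l * l').
Proof. by move=> h1 h2; apply: (is_lim_seq_mult' a b l l'). Qed.

Lemma is_lim_unique_R (a : nat -> R) (l l' : R) : is_lim_seq a l -> is_lim_seq a l' -> l = l'.
Proof. by move=> /is_lim_seq_unique H1 /is_lim_seq_unique; rewrite H1 => -[]. Qed.

Variable n : nat.

(** The limit is a telescoping series, so its distance to [f J] is controlled in the weighted norm
    and not only pointwise. *)
Lemma TA_telescope s A (f : nat -> vec n -> R) : 0 <= s -> 0 <= A ->
  (forall j, TA s (fun x => f j.+1 x - f j x) (A / 4 ^ j)) ->
  exists g, forall J, TA s (fun x => g x - f J x) (2 * A / 4 ^ J).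
Proof.
move=> s0 A0 Hf; pose D j x := f j.+1 x - f j x.
have S J : TA s (fun x => Series (fun m => D (J + m)%N x)) (2 * A / 4 ^ J) /\
  forall x, is_series (fun m => D (J + m)%N x) (Series (fun m => D (J + m)%N x)).
  have p4 : 0 < / 4 ^ J by apply: Rinv_0_lt_compat; apply: pow_lt; lra.
  apply: (TA_Series s0 (b := fun m => A / 4 ^ J * (/ 4) ^ m)).
    move=> m; have := Hf (J + m)%N; congr (TA _ _ _).
    rewrite pow_add pow_inv; field; split; apply: pow_nonzero; lra.
  move=> N; rewrite sum_scalR tech3; last lra.
  have : 0 <= (/ 4) ^ N.+1 by apply: pow_le; lra.
  set q := (/ 4) ^ N.+1 => q0; have -> : (1 - q) / (1 - / 4) = 4 / 3 * (1 - q) by field.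
  have a4 : 0 <= A / 4 ^ J by apply: Rmult_le_pos; lra.
  have -> : 2 * A / 4 ^ J = A / 4 ^ J * 2 by rewrite /Rdiv; ring.
  by apply: Rmult_le_compat_l; lra.
have Hsum J N x : sum_f_R0 (fun m => D (J + m)%N x) N = f (J + N).+1 x - f J x.
  by elim: N => [|N IH]; rewrite ?tech5 ?IH /= ?addn0 /D ?addnS; ring.
have HL J x : is_lim_seq (fun N => f N x) (f J x + Series (fun m => D (J + m)%N x)).
  have /is_series_lim h := (proj2 (S J)) x.
  have h2 : is_lim_seq (fun N => f (N + J.+1)%coq_nat x) (f J x + Series (fun m => D (J + m)%N x)).
    apply: (is_lim_seq_ext (fun N => f J x + sum_f_R0 (fun m => D (J + m)%N x) N)).
      move=> N; rewrite Hsum; have -> : (N + J.+1)%coq_nat = (J + N).+1 by rewrite plusE addnS addnC.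
      ring.
    by apply: is_lim_seq_plus' => //; apply: is_lim_seq_const.
  by apply/(is_lim_seq_incr_n (fun N => f N x) J.+1).
exists (fun x => f 0%N x + Series (fun m => D m x)) => J.
apply: TA_ext (proj1 (S J)) => x; have := is_lim_unique_R (HL J x) (HL 0%N x).
by move=> <-; ring.
Qed.

(** Differentiate [J^T P = zeta + dW], with [J = 1 + Du], in the direction [a]: the terms with
    second derivatives of [u] and [W] are symmetric in [i] and [a], hence so is [J^T DP]. *)
Lemma lagrangian_sym s (u P : 'I_n -> vec n -> R) G U (du : 'I_n -> 'I_n -> vec n -> R) (dP : 'I_n -> 'I_n -> vec n -> R) K :
  0 < s -> 0 <= K -> (forall i, TA s (u i) U) ->
  lagrangian s u P G -> (forall l, grad K (u l) (du l)) -> (forall l, grad K (P l) (dP l)) ->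
  forall i a x, rsum (fun l => (del l i + du l i x) * dP l a x) = rsum (fun l => (del l a + du l a x) * dP l i x).
Proof.
move=> s0 K0 Hu [du' [K' [zeta [W [dW [B [[K'0 Gu'] _ HW GW Hpot]]]]]]] Gu GP.
have sle : s <= s by lra.
have [KH [KH0 Hess]] := @TA_hess n s s s0 sle.
have Edu l i x : du' l i x = du l i x by exact: grad_unique K'0 K0 (Gu' l) (Gu l).
have [dW' [ddW [_ _ GW' GdW symW]]] := Hess _ _ HW.
have B0 := TA_ge0 HW.
have KB : 0 <= KH * B by apply: Rmult_le_pos.
have EdW i x : dW i x = dW' i x by exact: grad_unique K'0 KB GW GW'.
have Hd l : exists ddu : 'I_n -> 'I_n -> vec n -> R, (forall i, grad (KH * U) (du l i) (ddu i)) /\ forall i j x, ddu i j x = ddu j i x.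
  have [dg [ddg [_ _ G1 G2 G3]]] := Hess _ _ (Hu l).
  have KU : 0 <= KH * U by apply: Rmult_le_pos => //; apply: TA_ge0 (Hu l).
  exists ddg; split=> // i.
  have -> : du l i = dg i by apply: functional_extensionality => x; exact: grad_unique K0 KU (Gu l) G1.
  exact: G2.
have [ddu Hddu] := choiceE Hd.
have key i a x : rsum (fun l => ddu l i a x * P l x) + rsum (fun l => (del l i + du l i x) * dP l a x) = ddW i a x.
  apply: (uniqueness_limite (fun t => zeta i + dW' i (vadd x (vscal t (ebasis a)))) 0); last first.
    rewrite -[ddW i a x]Rplus_0_l; apply: derivable_pt_lim_plus; first exact: derivable_pt_lim_const.
    exact: grad_partial (GdW i).
  apply: (derivable_pt_lim_ext (fun t => rsum (fun l => (del l i + du l i (vadd x (vscal t (ebasis a)))) * P l (vadd x (vscal t (ebasis a)))))).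
    move=> t; rewrite -EdW -Hpot; apply: rsum_ext => l; by rewrite Edu.
  rewrite -rsum_plus; apply: rsum_derivable => l.
  have U0 : 0 <= KH * U by apply: Rmult_le_pos => //; apply: TA_ge0 (Hu l).
  have h1 : derivable_pt_lim (fun t => del l i + du l i (vadd x (vscal t (ebasis a)))) 0 (0 + ddu l i a x).
    apply: derivable_pt_lim_plus; first exact: derivable_pt_lim_const.
    exact: grad_partial (proj1 (Hddu l) i).
  have h2 : has_partial (P l) a x (dP l a x) by exact: grad_partial (GP l).
  have := derivable_pt_lim_mult _ _ _ _ _ h1 h2.
  by rewrite Rplus_0_l vadd_vscal0.
move=> i a x; have := key a i x; rewrite symW -key.
have -> : rsum (fun l => ddu l a i x * P l x) = rsum (fun l => ddu l i a x * P l x).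
  by apply: rsum_ext => l; rewrite (proj2 (Hddu l)).
lra.
Qed.

(** The gradient of [g - f J] is small by Cauchy's estimate; by uniqueness, adding it to that of
    [f J] gives the same gradient of [g] for all [J]. *)
Lemma TA_grad_close s A (f : nat -> vec n -> R) g B : 0 < s -> 0 <= A ->
  (forall j, TA s (f j) B) ->
  (forall J, TA s (fun x => g x - f J x) (2 * A / 4 ^ J)) ->
  exists dg df C K, [/\ 0 <= K, grad K g dg, forall j, grad K (f j) (df j) &
    forall j i x, Rabs (df j i x - dg i x) <= C / 4 ^ j].
Proof.
move=> s0 A0 Hf Hg; have pi0 := PI_RGT_0.
have sle : s <= s by lra.
have [KH [KH0 Hess]] := @TA_hess n s s s0 sle.
have B0 := TA_ge0 (Hf 0%N).
have Hj j : exists df : 'I_n -> vec n -> R, grad (KH * B) (f j) df.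
  by have [dg [_ [_ _ h _ _]]] := Hess _ _ (Hf j); exists dg.
have [df Hdf] := choiceE Hj.
have p4 J : 1 <= 4 ^ J by apply: pow_R1_Rle; lra.
have Hr J : exists dr : 'I_n -> vec n -> R, grad (KH * (2 * A / 4 ^ J)) (fun x => g x - f J x) dr /\
   forall i x, Rabs (dr i x) <= 2 * PI / s * (2 * A / 4 ^ J).
  have [dg [_ [h1 _ h _ _]]] := Hess _ _ (Hg J); exists dg; split=> // i x.
  by apply: TA_sup (h1 i); lra.
have [dr Hdr] := choiceE Hr.
have A2 J : 0 <= 2 * A / 4 ^ J <= 2 * A.
  have h : 0 < / 4 ^ J <= 1.
    by split; [apply: Rinv_0_lt_compat; have := p4 J; lra | rewrite -Rinv_1; apply: Rinv_le_contravar; [lra | apply: p4]].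
  by rewrite /Rdiv; split; nra.
pose K := KH * B + KH * (2 * A).
have Gg J : grad K g (fun i x => df J i x + dr J i x).
  apply: grad_le (grad_ext _ _ (grad_add (Hdf J) (proj1 (Hdr J)))) => //.
    by rewrite /K; have := A2 J; nra.
  by move=> x; ring.
have K0 : 0 <= K by rewrite /K; nra.
exists (fun i x => df 0%N i x + dr 0%N i x), df, (2 * PI / s * (2 * A)), K; split=> //.
  by move=> j; apply: grad_le (Hdf j); rewrite /K; nra.
move=> j i x; have := grad_unique i x K0 K0 (Gg 0%N) (Gg j) => ->.
have -> : df j i x - (df j i x + dr j i x) = - dr j i x by ring.
rewrite Rabs_Ropp; apply: Rle_trans (proj2 (Hdr j) i x) _; rewrite /Rdiv; right; ring.
Qed.

End Limits.

Section TorusLimit.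
Variables (n : nat) (w0 : vec n) (H : vec n * vec n -> R) (dH : 'I_n -> vec n * vec n -> R).
Variables (kap Kl : R).
Hypothesis Kl0 : 0 <= Kl.
Hypothesis Hlip : forall (p q v w : vec n) d, 0 <= d <= kap -> (forall i, Rabs (p i) <= kap) ->
  (forall i, Rabs (v i) <= d) -> (forall i, Rabs (w i) <= d) ->
  Rabs (H (fun i => p i + v i, fun i => q i + w i) - H (p, q)) <= Kl * d /\
  forall j, Rabs (dH j (fun i => p i + v i, fun i => q i + w i) - dH j (p, q)) <= Kl * d.

Variables (s A E : R) (sq : nat -> R) (u P : nat -> 'I_n -> vec n -> R) (G : nat -> 'I_n -> 'I_n -> vec n -> R).
Hypothesis s0 : 0 < s.
Hypothesis A0 : 0 <= A.
Hypothesis A2k : 2 * A <= kap.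
Hypothesis Hb : forall j, bounded_state s kap (u j) (P j) (G j).
Hypothesis Hd : forall j, defect H dH w0 s (E / 4 ^ j) (E / 4 ^ j) (u j) (P j) (G j).
Hypothesis Hl : forall j, lagrangian s (u j) (P j) (G j).
Hypothesis Hu : forall j i, TA s (fun x => u j.+1 i x - u j i x) (A / 4 ^ j).
Hypothesis HP : forall j i, TA s (fun x => P j.+1 i x - P j i x) (A / 4 ^ j).
Hypothesis HG : forall j i l, TA s (fun x => G j.+1 i l x - G j i l x) (A / 4 ^ j).

(** All relations pass to the limit pointwise, in a fixed width. The data [zeta] and [W] of the
    closed form come without bounds along the sequence, so the Lagrangian property passes to the
    limit through its consequence, the symmetry of [J^T DP]. *)
Theorem torus_limit : exists (ui Pi : 'I_n -> vec n -> R) (Gi : 'I_n -> 'I_n -> vec n -> R)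
   (du dP : 'I_n -> 'I_n -> vec n -> R) K,
  [/\ [/\ 0 <= K, forall i, TA s (fun x => ui i x - u 0%N i x) (2 * A), forall i, TA s (fun x => Pi i x - P 0%N i x) (2 * A) &
       forall i l, TA s (fun x => Gi i l x - G 0%N i l x) (2 * A)],
     (forall i, grad K (ui i) (du i)) /\ (forall i, grad K (Pi i) (dP i)),
     forall x y, H (emb Pi ui x) = H (emb Pi ui y),
     forall i x, rsum (fun j => Gi i j x * dH j (emb Pi ui x)) = w0 i &
     (forall i j x, rsum (fun l => Gi i l x * (del l j + du l j x)) = del i j) /\
     forall i a x, rsum (fun l => (del l i + du l i x) * dP l a x) = rsum (fun l => (del l a + du l a x) * dP l i x)].
Proof.
have s0' : 0 <= s by lra.
have [ui Hui] := choiceE (fun i => TA_telescope s0' A0 (fun j => Hu j i)).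
have [Pi HPi] := choiceE (fun i => TA_telescope s0' A0 (fun j => HP j i)).
have [Gi HGi] := choiceE (fun il : 'I_n * 'I_n => TA_telescope s0' A0 (fun j => HG j il.1 il.2)).
have [du Hdu] := choiceE (fun i => TA_grad_close s0 A0 (fun j => ltac:(by case: (Hb j) => h _ _; exact: (h i))) (Hui i)).
have {Hdu} [dfu Hdu] := choiceE Hdu. have {Hdu} [Cu Hdu] := choiceE Hdu. have {Hdu} [Ku Hdu] := choiceE Hdu.
have [dP HdP] := choiceE (fun i => TA_grad_close s0 A0 (fun j => ltac:(by case: (Hb j) => _ h _; exact: (h i))) (HPi i)).
have {HdP} [dfP HdP] := choiceE HdP. have {HdP} [CP HdP] := choiceE HdP. have {HdP} [KP HdP] := choiceE HdP.
pose K := rsum Ku + rsum KP.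
have Ku0 i : 0 <= Ku i by case: (Hdu i). have KP0 i : 0 <= KP i by case: (HdP i).
have sKu := rsum_ge0 Ku0. have sKP := rsum_ge0 KP0.
have KuK i : Ku i <= K by rewrite /K; have := rsum_ge_term i Ku0; lra.
have KPK i : KP i <= K by rewrite /K; have := rsum_ge_term i KP0; lra.
have K0 : 0 <= K by rewrite /K; lra.
have p4 J : 1 <= 4 ^ J by apply: pow_R1_Rle; lra.
have i4 J : 0 < / 4 ^ J <= 1.
  by split; [apply: Rinv_0_lt_compat; have := p4 J; lra | rewrite -Rinv_1; apply: Rinv_le_contravar; [lra | apply: p4]].
have limu i x : is_lim_seq (fun j => u j i x) (ui i x).
  by apply: (@lim_geom _ _ (2 * A)) => j; rewrite Rabs_minus_sym; apply: TA_sup (Hui i j).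
have limG i l x : is_lim_seq (fun j => G j i l x) (Gi (i, l) x).
  by apply: (@lim_geom _ _ (2 * A)) => j; rewrite Rabs_minus_sym; apply: TA_sup (HGi (i, l) j).
have limdu i a x : is_lim_seq (fun j => dfu i j a x) (du i a x).
  by apply: (@lim_geom _ _ (Cu i)) => j; case: (Hdu i) => _ _ _; apply.
have limdP i a x : is_lim_seq (fun j => dfP i j a x) (dP i a x).
  by apply: (@lim_geom _ _ (CP i)) => j; case: (HdP i) => _ _ _; apply.
have HLj j x : Rabs (H (emb Pi ui x) - H (emb (P j) (u j) x)) <= Kl * (2 * A / 4 ^ j) /\
   forall l, Rabs (dH l (emb Pi ui x) - dH l (emb (P j) (u j) x)) <= Kl * (2 * A / 4 ^ j).
  have -> : emb Pi ui x = (fun i => P j i x + (Pi i x - P j i x), fun i => (x i + u j i x) + (ui i x - u j i x)).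
    by rewrite /emb; congr pair; apply: functional_extensionality => i; ring.
  apply: Hlip => [|i|i|i].
  - have := i4 j; rewrite /Rdiv => h; split; first by apply: Rmult_le_pos; lra.
    by apply: Rle_trans A2k; rewrite -[X in _ <= X]Rmult_1_r; apply: Rmult_le_compat_l; lra.
  - by case: (Hb j) => _ h _; apply: TA_sup (h i).
  - exact: TA_sup (HPi i j).
  - exact: TA_sup (Hui i j).
have limdH l x : is_lim_seq (fun j => dH l (emb (P j) (u j) x)) (dH l (emb Pi ui x)).
  apply: (@lim_geom _ _ (Kl * (2 * A))) => j; rewrite Rabs_minus_sym.
  by apply: Rle_trans (proj2 (HLj j x) l) _; rewrite /Rdiv; right; ring.
exists ui, Pi, (fun i l => Gi (i, l)), du, dP, K; split.
- have e0 : 2 * A / 4 ^ 0 = 2 * A by rewrite /=; field.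
  by split=> // *; rewrite -e0; [apply: Hui | apply: HPi | apply: (HGi (_, _))].
- split=> i; first by apply: grad_le (KuK i) _; case: (Hdu i).
  by apply: grad_le (KPK i) _; case: (HdP i).
- move=> x y.
  have : is_lim_seq (fun _ : nat => H (emb Pi ui x) - H (emb Pi ui y)) 0.
    apply: (@lim_geom _ _ (Kl * (4 * A) + 2 * E)) => j; rewrite Rminus_0_r.
    have [[c Hc] _] := Hd j.
    have h1 := TA_sup s0' x Hc; have h2 := TA_sup s0' y Hc.
    have h3 := proj1 (HLj j x); have h4 := proj1 (HLj j y).
    have -> : (Kl * (4 * A) + 2 * E) / 4 ^ j = Kl * (2 * A / 4 ^ j) + E / 4 ^ j + (E / 4 ^ j + Kl * (2 * A / 4 ^ j)) by rewrite /Rdiv; ring.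
    have -> : H (emb Pi ui x) - H (emb Pi ui y) =
      (H (emb Pi ui x) - H (emb (P j) (u j) x)) + (H (emb (P j) (u j) x) - c) +
      (- (H (emb (P j) (u j) y) - c) + - (H (emb Pi ui y) - H (emb (P j) (u j) y))) by ring.
    apply: Rle_trans (Rabs_triang _ _) _; apply: Rplus_le_compat.
      by apply: Rle_trans (Rabs_triang _ _) _; apply: Rplus_le_compat.
    by apply: Rle_trans (Rabs_triang _ _) _; rewrite !Rabs_Ropp; apply: Rplus_le_compat.
  by move/is_lim_unique_R/(_ (is_lim_seq_const _)) => h; lra.
- move=> i x.
  apply: (@is_lim_unique_R (fun j => rsum (fun l => G j i l x * dH l (emb (P j) (u j) x)))).
    by apply: rsum_is_lim => l; apply: is_lim_multR.
  apply: (@lim_geom _ _ E) => j; have [_ h] := Hd j; exact: TA_sup (h i).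
split=> [i k x|i a x].
- have Hj j : rsum (fun l => G j i l x * (del l k + dfu l j k x)) = del i k.
    have [du' [K' [zeta [W [dW [B [[K'0 Gu'] GJ _ _ _]]]]]]] := Hl j.
    rewrite -(GJ i k x) /mmul; apply: rsum_ext => l; congr (_ * (_ + _)).
    case: (Hdu l) => h1 _ h2 _; exact: grad_unique h1 K'0 (h2 j) (Gu' l).
  apply: (@is_lim_unique_R (fun j => rsum (fun l => G j i l x * (del l k + dfu l j k x)))).
    by apply: rsum_is_lim => l; apply: is_lim_multR => //; apply: is_lim_seq_plus' => //; apply: is_lim_seq_const.
  by apply: (is_lim_seq_ext (fun _ => del i k)) => // j; apply: is_lim_seq_const.
- pose S j i a := rsum (fun l => (del l i + dfu l j i x) * dfP l j a x).
  have HS i' a' : is_lim_seq (fun j => S j i' a') (rsum (fun l => (del l i' + du l i' x) * dP l a' x)).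
    by apply: rsum_is_lim => l; apply: is_lim_multR => //; apply: is_lim_seq_plus' => //; apply: is_lim_seq_const.
  apply: (is_lim_unique_R (HS i a)); apply: (is_lim_seq_ext (fun j => S j a i)) => // j.
  have [hu _ _] := Hb j.
  apply: (lagrangian_sym (du := fun l => dfu l j) (dP := fun l => dfP l j) s0 K0 hu (Hl j)) => l.
    by case: (Hdu l) => _ _ h _; apply: grad_le (KuK l) (h j).
  by case: (HdP l) => _ _ h _; apply: grad_le (KPK l) (h j).
Qed.

End TorusLimit.

(** * The Bruno-Rüssmann condition *)

Section BrunoRussmann.
Variables (n : nat) (w : vec n) (i0 : 'I_n).
Hypothesis w1 : w i0 = 1.

Lemma nonresonant_kdot : nonresonant w -> forall k : 'I_n -> Z, 0 < knorm k -> kdot k w <> 0.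
Proof.
move=> H k k0 E.
have h : is_int_vec (fun i => IZR (k i)) by move=> i; exists (k i).
have : knorm k = 0 by apply: rsum_0 => i; rewrite (H _ h E i) Rabs_R0.
lra.
Qed.

Variable Psi : R -> R.
Hypothesis HPsi : forall Q, 1 <= Q -> is_Psi w Q (Psi Q).

Lemma Psi_bound Q (k : 'I_n -> Z) : 1 <= Q -> 0 < knorm k -> knorm k <= Q -> / Rabs (kdot k w) <= Psi Q.
Proof.
move=> Q1 k0 kQ; apply: (proj1 (HPsi Q1)); exists (fun i => IZR (k i)).
by split=> // i; exists (k i).
Qed.

Lemma Psi_mono Q Q' : 1 <= Q -> Q <= Q' -> Psi Q <= Psi Q'.
Proof.
move=> Q1 QQ; apply: (proj2 (HPsi Q1)) => y [k [h1 [h2 [h3 h4]]]].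
apply: (proj1 (HPsi (Rle_trans _ _ _ Q1 QQ))); exists k; split=> //; split=> //; split=> //; lra.
Qed.

(** Tested on the basis vector [i0], along which [w] is 1. *)
Lemma Psi_ge1 Q : 1 <= Q -> 1 <= Psi Q.
Proof.
move=> Q1; pose k i := if i == i0 then 1%Z else 0%Z.
have E (F : 'I_n -> R) : rsum (fun i => IZR (k i) * F i) = F i0.
  by rewrite -[RHS](rsum_delta F i0); apply: rsum_ext => i; rewrite /k; case: (i == i0).
have Ek : knorm k = 1.
  rewrite /knorm (rsum_ext (G := fun i => IZR (k i) * 1)) ?(E (fun _ => 1)) //.
  by move=> i; rewrite /k; case: (i == i0); rewrite ?Rabs_R1 ?Rabs_R0; ring.
have := @Psi_bound Q k Q1 ltac:(lra) ltac:(lra).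
by rewrite /kdot E w1 Rabs_R1 Rinv_1.
Qed.

Let f Q := / (Q * Q) * ln (Psi Q).
Variable Lb : R.
Hypothesis HI : forall T, 1 <= T -> exists pr : Riemann_integrable f 1 T, RiemannInt pr <= Lb.

Lemma f_int a b : 1 <= a -> a <= b -> ex_RInt f a b.
Proof.
move=> a1 ab; have [pr _] := HI (Rle_trans _ _ _ a1 ab).
apply: (ex_RInt_Chasles_2 f 1 a b); first by split.
exact: ex_RInt_Reals_1.
Qed.

(* A primitive of [ln (t * Psi t) / t ^ 2]. *)
Definition FBR T := RInt f 1 T - (1 + ln T) / T.

Lemma FBR_le T : 1 <= T -> FBR T <= Lb.
Proof.
move=> T1; have [pr h] := HI T1; rewrite /FBR (RInt_Reals f 1 T pr).
have l0 : 0 <= ln T by rewrite -ln_1; apply: ln_le; lra.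
have : 0 <= (1 + ln T) / T by apply: Rdiv_le_0_compat; lra.
lra.
Qed.

(** Integrate [m / t^2 <= ln (t Psi t) / t^2]. The explicit part [ln t / t^2] is moved to the side
    of [m], so that the comparison is with the given integrand. *)
Lemma FBR_incr a b m : 1 <= a -> a <= b ->
  (forall t, a <= t <= b -> m <= ln (t * Psi t)) -> m * (/ a - / b) <= FBR b - FBR a.
Proof.
move=> a1 ab Hm; have b1 : 1 <= b by lra.
have -> : FBR b - FBR a = RInt f a b - ((1 + ln b) / b - (1 + ln a) / a).
  have lra1 : 1 <= 1 by lra.
  have := RInt_Chasles f 1 a b (f_int lra1 a1) (f_int a1 ab); rewrite /plus /= /FBR => <-; ring.
pose g t := m / t ^ 2 - ln t / t ^ 2.
pose Gp t := (1 + ln t) / t - m / t.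
have Hg : is_RInt g a b (Gp b - Gp a).
  apply: (is_RInt_derive Gp g) => t; rewrite Rmin_left // Rmax_right // => -[t1 t2].
    by rewrite /Gp /g; auto_derive; [lra | field; lra].
  apply: (ex_derive_continuous g); rewrite /g; auto_derive.
  have h : t * (t * 1) <> 0 by nra.
  by repeat split => //; lra.
have H2 : RInt g a b <= RInt f a b.
  apply: RInt_le => //; [by exists (Gp b - Gp a) | exact: f_int |].
  move=> t [t1 t2]; have tp : 0 < t by lra.
  have p1 : 1 <= Psi t by apply: Psi_ge1; lra.
  have := Hm t (conj (Rlt_le _ _ t1) (Rlt_le _ _ t2)); rewrite ln_mult; [|lra|lra] => h.
  have -> : g t = / (t * t) * (m - ln t) by rewrite /g; field; lra.
  by apply: Rmult_le_compat_l; [apply: Rlt_le; apply: Rinv_0_lt_compat; nra | lra].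
rewrite (is_RInt_unique _ _ _ _ Hg) /Gp /Rdiv in H2; rewrite /Rdiv; lra.
Qed.

Lemma FBR_mono a b : 1 <= a -> a <= b -> FBR a <= FBR b.
Proof.
move=> a1 ab; have := @FBR_incr a b 0 a1 ab; rewrite Rmult_0_l => h.
suff : 0 <= FBR b - FBR a by lra.
apply: h => t [t1 t2]; rewrite -ln_1; apply: ln_le; first lra.
have := @Psi_ge1 t ltac:(lra); nra.
Qed.

Lemma FBR_tail eta : 0 < eta -> exists T0, 1 <= T0 /\ forall T, T0 <= T -> FBR T - FBR T0 <= eta.
Proof.
move=> e0.
have [S [S1 S2]] : { S | is_lub (fun y => exists T, 1 <= T /\ y = FBR T) S }.
  apply: completeness; first by exists Lb => y [T [T1 ->]]; apply: FBR_le.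
  by exists (FBR 1), 1; split=> //; lra.
have [T0 [T01 HT0]] : exists T0, 1 <= T0 /\ S - eta < FBR T0.
  apply: NNPP => H; have : S <= S - eta; last by lra.
  apply: S2 => y [T [T1 ->]]; apply: Rnot_lt_le => h; apply: H; by exists T.
exists T0; split=> // T HT.
have : FBR T <= S by apply: S1; exists T; split=> //; lra.
lra.
Qed.

Lemma max_nat (P : nat -> Prop) M : P 1%N -> (forall q, P q -> (q <= M)%N) ->
  exists q, (1 <= q)%N /\ P q /\ ~ P q.+1.
Proof.
move=> P1 HM; apply: NNPP => H.
have A q : P q.+1.
  elim: q => [//|q IH]; apply: NNPP => h; apply: H; by exists q.+1.
by have := HM _ (A M); rewrite ltnn.
Qed.

(* [Q j] is the last integer with [Q * Psi Q <= lam0 * 2 ^ j]: beyond it [ln (t * Psi t) >= j ln 2],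
   so Abel summation bounds the sum by the tail of the Bruno-Rüssmann integral. *)
Lemma BR_sequence c sigma : 0 < c -> 0 < sigma -> exists lam0 (Q : nat -> R),
  [/\ 1 <= lam0, forall j, 1 <= Q j, forall j, Q j <= lam0 * 2 ^ j,
      forall j, Q j * Psi (Q j) <= lam0 * 2 ^ j &
      forall J, sum_f_R0 (fun j => c / Q j) J <= sigma].
Proof.
move=> c0 sg0; have l2 : 0 < ln 2 by rewrite -ln_1; apply: ln_increasing; lra.
have eta0 : 0 < sigma * ln 2 / (4 * c) by apply: Rdiv_lt_0_compat; nra.
(* The final bound is [(2 c / ln 2) * 2 eta = sigma]: one [eta] for the tail of the integral and one
   for the boundary term of the Abel summation. *)
set eta := sigma * ln 2 / (4 * c) in eta0.
have [T0 [T01 HT0]] := FBR_tail eta0.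
have [M HM] : exists M : nat, T0 <= INR M.
  by exists (Z.to_nat (up T0)); rewrite INR_IZR_INZ Z2Nat.id; have [h _] := archimed T0; [lra | apply: le_IZR; lra].
have M1 : 1 <= INR M by lra.
have MP := Psi_ge1 M1.
(* [M] is admissible already at [j = 0], which pushes every [b j] beyond [T0]; [Psi 1] makes 1
   admissible, and 2 gives [2^(j + 1) <= lam j]. *)
pose lam0 := 2 + INR M * Psi (INR M) + Psi 1.
have p1 := @Psi_ge1 1 ltac:(lra).
have lam02 : 2 <= lam0 by rewrite /lam0; nra.
pose lam j := lam0 * 2 ^ j.
have two j : 1 <= 2 ^ j by apply: pow_R1_Rle; lra.
have lamj j : lam0 <= lam j by rewrite /lam; have := two j; nra.
pose P j q := INR q * Psi (INR q) <= lam j.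
have Pdown j q q' : (1 <= q')%N -> (q' <= q)%N -> P j q -> P j q'.
  move=> q1 qq; rewrite /P => h; apply: Rle_trans h.
  have a1 : 1 <= INR q' by apply: (le_INR 1); apply/leP.
  have a2 : INR q' <= INR q by apply: le_INR; apply/leP.
  apply: Rmult_le_compat => //; [lra | by have := Psi_ge1 a1; lra | exact: Psi_mono].
have Hq j : exists q, (1 <= q)%N /\ P j q /\ ~ P j q.+1.
  apply: (@max_nat _ (Z.to_nat (up (lam j)))).
    by rewrite /P /= Rmult_1_l; apply: Rle_trans (lamj j); rewrite /lam0; nra.
  move=> [//|q] Pq; apply/leP; apply: INR_le.
  have a1 : 1 <= INR q.+1 by apply: (le_INR 1); lia.
  have h : INR q.+1 <= lam j by apply: Rle_trans Pq; have := Psi_ge1 a1; nra.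
  rewrite [X in _ <= X]INR_IZR_INZ Z2Nat.id; have [h2 _] := archimed (lam j); first lra.
  by apply: le_IZR; lra.
have [q Hqj] := choiceE Hq.
have q1 j : 1 <= INR (q j) by apply: (le_INR 1); apply/leP; exact: (proj1 (Hqj j)).
have PP j : P j (q j) := proj1 (proj2 (Hqj j)).
have nP j : ~ P j (q j).+1 := proj2 (proj2 (Hqj j)).
(* The first integer that violates the bound; [1 / q j <= 2 / b j] leads back to [q] at the end. *)
pose b j := INR (q j).+1.
have bE j : b j = INR (q j) + 1 by rewrite /b S_INR.
have bmono j : b j <= b j.+1.
  apply: le_INR; apply/leP; rewrite ltnS leqNgt; apply/negP => h.
  apply: (nP j.+1); rewrite /P; apply: (Rle_trans _ (lam j)); last by rewrite /lam /=; have := two j; nra.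
  exact: Pdown h (PP j).
have b0T : T0 <= b 0%N.
  apply: Rle_trans HM _; apply: le_INR; apply/leP; rewrite leqNgt; apply/negP => h.
  apply: (nP 0%N); apply: (Pdown 0%N M) => //; first exact: ltnW.
  by rewrite /P /lam /= Rmult_1_r /lam0; nra.
have b1 j : 2 <= b j by rewrite bE; have := q1 j; lra.
have b0j j : T0 <= b j by elim: j => [//|j IH]; apply: Rle_trans IH (bmono j).
have gb j t : b j <= t -> INR j.+1 * ln 2 <= ln (t * Psi t).
  move=> bt; have b1j := b1 j.
  have h1 : lam j < b j * Psi (b j) by apply: Rnot_le_lt; exact: nP.
  have h2 : b j * Psi (b j) <= t * Psi t.
    apply: Rmult_le_compat => //; [lra | by have := @Psi_ge1 (b j) ltac:(lra); lra | by apply: Psi_mono; lra].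
  have -> : INR j.+1 * ln 2 = ln (2 ^ j.+1) by rewrite ln_pow //; lra.
  apply: ln_le; first by apply: pow_lt; lra.
  by apply: Rle_trans (_ : lam j <= _); [rewrite /lam /=; have := two j; nra | lra].
have Hinc j T m : 0 <= m -> m <= INR j.+1 * ln 2 -> b j <= T -> m * (/ b j - / T) <= FBR T - FBR (b j).
  move=> m0 mj bT; apply: FBR_incr => //; first by have := b1 j; lra.
  by move=> t [t1 t2]; apply: Rle_trans mj _; apply: gb.
(* Abel summation: on [[b j, b (j + 1)]] the integrand of [FBR] is at least [(j + 1) ln 2 / t^2]. *)
have S J : sum_f_R0 (fun j => ln 2 / b j) J <= FBR (b J.+1) - FBR (b 0%N) + INR J.+1 * ln 2 * / b J.+1.
  elim: J => [|J IH].
    have := Hinc 0%N (b 1%N) (ln 2) ltac:(lra) ltac:(rewrite /=; lra) (bmono 0%N).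
    by rewrite /= /Rdiv; lra.
  have p0 : 0 <= INR J.+2 * ln 2 by apply: Rmult_le_pos; [exact: pos_INR | lra].
  have := Hinc J.+1 (b J.+2) (INR J.+2 * ln 2) p0 ltac:(lra) (bmono J.+1).
  rewrite tech5 (S_INR J.+1) /Rdiv; lra.
have S2 J : sum_f_R0 (fun j => ln 2 / b j) J <= 2 * eta.
  have p0 : 0 <= INR J.+1 * ln 2 by apply: Rmult_le_pos; [exact: pos_INR | lra].
  (* Far enough for the boundary term [(J + 1) ln 2 / T] to be at most [eta]. *)
  pose T := b J.+1 + INR J.+1 * ln 2 / eta.
  have q0 : 0 <= INR J.+1 * ln 2 / eta by apply: Rdiv_le_0_compat.
  have bT : b J.+1 <= T by rewrite /T; lra.
  have bp := b1 J.+1; have Tp : 0 < T by lra.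
  have h := Hinc J.+1 T (INR J.+1 * ln 2) p0 ltac:(rewrite (S_INR J.+1); nra) bT.
  have h2 : FBR T - FBR T0 <= eta by apply: HT0; have := b0j J.+1; lra.
  have h3 : FBR T0 <= FBR (b 0%N) by apply: FBR_mono.
  have h4 : INR J.+1 * ln 2 * / T <= eta.
    apply: (Rmult_le_reg_r T) => //; rewrite Rmult_assoc Rinv_l; last lra.
    have : eta * (INR J.+1 * ln 2 / eta) = INR J.+1 * ln 2 by field; lra.
    by rewrite /T; nra.
  have := S J; lra.
exists lam0, (fun j => INR (q j)); split=> //; first lra.
- move=> j; apply: Rle_trans (PP j); have := q1 j => h; have := Psi_ge1 h; nra.
- move=> J; apply: (Rle_trans _ (2 * c / ln 2 * sum_f_R0 (fun j => ln 2 / b j) J)).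
    rewrite -sum_scalR; apply: sum_Rle => j _.
    have -> : 2 * c / ln 2 * (ln 2 / b j) = c * (2 / b j) by field; split; [have := b1 j|]; lra.
    rewrite /Rdiv; apply: Rmult_le_compat_l; first lra.
    have qj := q1 j; apply: (Rmult_le_reg_r (INR (q j) * b j)); first by rewrite bE; nra.
    have -> : / INR (q j) * (INR (q j) * b j) = b j by field; lra.
    have -> : 2 * / b j * (INR (q j) * b j) = 2 * INR (q j) by field; rewrite bE; lra.
    by rewrite bE; lra.
  have h : 0 <= 2 * c / ln 2 by apply: Rdiv_le_0_compat; lra.
  apply: Rle_trans (Rmult_le_compat_l _ _ _ h (S2 J)) _.
  by rewrite /eta; right; field; lra.
Qed.

End BrunoRussmann.

(** * Power series and analytic functions *)

Section PowerSeries.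

Definition domw (I : Type) (r : R) (x : I -> R) := forall i, Rabs (x i) <= r.
Definition wtw (I : Type) (r : R) (w : seq I) := r ^ size w.
(** The index type is arbitrary: the variables will be [n + n] phase coordinates, [n] momenta, or
    [n] momenta and one scalar. *)
Definition PS (I : Type) r := AN (domw r) (fun (w : seq I) x => pw w x) (wtw r).

Lemma wtw0 (I : Type) r (w : seq I) : 0 <= r -> 0 <= wtw r w.
Proof. exact: pow_le. Qed.

Lemma pw_cat (I : Type) (w1 w2 : seq I) (x : I -> R) : pw (w1 ++ w2) x = pw w1 x * pw w2 x.
Proof. by elim: w1 => [|l w IH] /=; [ring | rewrite IH; ring]. Qed.

Lemma PS_evM (I : Type) r (w1 w2 : seq I) : 0 <= r ->
  PS r (fun x => pw w1 x * pw w2 x) (wtw r w1 * wtw r w2).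
Proof.
move=> r0; apply: (AN_atom (c := 1) (a := w1 ++ w2)) => [x _|]; first by rewrite pw_cat; ring.
by rewrite Rabs_R1 /wtw size_cat pow_add; lra.
Qed.

Lemma PS_sup (I : Type) r F B (x : I -> R) : PS r F B -> domw r x -> Rabs (F x) <= B.
Proof. by move=> H; apply: (AN_sup _ H) => w y Hy; apply: pw_bound. Qed.

Lemma PS_mono (I : Type) r r' (F : (I -> R) -> R) B : 0 <= r' <= r -> PS r F B -> PS r' F B.
Proof.
move=> [r0 rr]; elim=> [c a g0 B0 Hg H|G b g0 B0 _ IH H Hs].
  apply: (AN_atom (c := c) (a := a)) => [x Hx|].
    by apply: Hg => i; have := Hx i; lra.
  apply: Rle_trans H; apply: Rmult_le_compat_l; first exact: Rabs_pos.
  exact: pow_incr.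
by apply: AN_series IH H _ => x Hx; apply: Hs => i; have := Hx i; lra.
Qed.

Section Substitution.
Variables (X At : Type) (dom : X -> Prop) (ev : At -> X -> R) (wt : At -> R).
Hypothesis wt0 : forall a, 0 <= wt a.
Hypothesis evwt : forall a x, dom x -> Rabs (ev a x) <= wt a.
Hypothesis evM : forall a b, AN dom ev wt (fun x => ev a x * ev b x) (wt a * wt b).
Variable a1 : At.
Hypothesis ev1 : forall x, dom x -> ev a1 x = 1.
Hypothesis wt1 : wt a1 = 1.
Variables (I : Type) (r : R).
Hypothesis r0 : 0 < r.

Lemma AN_pw a (S : I -> X -> R) w : 0 <= a -> (forall i, AN dom ev wt (S i) a) ->
  AN dom ev wt (fun x => pw w (fun i => S i x)) (a ^ size w).
Proof.
move=> a0 H; elim: w => [|l w IH] /=; last exact: AN_mul.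
by have := AN_const ev1 wt1 1; rewrite Rabs_R1.
Qed.

Lemma PS_subst F B (S : I -> X -> R) : PS r F B -> (forall i, AN dom ev wt (S i) r) ->
  AN dom ev wt (fun x => F (fun i => S i x)) B.
Proof.
move=> HF HS; rewrite -[B]Rmult_1_l.
apply: (AN_map (T := fun F x => F (fun i => S i x)) _ _ _ _ _ HF).
- by move=> a; apply: wtw0; lra.
- lra.
- by move=> G g H x Hx; apply: H => i /=; apply: AN_sup (HS i) _ Hx.
- by move=> c g a H x Hx; apply: H => i /=; apply: AN_sup (HS i) _ Hx.
by move=> w; rewrite Rmult_1_l; apply: AN_pw => //; lra.
Qed.

(** As for [TA_pw_diff], half the radius absorbs the length of the word, now over arbitrary
    atoms. *)
Lemma PS_diff F B (S d : I -> X -> R) dl : PS r F B -> 0 <= dl ->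
  (forall i, AN dom ev wt (S i) (r / 2)) -> (forall i, AN dom ev wt (fun x => S i x + d i x) (r / 2)) ->
  (forall i, AN dom ev wt (d i) dl) ->
  AN dom ev wt (fun x => F (fun i => S i x + d i x) - F (fun i => S i x)) (dl * (2 / r) * B).
Proof.
move=> HF dl0 HS HSd Hd.
have q0 : 0 < 2 / r by apply: Rdiv_lt_0_compat; lra.
apply: (AN_map (T := fun F x => F (fun i => S i x + d i x) - F (fun i => S i x)) _ _ _ _ _ HF).
- by move=> a; apply: wtw0; lra.
- by apply: Rmult_le_pos; lra.
- move=> G g H x Hx; apply: is_series_minusR; apply: H => i /=.
    by have := AN_sup evwt (HSd i) Hx; lra.
  by have := AN_sup evwt (HS i) Hx; lra.
- move=> c g a H x Hx; rewrite !H; first by ring.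
    by move=> i /=; have := AN_sup evwt (HS i) Hx; lra.
  by move=> i /=; have := AN_sup evwt (HSd i) Hx; lra.
rewrite /wtw; elim=> [|l w IH] /=.
  apply: AN_le (AN_ext _ (AN_zero _ _ _ a1)) _ => [x _|]; first by ring.
  by rewrite Rmult_1_r; apply: Rmult_le_pos; lra.
have r20 : 0 <= r / 2 by lra.
have H := AN_add wt0 a1 (AN_mul wt0 evM (Hd l) (AN_pw w r20 HSd)) (AN_mul wt0 evM (HS l) IH).
apply: AN_le (AN_ext _ H) _ => [x _|]; first by ring.
have h : (r / 2) ^ size w <= r ^ size w by apply: pow_incr; lra.
have -> : dl * (2 / r) * (r * r ^ size w) = dl * (r ^ size w) + dl * (r ^ size w) by field; lra.
have -> : r / 2 * (dl * (2 / r) * r ^ size w) = dl * r ^ size w by field; lra.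
by apply: Rplus_le_compat_r; apply: Rmult_le_compat_l.
Qed.

End Substitution.

Lemma PS_coord (I : Type) r (i : I) : PS r (fun x => x i) r.
Proof.
apply: (AN_atom (c := 1) (a := [:: i])) => [x _|]; first by rewrite /=; ring.
by rewrite Rabs_R1 /wtw /=; lra.
Qed.

Lemma PS_const (I : Type) r c : PS r (fun _ : I -> R => c) (Rabs c).
Proof. by apply: (@AN_const _ _ _ _ _ [::]). Qed.

Lemma PS_substPS (I J : Type) r r' F B (S : I -> (J -> R) -> R) : 0 < r -> 0 <= r' ->
  PS r F B -> (forall i, PS r' (S i) r) -> PS r' (fun x => F (fun i => S i x)) B.
Proof.
move=> r0 r'0 HF HS; apply: (@PS_subst _ _ _ _ _ _ _ _ [::] _ _ I r r0 F B S HF HS) => //.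
- by move=> a; apply: wtw0.
- by move=> a x Hx; apply: pw_bound.
- by move=> a b; apply: PS_evM.
Qed.

Lemma PS_diffPS (I J : Type) r r' F B (S d : I -> (J -> R) -> R) dl : 0 < r -> 0 <= r' ->
  PS r F B -> 0 <= dl -> (forall i, PS r' (S i) (r / 2)) -> (forall i, PS r' (fun x => S i x + d i x) (r / 2)) ->
  (forall i, PS r' (d i) dl) ->
  PS r' (fun x => F (fun i => S i x + d i x) - F (fun i => S i x)) (dl * (2 / r) * B).
Proof.
move=> r0 r'0 HF dl0 H1 H2 H3; apply: (@PS_diff _ _ _ _ _ _ _ _ [::] _ _ I r r0 F B S d dl HF dl0 H1 H2 H3) => //.
- by move=> a; apply: wtw0.
- by move=> a x Hx; apply: pw_bound.
- by move=> a b; apply: PS_evM.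
Qed.

Lemma PS_add (I : Type) r (F G : (I -> R) -> R) B B' : 0 <= r -> PS r F B -> PS r G B' ->
  PS r (fun x => F x + G x) (B + B').
Proof. by move=> r0; apply: AN_add [::] _ _ _ _ => a; apply: wtw0. Qed.

Lemma AN_big (X At : Type) (dom : X -> Prop) (ev : At -> X -> R) (wt : At -> R) (a0 : At)
  (J : Type) (s : seq J) (Q : pred J) (F : J -> X -> R) b : (forall a, 0 <= wt a) ->
  (forall j, Q j -> AN dom ev wt (F j) (b j)) ->
  AN dom ev wt (fun x => \big[Rplus/0]_(j <- s | Q j) F j x) (\big[Rplus/0]_(j <- s | Q j) b j).
Proof.
move=> wt0 H; elim: s => [|j s IH].
  by rewrite big_nil; apply: AN_ext (AN_zero _ _ _ a0) => x _; rewrite big_nil.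
rewrite big_cons; case E: (Q j); last by apply: AN_ext IH => x _; rewrite big_cons E.
by apply: AN_ext (AN_add wt0 a0 (H j E) IH) => x _; rewrite big_cons E.
Qed.

Definition word_of n k (a : {ffun 'I_n -> 'I_k}) : seq 'I_n :=
  flatten [seq nseq (a i) i | i <- index_enum 'I_n].

Lemma pw_word n k (a : {ffun 'I_n -> 'I_k}) (y : vec n) : pw (word_of a) y = rprod (fun i => y i ^ nat_of_ord (a i)).
Proof.
rewrite /word_of /rprod; elim: (index_enum _) => [|i s IH] /=; first by rewrite big_nil.
rewrite pw_cat big_cons IH; congr (_ * _).
by elim: (nat_of_ord (a i)) => [|m IHm] //=; rewrite IHm.
Qed.

Lemma size_word n k (a : {ffun 'I_n -> 'I_k}) : size (word_of a) = (\sum_(i < n) nat_of_ord (a i))%N.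
Proof.
rewrite /word_of; elim: (index_enum _) => [|i s IH] /=; first by rewrite big_nil.
by rewrite size_cat size_nseq big_cons IH.
Qed.

(** The radius is halved because convergence is given on an open polydisc while [PS] asks for a
    closed one. *)
Lemma analytic_PS n (g : vec n -> R) x0 : analytic_at g x0 ->
  exists r B, 0 < r /\ PS r (fun y => g (fun i => x0 i + y i)) B.
Proof.
move=> [c [r [r0 [[B HB] Hs]]]]; exists (r / 2), B; split; first lra.
have r2 : 0 <= r / 2 by lra.
apply: (AN_series (G := fun N y => monomials_deg N c y) (b := fun N => abs_monomials_deg N c r)) => //.
  move=> N; apply: AN_big => [|a|a /eqP Ea]; [exact: [::] | exact: wtw0 |].
  apply: (AN_atom (c := c (fun i => nat_of_ord (a i))) (a := word_of a)) => [y _|]; first by rewrite pw_word.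
  rewrite /wtw size_word Ea; apply: Rmult_le_compat_l; first exact: Rabs_pos.
  by apply: pow_incr; lra.
move=> y Hy; apply/is_series_lim.
have := Hs (fun i => x0 i + y i); have -> : vsub (fun i => x0 i + y i) x0 = y.
  by apply: functional_extensionality => i; rewrite /vsub; ring.
move=> h; apply/is_lim_seq_Reals; apply: h => i.
have -> : x0 i + y i - x0 i = y i by ring.
by have := Hy i; lra.
Qed.

End PowerSeries.

(** * Expansions with radius and bound uniform over the torus *)

Section Uniform.
Variables (n : nat) (f : vec n -> vec n -> R).
Hypothesis fper : periodic_q f.
Hypothesis fan : forall q, analytic2_at f (vzero n) q.

Definition Fq (q : vec n) (y : 'I_(n + n) -> R) := f (lpart y) (fun i => q i + rpart y i).

Lemma Fq_local q : exists r B, 0 < r /\ PS r (Fq q) B.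
Proof.
have [r [B [r0 H]]] := analytic_PS (fan q); exists r, B; split=> //.
apply: AN_ext H => y _; rewrite /Fq; congr (f _ _); apply: functional_extensionality => i.
  rewrite /lpart /joinv; case: splitP => j /= E; first by rewrite /vzero; ring.
  by have := ltn_ord i; rewrite E ltnNge leq_addr.
rewrite /rpart /joinv; case: splitP => j /= E.
  by have := ltn_ord j; rewrite -E ltnNge leq_addr.
by congr (q _ + _); apply: val_inj => /=; apply/eqP; rewrite -(eqn_add2l n) E.
Qed.

(** Recentring is the substitution of [y + (q' - q)], of norm at most [r / 2 + r / 2], and keeps the
    bound. *)
Lemma Fq_shift q q' r B : 0 < r -> PS r (Fq q) B -> (forall i, Rabs (q' i - q i) <= r / 2) -> PS (r / 2) (Fq q') B.
Proof.
move=> r0 HF Hq.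
pose S (i : 'I_(n + n)) (y : 'I_(n + n) -> R) := y i + match split i with inl _ => 0 | inr j => q' j - q j end.
have HS i : PS (r / 2) (S i) r.
  have -> : r = r / 2 + r / 2 by field.
  have -> : (r / 2 + r / 2) / 2 = r / 2 by field.
  apply: PS_add; [lra | exact: PS_coord |].
  apply: AN_le (PS_const _ _ _) _; case: (split i) => j; last exact: Hq.
  by rewrite Rabs_R0; lra.
have r20 : 0 <= r / 2 by lra.
apply: AN_ext (PS_substPS r0 r20 HF HS) => y _.
rewrite /Fq; congr (f _ _); apply: functional_extensionality => i; rewrite /lpart /rpart /S.
  by case: splitP => j /= E; [ring | have := ltn_ord i; rewrite E ltnNge leq_addr].
case: splitP => j /= E; first by have := ltn_ord j; rewrite -E ltnNge leq_addr.
have -> : j = i by apply: val_inj => /=; apply/eqP; rewrite -(eqn_add2l n) E.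
ring.
Qed.

(** Conversion to the nested tuples in which compactness of boxes is stated. *)
Fixpoint toT (m : nat) (g : nat -> R) : Compactness.Tn m R :=
  if m is m'.+1 then (g 0%N, toT m' (fun k => g k.+1)) else tt.
Fixpoint fromT (m : nat) : Compactness.Tn m R -> nat -> R :=
  if m is m'.+1 then fun t k => if k is k'.+1 then fromT t.2 k' else t.1 else fun _ _ => 0.

Lemma toT_bounded m g : (forall k, 0 <= g k <= 1) ->
  bounded_n m (toT m (fun _ => 0)) (toT m (fun _ => 1)) (toT m g).
Proof. by elim: m g => [//|m IH] g H /=; split=> //; apply: IH => k; apply: H. Qed.

Lemma toT_close m g d t : close_n m d (toT m g) t -> forall k, (k < m)%N -> Rabs (g k - fromT t k) < d.
Proof.
elim: m g t => [//|m IH] g [t1 t2] /= [h1 h2] [|k] hk //=.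
exact: (IH (fun k => g k.+1)).
Qed.

(** Compactness of the unit cube; periodicity then reaches every [q] through its fractional part. *)
Lemma Fq_uniform : exists r B, 0 < r /\ forall q, PS r (Fq q) B.
Proof.
have [rr Hrr] := choiceE Fq_local; have [BB HBB] := choiceE Hrr.
pose tv (t : Compactness.Tn n R) : vec n := fun i => fromT t i.
(* One number encodes both requirements: any [d] below it is an admissible radius, and [1 / d] is an
   admissible bound. *)
have dpos t : 0 < Rmin (rr (tv t) / 2) (/ (1 + Rabs (BB (tv t)))).
  apply: Rmin_pos; first by have := proj1 (HBB (tv t)); lra.
  by apply: Rinv_0_lt_compat; have := Rabs_pos (BB (tv t)); lra.
have [d Hd] := compactness_value n (toT n (fun _ => 0)) (toT n (fun _ => 1)) (fun t => mkposreal _ (dpos t)).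
exists d, (/ d); split; first exact: cond_pos.
have d0 := cond_pos d.
have key q : (forall i, 0 <= q i <= 1) -> PS d (Fq q) (/ d).
  move=> Hq; pose g (k : nat) := if insub k is Some i then q i else 0.
  have Hg k : 0 <= g k <= 1 by rewrite /g; case: insub => [i|]; [apply: Hq | lra].
  have [t [_ [Hc Hdt]]] := NNPP _ (Hd _ (toT_bounded n Hg)); rewrite /= in Hdt Hc.
  have [r0 HP] := HBB (tv t).
  have b1 : Rabs (BB (tv t)) < 1 + Rabs (BB (tv t)) by lra.
  have b0 := Rabs_pos (BB (tv t)).
  have h1 := Rle_trans _ _ _ Hdt (Rmin_l _ _); have h2 := Rle_trans _ _ _ Hdt (Rmin_r _ _).
  have Hq' i : Rabs (q i - tv t i) <= rr (tv t) / 2.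
    have := toT_close Hc (ltn_ord i); rewrite /g valK => h.
    by have := Rmin_l (rr (tv t) / 2) (/ (1 + Rabs (BB (tv t)))); rewrite /tv in h *; lra.
  have H := PS_mono (conj (Rlt_le _ _ d0) h1) (Fq_shift r0 HP Hq').
  apply: AN_le H _; apply: Rle_trans (Rle_abs _) _.
  apply: (Rle_trans _ (1 + Rabs (BB (tv t)))); first lra.
  by rewrite -[X in X <= _]Rinv_inv; apply: Rinv_le_contravar.
move=> q; pose k i := IZR (Int_part (q i)).
have Hk : is_int_vec k by move=> i; exists (Int_part (q i)).
have Hf : forall i, 0 <= frac_part (q i) <= 1 by move=> i; have := base_fp (q i); lra.
apply: AN_ext (key _ Hf) => y _; rewrite /Fq.
rewrite -(fper (lpart y) (fun i => frac_part (q i) + rpart y i) Hk); congr (f _ _).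
by apply: functional_extensionality => i; rewrite /vadd /k /frac_part; ring.
Qed.

End Uniform.

(** * Means over the torus *)

Section Average.
Variable n : nat.
Implicit Types (q y : vec n) (h : vec n -> R).

Definition periodic h := forall q k, is_int_vec k -> h (vadd q k) = h q.

(* Means over the torus are limits of grid averages, which suffice for Lipschitz integrands
   and need no integration. *)
Definition gridpt N (a : {ffun 'I_n -> 'I_N.+1}) : vec n := fun i => INR (a i) / INR N.+1.

Definition avg (N : nat) h : R :=
  / INR #|{ffun 'I_n -> 'I_N.+1}| * \big[Rplus/0]_(a : {ffun 'I_n -> 'I_N.+1}) h (gridpt a).

Lemma card_pos N : 0 < INR #|{ffun 'I_n -> 'I_N.+1}|.
Proof. by apply: lt_0_INR; apply/ltP; rewrite card_ffun !card_ord expn_gt0. Qed.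

Lemma avg_ext N h h' : (forall q, h q = h' q) -> avg N h = avg N h'.
Proof. by move=> E; rewrite /avg; congr (_ * _); apply: eq_bigr. Qed.

Lemma big_const_R (I : finType) (c : R) : \big[Rplus/0]_(i : I) c = INR #|I| * c.
Proof.
rewrite big_const; elim: #|I| => [|m IH]; first by rewrite /=; ring.
by rewrite iterS IH S_INR; ring.
Qed.

Lemma avg_const N c : avg N (fun _ => c) = c.
Proof.
have h := card_pos N.
by rewrite /avg big_const_R -Rmult_assoc Rinv_l ?Rmult_1_l //; apply: Rgt_not_eq.
Qed.

Lemma avg_plus N h h' : avg N (fun q => h q + h' q) = avg N h + avg N h'.
Proof. by rewrite /avg big_split /=; ring. Qed.

Lemma avg_scal N c h : avg N (fun q => c * h q) = c * avg N h.
Proof. by rewrite /avg -big_distrr /=; ring. Qed.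

Lemma avg_minus N h h' : avg N (fun q => h q - h' q) = avg N h - avg N h'.
Proof.
rewrite (avg_ext N (h' := fun q => h q + (-1) * h' q)); last by move=> q; ring.
by rewrite avg_plus avg_scal; ring.
Qed.

Lemma avg_ge0 N h : (forall q, 0 <= h q) -> 0 <= avg N h.
Proof.
move=> H; apply: Rmult_le_pos; first by apply: Rlt_le; apply: Rinv_0_lt_compat; apply: card_pos.
exact: big_ge0.
Qed.

Lemma avg_exch N N' (h : vec n -> vec n -> R) :
  avg N (fun q => avg N' (h q)) = avg N' (fun y => avg N (fun q => h q y)).
Proof.
rewrite /avg -!big_distrr /= exchange_big /=; ring.
Qed.

(** Translation by a grid vector permutes the grid modulo integer vectors; [sg] is this
    permutation. *)
Lemma avg_shift_int N h (z : 'I_n -> Z) : periodic h ->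
  avg N (fun q => h (fun i => q i + IZR (z i) / INR N.+1)) = avg N h.
Proof.
move=> hp; rewrite /avg; congr (_ * _).
pose M := Z.of_nat N.+1; have M0 : (0 < M)%Z by rewrite /M; lia.
pose rr (a : {ffun 'I_n -> 'I_N.+1}) i := ((Z.of_nat (a i) + z i) mod M)%Z.
have rb a i : (0 <= rr a i < M)%Z by apply: Z.mod_pos_bound.
pose sg (a : {ffun 'I_n -> 'I_N.+1}) : {ffun 'I_n -> 'I_N.+1} := [ffun i => inord (Z.to_nat (rr a i))].
have sgE a i : Z.of_nat (sg a i) = rr a i.
  rewrite ffunE inordK; first by rewrite Z2Nat.id //; case: (rb a i).
  by apply/ltP; have := rb a i; rewrite /M; lia.
have inj : injective sg.
  move=> a b E; apply/ffunP => i; apply: val_inj => /=.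
  have E2 : rr a i = rr b i by rewrite -!sgE E.
  have d1 := Z.div_mod (Z.of_nat (a i) + z i) M ltac:(lia).
  have d2 := Z.div_mod (Z.of_nat (b i) + z i) M ltac:(lia).
  rewrite -/(rr a i) in d1; rewrite -/(rr b i) -E2 in d2.
  have b1 := ltn_ord (a i); have b2 := ltn_ord (b i).
  move: b1 b2 => /ltP b1 /ltP b2.
  have E3 : ((Z.of_nat (a i) + z i) / M = (Z.of_nat (b i) + z i) / M)%Z by rewrite /M in d1 d2 *; nia.
  by rewrite E3 in d1; lia.
rewrite [RHS](reindex_inj inj) /=; apply: eq_bigr => a _.
pose c i := IZR ((Z.of_nat (a i) + z i) / M).
have hc : is_int_vec c by move=> i; exists ((Z.of_nat (a i) + z i) / M)%Z.
rewrite -(hp (gridpt (sg a)) c hc); congr h; apply: functional_extensionality => i.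
have Mp : 0 < INR N.+1 by apply: lt_0_INR; lia.
rewrite /vadd /gridpt /c [INR (sg a i)]INR_IZR_INZ sgE.
apply: (Rmult_eq_reg_r (INR N.+1)); last lra.
have -> : (INR (a i) / INR N.+1 + IZR (z i) / INR N.+1) * INR N.+1 = INR (a i) + IZR (z i) by field; lra.
have -> : (IZR (rr a i) / INR N.+1 + IZR ((Z.of_nat (a i) + z i) / M)) * INR N.+1 =
  IZR (rr a i) + IZR ((Z.of_nat (a i) + z i) / M) * INR N.+1 by field; lra.
rewrite !INR_IZR_INZ -mult_IZR -!plus_IZR; congr IZR.
by rewrite {1}(Z.div_mod (Z.of_nat (a i) + z i) M) -/(rr a i) /M; lia.
Qed.

Section AverageAN.
Variables (X At : Type) (dom : X -> Prop) (ev : At -> X -> R) (wt : At -> R) (a0 : At).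
Hypothesis wt0 : forall a, 0 <= wt a.
Hypothesis evwt : forall a x, dom x -> Rabs (ev a x) <= wt a.
Notation AN := (AN dom ev wt).

Lemma avg_AN N (g : vec n -> X -> R) B : (forall q, AN (g q) B) -> AN (fun x => avg N (fun q => g q x)) B.
Proof.
move=> H; have c0 := card_pos N.
have hb : AN (fun x => \big[Rplus/0]_(a : {ffun 'I_n -> 'I_N.+1}) g (gridpt a) x) (\big[Rplus/0]_(a : {ffun 'I_n -> 'I_N.+1}) B).
  by apply: AN_big.
have h := AN_scal (/ INR #|{ffun 'I_n -> 'I_N.+1}|) hb.
apply: AN_le h _; rewrite big_const_R Rabs_pos_eq; last by apply: Rlt_le; apply: Rinv_0_lt_compat.
by rewrite -Rmult_assoc Rinv_l ?Rmult_1_l; [lra | apply: Rgt_not_eq].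
Qed.

Variables (g : vec n -> X -> R) (L : R).
Hypothesis L0 : 0 <= L.
Hypothesis gper : forall q k x, is_int_vec k -> g (vadd q k) x = g q x.
Hypothesis glip : forall q q' d, (forall i, Rabs (q i - q' i) <= d) -> AN (fun x => g q x - g q' x) (L * d).

(** Rounding [y] down to the grid costs at most [1 / (N + 1)] in each coordinate. *)
Lemma avg_shift N y : AN (fun x => avg N (fun q => g (fun i => q i + y i) x) - avg N (fun q => g q x)) (L / INR N.+1).
Proof.
have Mp : 0 < INR N.+1 by apply: lt_0_INR; lia.
pose z i := Int_part (y i * INR N.+1).
apply: (AN_ext (g := fun x => avg N (fun q => g (fun i => q i + y i) x - g (fun i => q i + IZR (z i) / INR N.+1) x))).
  move=> x _; rewrite avg_minus; congr (_ - _).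
  by rewrite (@avg_shift_int N (fun q => g q x) z) // => q k hk; apply: gper.
apply: avg_AN => q; apply: glip => i.
have := base_fp (y i * INR N.+1); rewrite /frac_part -/(z i) => h.
have -> : q i + y i - (q i + IZR (z i) / INR N.+1) = (y i * INR N.+1 - IZR (z i)) * / INR N.+1 by field; lra.
have ip : 0 < / INR N.+1 by apply: Rinv_0_lt_compat.
rewrite Rabs_mult (Rabs_pos_eq (/ _)); last lra.
by rewrite Rabs_pos_eq; [nra | lra].
Qed.

(** Both averages are compared with the double average over sums of points of the two grids, which
    is symmetric. *)
Lemma avg_cauchy N N' : AN (fun x => avg N (fun q => g q x) - avg N' (fun q => g q x)) (L / INR N.+1 + L / INR N'.+1).
Proof.
have h1 := @avg_AN N' (fun y x => avg N (fun q => g (fun i => q i + y i) x) - avg N (fun q => g q x)) _ (avg_shift N).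
have h2 := @avg_AN N (fun y x => avg N' (fun q => g (fun i => q i + y i) x) - avg N' (fun q => g q x)) _ (avg_shift N').
apply: AN_le (AN_ext _ (AN_sub wt0 a0 h2 h1)) _ => [x _|]; last by right; ring.
rewrite !avg_minus !avg_const avg_exch.
have -> : avg N' (fun y => avg N (fun q => g (fun i => y i + q i) x)) = avg N' (fun y => avg N (fun q => g (fun i => q i + y i) x)).
  apply: avg_ext => y; apply: avg_ext => q; congr (g _ x); apply: functional_extensionality => i; ring.
ring.
Qed.

Definition mean h : R := real (Lim_seq (fun N => avg N h)).
Definition is_mean h m := is_lim_seq (fun N => avg N h) (Finite m).

Lemma mean_exists x : dom x -> is_mean (fun q => g q x) (mean (fun q => g q x)).
Proof.
move=> Hx; apply: Lim_seq_correct'; apply/ex_lim_seq_cauchy_corr => eps.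
have e0 : 0 < eps / (2 * L + 1).
  by apply: Rdiv_lt_0_compat; [exact: cond_pos | lra].
have [M HM] : exists M : nat, (2 * L + 1) / eps <= INR M.
  exists (Z.to_nat (up ((2 * L + 1) / eps))).
  have q0 : 0 < (2 * L + 1) / eps by apply: Rdiv_lt_0_compat; [lra | exact: cond_pos].
  by rewrite INR_IZR_INZ Z2Nat.id; have [h _] := archimed ((2 * L + 1) / eps); [lra | apply: le_IZR; lra].
have ep := cond_pos eps.
have bnd N : (M <= N)%coq_nat -> L / INR N.+1 <= eps * L / (2 * L + 1).
  move=> /le_INR h; have hS : INR N < INR N.+1 by rewrite S_INR; lra.
  have q0 : 0 < (2 * L + 1) / eps by apply: Rdiv_lt_0_compat; lra.
  rewrite /Rdiv (Rmult_comm eps) Rmult_assoc; apply: Rmult_le_compat_l => //.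
  have -> : eps * / (2 * L + 1) = / ((2 * L + 1) / eps) by field; lra.
  by apply: Rinv_le_contravar; lra.
exists M => N N' h1 h2; have := AN_sup evwt (avg_cauchy N N') Hx.
have b1 := bnd N h1; have b2 := bnd N' h2.
move=> h; apply: (Rle_lt_trans _ (2 * (eps * L / (2 * L + 1)))); first lra.
have -> : 2 * (eps * L / (2 * L + 1)) = eps * (2 * L / (2 * L + 1)) by field; lra.
rewrite -[X in _ < X]Rmult_1_r; apply: Rmult_lt_compat_l => //.
apply: (Rmult_lt_reg_r (2 * L + 1)); first lra.
by rewrite /Rdiv Rmult_assoc Rinv_l; lra.
Qed.

(** [AN] is closed under series, and not a priori under pointwise limits: the mean is therefore
    reached by a telescoping series over dyadic refinements of the grid, whose norms are
    summable. *)
Lemma mean_AN N : AN (fun x => mean (fun q => g q x) - avg N (fun q => g q x)) (4 * L / INR N.+1).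
Proof.
(* The predecessor, since [avg N] uses [N + 1] points per coordinate. *)
pose ph j := (N.+1 * 2 ^ j).-1.
have phE j : (ph j).+1 = (N.+1 * 2 ^ j)%N by rewrite /ph prednK // muln_gt0 /= expn_gt0.
have Mp : 0 < INR N.+1 by apply: lt_0_INR; lia.
have phR j : INR (ph j).+1 = INR N.+1 * 2 ^ j.
  rewrite phE mult_INR; congr (_ * _); elim: j => [//|j IH]; by rewrite expnS mult_INR IH.
pose b j := 2 * (L / INR N.+1) * (/ 2) ^ j.
have q0 : 0 <= L / INR N.+1 by apply: Rdiv_le_0_compat.
apply: (AN_series (G := fun j x => avg (ph j.+1) (fun q => g q x) - avg (ph j) (fun q => g q x)) (b := b)).
- move=> j; apply: AN_le (avg_cauchy _ _) _; rewrite !phR /b pow_inv (_ : 2 ^ j.+1 = 2 * 2 ^ j) //.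
  have p : 0 < 2 ^ j by apply: pow_lt; lra.
  have -> : L / (INR N.+1 * (2 * 2 ^ j)) + L / (INR N.+1 * 2 ^ j) = (3 / 2) * (L / INR N.+1) * / 2 ^ j by field; lra.
  by apply: Rmult_le_compat_r; [apply: Rlt_le; apply: Rinv_0_lt_compat | lra].
- move=> K; rewrite sum_scalR tech3; last lra.
  have : 0 <= (/ 2) ^ K.+1 by apply: pow_le; lra.
  set r := (/ 2) ^ K.+1 => r0; have -> : (1 - r) / (1 - / 2) = 2 * (1 - r) by field.
  have -> : 4 * L / INR N.+1 = 2 * (L / INR N.+1) * 2 by rewrite /Rdiv; ring.
  by apply: Rmult_le_compat_l; lra.
move=> x Hx; apply/is_series_lim.
apply: (is_lim_seq_ext (fun K => avg (ph K.+1) (fun q => g q x) - avg N (fun q => g q x))).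
  elim=> [|K IH]; last by rewrite tech5 -IH; ring.
  by rewrite /=; congr (_ - avg _ _); rewrite /ph expn0 muln1.
apply: is_lim_seq_minus'; last exact: is_lim_seq_const.
apply: (is_lim_seq_subseq (fun N => avg N (fun q => g q x)) _ (fun K => ph K.+1)); last exact: mean_exists Hx.
apply: eventually_subseq => K; apply/ltP; rewrite -ltnS !phE ltn_mul2l /= ltn_exp2l //.
Qed.

End AverageAN.
End Average.

Section Means.
Variable n : nat.
Implicit Types (q y x : vec n) (h : vec n -> R).

Lemma is_mean_ext h h' m : (forall q, h q = h' q) -> is_mean h m -> is_mean h' m.
Proof. by move=> E; apply: is_lim_seq_ext => N; apply: avg_ext. Qed.
Arguments is_mean_ext : clear implicits. Arguments is_mean_ext {h h' m} _ _.


Lemma is_mean_plus h h' m m' : is_mean h m -> is_mean h' m' -> is_mean (fun q => h q + h' q) (m + m').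
Proof.
move=> H H'; apply: (is_lim_seq_ext (fun N => avg N h + avg N h')); first by move=> N; rewrite avg_plus.
exact: is_lim_seq_plus'.
Qed.
Arguments is_mean_plus : clear implicits. Arguments is_mean_plus {h h' m m'} _ _.


Lemma is_mean_minus h h' m m' : is_mean h m -> is_mean h' m' -> is_mean (fun q => h q - h' q) (m - m').
Proof.
move=> H H'; apply: (is_lim_seq_ext (fun N => avg N h - avg N h')); first by move=> N; rewrite avg_minus.
exact: is_lim_seq_minus'.
Qed.
Arguments is_mean_minus : clear implicits. Arguments is_mean_minus {h h' m m'} _ _.


Lemma is_mean_scal c h m : is_mean h m -> is_mean (fun q => c * h q) (c * m).
Proof.
move=> H; apply: (is_lim_seq_ext (fun N => c * avg N h)); first by move=> N; rewrite avg_scal.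
by apply: is_lim_multR => //; apply: is_lim_seq_const.
Qed.
Arguments is_mean_scal : clear implicits. Arguments is_mean_scal c {h m} _.


Lemma is_mean_const c : is_mean (fun _ : vec n => c) c.
Proof. by apply: (is_lim_seq_ext (fun N => c)) => [N|]; [rewrite avg_const | apply: is_lim_seq_const]. Qed.
Arguments is_mean_const : clear implicits. Arguments is_mean_const c.


Lemma is_mean_big (I : Type) (s : seq I) (Q : pred I) (F : I -> vec n -> R) m :
  (forall i, is_mean (F i) (m i)) ->
  is_mean (fun q => \big[Rplus/0]_(i <- s | Q i) F i q) (\big[Rplus/0]_(i <- s | Q i) m i).
Proof.
move=> H; elim: s => [|i s IH].
  by rewrite big_nil; apply: (is_mean_ext _ (is_mean_const 0)) => q; rewrite big_nil.
rewrite big_cons; case E: (Q i); last by apply: (is_mean_ext _ IH) => q; rewrite big_cons E.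
by apply: (is_mean_ext _ (is_mean_plus (H i) IH)) => q; rewrite big_cons E.
Qed.

Lemma is_mean_sum (F : nat -> vec n -> R) m K : (forall i, is_mean (F i) (m i)) ->
  is_mean (fun q => sum_f_R0 (fun i => F i q) K) (sum_f_R0 m K).
Proof. by move=> H; elim: K => [|K IH]; [apply: H | apply: is_mean_plus]. Qed.

Lemma is_mean_unique h m m' : is_mean h m -> is_mean h m' -> m = m'.
Proof. exact: is_lim_unique_R. Qed.

Lemma is_mean_ge0 h m : (forall q, 0 <= h q) -> is_mean h m -> 0 <= m.
Proof.
move=> H0 H; exact: (is_lim_seq_le (fun _ => 0) _ 0 m (fun N => avg_ge0 N H0) (is_lim_seq_const 0) H).
Qed.

Lemma avg_abs_le N h B : (forall q, Rabs (h q) <= B) -> Rabs (avg N h) <= B.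
Proof.
move=> H; apply/Rabs_le_between; split.
  have := avg_ge0 N (h := fun q => h q - (- B)); rewrite avg_minus avg_const => h1.
  have h2 : 0 <= avg N h - - B by apply: h1 => q; have := proj1 (Rabs_le_between _ _) (H q); lra.
  lra.
have := avg_ge0 N (h := fun q => B - h q); rewrite avg_minus avg_const => h1.
have h2 : 0 <= B - avg N h by apply: h1 => q; have := proj1 (Rabs_le_between _ _) (H q); lra.
lra.
Qed.

Lemma is_mean_unif h (hK : nat -> vec n -> R) (eta : nat -> R) m K0 :
  (forall K q, Rabs (h q - hK K q) <= eta K) -> is_lim_seq eta 0 ->
  (forall K, (K0 <= K)%N -> is_mean (hK K) m) -> is_mean h m.
Proof.
move=> Hu He Hm; apply/is_lim_seq_spec => eps.
have e2 : 0 < eps / 2 by have := cond_pos eps; lra.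
have [K1 HK1] := proj2 (is_lim_seq_spec _ _) He (mkposreal _ e2).
pose K := maxn K0 K1.
have HK : Rabs (eta K - 0) < eps / 2 by apply: HK1; apply/leP; apply: leq_maxr.
have [N0 HN0] := proj2 (is_lim_seq_spec _ _) (Hm K (leq_maxl _ _)) (mkposreal _ e2).
exists N0 => N HN; have := HN0 N HN; rewrite /= => h1.
have -> : avg N h - m = (avg N h - avg N (hK K)) + (avg N (hK K) - m) by ring.
apply: Rle_lt_trans (Rabs_triang _ _) _; rewrite -avg_minus.
have := avg_abs_le N (Hu K); have := Rle_abs (eta K); rewrite Rminus_0_r in HK; lra.
Qed.

(** Scalars are functions on a one-point space with a single atom. *)
Lemma avg_shift_scalar N h L y : 0 <= L -> periodic h ->
  (forall q q' d, (forall i, Rabs (q i - q' i) <= d) -> Rabs (h q - h q') <= L * d) ->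
  Rabs (avg N (fun q => h (fun i => q i + y i)) - avg N h) <= L / INR N.+1.
Proof.
move=> L0 hp hl.
have wt0 (a : unit) : 0 <= 1 by lra.
have evwt (a x : unit) : True -> Rabs 1 <= 1 by rewrite Rabs_R1; lra.
have := @avg_shift n unit unit (fun _ => True) (fun _ _ => 1) (fun _ => 1) tt wt0 (fun q _ => h q) L.
move=> /(_ (fun q k _ => @hp q k)) H.
have /H : forall q q' d, (forall i, Rabs (q i - q' i) <= d) ->
   AN (fun _ : unit => True) (fun _ _ : unit => 1) (fun _ => 1) (fun _ => h q - h q') (L * d).
  move=> q q' d Hd; apply: (AN_atom (c := h q - h q') (a := tt)) => [x _|]; first by ring.
  by rewrite Rmult_1_r; apply: hl.
move=> /(_ N y) HA; exact: (AN_sup evwt HA (x := tt) I).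
Qed.

Lemma is_lim_div_INR L : is_lim_seq (fun N => L / INR N.+1) 0.
Proof.
have H : is_lim_seq (fun N => / INR N) 0.
  have -> : Finite 0 = Rbar_inv p_infty by [].
  by apply: is_lim_seq_inv; [exact: is_lim_seq_INR | ].
have -> : Finite 0 = Rbar_mult L 0 by rewrite /= Rmult_0_r.
exact: is_lim_seq_scal_l (proj1 (is_lim_seq_incr_1 _ _) H).
Qed.

Lemma is_mean_shift h L y m : 0 <= L -> periodic h ->
  (forall q q' d, (forall i, Rabs (q i - q' i) <= d) -> Rabs (h q - h q') <= L * d) ->
  is_mean h m -> is_mean (fun q => h (fun i => q i + y i)) m.
Proof.
move=> L0 hp hl Hm.
have H0 : is_lim_seq (fun N => avg N (fun q => h (fun i => q i + y i)) - avg N h) 0.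
  apply: (is_lim_seq_le_le (fun N => - (L / INR N.+1)) _ (fun N => L / INR N.+1)).
  - by move=> N; have := proj1 (Rabs_le_between _ _) (avg_shift_scalar N y L0 hp hl); lra.
  - have -> : Finite 0 = Rbar_opp 0 by rewrite /= Ropp_0.
    by apply: (is_lim_seq_opp (fun N => L / INR N.+1) 0).1; apply: is_lim_div_INR.
  - exact: is_lim_div_INR.
have := is_lim_seq_plus' _ _ _ _ H0 Hm; rewrite Rplus_0_l; apply: is_lim_seq_ext => N; ring.
Qed.

Definition cosk (k : 'I_n -> Z) (p : R) q := cos (2 * PI * kdot k q + p).

Lemma cosk_per k p : periodic (cosk k p).
Proof. by move=> q z hz; exact: (tev_per (k, p) q hz). Qed.

Lemma cosk_lip k p q q' d : (forall i, Rabs (q i - q' i) <= d) ->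
  Rabs (cosk k p q - cosk k p q') <= 2 * PI * knorm k * d.
Proof.
move=> Hd; have pi0 := PI_RGT_0.
have -> : cosk k p q = cos (2 * PI * kdot k q' + p + 2 * PI * kdot k (fun i => q i - q' i)).
  rewrite -(tev_shift (k, p)) /cosk /tev /=; congr (cos (2 * PI * kdot k _ + p)).
  by apply: functional_extensionality => i; ring.
apply: Rle_trans (cos_lip _ _) _; rewrite Rabs_mult (Rabs_pos_eq (2 * PI)); last lra.
by rewrite (Rmult_assoc (2 * PI) (knorm k)); apply: Rmult_le_compat_l; [lra | apply: kdot_bound].
Qed.

Lemma cosk_bound k p q : Rabs (cosk k p q) <= 1.
Proof. by apply/Rabs_le; apply: COS_bound. Qed.

Lemma is_mean_cos0 (k : 'I_n -> Z) p : (forall i, k i = 0%Z) -> is_mean (cosk k p) (cos p).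
Proof.
move=> k0; apply: (is_mean_ext _ (is_mean_const (cos p))) => q; rewrite /cosk.
by rewrite /kdot rsum_0 ?Rmult_0_r ?Rplus_0_l // => i; rewrite k0; ring.
Qed.

(** Shifting coordinate [i] by [1 / (2 k_i)], half a period, changes the sign of the cosine; so each
    grid average is close to its opposite. *)
Lemma is_mean_cos (k : 'I_n -> Z) p i : k i <> 0%Z -> is_mean (cosk k p) 0.
Proof.
move=> ki; have pi0 := PI_RGT_0; have kR : IZR (k i) <> 0 by apply: IZR_neq.
pose y j := (if j == i then 1 else 0) * / (2 * IZR (k i)).
have Ey : kdot k y = / 2.
  rewrite /kdot (rsum_ext (G := fun j => (if j == i then 1 else 0) * (IZR (k j) * / (2 * IZR (k i))))).
    by rewrite (rsum_delta (fun j => IZR (k j) * / (2 * IZR (k i)))); field.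
  by move=> j; rewrite /y; ring.
have L0 : 0 <= 2 * PI * knorm k by apply: Rmult_le_pos; [lra | apply: knorm_ge0].
have H N : Rabs (avg N (cosk k p)) <= (PI * knorm k) / INR N.+1.
  have := avg_shift_scalar N y L0 (@cosk_per k p) (@cosk_lip k p).
  have -> : avg N (fun q => cosk k p (fun i => q i + y i)) = - avg N (cosk k p).
    rewrite (avg_ext N (h' := fun q => (-1) * cosk k p q)); first by rewrite avg_scal; ring.
    move=> q; have := tev_shift (k, p) q y; rewrite /tev /= Ey /cosk => ->.
    have -> : 2 * PI * kdot k q + p + 2 * PI * / 2 = 2 * PI * kdot k q + p + PI by field.
    by rewrite neg_cos; ring.
  have -> : - avg N (cosk k p) - avg N (cosk k p) = -2 * avg N (cosk k p) by ring.
  rewrite Rabs_mult (Rabs_left (-2)); last lra.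
  have -> : 2 * PI * knorm k / INR N.+1 = 2 * (PI * knorm k / INR N.+1) by rewrite /Rdiv; ring.
  lra.
apply: (is_lim_seq_le_le (fun N => - (PI * knorm k / INR N.+1)) _ (fun N => PI * knorm k / INR N.+1)).
- by move=> N; have := proj1 (Rabs_le_between _ _) (H N); lra.
- have -> : Finite 0 = Rbar_opp 0 by rewrite /= Ropp_0.
  by apply: (is_lim_seq_opp (fun N => PI * knorm k / INR N.+1) 0).1; apply: is_lim_div_INR.
- exact: is_lim_div_INR.
Qed.

End Means.
#[global] Arguments is_mean_big : clear implicits.
#[global] Arguments is_mean_big {n I} s Q {F m} _.
#[global] Arguments is_mean_ext : clear implicits.
#[global] Arguments is_mean_ext {n h h' m} _ _.
#[global] Arguments is_mean_plus : clear implicits.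
#[global] Arguments is_mean_plus {n h h' m m'} _ _.
#[global] Arguments is_mean_minus : clear implicits.
#[global] Arguments is_mean_minus {n h h' m m'} _ _.
#[global] Arguments is_mean_scal : clear implicits.
#[global] Arguments is_mean_scal {n} c {h m} _.

(** * Expansion in one distinguished variable *)

Section PowerSeriesVariable.

Lemma ps_unique (a c : nat -> R) (v : R -> R) rho : 0 < rho ->
  (forall t, Rabs t <= rho -> is_series (fun m => a m * t ^ m) (v t)) ->
  (forall t, Rabs t <= rho -> is_series (fun m => c m * t ^ m) (v t)) -> forall m, a m = c m.
Proof.
move=> r0 Ha Hc m.
have E (d : nat -> R) t l : is_series (fun m => d m * t ^ m) l -> is_pseries d t l.
  by apply: is_series_ext => i; rewrite /scal /= /mult /= pow_n_pow Rmult_comm.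
have CV (d : nat -> R) l : is_series (fun m => d m * rho ^ m) l -> Rbar_lt 0 (CV_radius d).
  move=> Hd; apply: (Rbar_lt_le_trans 0 rho) => //.
  apply: (proj1 (CV_radius_bounded d)).
  have L0 : is_lim_seq (fun m => d m * rho ^ m) 0 by apply: ex_series_lim_0; exists l.
  have [M HM] := filterlim_bounded _ (ex_intro _ 0 L0).
  by exists M => i; apply: HM.
have ar : Rabs rho <= rho by rewrite Rabs_pos_eq; lra.
apply: PSeries_ext_recip; [exact: CV (Ha rho ar) | exact: CV (Hc rho ar) |].
exists (mkposreal _ r0) => t; rewrite /ball /= /AbsRing_ball /abs /minus /plus /opp /= Ropp_0 Rplus_0_r => ht.
rewrite (is_pseries_unique _ _ _ (E _ _ _ (Ha t _))); last lra.
by rewrite (is_pseries_unique _ _ _ (E _ _ _ (Hc t _))); last lra.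
Qed.

Variable I : Type.

Definition pt (p : I -> R) (t : R) : option I -> R := fun o => if o is Some j then p j else t.

Lemma pw_pt (w : seq (option I)) p t : pw w (pt p t) = pw (pmap id w) p * t ^ count (fun o => if o is None then true else false) w.
Proof.
elim: w => [|[l|] w IH] /=; [ring | rewrite IH add0n; ring |].
by rewrite IH add0n; ring.
Qed.

Lemma size_pt (w : seq (option I)) : size w = (size (pmap id w) + count (fun o => if o is None then true else false) w)%N.
Proof. by elim: w => [//|[l|] w IH] /=; rewrite IH /= ?add1n ?addnS. Qed.

Lemma sum_single (v : R) (h : nat -> R) m0 N :
  sum_f_R0 (fun m => (if m == m0 then v else 0) * h m) N = if (m0 <= N)%N then v * h m0 else 0.
Proof.
elim: N => [|N IH] /=.
  by rewrite leqn0 (eq_sym 0%N); case: eqP => [->|_]; ring.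
rewrite IH (leq_eqVlt m0 N.+1) (eq_sym N.+1) ltnS; case: eqP => [->|_] /=; last by ring.
by rewrite ltnn; ring.
Qed.

Lemma partial_le_Series (b : nat -> R) B N : (forall m, 0 <= b m) -> (forall N, sum_f_R0 b N <= B) ->
  sum_f_R0 b N <= Series b.
Proof.
move=> b0 HB; have [l Hl] := ex_series_bounded b0 HB; rewrite (is_series_unique _ _ Hl).
have /is_series_lim H := Hl.
by have := is_lim_seq_incr_compare _ _ H; apply => m; rewrite tech5; have := b0 m.+1; lra.
Qed.

(* The remainder estimate spares a rearrangement of the double series. *)
Lemma PS_t r G B : 0 < r -> PS r G B ->
  exists (g : nat -> (I -> R) -> R) (b : nat -> R),
  [/\ forall m, PS r (g m) (b m), forall N, sum_f_R0 (fun m => b m * r ^ m) N <= B &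
      forall p t N, domw r p -> Rabs t <= r / 2 ->
        Rabs (G (pt p t) - sum_f_R0 (fun m => g m p * t ^ m) N) <= B * (/ 2) ^ N].
Proof.
move=> r0; elim=> [c w g0 B0 Hg H|Gm bm g0 B0 HG IH H Hser].
  pose m0 := count (fun o => if o is None then true else false) w; pose w' := pmap id w.
  rewrite /wtw size_pt -/m0 -/w' pow_add in H.
  have c0 := Rabs_pos c; have p1 : 0 < r ^ size w' by apply: pow_lt.
  have p2 : 0 < r ^ m0 by apply: pow_lt.
  exists (fun m p => (if m == m0 then c * pw w' p else 0)), (fun m => if m == m0 then Rabs c * r ^ size w' else 0).
  have B00 : 0 <= B0 by apply: Rle_trans H; apply: Rmult_le_pos => //; nra.
  split.
  - move=> m; case: eqP => _; first by apply: (AN_atom (c := c) (a := w')) => //; rewrite /wtw; lra.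
    exact: (AN_zero _ _ _ [::]).
  - move=> N; rewrite (sum_single (Rabs c * r ^ size w') (fun m => r ^ m)); case: (m0 <= N)%N => //.
    by rewrite Rmult_assoc.
  - move=> p t N Hp Ht.
    rewrite Hg; last by case=> [j|] /=; [apply: Hp | lra].
    rewrite pw_pt -/m0 -/w' (sum_single (c * pw w' p) (fun m => t ^ m)).
    have q0 : 0 < (/ 2) ^ N by apply: pow_lt; lra.
    case: leqP => hN; first by rewrite Rmult_assoc Rminus_diag Rabs_R0; apply: Rmult_le_pos; lra.
    rewrite Rminus_0_r !Rabs_mult -RPow_abs.
    have h1 := pw_bound w' Hp.
    have h2 : Rabs t ^ m0 <= r ^ m0 * (/ 2) ^ m0 by rewrite -Rpow_mult_distr; apply: pow_incr; split; [apply: Rabs_pos | lra].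
    have h3 : (/ 2) ^ m0 <= (/ 2) ^ N.
      rewrite !pow_inv; apply: Rinv_le_contravar; first by apply: pow_lt; lra.
      by apply: Rle_pow; [lra | apply/leP; apply: ltnW].
    apply: (Rle_trans _ (Rabs c * (r ^ size w' * (r ^ m0 * (/ 2) ^ N)))).
      apply: Rmult_le_compat_l => //; apply: Rmult_le_compat => //; [exact: Rabs_pos | by apply: pow_le; apply: Rabs_pos |].
      by apply: Rle_trans h2 _; apply: Rmult_le_compat_l; lra.
    have -> : Rabs c * (r ^ size w' * (r ^ m0 * (/ 2) ^ N)) = Rabs c * (r ^ size w' * r ^ m0) * (/ 2) ^ N by ring.
    by apply: Rmult_le_compat_r; lra.
have [gb Hgb] := choiceE (P := fun l (z : (nat -> (I -> R) -> R) * (nat -> R)) =>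
  [/\ forall m, PS r (z.1 m) (z.2 m), forall N, sum_f_R0 (fun m => z.2 m * r ^ m) N <= bm l &
      forall p t N, domw r p -> Rabs t <= r / 2 ->
        Rabs (Gm l (pt p t) - sum_f_R0 (fun m => z.1 m p * t ^ m) N) <= bm l * (/ 2) ^ N])
  ltac:(by move=> l; case: (IH l) => g [b h]; exists (g, b)).
have rp m : 0 < r ^ m by apply: pow_lt.
have b0 l m : 0 <= (gb l).2 m.
  by case: (Hgb l) => h _ _; apply: AN_ge0 (h m) => a; apply: wtw0; lra.
have bnd t : 0 <= t -> forall N, sum_f_R0 (fun m => t * bm m) N <= t * B0.
  by move=> t0 N; rewrite sum_scalR; apply: Rmult_le_compat_l.
have bl l m : (gb l).2 m <= / r ^ m * bm l.
  apply: (Rmult_le_reg_r (r ^ m)) => //.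
  have -> : / r ^ m * bm l * r ^ m = bm l by field; have := rp m; lra.
  case: (Hgb l) => _ h _; apply: Rle_trans (h m).
  case: m => [|m] /=; first by lra.
  have : 0 <= sum_f_R0 (fun m => (gb l).2 m * r ^ m) m by apply: cond_pos_sum => i; apply: Rmult_le_pos => //; apply: Rlt_le.
  by lra.
have bs m N : sum_f_R0 (fun l => (gb l).2 m) N <= / r ^ m * B0.
  apply: Rle_trans (bnd (/ r ^ m) (Rlt_le _ _ (Rinv_0_lt_compat _ (rp m))) N).
  by apply: sum_Rle => l _.
have bser m : is_series (fun l => (gb l).2 m) (Series (fun l => (gb l).2 m)).
  by apply: (proj1 (dominated_series _ (bs m))) => l; rewrite Rabs_pos_eq //; lra.
have S m : PS r (fun p => Series (fun l => (gb l).1 m p)) (Series (fun l => (gb l).2 m)) /\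
  forall p, domw r p -> is_series (fun l => (gb l).1 m p) (Series (fun l => (gb l).1 m p)).
  have ev (a : seq I) (x : I -> R) : domw r x -> Rabs (pw a x) <= wtw r a by move=> h; apply: (pw_bound a h).
  apply: (AN_Series ev (G := fun l => (gb l).1 m) (b := fun l => (gb l).2 m)) => [l|N]; first by case: (Hgb l) => h _ _; exact: h.
  exact: partial_le_Series (bs m).
exists (fun m p => Series (fun l => (gb l).1 m p)), (fun m => Series (fun l => (gb l).2 m)); split.
- by move=> m; exact: (proj1 (S m)).
- move=> N; apply: (is_series_ub (a := fun l => sum_f_R0 (fun m => (gb l).2 m * r ^ m) N)).
    elim: N => [|N IHN]; first by apply: is_series_scalrR.
    by rewrite tech5; apply: (is_series_ext _ _ _ (fun m => esym (tech5 _ _))); apply: is_series_plusR => //; apply: is_series_scalrR.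
  by move=> K; apply: Rle_trans (H K); apply: sum_Rle => l _; case: (Hgb l).
- move=> p t N Hp Ht.
  apply: (is_series_abs_ub (a := fun l => Gm l (pt p t) - sum_f_R0 (fun m => (gb l).1 m p * t ^ m) N) (b := fun l => (/ 2) ^ N * bm l)).
  + apply: is_series_minusR.
      by apply: Hser; case=> [j|] /=; [apply: Hp | lra].
    elim: N => [|N IHN]; first by apply: is_series_scalrR; apply: (proj2 (S _)).
    by rewrite tech5; apply: (is_series_ext _ _ _ (fun m => esym (tech5 _ _))); apply: is_series_plusR => //; apply: is_series_scalrR; apply: (proj2 (S _)).
  + by move=> l; rewrite Rmult_comm; case: (Hgb l) => _ _; apply.
  + by move=> K; rewrite (Rmult_comm B0); apply: bnd; apply: pow_le; lra.
Qed.

End PowerSeriesVariable.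

(** * Fourier coefficients *)

Section FourierDecay.
Variables (n : nat) (f : vec n -> vec n -> R).
Hypothesis fper : periodic_q f.
Variables (r B : R).
Hypothesis r0 : 0 < r.
Hypothesis B0 : 0 < B.
Hypothesis HFq : forall q, PS (4 * r) (Fq f q) B.
Implicit Types (k : 'I_n -> Z) (p q : vec n).

Let wtr (I : Type) (w : seq I) : 0 <= wtw r w.
Proof. by apply: wtw0; lra. Qed.
Let evr (I : Type) (w : seq I) (x : I -> R) : domw r x -> Rabs (pw w x) <= wtw r w.
Proof. by move=> h; apply: (pw_bound w h). Qed.

(** The function [(p, t) -> f (p, q + t e_i)], with [t] in the slot [None]: a power series whose
    bound is uniform in [q]. *)
Definition slice (i : 'I_n) (q : vec n) (x : option 'I_n -> R) : R :=
  f (fun j => x (Some j)) (fun j => q j + (if j == i then x None else 0)).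

Definition slc (i : 'I_n) (l : 'I_(n + n)) (x : option 'I_n -> R) : R :=
  match split l with inl j => x (Some j) | inr j => if j == i then x None else 0 end.

Lemma slice_Fq i q x : slice i q x = Fq f q (fun l => slc i l x).
Proof.
rewrite /slice /Fq /lpart /rpart /slc; congr f; apply: functional_extensionality => j.
  by case: splitP => l E; [congr (x (Some _)); apply: val_inj | have := ltn_ord j; rewrite [X in (X < _)%N]E ltnNge leq_addr].
case: splitP => l E; first by have := ltn_ord l; rewrite -E ltnNge leq_addr.
by have -> : j = l by apply: val_inj; apply: (@addnI n).
Qed.

Lemma slc_PS i l : PS r (slc i l) r.
Proof.
rewrite /slc; case: (split l) => j; first exact: PS_coord.
case: eqP => _; first exact: PS_coord.
by apply: AN_le (AN_zero _ _ _ [::]) _; lra.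
Qed.

Lemma slice_PS i q : PS r (slice i q) B.
Proof.
apply: (AN_ext (fun x _ => slice_Fq i q x)).
apply: (PS_substPS (r := 4 * r)) => //; try lra.
by move=> l; apply: AN_le (slc_PS i l) _; lra.
Qed.

Lemma slice_lip i q q' d : (forall j, Rabs (q j - q' j) <= d) ->
  PS r (fun x => slice i q x - slice i q' x) (2 * B / r * d).
Proof.
move=> Hd; have ir : 0 < / r by apply: Rinv_0_lt_compat.
have d0 : 0 <= d by apply: Rle_trans (Rabs_pos _) (Hd i).
(* Beyond the distance [r], the trivial bound [2 B] is already Lipschitz. *)
case: (Rle_dec d r) => hd; last first.
  apply: AN_le (AN_sub (wtr (I := _)) [::] (slice_PS i q) (slice_PS i q')) _.
  have -> : B + B = 2 * B / r * r by field; lra.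
  apply: Rmult_le_compat_l; last lra.
  by apply: Rmult_le_pos; lra.
pose e (l : 'I_(n + n)) (x : option 'I_n -> R) := match split l with inl _ => 0 | inr j => q j - q' j end.
have He l : PS r (e l) d.
  rewrite /e; case: (split l) => j; first by apply: AN_le (AN_zero _ _ _ [::]) _.
  by apply: AN_le (@PS_const _ _ _) _.
have H : PS r (fun x => Fq f q' (fun l => slc i l x + e l x) - Fq f q' (fun l => slc i l x)) (d * (2 / (4 * r)) * B).
  apply: PS_diffPS => //; try lra.
    by move=> l; apply: AN_le (slc_PS i l) _; lra.
  by move=> l; apply: AN_le (PS_add _ (slc_PS i l) (He l)) _; lra.
apply: AN_le (AN_ext _ H) _ => [x _|]; last first.
  have -> : d * (2 / (4 * r)) * B = / 4 * (2 * B / r * d) by field; lra.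
  have : 0 <= 2 * B / r * d by apply: Rmult_le_pos => //; apply: Rmult_le_pos; lra.
  lra.
rewrite !slice_Fq; congr (_ - _).
rewrite /Fq; congr f; apply: functional_extensionality => j.
  rewrite /lpart /e; case: splitP => l E; first by ring.
  by have := ltn_ord j; rewrite [X in (X < _)%N]E ltnNge leq_addr.
rewrite /rpart /e; case: splitP => l E; first by have := ltn_ord l; rewrite -E ltnNge leq_addr.
have -> : j = l by apply: val_inj; apply: (@addnI n).
ring.
Qed.

Lemma slice_per i q z x : is_int_vec z -> slice i (vadd q z) x = slice i q x.
Proof.
move=> hz; rewrite /slice -[RHS](fper _ _ hz); congr f; apply: functional_extensionality => j.
by rewrite /vadd; ring.
Qed.

Let term i k phi q x := slice i q x * cosk k phi q.
Let lipc k := 2 * B / r + 2 * PI * knorm k * B.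

Let lipc0 k : 0 <= lipc k.
Proof.
have ir : 0 < / r by apply: Rinv_0_lt_compat.
have pi0 := PI_RGT_0; have k0 := knorm_ge0 k.
apply: Rplus_le_le_0_compat; first by apply: Rmult_le_pos; lra.
by apply: Rmult_le_pos; [apply: Rmult_le_pos; lra | lra].
Qed.

Let term_PS i k phi q : PS r (term i k phi q) B.
Proof.
apply: AN_le (AN_ext _ (AN_scal (cosk k phi q) (slice_PS i q))) _ => [x _|]; first by rewrite /term; ring.
by have := cosk_bound k phi q; nra.
Qed.

Let term_per i k phi q z x : is_int_vec z -> term i k phi (vadd q z) x = term i k phi q x.
Proof. by move=> hz; rewrite /term slice_per // cosk_per. Qed.

Let term_lip i k phi q q' d : (forall j, Rabs (q j - q' j) <= d) ->
  PS r (fun x => term i k phi q x - term i k phi q' x) (lipc k * d).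
Proof.
move=> Hd.
have h1 := AN_scal (cosk k phi q) (slice_lip i Hd).
have h2 := AN_scal (cosk k phi q - cosk k phi q') (slice_PS i q').
apply: AN_le (AN_ext _ (AN_add (wtr (I := _)) [::] h1 h2)) _ => [x _|]; first by rewrite /term; ring.
have := cosk_bound k phi q; have := cosk_lip k phi Hd; have := AN_ge0 (wtr (I := _)) (slice_lip i Hd).
by rewrite /lipc; nra.
Qed.

(** Phase 0 gives the cosine coefficient and phase [- PI / 2] the sine coefficient. *)
Definition fourier k (phi : R) (p : vec n) : R := mean (fun q => f p q * cosk k phi q).

Lemma slice0 i q p : slice i q (pt p 0) = f p q.
Proof. by rewrite /slice /pt; congr f; apply: functional_extensionality => j; case: eqP => _; ring. Qed.

Let pt_dom p t : domw r p -> Rabs t <= r -> domw r (pt p t).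
Proof. by move=> Hp Ht [j|] /=; [apply: Hp | lra]. Qed.

Lemma fourier_is_mean (i : 'I_n) k phi p : domw r p -> is_mean (fun q => f p q * cosk k phi q) (fourier k phi p).
Proof.
move=> Hp.
have Hd : domw r (pt p 0) by apply: pt_dom => //; rewrite Rabs_R0; lra.
have := mean_exists [::] (wtr (I := _)) (evr (I := _)) (lipc0 k) (@term_per i k phi) (@term_lip i k phi) Hd.
have -> : (fun q => term i k phi q (pt p 0)) = (fun q => f p q * cosk k phi q).
  by apply: functional_extensionality => q; rewrite /term slice0.
by [].
Qed.

Arguments fourier_is_mean : clear implicits.
Arguments fourier_is_mean i k phi {p} _.

Let smean i k phi x := mean (fun q => term i k phi q x).

(** The grid is taken so fine that its error is at most [B], the bound of each average. *)
Let smean_PS i k phi : PS r (smean i k phi) (2 * B).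
Proof.
pose M := 4 * lipc k / B.
have M0 : 0 <= M by apply: Rmult_le_pos; [have := lipc0 k; lra | apply: Rlt_le; apply: Rinv_0_lt_compat].
pose N := Z.to_nat (up M).
have HN : M <= INR N.+1.
  have [h _] := archimed M.
  by rewrite S_INR INR_IZR_INZ Z2Nat.id; [lra | apply: le_IZR; lra].
have h1 := mean_AN [::] (wtr (I := _)) (evr (I := _)) (lipc0 k) (@term_per i k phi) (@term_lip i k phi) N.
have h2 := avg_AN [::] (wtr (I := _)) N (@term_PS i k phi).
apply: AN_le (AN_ext _ (AN_add (wtr (I := _)) [::] h1 h2)) _ => [x _|]; first by rewrite /smean; ring.
have Np : 0 < INR N.+1 by apply: lt_0_INR; lia.
have : 4 * lipc k / INR N.+1 <= B; last lra.
apply: (Rmult_le_reg_r (INR N.+1)) => //.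
have -> : 4 * lipc k / INR N.+1 * INR N.+1 = B * M by rewrite /M; field; lra.
by apply: Rmult_le_compat_l; lra.
Qed.

(** The mean is invariant under the shift of [q] by [- t e_i], which moves [t] out of [f] and into
    the cosine. *)
Let smean_pt i k phi p t : domw r p -> Rabs t <= r ->
  smean i k phi (pt p t) = cos (2 * PI * IZR (k i) * t) * fourier k phi p
    + sin (2 * PI * IZR (k i) * t) * fourier k (phi - PI / 2) p.
Proof.
move=> Hp Ht; have Hd := pt_dom Hp Ht; set z := 2 * PI * IZR (k i) * t.
have H1 := mean_exists [::] (wtr (I := _)) (evr (I := _)) (lipc0 k) (@term_per i k phi) (@term_lip i k phi) Hd.
have H2 := @is_mean_shift n (fun q => term i k phi q (pt p t)) (lipc k) (fun j => - (if j == i then t else 0)) _ (lipc0 k).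
have H3 := H2 (smean i k phi (pt p t)) (fun q z hz => @term_per i k phi q z _ hz).
have /H3 {H2}H3 : forall q q' d, (forall j, Rabs (q j - q' j) <= d) -> Rabs (term i k phi q (pt p t) - term i k phi q' (pt p t)) <= lipc k * d.
  by move=> q q' d hd; apply: (PS_sup (@term_lip i k phi q q' d hd) Hd).
have {H1}/H3 H3 := H1.
have H4 := is_mean_plus (is_mean_scal (cos z) (fourier_is_mean i k phi Hp)) (is_mean_scal (sin z) (fourier_is_mean i k (phi - PI / 2) Hp)).
apply: is_mean_unique H3 _; apply: (is_mean_ext _ H4) => q.
rewrite /term /slice /pt.
have -> : (fun j => q j + - (if j == i then t else 0) + (if j == i then t else 0)) = q.
  by apply: functional_extensionality => j; ring.
have -> : cosk k phi (fun j => q j + - (if j == i then t else 0)) = cos z * cosk k phi q + sin z * cosk k (phi - PI / 2) q.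
  have := tev_shift (k, phi) q (fun j => - (if j == i then t else 0)); rewrite /tev /cosk /= => ->.
  have -> : kdot k (fun j => - (if j == i then t else 0)) = - (IZR (k i) * t).
    rewrite /kdot (rsum_ext (G := fun j => (if j == i then 1 else 0) * (- (IZR (k j) * t)))); first by rewrite (rsum_delta (fun j => - (IZR (k j) * t))).
    by move=> j; case: eqP => _; ring.
  have -> : 2 * PI * kdot k q + (phi - PI / 2) = - (PI / 2 - (2 * PI * kdot k q + phi)) by ring.
  rewrite cos_neg cos_shift -/(cos z) (_ : _ + 2 * PI * - (IZR (k i) * t) = (2 * PI * kdot k q + phi) - z); last by rewrite /z; ring.
  by rewrite cos_minus; ring.
change (f (fun j => p j) q) with (f p q); ring.
Qed.

(** One more factor [cosT 0 m] turns the Taylor coefficients of the cosine into those of the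
    hyperbolic cosine. *)
Lemma cosT0_sqr m : 2 * cosT 0 m * cosT 0 m = 1 + (-1) ^ m.
Proof.
rewrite /cosT Rplus_0_l.
have -> : (-1) ^ m = cos (INR m * PI).
  elim: m => [|m IH]; first by rewrite /= Rmult_0_l cos_0.
  by rewrite S_INR Rmult_plus_distr_r Rmult_1_l neg_cos -IH /=; ring.
have -> : INR m * PI = 2 * (INR m * (PI / 2)) by field.
by rewrite cos_2a_cos; ring.
Qed.

(* Comparing even Taylor coefficients in [t] of [smean_pt], the function
   [cosh (2 PI k_i r) * fourier k phi] has norm at most [2 * B]. *)
Lemma fourier_coord i k phi : PS r (fourier k phi) (4 * B * exp (- (2 * PI * r * Rabs (IZR (k i))))).
Proof.
have [g [b [Hg Hb HG]]] := PS_t r0 (smean_PS i k phi).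
pose z := 2 * PI * IZR (k i).
have ser p t : domw r p -> Rabs t <= r / 2 -> is_series (fun m => g m p * t ^ m) (smean i k phi (pt p t)).
  move=> Hp Ht; apply/is_series_lim; apply/is_lim_seq_spec => eps.
  have h0 : is_lim_seq (fun N => 2 * B * (/ 2) ^ N) 0.
    have -> : Finite 0 = Rbar_mult (2 * B) 0 by rewrite /= Rmult_0_r.
    by apply: is_lim_seq_scal_l; apply: is_lim_seq_geom; rewrite Rabs_pos_eq; lra.
  have [N0 HN0] := proj2 (is_lim_seq_spec _ _) h0 eps.
  exists N0 => N hN; have := HN0 N hN; have := HG p t N Hp Ht; rewrite Rabs_minus_sym Rminus_0_r => h1 h2.
  by apply: Rle_lt_trans h1 (Rle_lt_trans _ _ _ (Rle_abs _) h2).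
(* Adding the values at [t] and [- t] removes the sine term; the coefficients are then compared by
   uniqueness of power series. *)
have id p m : domw r p -> g m p * (1 + (-1) ^ m) = 2 * fourier k phi p * (cosT 0 m * (z ^ m / INR (fact m))).
  move=> Hp.
  pose v t := 2 * fourier k phi p * cos (0 + z * t).
  apply: (@ps_unique (fun m => g m p * (1 + (-1) ^ m)) (fun m => 2 * fourier k phi p * (cosT 0 m * (z ^ m / INR (fact m)))) v (r / 2)); first by lra.
    move=> t Ht; have Ht' : Rabs (- t) <= r / 2 by rewrite Rabs_Ropp.
    have -> : v t = smean i k phi (pt p t) + smean i k phi (pt p (- t)).
      rewrite !smean_pt //; try lra.
      have -> : 2 * PI * IZR (k i) * - t = - (z * t) by rewrite /z; ring.
      by rewrite cos_neg sin_neg -/z /v Rplus_0_l; ring.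
    apply: is_series_ext (is_series_plusR (ser p t Hp Ht) (ser p (- t) Hp Ht')) => l.
    have -> : (- t) ^ l = (-1) ^ l * t ^ l by rewrite -Rpow_mult_distr; congr (_ ^ l); ring.
    have e : g l p * t ^ l + g l p * ((-1) ^ l * t ^ l) = g l p * (1 + (-1) ^ l) * t ^ l by ring.
    exact: e.
  move=> t _; have h := @is_series_scalR (2 * fourier k phi p) _ _ (cos_series 0 (z * t)).
  apply: (is_series_ext _ _ _ _ h) => l; rewrite Rpow_mult_distr /Rdiv.
  have e : 2 * fourier k phi p * (cosT 0 l * (z ^ l * t ^ l * / INR (fact l))) = 2 * fourier k phi p * (cosT 0 l * (z ^ l * / INR (fact l))) * t ^ l by ring.
  exact: e.
pose Z := 2 * PI * r * Rabs (IZR (k i)).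
have Z0 : 0 <= Z.
  have pi0 := PI_RGT_0; apply: Rmult_le_pos; last exact: Rabs_pos.
  by apply: Rmult_le_pos; lra.
(* [sg] is the sign of [k i], which makes the exponent [Z] nonnegative. *)
have [sg [Hsg Esg]] : exists sg, Rabs sg <= 1 /\ sg * z * r = Z.
  have pi0 := PI_RGT_0; rewrite /Z /z; case: (Rcase_abs (IZR (k i))) => h.
    by exists (-1); rewrite (Rabs_left (IZR (k i))) // (Rabs_left (-1)); lra.
  exists 1; rewrite Rabs_R1 (Rabs_right _ h); split; [exact: Rle_refl | by ring].
(* The even coefficients, reweighted, are summed at [t = r], where their bounds [b m * r ^ m] are
   summable. *)
have H : PS r (fun p => (exp Z + exp (- Z)) * fourier k phi p) (4 * B).
  apply: (AN_series (G := fun m p => (Z ^ m / INR (fact m) + (- Z) ^ m / INR (fact m)) * fourier k phi p) (b := fun m => 2 * (b m * r ^ m))).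
  - move=> m.
    apply: AN_le (AN_ext _ (AN_scal (cosT 0 m * sg ^ m * r ^ m * (1 + (-1) ^ m)) (Hg m))) _ => [p Hp|].
      rewrite (_ : _ * g m p = cosT 0 m * sg ^ m * r ^ m * (g m p * (1 + (-1) ^ m))); last ring.
      rewrite id // (_ : - Z = (-1) * Z); last ring.
      rewrite (Rpow_mult_distr (-1)) -Esg (Rpow_mult_distr (sg * z)) (Rpow_mult_distr sg).
      have -> : cosT 0 m * sg ^ m * r ^ m * (2 * fourier k phi p * (cosT 0 m * (z ^ m / INR (fact m)))) =
        (2 * cosT 0 m * cosT 0 m) * (sg ^ m * z ^ m * r ^ m / INR (fact m)) * fourier k phi p by rewrite /Rdiv; ring.
      by rewrite cosT0_sqr /Rdiv; ring.
    have b0 : 0 <= b m by exact: (AN_ge0 (@wtr _) (Hg m)).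
    have rm : 0 < r ^ m by apply: pow_lt.
    rewrite !Rabs_mult (Rabs_pos_eq (r ^ m)); last lra.
    have h1 := cosT_bound 0 m.
    have h2 : Rabs (sg ^ m) <= 1 by rewrite -RPow_abs -(pow1 m); apply: pow_incr; split => //; apply: Rabs_pos.
    have h3 : Rabs (1 + (-1) ^ m) <= 2.
      apply: Rle_trans (Rabs_triang _ _) _; rewrite Rabs_R1 pow_1_abs; lra.
    have h4 : Rabs (cosT 0 m) * Rabs (sg ^ m) <= 1.
      rewrite -(Rmult_1_r 1); apply: Rmult_le_compat => //; apply: Rabs_pos.
    have h5 : Rabs (cosT 0 m) * Rabs (sg ^ m) * r ^ m * Rabs (1 + (-1) ^ m) <= 1 * r ^ m * 2.
      apply: Rmult_le_compat => //; [|exact: Rabs_pos | apply: Rmult_le_compat_r; lra].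
      by apply: Rmult_le_pos; [apply: Rmult_le_pos; apply: Rabs_pos | lra].
    by have := Rmult_le_compat_r _ _ _ b0 h5; lra.
  - by move=> N; rewrite sum_scalR; have := Hb N; lra.
  - move=> p Hp; apply: is_series_scalrR; apply: is_series_plusR; exact: exp_series.
have e0 := exp_pos Z; have e1 := exp_pos (- Z).
apply: AN_le (AN_ext _ (AN_scal (/ (exp Z + exp (- Z))) H)) _ => [p _|].
  by rewrite -Rmult_assoc Rinv_l ?Rmult_1_l //; lra.
rewrite Rabs_pos_eq; last by apply: Rlt_le; apply: Rinv_0_lt_compat; lra.
rewrite Rmult_comm; apply: Rmult_le_compat_l; first lra.
rewrite -/Z {2}exp_Ropp; apply: Rinv_le_contravar => //; lra.
Qed.

(** Some coordinate of [k] carries at least the fraction [1 / n] of its norm. *)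
Lemma fourier_decay k phi : (0 < n)%N ->
  PS r (fourier k phi) (4 * B * exp (- (2 * PI * r / INR n * knorm k))).
Proof.
move=> n0; have nR : 0 < INR n by apply: lt_0_INR; apply/ltP.
have pi0 := PI_RGT_0.
have [i Hi] : exists i, knorm k <= INR n * Rabs (IZR (k i)).
  apply: NNPP => H.
  have Hi i : INR n * Rabs (IZR (k i)) < knorm k by apply: Rnot_le_lt => h; apply: H; exists i.
  have : INR n * knorm k <= INR n * knorm k - 0 by lra.
  have h : rsum (fun i => INR n * Rabs (IZR (k i))) = INR n * knorm k by rewrite rsum_scal.
  pose i0 := Ordinal n0.
  have : rsum (fun i => knorm k - INR n * Rabs (IZR (k i))) = 0.
    by rewrite rsum_minus rsum_const h; ring.
  have := @rsum_ge_term n (fun i => knorm k - INR n * Rabs (IZR (k i))) i0.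
  move=> /(_ (fun i => ltac:(by have := Hi i; lra))) /=; have := Hi i0; lra.
apply: AN_le (fourier_coord i k phi) _; apply: Rmult_le_compat_l; first lra.
apply: exp_le; apply: Ropp_le_contravar.
have -> : 2 * PI * r * Rabs (IZR (k i)) = 2 * PI * r / INR n * (INR n * Rabs (IZR (k i))) by field; lra.
apply: Rmult_le_compat_l => //; apply: Rlt_le; apply: Rdiv_lt_0_compat => //.
by apply: Rmult_lt_0_compat; lra.
Qed.

End FourierDecay.
#[global] Arguments fourier_is_mean : clear implicits.
#[global] Arguments fourier_is_mean {n f} fper {r B} r0 B0 HFq i k phi {p} _.

(** * Uniqueness of Fourier coefficients by the Fejér kernel *)

Section TrigUniqueness.
Variable n : nat.
Implicit Types (k l : 'I_n -> Z) (q x y : vec n).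

Definition kronecker k : R := if [forall i, Z.eqb (k i) 0] then 1 else 0.

Lemma kronecker_ge0 k : 0 <= kronecker k.
Proof. by rewrite /kronecker; case: ifP => _; lra. Qed.

Lemma is_mean_cosk k p : is_mean (cosk k p) (kronecker k * cos p).
Proof.
rewrite /kronecker; case: forallP => h.
  by rewrite Rmult_1_l; apply: is_mean_cos0 => i; apply/Z.eqb_eq; apply: h.
have [i hi] : exists i, k i <> 0%Z by apply: NNPP => H; apply: h => i; apply/Z.eqb_eq; apply: NNPP => h; apply: H; exists i.
by rewrite Rmult_0_l; apply: is_mean_cos hi.
Qed.

Lemma is_mean_coskM k l p p' : is_mean (fun q => cosk k p q * cosk l p' q)
  (/ 2 * (kronecker (fun i => k i + l i)%Z * cos (p + p') + kronecker (fun i => k i - l i)%Z * cos (p - p'))).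
Proof.
have H := is_mean_scal (/ 2) (is_mean_plus (@is_mean_cosk (fun i => k i + l i)%Z (p + p')) (@is_mean_cosk (fun i => k i - l i)%Z (p - p'))).
apply: (is_mean_ext _ H) => q; rewrite /cosk kdot_addl kdot_subl.
set a := 2 * PI * kdot k q + p; set b := 2 * PI * kdot l q + p'.
have -> : 2 * PI * (kdot k q + kdot l q) + (p + p') = a + b by rewrite /a /b; ring.
have -> : 2 * PI * (kdot k q - kdot l q) + (p - p') = a - b by rewrite /a /b; ring.
by rewrite cos_plus cos_minus; field.
Qed.

(** [1 - cos (2 PI t) = 2 sin^2 (PI t)], and the cubic lower bound gives [sin a >= a / 3] on
    [[0, 2]]. *)
Lemma sqr_le_1_minus_cos t : Rabs t <= / 2 -> t ^ 2 <= 1 - cos (2 * PI * t).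
Proof.
move=> ht; have pi3 : 3 < PI by have := PI2_3_2; rewrite /PI; lra.
have pi4 := PI_4.
have -> : cos (2 * PI * t) = cos (2 * (PI * Rabs t)).
  rewrite /Rabs; case: (Rcase_abs t) => _; last by congr cos; ring.
  by rewrite -cos_neg; congr cos; ring.
rewrite cos_2a_sin -pow2_abs; set u := Rabs t; have u0 : 0 <= u by apply: Rabs_pos.
have h0 : 0 <= PI * u by apply: Rmult_le_pos; lra.
have h2 : PI * u <= 2 by rewrite -/u in ht; nra.
have := proj1 (sin_bound (PI * u) 0 h0 ltac:(lra)).
rewrite /sin_approx /sin_term /=; set a := PI * u => hs.
have ha : a / 3 <= sin a by rewrite -/a in h0 h2; nra.
have hu : u <= a / 3 by rewrite /a; nra.
have : u <= sin a by lra.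
nra.
Qed.

Section Fejer.
Variables (M : nat) (x : vec n).
Local Notation T := {ffun 'I_n -> 'I_M.+1}.

Definition fdiff (a b : T) : 'I_n -> Z := fun i => (Z.of_nat (a i) - Z.of_nat (b i))%Z.
Definition cosx k q := cosk k (- (2 * PI * kdot k x)) q.
(** The Fejér kernel centred at [x], written as a sum over pairs of points of a box, so that its
    coefficients are counts of pairs. *)
Definition fejer q := / INR #|{: T}| * \big[Rplus/0]_(a : T) \big[Rplus/0]_(b : T) cosx (fdiff a b) q.

Let Tpos : 0 < INR #|{: T}|. Proof. exact: card_pos. Qed.

Lemma cosxE k q : cosx k q = cos (2 * PI * kdot k (fun i => q i - x i)).
Proof.
rewrite /cosx /cosk; congr cos.
have -> : kdot k (fun i => q i - x i) = kdot k q - kdot k x.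
  by rewrite /kdot -rsum_minus; apply: rsum_ext => i; ring.
ring.
Qed.

(** The double sum is the squared modulus of an exponential sum over the box. *)
Lemma fejer_ge0 q : 0 <= fejer q.
Proof.
apply: Rmult_le_pos; first by apply: Rlt_le; apply: Rinv_0_lt_compat.
pose w (a : T) := 2 * PI * kdot (fun i => Z.of_nat (a i)) (fun i => q i - x i).
have -> : \big[Rplus/0]_(a : T) \big[Rplus/0]_(b : T) cosx (fdiff a b) q =
  (\big[Rplus/0]_(a : T) cos (w a)) * (\big[Rplus/0]_(a : T) cos (w a)) +
  (\big[Rplus/0]_(a : T) sin (w a)) * (\big[Rplus/0]_(a : T) sin (w a)).
  rewrite !big_distrl /= -big_split /=; apply: eq_bigr => a _.
  rewrite !big_distrr /= -big_split /=; apply: eq_bigr => b _.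
  rewrite cosxE -cos_minus /w; congr cos.
  by rewrite -Rmult_minus_distr_l -kdot_subl.
nra.
Qed.

Lemma is_mean_cosx k : is_mean (cosx k) (kronecker k).
Proof.
have H := @is_mean_cosk k (- (2 * PI * kdot k x)).
suff <- : kronecker k * cos (- (2 * PI * kdot k x)) = kronecker k by [].
rewrite /kronecker; case: forallP => h; last by rewrite Rmult_0_l.
rewrite /kdot rsum_0 ?Rmult_0_r ?Ropp_0 ?cos_0; first ring.
by move=> i; have /Z.eqb_eq -> := h i; ring.
Qed.

Arguments is_mean_cosx : clear implicits.

Lemma fdiff_eq0 a b : kronecker (fdiff a b) = if a == b then 1 else 0.
Proof.
rewrite /kronecker; case: eqP => [->|ne]; first by have -> : [forall i, Z.eqb (fdiff b b i) 0] by apply/forallP => i; apply/Z.eqb_eq; rewrite /fdiff; lia.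
case: forallP => h //; case: ne; apply/ffunP => i; apply: val_inj.
have /Z.eqb_eq := h i; rewrite /fdiff /=; move: (nat_of_ord (a i)) (nat_of_ord (b i)) => u v; lia.
Qed.

Lemma fejer_mean : is_mean fejer 1.
Proof.
have H := is_mean_scal (/ INR #|{: T}|) (is_mean_big (index_enum T) predT
  (fun a => is_mean_big (index_enum T) predT (fun b => is_mean_cosx (fdiff a b)))).
suff -> : 1 = / INR #|{: T}| * \big[Rplus/0]_(a : T) \big[Rplus/0]_(b : T) kronecker (fdiff a b) by [].
rewrite (eq_bigr (fun _ => 1)); first by rewrite big_const_R Rmult_1_r Rinv_l //; lra.
move=> a _; rewrite (bigD1 a) //= fdiff_eq0 eqxx big1 ?Rplus_0_r // => b /negbTE ne.
by rewrite fdiff_eq0 eq_sym ne.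
Qed.

Definition eZ (i : 'I_n) : 'I_n -> Z := fun j => if j == i then 1%Z else 0%Z.

Lemma kdot_eZ i y : kdot (eZ i) y = y i.
Proof.
rewrite /kdot (rsum_ext (G := fun j => (if j == i then 1 else 0) * y j)); first by rewrite (rsum_delta y).
by move=> j; rewrite /eZ; case: eqP.
Qed.

(** The indicator is a product over the coordinates, so the count factorizes; the layer fixed by
    coordinate [i] is one out of [M + 1]. *)
Lemma count_coord (i : 'I_n) (c : 'I_M.+1) :
  INR M.+1 * \big[Rplus/0]_(b : T) (if b i == c then 1 else 0) = INR #|{: T}|.
Proof.
pose F (j : 'I_n) (z : 'I_M.+1) := if j == i then (if z == c then 1 else 0) else 1.
have E (b : T) : (if b i == c then 1 else 0) = \big[Rmult/1]_j F j (b j).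
  rewrite (bigD1 i) //= big1; first by rewrite /F eqxx; ring.
  by move=> j /negbTE ne; rewrite /F ne.
rewrite (eq_bigr _ (fun b _ => E b)) -bigA_distr_bigA.
have -> : INR #|{: T}| = \big[Rmult/1]_(j < n) \big[Rplus/0]_(z < M.+1) 1.
  rewrite (bigA_distr_bigA (fun _ _ => 1)) -[LHS]Rmult_1_r -big_const_R.
  by apply: eq_bigr => b _; rewrite big1.
rewrite (bigD1 i) // [RHS](bigD1 i) // -Rmult_assoc; congr (_ * _).
  rewrite (bigD1 c) // /F eqxx eqxx big1; last by move=> z /andP [_ /negbTE ->].
  by rewrite big_const_R card_ord; congr (_ * _); apply: Rplus_0_r.
by apply: eq_bigr => j /= /negbTE ne; rewrite /F ne.
Qed.

(** Unless [b] is on the upper face, its neighbour [b + e_i] lies in the box and contributes 1. *)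
Lemma fdiff_succ (i : 'I_n) (b : T) : (b i != ord_max) ->
  1 <= \big[Rplus/0]_(a : T) kronecker (fun j => fdiff a b j - eZ i j)%Z.
Proof.
move=> ne; have lt : ((b i).+1 < M.+1)%N.
  by rewrite ltn_neqAle ltn_ord andbT; apply: contra ne => /eqP E; apply/eqP; apply: val_inj; case: E.
pose a : T := [ffun j => if j == i then Ordinal lt else b j].
rewrite (bigD1 a) //=.
have -> : kronecker (fun j => fdiff a b j - eZ i j)%Z = 1.
  rewrite /kronecker; have -> // : [forall j, Z.eqb (fdiff a b j - eZ i j) 0].
  apply/forallP => j; apply/Z.eqb_eq; rewrite /fdiff /eZ ffunE; case: eqP => [->|_]; first rewrite [nat_of_ord (Ordinal lt)]/=.
    by move: (nat_of_ord (b i)) => u; lia.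
  by move: (nat_of_ord (b j)) => u; lia.
by rewrite -{1}[1]Rplus_0_r; apply: Rplus_le_compat_l; apply: big_ge0 => a' _; apply: kronecker_ge0.
Qed.

Lemma fdiff_pred (i : 'I_n) (b : T) : (b i != ord0) ->
  1 <= \big[Rplus/0]_(a : T) kronecker (fun j => fdiff a b j + eZ i j)%Z.
Proof.
move=> ne; have lt : ((b i).-1 < M.+1)%N by apply: leq_ltn_trans (leq_pred _) (ltn_ord _).
have b0 : (0 < b i)%N by rewrite lt0n; apply: contra ne => /eqP E; apply/eqP; apply: val_inj.
pose a : T := [ffun j => if j == i then Ordinal lt else b j].
rewrite (bigD1 a) //=.
have -> : kronecker (fun j => fdiff a b j + eZ i j)%Z = 1.
  rewrite /kronecker; have -> // : [forall j, Z.eqb (fdiff a b j + eZ i j) 0].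
  apply/forallP => j; apply/Z.eqb_eq; rewrite /fdiff /eZ ffunE; case: eqP => [->|_]; first rewrite [nat_of_ord (Ordinal lt)]/=.
    by move: b0; move: (nat_of_ord (b i)) => u /ltP; lia.
  by move: (nat_of_ord (b j)) => u; lia.
by rewrite -{1}[1]Rplus_0_r; apply: Rplus_le_compat_l; apply: big_ge0 => a' _; apply: kronecker_ge0.
Qed.

(** Concentration at [x]: the mean is half the proportion of box points having a neighbour [b + e_i]
    plus half that of points having [b - e_i], and on each side only one layer out of [M + 1] lacks
    it. *)
Lemma fejer_cos_mean i : exists m, is_mean (fun q => fejer q * cosx (eZ i) q) m /\ 1 - / INR M.+1 <= m.
Proof.
pose ph k := - (2 * PI * kdot k x).
pose v (a b : T) := / 2 * (kronecker (fun j => fdiff a b j + eZ i j)%Z + kronecker (fun j => fdiff a b j - eZ i j)%Z).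
have Hv a b : is_mean (fun q => cosx (fdiff a b) q * cosx (eZ i) q) (v a b).
  have H1 := is_mean_scal (/ 2) (is_mean_plus (is_mean_cosx (fun j => fdiff a b j + eZ i j)%Z) (is_mean_cosx (fun j => fdiff a b j - eZ i j)%Z)).
  apply: (is_mean_ext _ H1) => q; rewrite !cosxE kdot_addl kdot_subl (Rmult_plus_distr_l (2 * PI)) (Rmult_minus_distr_l (2 * PI)).
  by rewrite cos_plus cos_minus; field.
have H := is_mean_scal (/ INR #|{: T}|) (is_mean_big (index_enum T) predT
  (fun b => is_mean_big (index_enum T) predT (fun a => Hv a b))).
eexists; split.
  apply: (is_mean_ext _ H) => q.
  rewrite /fejer exchange_big /= Rmult_assoc; congr (_ * _).
  by rewrite big_distrl /=; apply: eq_bigr => b _; rewrite big_distrl.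
have Mp : 0 < INR M.+1 by apply: lt_0_INR; lia.
pose lo (b : T) := / 2 * ((1 - (if b i == ord0 then 1 else 0)) + (1 - (if b i == ord_max then 1 else 0))).
have Hlo b : lo b <= \big[Rplus/0]_(a : T) v a b.
  rewrite /v -big_distrr /= big_split /=; apply: Rmult_le_compat_l; first lra.
  apply: Rplus_le_compat.
    case: eqP => E; last by rewrite Rminus_0_r; apply: fdiff_pred; apply/eqP.
    by rewrite Rminus_diag; apply: big_ge0 => a _; apply: kronecker_ge0.
  case: eqP => E; last by rewrite Rminus_0_r; apply: fdiff_succ; apply/eqP.
  by rewrite Rminus_diag; apply: big_ge0 => a _; apply: kronecker_ge0.
apply: (Rle_trans _ (/ INR #|{: T}| * \big[Rplus/0]_(b : T) lo b)); last first.
  apply: Rmult_le_compat_l; first by apply: Rlt_le; apply: Rinv_0_lt_compat.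
  by apply: big_le => b _; apply: Hlo.
have c0 := count_coord i ord0; have c1 := count_coord i ord_max.
rewrite /lo -big_distrr big_split.
have E c : \big[Rplus/0]_(b : T) (1 - (if b i == c then 1 else 0)) = INR #|{: T}| - INR #|{: T}| / INR M.+1.
  have -> : INR #|{: T}| / INR M.+1 = \big[Rplus/0]_(b : T) (if b i == c then 1 else 0).
    by rewrite -(count_coord i c); field; lra.
  rewrite -[X in X - _]Rmult_1_r -big_const_R.
  rewrite (eq_bigr (fun b : T => 1 + (-1) * (if b i == c then 1 else 0))); last by move=> b _; ring.
  by rewrite big_split /= -big_distrr /=; ring.
rewrite (E ord0) (E ord_max); apply: Req_le.
have -> : 1 - / INR M.+1 = / INR #|{: T}| * (/ 2 * ((INR #|{: T}| - INR #|{: T}| / INR M.+1) + (INR #|{: T}| - INR #|{: T}| / INR M.+1))) by field; lra.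
by [].
Qed.

End Fejer.

Lemma nearest_int (u : R) : exists m : Z, Rabs (u - IZR m) <= / 2.
Proof.
have [h1 h2] := base_Int_part (u + / 2); exists (Int_part (u + / 2)).
apply/Rabs_le; lra.
Qed.

(* If [d x > 0], then [d >= d x / 2 - C * sum_i (1 - cos (2 PI (q_i - x_i)))]; testing this against
   the Fejér kernel centred at [x] contradicts the vanishing of the means. *)
Lemma trig_le0 (d : vec n -> R) L : 0 <= L -> periodic d ->
  (forall q q' e, (forall i, Rabs (q i - q' i) <= e) -> Rabs (d q - d q') <= L * e) ->
  (forall l p, is_mean (fun q => d q * cosk l p q) 0) -> forall x, d x <= 0.
Proof.
move=> L0 dper dlip dz x; apply: Rnot_lt_le => a0; set a := d x in a0.
(* From [L w <= a / 2 + L^2 w^2 / (2 a)], with [w] bounding the distance from [q] to [x] modulo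
   integers. *)
pose C := L ^ 2 / (2 * a).
have C0 : 0 <= C by apply: Rmult_le_pos; [nra | apply: Rlt_le; apply: Rinv_0_lt_compat; lra].
have low q : a / 2 - C * rsum (fun i => 1 - cosx x (eZ i) q) <= d q.
  have [m Hm] := choiceE (fun i => nearest_int (q i - x i)).
  have -> : d q = d (fun i => q i - IZR (m i)).
    rewrite -(dper (fun i => q i - IZR (m i)) (fun i => IZR (m i))); last by move=> i; exists (m i).
    by congr d; apply: functional_extensionality => i; rewrite /vadd; ring.
  pose S := rsum (fun i => 1 - cosx x (eZ i) q).
  have Hs i : (q i - IZR (m i) - x i) ^ 2 <= 1 - cosx x (eZ i) q.
    have -> : q i - IZR (m i) - x i = q i - x i - IZR (m i) by ring.
    apply: Rle_trans (sqr_le_1_minus_cos (Hm i)) _; right; congr (1 - _).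
    rewrite cosxE kdot_eZ -(cos_2PI_Z (2 * PI * (q i - x i - IZR (m i))) (m i)); congr cos; ring.
  have Hn i : 0 <= 1 - cosx x (eZ i) q by have := Hs i; have := pow2_ge_0 (q i - IZR (m i) - x i); lra.
  have S0 : 0 <= S by apply: rsum_ge0.
  have He i : Rabs (q i - IZR (m i) - x i) <= sqrt S.
    rewrite -sqrt_Rsqr_abs; apply: sqrt_le_1_alt; rewrite Rsqr_pow2.
    by apply: Rle_trans (Hs i) _; apply: (rsum_ge_term (F := fun i => 1 - cosx x (eZ i) q)).
  have := dlip _ _ _ He; rewrite -/a => h1.
  have h2 : L * sqrt S <= a / 2 + C * S.
    rewrite /C; set w := sqrt S; have -> : S = w ^ 2 by rewrite /w /= Rmult_1_r sqrt_sqrt.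
    apply: (Rmult_le_reg_l (2 * a)); first lra.
    have -> : 2 * a * (a / 2 + L ^ 2 / (2 * a) * w ^ 2) = a ^ 2 + L ^ 2 * w ^ 2 by field; lra.
    have := pow2_ge_0 (a - L * w); nra.
  have := proj1 (Rabs_le_between _ _) h1; rewrite -/S; lra.
(* Large enough for [C n / (M + 1) < a / 2], which contradicts the test against the kernel. *)
have [M HM] : exists M : nat, 2 * C * INR n / a < INR M.
  have [h1 h2] := archimed (2 * C * INR n / a).
  have h3 : 0 <= 2 * C * INR n / a.
    apply: Rmult_le_pos; last by apply: Rlt_le; apply: Rinv_0_lt_compat.
    by apply: Rmult_le_pos; [lra | apply: pos_INR].
  exists (Z.to_nat (up (2 * C * INR n / a))).
  by rewrite (INR_IZR_INZ (Z.to_nat _)) Z2Nat.id; [lra | apply: le_IZR; lra].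
have Mp : 0 < INR M.+1 by apply: lt_0_INR; lia.
have [mc Hmc] := choiceE (fejer_cos_mean M x).
have z0 : is_mean (fun q => fejer M x q * d q) 0.
  have H := is_mean_scal (/ INR #|{ffun 'I_n -> 'I_M.+1}|)
    (is_mean_big (index_enum {ffun 'I_n -> 'I_M.+1}) predT (fun a =>
      is_mean_big (index_enum {ffun 'I_n -> 'I_M.+1}) predT (fun b => dz (fdiff a b) (- (2 * PI * kdot (fdiff a b) x))))).
  have -> : 0 = / INR #|{ffun 'I_n -> 'I_M.+1}| * \big[Rplus/0]_(a : {ffun 'I_n -> 'I_M.+1}) \big[Rplus/0]_(b : {ffun 'I_n -> 'I_M.+1}) 0.
    by rewrite big1 ?Rmult_0_r // => b _; rewrite big1.
  apply: (is_mean_ext _ H) => q.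
  rewrite /fejer Rmult_assoc; congr (_ * _); rewrite big_distrl /=; apply: eq_bigr => b _.
  by rewrite big_distrl /=; apply: eq_bigr => c _; rewrite Rmult_comm.
have z1 := is_mean_plus (is_mean_scal (- (a / 2)) (@fejer_mean M x)) (is_mean_scal C
  (is_mean_big (index_enum 'I_n) predT (fun i => is_mean_minus (@fejer_mean M x) (proj1 (Hmc i))))).
have z2 := is_mean_plus z0 z1.
have : 0 <= 0 + (- (a / 2) * 1 + C * \big[Rplus/0]_(i < n) (1 - mc i)).
  apply: (is_mean_ge0 _ z2) => q.
  have h1 := low q; have h2 := fejer_ge0 M x q.
  have -> : \big[Rplus/0]_(i < n) (fejer M x q - fejer M x q * cosx x (eZ i) q) = fejer M x q * rsum (fun i => 1 - cosx x (eZ i) q).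
    by rewrite -rsum_scal; apply: eq_bigr => i _; ring.
  have := Rmult_le_compat_l _ _ _ h2 h1; nra.
have : \big[Rplus/0]_(i < n) (1 - mc i) <= INR n * / INR M.+1.
  rewrite -rsum_const; apply: big_le => i _; have := proj2 (Hmc i); lra.
move=> h1 h2.
have h3 : C * (INR n * / INR M.+1) < a / 2.
  apply: (Rmult_lt_reg_r (2 * INR M.+1 / a)); first by apply: Rdiv_lt_0_compat; lra.
  have -> : C * (INR n * / INR M.+1) * (2 * INR M.+1 / a) = 2 * C * INR n / a by field; lra.
  have -> : a / 2 * (2 * INR M.+1 / a) = INR M.+1 by field; lra.
  by rewrite S_INR; lra.
have := Rmult_le_compat_l _ _ _ C0 h1; lra.
Qed.

Lemma trig_eq0 (d : vec n -> R) L : 0 <= L -> periodic d ->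
  (forall q q' e, (forall i, Rabs (q i - q' i) <= e) -> Rabs (d q - d q') <= L * e) ->
  (forall l p, is_mean (fun q => d q * cosk l p q) 0) -> forall x, d x = 0.
Proof.
move=> L0 dper dlip dz x; apply: Rle_antisym; first exact: (trig_le0 L0 dper dlip dz).
have h : - d x <= 0; last lra.
apply: (@trig_le0 (fun q => - d q) L L0) => [q k hk|q q' e he|l p]; first by rewrite dper.
  by rewrite (_ : - d q - - d q' = - (d q - d q')) ?Rabs_Ropp; [apply: dlip | ring].
have := is_mean_scal (-1) (dz l p); rewrite Rmult_0_r.
by apply: is_mean_ext => q; ring.
Qed.

End TrigUniqueness.

(** * Fourier inversion for the perturbation *)

Section FourierSum.
Variables (n : nat) (f : vec n -> vec n -> R).
Hypothesis fper : periodic_q f.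
Variables (r B : R).
Hypothesis r0 : 0 < r.
Hypothesis B0 : 0 < B.
Hypothesis HFq : forall q, PS (4 * r) (Fq f q) B.
Hypothesis n0 : (0 < n)%N.
Implicit Types (k l : 'I_n -> Z) (p q : vec n).

Let i0 : 'I_n := Ordinal n0.
Let F := fourier f.

Lemma PS_HF s g b k phi : 0 <= s -> PS r g b -> HF r s (fun x => g x.1 * cosk k phi x.2) (exp (s * knorm k) * b).
Proof.
move=> s0; apply: (AN_map (T := fun g (x : vec n * vec n) => g x.1 * cosk k phi x.2)).
- by move=> a; apply: wtw0; lra.
- exact: Rlt_le (exp_pos _).
- by move=> G h H x Hx; apply: is_series_scalrR; apply: H.
- by move=> c h a H x Hx; rewrite H //; ring.
move=> w; apply: (AN_atom (c := 1) (a := (w, (k, phi)))) => [x _|]; first by rewrite Rmult_1_l.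
by rewrite Rabs_R1 Rmult_1_l Rmult_comm; apply: Rle_refl.
Qed.

(** Both [k] and [- k] will be summed, hence the absence of the factor 2 of the real Fourier
    series. *)
Definition mode k (x : vec n * vec n) :=
  F k 0 x.1 * cosk k 0 x.2 + F k (- (PI / 2)) x.1 * cosk k (- (PI / 2)) x.2.

Let sg := 2 * PI * r / INR n.
Let nR : 0 < INR n. Proof. by apply: lt_0_INR; apply/ltP. Qed.
Let sg0 : 0 < sg.
Proof. by apply: Rdiv_lt_0_compat => //; have := PI_RGT_0 => h; apply: Rmult_lt_0_compat; lra. Qed.

Lemma mode_HF k : HF r (sg / 2) (mode k) (8 * B * exp (- (sg / 2 * knorm k))).
Proof.
have s2 : 0 <= sg / 2 by lra.
have h phi := PS_HF k phi s2 (fourier_decay fper r0 B0 HFq k phi n0).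
apply: AN_le (HF_add (Rlt_le _ _ r0) (h 0) (h (- (PI / 2)))) _.
rewrite -/sg.
have -> : exp (- (sg / 2 * knorm k)) = exp (sg / 2 * knorm k) * exp (- (sg * knorm k)).
  by rewrite -exp_plus; congr exp; field.
by right; ring.
Qed.

Local Notation T N := {ffun 'I_n -> 'I_(2 * N).+1}.
(** Frequencies of sup norm at most [N] are coded by a box of side [2 N + 1]; the shell keeps those
    of norm exactly [N], so each shell is finite and each frequency belongs to one of them. *)
Definition kz N (a : T N) : 'I_n -> Z := fun i => (Z.of_nat (a i) - Z.of_nat N)%Z.
Definition onshell N (a : T N) := [exists i, Z.eqb (Z.abs (kz a i)) (Z.of_nat N)].
Definition shell N x := \big[Rplus/0]_(a : T N | onshell a) mode (kz a) x.

(** The [(2 N + 1)^n] points of the box cost half of the decay rate: with [tau = sg / 8],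
    [exp (tau (2 N + 1))] is [exp tau * exp (sg / 4 * N)]. *)
Lemma shell_bound : exists C, 0 <= C /\ forall N, HF r (sg / 2) (shell N) (C * exp (- (sg / 4)) ^ N).
Proof.
pose tau := sg / 8; have t0 : 0 < tau by rewrite /tau; lra.
pose C := 8 * B * (INR (fact n) / tau ^ n * exp tau).
have tn : 0 < tau ^ n by apply: pow_lt.
have f0 := INR_fact_lt_0 n.
have C0 : 0 <= C.
  apply: Rmult_le_pos; first lra.
  by apply: Rmult_le_pos; [apply: Rdiv_le_0_compat; lra | apply: Rlt_le; apply: exp_pos].
exists C; split => // N.
have H : HF r (sg / 2) (shell N) (\big[Rplus/0]_(a : T N | onshell a) (8 * B * exp (- (sg / 2 * INR N)))).
  rewrite /shell /HF; apply: (AN_big (@h0 n)) => [a|a Ha]; first by apply: hwt0; lra.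
  apply: AN_le (mode_HF (kz a)) _; apply: Rmult_le_compat_l; first lra.
  apply: exp_le; apply: Ropp_le_contravar; apply: Rmult_le_compat_l; first lra.
  have [i /Z.eqb_eq Hi] := existsP Ha.
  apply: Rle_trans (knorm_coord (kz a) i); rewrite -abs_IZR Hi INR_IZR_INZ; exact: Rle_refl.
apply: AN_le H _; set e := exp (- (sg / 2 * INR N)); have e0 : 0 < e := exp_pos _.
apply: (Rle_trans _ (\big[Rplus/0]_(a : T N) (8 * B * e))).
  rewrite big_mkcond; apply: big_le => a _; case: ifP => _; first exact: Rle_refl.
  by apply: Rmult_le_pos; lra.
rewrite big_const_R card_ffun !card_ord.
have -> : INR ((2 * N).+1 ^ n) = INR (2 * N).+1 ^ n by elim: (n) => [//|m IH]; rewrite expnS mult_INR IH.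
have N0 : 0 <= INR (2 * N).+1 by apply: pos_INR.
have h := @pow_fact_le_exp (tau * INR (2 * N).+1) n (Rmult_le_pos _ _ (Rlt_le _ _ t0) N0).
have h1 : INR (2 * N).+1 ^ n <= INR (fact n) / tau ^ n * exp (tau * INR (2 * N).+1).
  apply: (Rmult_le_reg_l (tau ^ n / INR (fact n))); first exact: Rdiv_lt_0_compat.
  have -> : tau ^ n / INR (fact n) * INR (2 * N).+1 ^ n = (tau * INR (2 * N).+1) ^ n / INR (fact n).
    by rewrite Rpow_mult_distr /Rdiv; ring.
  have -> : tau ^ n / INR (fact n) * (INR (fact n) / tau ^ n * exp (tau * INR (2 * N).+1)) = exp (tau * INR (2 * N).+1) by field; lra.
  exact: h.
have E : exp (- (sg / 4)) ^ N = exp (- (sg / 4 * INR N)).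
  elim: (N) => [|m IH]; first by rewrite /= Rmult_0_r Ropp_0 exp_0.
  by rewrite (S_INR m) [LHS]/= IH -exp_plus; congr exp; ring.
rewrite E /C.
have -> : exp (- (sg / 4 * INR N)) = exp (- (sg / 2 * INR N)) * exp (sg / 4 * INR N) by rewrite -exp_plus; congr exp; field.
have E2 : exp (tau * INR (2 * N).+1) = exp tau * exp (sg / 4 * INR N).
  by rewrite -exp_plus S_INR mult_INR; congr exp; rewrite /tau (_ : INR 2 = 2) //; field.
rewrite E2 in h1; rewrite -/e.
have -> : 8 * B * (INR (fact n) / tau ^ n * exp tau) * (e * exp (sg / 4 * INR N)) =
  INR (fact n) / tau ^ n * (exp tau * exp (sg / 4 * INR N)) * (8 * B * e) by ring.
by apply: Rmult_le_compat_r => //; apply: Rmult_le_pos; lra.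
Qed.

Definition fsum x := Series (fun N => shell N x).

Lemma fsum_HF : exists C eta, [/\ HF r (sg / 2) fsum C, is_lim_seq eta 0 &
  forall x K, hdom r x -> Rabs (fsum x - sum_f_R0 (fun N => shell N x) K) <= eta K].
Proof.
have [C [C0 HC]] := shell_bound; set th := exp (- (sg / 4)) in HC.
have t0 : 0 < th := exp_pos _.
have t1 : th < 1 by rewrite -exp_0; apply: exp_increasing; lra.
have bnd D : 0 <= D -> forall N, sum_f_R0 (fun N => D * th ^ N) N <= D / (1 - th).
  move=> D0 N; rewrite sum_scalR; apply: Rmult_le_compat_l => //.
  rewrite tech3; last lra.
  rewrite /Rdiv -[X in _ <= X]Rmult_1_l; apply: Rmult_le_compat_r; first by apply: Rlt_le; apply: Rinv_0_lt_compat; lra.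
  have := pow_lt th N.+1 t0; lra.
have s2 : 0 <= sg / 2 by lra.
have [H1 H2] := AN_Series (fun a x => @hev_hwt n r (sg / 2) a x s2) HC (bnd C C0).
exists (C / (1 - th)), (fun K => C / (1 - th) * th ^ K.+1); split => //.
  have -> : Finite 0 = Rbar_mult (C / (1 - th)) 0 by rewrite /= Rmult_0_r.
  apply: is_lim_seq_scal_l; apply: (proj1 (is_lim_seq_incr_1 (fun K => th ^ K) 0)).
  by apply: is_lim_seq_geom; rewrite Rabs_pos_eq; lra.
move=> x K Hx; have /is_series_lim HS := H2 x Hx.
have HS2 : is_lim_seq (fun M => sum_f_R0 (fun N => shell N x) (K.+1 + M) - sum_f_R0 (fun N => shell N x) K) (fsum x - sum_f_R0 (fun N => shell N x) K).
  apply: is_lim_seq_minus'; last exact: is_lim_seq_const.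
  apply: (is_lim_seq_ext (fun M => sum_f_R0 (fun N => shell N x) (M + K.+1))) => [M|]; first by rewrite addnC.
  by apply: (proj1 (is_lim_seq_incr_n _ K.+1 _)) HS.
apply: (is_series_abs_ub (a := fun m => shell (K.+1 + m) x) (b := fun m => C * th ^ K.+1 * th ^ m)).
- apply/is_series_lim; apply: (is_lim_seq_ext _ _ _ _ HS2) => M.
  have h1 : (K < (K.+1 + M)%N)%coq_nat by rewrite -plusE; lia.
  have h2 : ((K.+1 + M)%N - K.+1)%coq_nat = M by rewrite -plusE; lia.
  by rewrite (tech2 (fun N => shell N x) _ _ h1) h2 Rplus_minus_l.
- move=> m; apply: Rle_trans (AN_sup (fun a x => @hev_hwt n r (sg / 2) a x s2) (HC _) Hx) _.
  by rewrite pow_add; right; ring.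
- move=> M; have := bnd (C * th ^ K.+1) (Rmult_le_pos _ _ C0 (pow_le _ _ (Rlt_le _ _ t0))) M.
  by rewrite /Rdiv => h; apply: Rle_trans h _; right; ring.
Qed.

Lemma fourier_phase k phi p : domw r p ->
  F k phi p = cos phi * F k 0 p - sin phi * F k (- (PI / 2)) p.
Proof.
move=> Hp; have H a := fourier_is_mean fper r0 B0 HFq i0 k a Hp.
apply: is_mean_unique (H phi) _.
apply: (is_mean_ext _ (is_mean_minus (is_mean_scal (cos phi) (H 0)) (is_mean_scal (sin phi) (H (- (PI / 2)))))) => q.
rewrite /cosk Rplus_0_r; set a := 2 * PI * kdot k q.
have -> : a + - (PI / 2) = - (PI / 2 - a) by ring.
by rewrite cos_neg cos_shift cos_plus; ring.
Qed.

Lemma fourier_neg k phi p : F (fun i => - k i)%Z (- phi) p = F k phi p.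
Proof.
rewrite /F /fourier; congr mean; apply: functional_extensionality => q; congr (_ * _).
rewrite /cosk; have -> : kdot (fun i => - k i)%Z q = - kdot k q.
  by rewrite /kdot -rsum_opp; apply: rsum_ext => i; rewrite opp_IZR; ring.
by rewrite -cos_neg; congr cos; ring.
Qed.

Lemma kronecker_eq k l : kronecker (fun i => k i - l i)%Z <> 0 -> k = l.
Proof.
rewrite /kronecker; case: forallP => // h _; apply: functional_extensionality => i.
by have /Z.eqb_eq := h i; lia.
Qed.

(** The frequency [l] is met by the modes [k = l] and [k = - l], each giving half of the
    coefficient. *)
Lemma mode_mean k l phi p : domw r p ->
  is_mean (fun q => mode k (p, q) * cosk l phi q)
    (/ 2 * F l phi p * (kronecker (fun i => k i - l i)%Z + kronecker (fun i => k i - - l i)%Z)).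
Proof.
move=> Hp.
have H := is_mean_plus (is_mean_scal (F k 0 p) (@is_mean_coskM n k l 0 phi))
                       (is_mean_scal (F k (- (PI / 2)) p) (@is_mean_coskM n k l (- (PI / 2)) phi)).
have E2 : (fun i => k i - - l i)%Z = (fun i => k i + l i)%Z by apply: functional_extensionality => i; lia.
rewrite E2 in H *; move: H.
set m := _ + _; set m' := _ * _ => H; suff E : m' = m.
  by rewrite E; apply: (is_mean_ext _ H) => q; rewrite /mode /=; ring.
rewrite /m /m' {m m' H}; set d1 := kronecker (fun i => k i - l i)%Z; set d2 := kronecker (fun i => k i + l i)%Z.
have E1 : d1 * F l phi p = d1 * (cos phi * F k 0 p - sin phi * F k (- (PI / 2)) p).
  case: (Req_dec d1 0) => [->|]; first by ring.
  by move=> /kronecker_eq ->; rewrite fourier_phase.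
have E3 : d2 * F l phi p = d2 * (cos phi * F k 0 p + sin phi * F k (- (PI / 2)) p).
  case: (Req_dec d2 0) => [->|]; first by ring.
  rewrite /d2 -E2 => /kronecker_eq E; rewrite -fourier_neg -E fourier_phase // cos_neg sin_neg; ring.
have -> : / 2 * F l phi p * (d1 + d2) = / 2 * (d1 * F l phi p + d2 * F l phi p) by ring.
rewrite E1 E3 !Rplus_0_l.
have -> : 0 - phi = - phi by ring.
have -> : - (PI / 2) + phi = - (PI / 2 - phi) by ring.
have -> : - (PI / 2) - phi = - (PI / 2 - - phi) by ring.
by rewrite !cos_neg !cos_shift sin_neg; ring.
Qed.

(** [l] is met exactly once, in the shell indexed by its sup norm [L]. *)
Lemma shell_count l K : (forall i, (Z.abs (l i) <= Z.of_nat K)%Z) ->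
  sum_f_R0 (fun N => \big[Rplus/0]_(a : T N | onshell a) kronecker (fun i => kz a i - l i)%Z) K = 1.
Proof.
move=> HK; pose L := (\max_(i < n) Z.abs_nat (l i))%N.
have LK : (L <= K)%N by apply/bigmax_leqP => i _; have := HK i => h; apply/leP; lia.
have Ll i : (Z.abs (l i) <= Z.of_nat L)%Z.
  have /leP h : (Z.abs_nat (l i) <= L)%N by apply: (leq_bigmax (F := fun i => Z.abs_nat (l i))).
  lia.
have [j Hj] : exists j, Z.abs (l j) = Z.of_nat L.
  have [|j E] := @eq_bigmax 'I_n (fun i => Z.abs_nat (l i)); first by rewrite card_ord.
  by exists j; rewrite /L E; lia.
have E N : \big[Rplus/0]_(a : T N | onshell a) kronecker (fun i => kz a i - l i)%Z = (if N == L then 1 else 0) * 1.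
  rewrite Rmult_1_r; case: eqP => [->|ne].
    have lt i : (Z.to_nat (l i + Z.of_nat L) < (2 * L).+1)%N by apply/ltP; rewrite -multE; have := Ll i => h; lia.
    pose a : T L := [ffun i => Ordinal (lt i)].
    have Ea : kz a = l.
      apply: functional_extensionality => i; rewrite /kz ffunE [nat_of_ord _]/= Z2Nat.id; first lia.
      by have := Ll i; lia.
    rewrite (bigD1 a) /=; last by apply/existsP; exists j; apply/Z.eqb_eq; rewrite Ea.
    rewrite big1.
      rewrite Ea /kronecker; have -> : [forall i, Z.eqb (l i - l i) 0] by apply/forallP => i; apply/Z.eqb_eq; lia.
      exact: Rplus_0_r.
    move=> b /andP [_ /negP nb]; apply: NNPP => /kronecker_eq Eb; apply: nb; apply/eqP/ffunP => i; apply: val_inj.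
    by have := f_equal (fun k => k i) (eq_trans Eb (esym Ea)); rewrite /kz /=; move: (nat_of_ord (a i)) (nat_of_ord (b i)) => u v; lia.
  apply: big1 => a Ha; apply: NNPP => /kronecker_eq Ea; apply: ne.
  have [i /Z.eqb_eq Hi] := existsP Ha; rewrite Ea in Hi.
  have h1 := Ll i; have h2 : (Z.abs (l j) <= Z.of_nat N)%Z.
    by rewrite -Ea /kz; have := ltn_ord (a j); move: (nat_of_ord (a j)) => u /ltP; rewrite -multE; lia.
  lia.
rewrite (sum_extR (b := fun N => (if N == L then 1 else 0) * 1) K E) (sum_single 1 (fun _ => 1)) LK; ring.
Qed.

Lemma sum_mean l phi p K : domw r p -> (forall i, (Z.abs (l i) <= Z.of_nat K)%Z) ->
  is_mean (fun q => sum_f_R0 (fun N => shell N (p, q)) K * cosk l phi q) (F l phi p).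
Proof.
move=> Hp HK.
have H N := is_mean_big (index_enum (T N)) (fun a : T N => onshell a) (fun a : T N => @mode_mean (kz a) l phi p Hp).
have := is_mean_sum (K := K) H.
set m := sum_f_R0 _ _; have -> : m = F l phi p.
  pose S l := sum_f_R0 (fun N => \big[Rplus/0]_(a : T N | onshell a) kronecker (fun i => kz a i - l i)%Z) K.
  have -> : m = / 2 * F l phi p * (S l + S (fun i => - l i)%Z).
    rewrite /m /S -plus_sum -sum_scalR; apply: sum_extR => N.
    by rewrite -big_distrr /= big_split.
  rewrite /S !shell_count //; first by field.
  by move=> i; have := HK i; lia.
apply: is_mean_ext => q; rewrite -[RHS]Rmult_comm -sum_scalR; apply: sum_extR => N.
by rewrite /shell big_distrr /=; apply: eq_bigr => a _; rewrite Rmult_comm.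
Qed.

(** At fixed [p], the function and its Fourier sum are periodic, Lipschitz, and have the same means
    against all cosines; [trig_eq0] applies to their difference. *)
Lemma fourier_inversion p q : domw r p -> f p q = fsum (p, q).
Proof.
move=> Hp.
have [C [eta [HC Heta Htail]]] := fsum_HF.
have Hx q' : hdom r (p, q') by [].
have HTA : TA (sg / 4) (fun x => fsum (p, x)) C.
  apply: (TA_ext (g := fun x => fsum (fun i => p i, fun i => x i + 0))) => [x|].
    by congr (fsum (_, _)); apply: functional_extensionality => i; ring.
  apply: (HF_subst (y := 0) _ _ _ HC (P := fun i _ => p i) (u := fun _ _ => 0)); try lra.
    by move=> i; apply: TA_le (TA_const _ _ _) (Hp i).
  by move=> i; apply: TA_zero; lra.
have C0 : 0 <= C by apply: TA_ge0 HTA; lra.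
have ir : 0 < / r by apply: Rinv_0_lt_compat.
pose L := 2 * B / r + 2 * PI / (sg / 4) * C.
have pi0 := PI_RGT_0.
have L1 : 0 <= 2 * B / r by apply: Rmult_le_pos; lra.
have L2 : 0 <= 2 * PI / (sg / 4) * C by apply: Rmult_le_pos => //; apply: Rdiv_le_0_compat; lra.
have H : f p q - fsum (p, q) = 0; last lra.
apply: (@trig_eq0 n (fun q => f p q - fsum (p, q)) L) => [|q1 k hk|q1 q2 e he|l phi].
- by rewrite /L; lra.
- by rewrite fper // (TA_per (g := fun x => fsum (p, x)) q1 HTA hk).
- have e0 : 0 <= e by apply: Rle_trans (Rabs_pos _) (he i0).
  have h1 := TA_lip q2 (v := fun i => q1 i - q2 i) (ltac:(lra) : 0 < sg / 4) HTA e0 he.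
  have h2 := PS_sup (slice_lip r0 B0 HFq i0 he) (x := pt p 0); rewrite !slice0 in h2.
  have E : (fun i => q2 i + (q1 i - q2 i)) = q1 by apply: functional_extensionality => i; ring.
  rewrite E in h1.
  have -> : f p q1 - fsum (p, q1) - (f p q2 - fsum (p, q2)) = (f p q1 - f p q2) - (fsum (p, q1) - fsum (p, q2)) by ring.
  apply: Rle_trans (Rabs_triang _ _) _; rewrite Rabs_Ropp /L Rmult_plus_distr_r.
  apply: Rplus_le_compat; last exact: h1.
  by apply: h2; case=> [j|] /=; [apply: Hp | rewrite Rabs_R0; lra].
- have h1 := fourier_is_mean fper r0 B0 HFq i0 l phi Hp.
  have [K0 HK0] : exists K0 : nat, forall i, (Z.abs (l i) <= Z.of_nat K0)%Z.
    exists (\max_(i < n) Z.abs_nat (l i))%N => i.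
    have /leP h : (Z.abs_nat (l i) <= \max_(i < n) Z.abs_nat (l i))%N by apply: (leq_bigmax (F := fun i => Z.abs_nat (l i))).
    lia.
  have h2 : is_mean (fun q => fsum (p, q) * cosk l phi q) (F l phi p).
    apply: (@is_mean_unif n _ (fun K q => sum_f_R0 (fun N => shell N (p, q)) K * cosk l phi q) eta _ K0) => // [K q1|K hK].
      rewrite -Rmult_minus_distr_r Rabs_mult.
      have := Htail (p, q1) K (Hx q1); have := cosk_bound l phi q1; have := Rabs_pos (cosk l phi q1).
      by have := Rabs_pos (fsum (p, q1) - sum_f_R0 (fun N => shell N (p, q1)) K); nra.
    by apply: sum_mean => // i; have := HK0 i; move/leP: hK; lia.
  have := is_mean_minus h1 h2; rewrite /F Rminus_diag; apply: is_mean_ext => q1; ring.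
Qed.

End FourierSum.

Lemma analytic_HF n (f : vec n -> vec n -> R) : (0 < n)%N -> periodic_q f ->
  (forall q, analytic2_at f (vzero n) q) ->
  exists r s B, [/\ 0 < r, 0 < s & HF r s (fun x => f x.1 x.2) B].
Proof.
move=> n0 fper fan; have [rho [B [rho0 HB]]] := Fq_uniform fper fan.
pose r := rho / 4; have r0 : 0 < r by rewrite /r; lra.
have B1 : 0 <= B by apply: AN_ge0 (HB (vzero n)) => a; apply: wtw0; lra.
have Bp : 0 < B + 1 by lra.
have HFq q : PS (4 * r) (Fq f q) (B + 1).
  by rewrite (_ : 4 * r = rho); [apply: AN_le (HB q) _; lra | rewrite /r; field].
have nR : 0 < INR n by apply: lt_0_INR; apply/ltP.
have pi0 := PI_RGT_0.
have [C [eta [HC _ _]]] := fsum_HF fper r0 Bp HFq n0.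
exists r, (2 * PI * r / INR n / 2), C; split => //.
  apply: Rdiv_lt_0_compat; last lra.
  by apply: Rdiv_lt_0_compat => //; apply: Rmult_lt_0_compat; lra.
by apply: AN_ext HC => -[p q] Hx; apply: (fourier_inversion fper r0 Bp HFq n0).
Qed.

(** * Representation of the Hamiltonian *)

Section Representation.
Variable n : nat.
Implicit Types (F : vec n * vec n -> R).

Lemma HF_mono r r' s s' F B : 0 <= r' <= r -> s' <= s -> HF r s F B -> HF r' s' F B.
Proof.
move=> Hr Hs H; rewrite -[B]Rmult_1_l.
have sub x : hdom r' x -> hdom r x by move=> h i; have := h i; lra.
apply: (AN_map (T := id) _ _ _ _ _ H).
- by move=> a; apply: hwt0; lra.
- lra.
- by move=> G g h x /sub; apply: h.
- by move=> c g a h x /sub; apply: h.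
move=> a; apply: (AN_atom (c := 1) (a := a)) => [x _|]; first by rewrite Rmult_1_l.
rewrite Rabs_R1 !Rmult_1_l; apply: Rmult_le_compat.
- by apply: pow_le; lra.
- exact: twt0.
- exact: pow_incr.
- by apply: exp_le; apply: Rmult_le_compat_r => //; apply: knorm_ge0.
Qed.

Lemma analytic_HF_p (h : vec n -> R) : analytic_at h (vzero n) ->
  exists r B, 0 < r /\ forall s, HF r s (fun x => h x.1) B.
Proof.
move=> /analytic_PS [r [B [r0 HB]]]; exists r, B; split => // s; rewrite -[B]Rmult_1_l.
have {}HB : PS r h B.
  by apply: AN_ext HB => x _; congr h; apply: functional_extensionality => i; rewrite /vzero; ring.
apply: (AN_map (T := fun g (x : vec n * vec n) => g x.1) _ _ _ _ _ HB).
- by move=> a; apply: wtw0; lra.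
- lra.
- by move=> G g H x Hx; apply: H.
- by move=> c g a H x Hx; apply: H.
move=> w; apply: (AN_atom (c := 1) (a := (w, a0 n))) => [x _|]; first by rewrite /hev /= tev0; ring.
by rewrite /hwt twt_a0 Rabs_R1 /wtw /=; lra.
Qed.

(** Taylor's formula from zero momentum at the same angles; it keeps the momentum Hessian near its
    value at [p = 0]. *)
Lemma HF_lip r s F B : 0 < r -> 0 < s -> HF r s F B -> exists C, 0 <= C /\
  forall s' (P u : 'I_n -> vec n -> R) y dl, 0 <= s' -> 0 <= y -> 0 <= dl <= r / 4 ->
    (forall i, TA s' (P i) dl) -> (forall i, TA s' (u i) y) -> s' + 2 * PI * y <= s ->
    TA s' (fun x => F (emb P u x) - F (vzero n, fun i => x i + u i x)) (C * dl).
Proof.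
move=> r0 s0 H; have B0 : 0 <= B by apply: AN_ge0 H => a; apply: hwt0; lra.
have [C1 [_ HT]] := HF_taylor n r0 s0; have [dF [dq [HdF HTy _ _]]] := HT F B H.
have ir : 0 < / r by apply: Rinv_0_lt_compat.
have c1 : 0 <= 4 / r ^ 2 by apply: Rdiv_le_0_compat; [lra | apply: pow_lt].
have c2 : 0 <= 2 / r * B by apply: Rmult_le_pos => //; lra.
exists (4 / r ^ 2 * (r / 4) * B + INR n * (2 / r * B)); split.
  apply: Rplus_le_le_0_compat; last by apply: Rmult_le_pos; [apply: pos_INR|].
  by apply: Rmult_le_pos => //; apply: Rmult_le_pos; lra.
move=> s' P u y dl s'0 y0 Hdl HP Hu Hs.
have H0 i : TA s' (fun _ : vec n => vzero n i) (r / 4) by apply: TA_le (TA_zero n s') _; lra.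
have h1 := HTy s' (fun i _ => vzero n i) P u y dl s'0 y0 Hdl H0 HP Hu Hs.
have h2 i : TA s' (fun x => dF i (vzero n, fun i => x i + u i x)) (2 / r * B).
  apply: (HF_subst s'0 _ y0 (HdF i) (P := fun i _ => vzero n i) _ Hu Hs); first lra.
  by move=> j; apply: TA_le (TA_zero n s') _; lra.
have h3 := TA_rsumc (fun i => TA_mul s'0 (h2 i) (HP i)).
apply: TA_le (TA_ext _ (TA_add h1 h3)) _ => [x|].
  rewrite /emb (_ : (fun i => vzero n i + P i x) = (fun i => P i x)); last by apply: functional_extensionality => i; rewrite /vzero; ring.
  change (fun i => vzero n i) with (vzero n).
  by rewrite /Rminus Rplus_assoc Rplus_opp_l Rplus_0_r.
have -> : (4 / r ^ 2 * (r / 4) * B + INR n * (2 / r * B)) * dl = 4 / r ^ 2 * B * (r / 4 * dl) + INR n * (2 / r * B * dl) by ring.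
have -> : 4 / r ^ 2 * dl ^ 2 * B = 4 / r ^ 2 * B * (dl * dl) by ring.
apply: Rplus_le_compat_r.
apply: Rmult_le_compat_l; first by apply: Rmult_le_pos.
by apply: Rmult_le_compat_r; lra.
Qed.

End Representation.

(** * Analyticity of the lifted angle *)

Section CoordinateAnalytic.
Variable n : nat.
Implicit Types (x y : vec n) (g h : vec n -> R).

Lemma analytic_plus g h x : analytic_at g x -> analytic_at h x -> analytic_at (fun y => g y + h y) x.
Proof.
move=> [c [r [r0 [[B HB] Hc]]]] [d [r' [r'0 [[B' HB'] Hd]]]].
pose rr := Rmin r r'; have rr0 : 0 < rr by apply: Rmin_glb_lt.
have [h1 h2] : rr <= r /\ rr <= r' by split; [apply: Rmin_l | apply: Rmin_r].
exists (fun a => c a + d a), rr; split => //; split.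
  exists (B + B') => N; apply: (Rle_trans _ (sum_f_R0 (fun k => abs_monomials_deg (n := n) k c r) N + sum_f_R0 (fun k => abs_monomials_deg (n := n) k d r') N)); last by have := HB N; have := HB' N; lra.
  rewrite -plus_sum; apply: sum_Rle => k _; rewrite /abs_monomials_deg -big_split /=.
  apply: big_le => a _; have := Rabs_triang (c (fun i => nat_of_ord (a i))) (d (fun i => nat_of_ord (a i))).
  have e1 : rr ^ k <= r ^ k by apply: pow_incr; lra.
  have e2 : rr ^ k <= r' ^ k by apply: pow_incr; lra.
  have e0 : 0 <= rr ^ k by apply: pow_le; lra.
  move=> ht; have := Rmult_le_compat_r _ _ _ e0 ht; rewrite Rmult_plus_distr_r => ht'.
  have := Rmult_le_compat_l _ _ _ (Rabs_pos (c (fun i => nat_of_ord (a i)))) e1.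
  have := Rmult_le_compat_l _ _ _ (Rabs_pos (d (fun i => nat_of_ord (a i)))) e2.
  lra.
move=> y Hy; have /Hc hc : in_ball x r y by move=> i; have := Hy i; lra.
have /Hd hd : in_ball x r' y by move=> i; have := Hy i; lra.
apply: (Un_cv_ext _ _ _ _ (CV_plus _ _ _ _ hc hd)) => N.
rewrite -plus_sum; apply: sum_extR => k; rewrite /monomials_deg -big_split /=.
by apply: eq_bigr => a _; ring.
Qed.

Lemma analytic_coord i x : analytic_at (fun y => y i) x.
(* The lift [theta + u theta] is not periodic, so its linear part lies outside [TA] and gets its own
   expansion, with terms of degree 0 and 1 only. *)
Proof.
pose c (a : 'I_n -> nat) := if [forall j, a j == 0%N] then x i else if [forall j, a j == (j == i)%N] then 1 else 0.
have c2 k (a : {ffun 'I_n -> 'I_k.+1}) : (\sum_(j < n) nat_of_ord (a j))%N == k -> (2 <= k)%N -> c (fun j => nat_of_ord (a j)) = 0.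
  move=> /eqP Ek hk; rewrite /c; case: forallP => h.
    by move: hk; rewrite -Ek big1 // => j _; apply/eqP; apply: h.
  case: forallP => h' //; move: hk; rewrite -Ek (eq_bigr (fun j => nat_of_bool (j == i))); last by move=> j _; apply/eqP; apply: h'.
  by rewrite (bigD1 i) //= eqxx big1 // => j /negbTE ->.
have M2 k r : (2 <= k)%N -> abs_monomials_deg (n := n) k c r = 0.
  by move=> hk; apply: big1 => a Ha; rewrite c2 // Rabs_R0 Rmult_0_l.
have m2 k y : (2 <= k)%N -> monomials_deg k c y = 0.
  by move=> hk; apply: big1 => a Ha; rewrite c2 // Rmult_0_l.
have m0 y : monomials_deg 0 c y = x i.
  rewrite /monomials_deg (bigD1 [ffun => ord0]) /=; last by rewrite big1 // => j _; rewrite ffunE.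
  rewrite big1 => [|a /andP [_ /negP na]]; last first.
    by case: na; apply/eqP/ffunP => j; rewrite ffunE; apply: val_inj; have := ltn_ord (a j); rewrite ltnS leqn0 => /eqP.
  have -> : c (fun j => nat_of_ord (([ffun => ord0] : {ffun 'I_n -> 'I_1}) j)) = x i.
    by rewrite /c; have -> : [forall j, nat_of_ord (([ffun => ord0] : {ffun 'I_n -> 'I_1}) j) == 0%N] by apply/forallP => j; rewrite ffunE.
  by rewrite Rplus_0_r /rprod big1 ?Rmult_1_r // => j _; rewrite ffunE.
have m1 y : monomials_deg 1 c y = y i.
  pose e : {ffun 'I_n -> 'I_2} := [ffun j => if j == i then ord_max else ord0].
  have Ee j : nat_of_ord (e j) = (j == i)%N by rewrite ffunE; case: (j == i).
  have Hc : c (fun j => nat_of_ord (e j)) = 1.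
    rewrite /c; case: forallP => [h|_]; first by have := h i; rewrite Ee eqxx.
    by have -> : [forall j, nat_of_ord (e j) == (j == i)%N] by apply/forallP => j; rewrite Ee.
  rewrite /monomials_deg (bigD1 e) /=; last first.
    by rewrite (bigD1 i) //= Ee eqxx big1 // => j /negbTE ne; rewrite Ee ne.
  rewrite big1 => [|a /andP [/eqP Ha /negP na]].
    rewrite Rplus_0_r Hc Rmult_1_l /rprod (bigD1 i) //= Ee eqxx big1; first by rewrite /=; ring.
    by move=> j /negbTE ne; rewrite Ee ne.
  have -> : c (fun j => nat_of_ord (a j)) = 0; last by rewrite Rmult_0_l.
  rewrite /c; case: forallP => [h|_]; first by move: Ha; rewrite big1 // => j _; apply/eqP; apply: h.
  case: forallP => h //; case: na; apply/eqP/ffunP => j; apply: val_inj.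
  by change (nat_of_ord (a j) = nat_of_ord (e j)); rewrite Ee; apply/eqP; apply: h.
exists c, 1; split; first lra; split.
  exists (abs_monomials_deg (n := n) 0 c 1 + abs_monomials_deg (n := n) 1 c 1).
  have p k : 0 <= abs_monomials_deg (n := n) k c 1.
    by apply: big_ge0 => a _; rewrite pow1 Rmult_1_r; apply: Rabs_pos.
  case=> [|N]; first by rewrite /=; have := p 1%N; lra.
  elim: N => [|N IH]; first by rewrite /=; lra.
  by rewrite tech5 (M2 N.+2) //; lra.
move=> y _ eps he; exists 1%N => -[|N] hN; first by lia.
have -> : sum_f_R0 (fun k => monomials_deg k c (vsub y x)) N.+1 = y i.
  elim: N {hN} => [|N IH]; first by rewrite /= m0 m1 /vsub; ring.
  by rewrite tech5 IH m2 // Rplus_0_r.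
by rewrite /Rdist Rminus_diag Rabs_R0.
Qed.

End CoordinateAnalytic.

(** * Geometry of the limit torus *)

Section InvariantTorus.
Variables (n : nat) (w0 : vec n) (H : vec n * vec n -> R) (dH dq : 'I_n -> vec n * vec n -> R) (kap Kh : R).
Hypothesis kap0 : 0 < kap.
Hypothesis Kh0 : 0 <= Kh.
Hypothesis HC11 : forall (p q v w : vec n) dl, 0 <= dl <= kap -> (forall i, Rabs (p i) <= kap) ->
  (forall i, Rabs (v i) <= dl) -> (forall i, Rabs (w i) <= dl) ->
  Rabs (H (fun i => p i + v i, fun i => q i + w i) - H (p, q) - rsum (fun i => dH i (p, q) * v i)
    - rsum (fun i => dq i (p, q) * w i)) <= Kh * dl ^ 2.

Lemma derivable_along (c1 c2 : R -> vec n) t (v1 v2 : vec n) :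
  (forall i, derivable_pt_lim (fun s => c1 s i) t (v1 i)) ->
  (forall i, derivable_pt_lim (fun s => c2 s i) t (v2 i)) -> (forall i, Rabs (c1 t i) <= kap) ->
  derivable_pt_lim (fun s => H (c1 s, c2 s)) t
    (rsum (fun i => dH i (c1 t, c2 t) * v1 i) + rsum (fun i => dq i (c1 t, c2 t) * v2 i)).
Proof.
move=> h1 h2 hk; apply: (curve_derivable (r := kap) (K := Kh) kap0 Kh0 h1 h2) => s d Hd H1 H2.
have := @HC11 (c1 t) (c2 t) (fun i => c1 s i - c1 t i) (fun i => c2 s i - c2 t i) d _ hk H1 H2.
have E (c : R -> vec n) : (fun i => c t i + (c s i - c t i)) = c s by apply: functional_extensionality => i; ring.
by rewrite !E; apply; lra.
Qed.

Let const_der (c t : R) : derivable_pt_lim (fun _ => c) t 0.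
Proof. exact: derivable_pt_lim_const. Qed.

Lemma partial_p (p q : vec n) i : (forall i, Rabs (p i) <= kap) -> has_partial (fun x => H (x, q)) i p (dH i (p, q)).
Proof.
move=> hp; rewrite /has_partial.
have := @derivable_along (fun t => vadd p (vscal t (ebasis i))) (fun _ => q) 0 (ebasis i) (vzero n) _ _.
rewrite vadd_vscal0 rsum_ebasis (rsum_0 (F := fun j => dq j (p, q) * vzero n j)) ?Rplus_0_r => [H0|j]; last by rewrite /vzero; ring.
by apply: H0 => // j; apply: line_derivable.
Qed.

Lemma partial_q (p q : vec n) i : (forall i, Rabs (p i) <= kap) -> has_partial (fun y => H (p, y)) i q (dq i (p, q)).
Proof.
move=> hp; rewrite /has_partial.
have := @derivable_along (fun _ => p) (fun t => vadd q (vscal t (ebasis i))) 0 (vzero n) (ebasis i) _ _.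
rewrite vadd_vscal0 rsum_ebasis (rsum_0 (F := fun j => dH j (p, q) * vzero n j)) ?Rplus_0_l => [H0|j]; last by rewrite /vzero; ring.
by apply: H0 => // j; apply: line_derivable.
Qed.

Variables (u P : 'I_n -> vec n -> R) (G du dP : 'I_n -> 'I_n -> vec n -> R) (K s A : R).
Hypothesis s0 : 0 < s.
Hypothesis Hu : forall i, TA s (u i) A.
Hypothesis HP : forall i, TA s (P i) A.
Hypothesis HG : forall i j, TA s (fun x => G i j x - del i j) A.
Hypothesis K0 : 0 <= K.
Hypothesis Hdu : forall i, grad K (u i) (du i).
Hypothesis HdP : forall i, grad K (P i) (dP i).
Hypothesis energy : forall x y, H (emb P u x) = H (emb P u y).
Hypothesis velocity : forall i x, rsum (fun j => G i j x * dH j (emb P u x)) = w0 i.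
Hypothesis HGdu : forall i j x, rsum (fun l => G i l x * (del l j + du l j x)) = del i j.
Hypothesis Hsym : forall i a x, rsum (fun l => (del l i + du l i x) * dP l a x) =
  rsum (fun l => (del l a + du l a x) * dP l i x).
Hypothesis A1 : A <= kap.
Hypothesis A2 : A <= / (2 * INR n).
Hypothesis A3 : 2 * PI / s * A < 1.

Let s00 : 0 <= s. Proof. exact: Rlt_le. Qed.
Let J x i j := del i j + du i j x.
Let Pbound i x : Rabs (P i x) <= kap.
Proof. exact: Rle_trans (TA_sup s00 x (HP i)) A1. Qed.

Let G_inj x v : (forall i, mvec (fun i j => G i j x) v i = 0) -> forall i, v i = 0.
Proof. by apply: near_id_inj => i j; apply: Rle_trans (TA_sup s00 x (HG i j)) A2. Qed.

(** [G (J G - 1) = 0] because [G J = 1], and [G] is injective, being near the identity. *)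
Let JG x i j : mmul (J x) (fun i j => G i j x) i j = del i j.
Proof.
suff : forall i, mmul (J x) (fun i j => G i j x) i j - del i j = 0 by move=> /(_ i); lra.
apply: (G_inj (x := x)) => {}i.
have -> : mvec (fun i j => G i j x) (fun i => mmul (J x) (fun i j => G i j x) i j - del i j) i =
  mmul (fun i j => G i j x) (mmul (J x) (fun i j => G i j x)) i j - mmul (fun i j => G i j x) (@del n) i j.
  by rewrite /mvec /mmul -rsum_minus; apply: rsum_ext => l; ring.
rewrite -mmulA mmul_delr (mmul_ext (A' := @del n) (B' := fun i j => G i j x)) //; first by rewrite mmul_dell; ring.
by move=> a b; apply: HGdu.
Qed.

Let angular_velocity x i : mvec (J x) w0 i = dH i (emb P u x).
Proof.
rewrite (mvec_ext (B := J x) (u := mvec (fun i j => G i j x) (fun j => dH j (emb P u x)))) //.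
  rewrite -mmul_mvec (mvec_ext (B := @del n) (u := fun j => dH j (emb P u x))) ?mvec_del //.
by move=> j; rewrite -(velocity j x).
Qed.

Let theta th t := vadd th (vscal t w0).

Let der_P th t i : derivable_pt_lim (fun r => P i (theta th r)) t (rsum (fun a => dP i a (theta th t) * w0 a)).
Proof. by apply: (grad_curve (c := theta th) (v := w0) K0 (HdP i)) => j; apply: line_derivable. Qed.

Let der_u x v t i : derivable_pt_lim (fun r => u i (vadd x (vscal r v))) t (rsum (fun a => du i a (vadd x (vscal t v)) * v a)).
Proof. by apply: (grad_curve (c := fun r => vadd x (vscal r v)) (v := v) K0 (Hdu i)) => j; apply: line_derivable. Qed.

Let der_Q x v t i : derivable_pt_lim (fun r => vadd x (vscal r v) i + u i (vadd x (vscal r v))) t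
  (mvec (J (vadd x (vscal t v))) v i).
Proof.
have -> : mvec (J (vadd x (vscal t v))) v i = v i + rsum (fun a => du i a (vadd x (vscal t v)) * v a).
  rewrite -{1}(mvec_del v i) /mvec -rsum_plus; apply: rsum_ext => l; rewrite /J; ring.
by apply: derivable_pt_lim_plus; [apply: line_derivable | apply: der_u].
Qed.

(* Differentiating the energy along the torus and using the symmetry of the Lagrangian
   form gives [(1 + Du)^T (P' + d_q H) = 0]. *)
Lemma angle_force x i : rsum (fun a => dP i a x * w0 a) = - dq i (emb P u x).
Proof.
pose z l := rsum (fun a => dP l a x * w0 a) + dq l (emb P u x).
suff : z i = 0 by rewrite /z; lra.
have Hz a : rsum (fun l => J x l a * z l) = 0.
  have h := @derivable_along (fun t l => P l (vadd x (vscal t (ebasis a)))) (fun t l => vadd x (vscal t (ebasis a)) l + u l (vadd x (vscal t (ebasis a)))) 0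
     (fun l => dP l a x) (fun l => J x l a).
  have h1 : forall l, derivable_pt_lim (fun t => P l (vadd x (vscal t (ebasis a)))) 0 (dP l a x).
    by move=> l; apply: (grad_partial x a K0 (HdP l)).
  have h2 : forall l, derivable_pt_lim (fun t => vadd x (vscal t (ebasis a)) l + u l (vadd x (vscal t (ebasis a)))) 0 (J x l a).
    move=> l; have := der_Q x (ebasis a) 0 l; rewrite vadd_vscal0.
    by rewrite /mvec (rsum_ebasis (fun j => J x l j)).
  have {}h := h h1 h2 (fun l => Pbound l _).
  have h3 : derivable_pt_lim (fun t => H (emb P u (vadd x (vscal t (ebasis a))))) 0 0.
    have -> : (fun t => H (emb P u (vadd x (vscal t (ebasis a))))) = (fun _ => H (emb P u x)).
      by apply: functional_extensionality => t; apply: energy.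
    exact: const_der.
  have := uniqueness_limite _ _ _ _ h h3; rewrite vadd_vscal0 -/(emb P u x) => E.
  rewrite -{}E (rsum_ext (G := fun l => J x l a * rsum (fun b => dP l b x * w0 b) + dq l (emb P u x) * J x l a)); last by move=> l; rewrite /z; ring.
  rewrite rsum_plus; congr (_ + _).
  transitivity (rsum (fun b => w0 b * rsum (fun l => J x l a * dP l b x))).
    rewrite (rsum_ext (G := fun l => rsum (fun b => J x l a * (dP l b x * w0 b)))); last by move=> l; rewrite rsum_scal.
    rewrite rsum_exch; apply: rsum_ext => b; rewrite -rsum_scal; apply: rsum_ext => l; ring.
  rewrite (rsum_ext (G := fun b => w0 b * rsum (fun l => J x l b * dP l a x))); last by move=> b; rewrite /J Hsym.
  rewrite (rsum_ext (G := fun b => rsum (fun l => w0 b * (J x l b * dP l a x)))); last by move=> b; rewrite rsum_scal.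
  rewrite rsum_exch; apply: rsum_ext => l; rewrite -angular_velocity /mvec -rsum_scalr.
  by apply: rsum_ext => b; ring.
rewrite -(rsum_delr z i) (rsum_ext (G := fun l => rsum (fun a => J x l a * G a i x) * z l)); last by move=> l; rewrite -(JG x l i) /mmul; ring.
rewrite (rsum_ext (G := fun l => rsum (fun a => G a i x * (J x l a * z l)))); last by move=> l; rewrite -rsum_scalr; apply: rsum_ext => a; ring.
by rewrite rsum_exch; apply: rsum_0 => a; rewrite rsum_scal Hz Rmult_0_r.
Qed.

Lemma torus_invariant : invariant_quasi_periodic (fun p q => H (p, q)) w0 (fun x i => P i x) (fun x i => x i + u i x).
Proof.
move=> th t i; set x := vadd th (vscal t w0).
exists (dH i (emb P u x)), (dq i (emb P u x)); split; first exact: partial_p.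
split; first exact: partial_q.
split; first by rewrite -angle_force; apply: der_P.
by rewrite -angular_velocity; apply: der_Q.
Qed.

(** If the angles of [th] and [th'] differ by an integer vector [k], then [v = th' + k - th] is a
    difference of two values of [u] at points at distance [v]; as [u] is a contraction, [v = 0]. The
    immersion property holds because [G] is a left inverse of [1 + Du]. *)
Lemma torus_embedded (D : vec n -> Prop) : (forall p : vec n, (forall i, Rabs (p i) <= A) -> D p) ->
  torus_embedding D (fun x i => P i x) (fun x i => x i + u i x).
Proof.
move=> HD; split; [|split; [|split; [|split]]].
- move=> th k hk; split; first by apply: functional_extensionality => i; apply: TA_per (HP i) hk.
  by move=> i; rewrite /vsub (TA_per th (Hu i) hk) /vadd; have [z hz] := hk i; exists z; rewrite hz; ring.
- by move=> th; apply: HD => i; apply: TA_sup (HP i).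
- move=> th i; split; first exact: TA_analytic s0 (HP i).
  by apply: analytic_plus; [apply: analytic_coord | apply: TA_analytic s0 (Hu i)].
- move=> th th' _ hk; set k := vsub _ _ in hk.
  pose y := vadd th' k; pose v i := y i - th i; pose d := rsum (fun i => Rabs (v i)).
  have Ev i : v i = u i th - u i y.
    rewrite (TA_per th' (Hu i) hk) /v /y /vadd /k /vsub; ring.
  have d0 : 0 <= d by apply: rsum_ge0 => i; apply: Rabs_pos.
  (* The largest [Rabs (v i)], or 0 in dimension 0; the contraction forces it to vanish. *)
  have [i1 Hi1] : exists m, 0 <= m /\ (forall i, Rabs (v i) <= m) /\ (m <= 2 * PI / s * A * m).
    case: (posnP n) => [n0|n0].
      by exists 0; split; [lra | split; [move=> i; have := ltn_ord i; rewrite {2}n0 | lra]].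
    pose i0 := Ordinal n0; pose m := \big[Rmax/Rabs (v i0)]_(i < n) Rabs (v i).
    have Hm i : Rabs (v i) <= m.
      rewrite /m; elim: (index_enum _) (mem_index_enum i) => [//|j l IH].
      rewrite in_cons big_cons => /orP [/eqP ->|/IH h]; first exact: Rmax_l.
      exact: Rle_trans h (Rmax_r _ _).
    have m0 : 0 <= m by apply: Rle_trans (Rabs_pos _) (Hm i0).
    exists m; split => //; split => //.
    have Hlip i : Rabs (v i) <= 2 * PI / s * A * m.
      rewrite Ev; have := TA_lip th s0 (Hu i) m0 Hm.
      have -> : (fun i => th i + v i) = y by apply: functional_extensionality => j; rewrite /v; ring.
      by rewrite Rabs_minus_sym.
    rewrite {1}/m; apply: (big_ind (fun z => z <= 2 * PI / s * A * m)) => // a b ha hb.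
    exact: Rmax_lub.
  case: Hi1 => m0 [Hm hm].
  have Em : i1 = 0 by nra.
  move=> i; have := Hm i; rewrite Em => h.
  have {h} h : v i = 0 by apply: Rabs_eq_0; have := Rabs_pos (v i); lra.
  have [z hz] := hk i; exists z; rewrite -hz /vsub; move: h; rewrite /v /y /vadd; lra.
- move=> th v Hv i.
  have HJ l : mvec (J th) v l = 0.
    by have := der_Q th v 0 l; rewrite vadd_vscal0 => h; apply: uniqueness_limite h (proj2 (Hv l)).
  have E a b : mmul (fun i j => G i j th) (J th) a b = del a b by apply: HGdu.
  rewrite -(mvec_del v i) -(mvec_ext (A := mmul (fun i j => G i j th) (J th)) (v := v) i E (fun _ => erefl)).
  by rewrite mmul_mvec; apply: rsum_0 => l; rewrite HJ Rmult_0_r.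
Qed.

End InvariantTorus.

(** * Jets of the Hamiltonian *)

Section Jets.
Variable n : nat.
Implicit Types (F : vec n * vec n -> R) (dF dq : 'I_n -> vec n * vec n -> R) (ddF : 'I_n -> 'I_n -> vec n * vec n -> R).

(* [F] has momentum derivatives [dF], [ddF] and angle derivative [dq], controlled by
   [C] in the norms of the tori of momentum at most [kap] and in the sup norm. *)
Record jet (kap s0 C : R) F dF dq ddF : Prop := Jet {
  jet_taylor : forall s (P d u : 'I_n -> vec n -> R) dl, 0 <= s <= s0 -> 0 <= dl <= kap ->
    (forall i, TA s (P i) kap) -> (forall i, TA s (d i) dl) -> (forall i, TA s (u i) kap) ->
    TA s (fun x => F (emb (fun i x => P i x + d i x) u x) - F (emb P u x) - rsum (fun i => dF i (emb P u x) * d i x)) (C * dl ^ 2);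
  jet_taylor1 : forall j s (P d u : 'I_n -> vec n -> R) dl, 0 <= s <= s0 -> 0 <= dl <= kap ->
    (forall i, TA s (P i) kap) -> (forall i, TA s (d i) dl) -> (forall i, TA s (u i) kap) ->
    TA s (fun x => dF j (emb (fun i x => P i x + d i x) u x) - dF j (emb P u x) - rsum (fun i => ddF j i (emb P u x) * d i x)) (C * dl ^ 2);
  jet_C11 : forall (p q v w : vec n) dl, 0 <= dl <= kap -> (forall i, Rabs (p i) <= kap) ->
    (forall i, Rabs (v i) <= dl) -> (forall i, Rabs (w i) <= dl) ->
    Rabs (F (fun i => p i + v i, fun i => q i + w i) - F (p, q) - rsum (fun i => dF i (p, q) * v i)
      - rsum (fun i => dq i (p, q) * w i)) <= C * dl ^ 2;
  jet_lip : forall (p q v w : vec n) dl, 0 <= dl <= kap -> (forall i, Rabs (p i) <= kap) ->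
    (forall i, Rabs (v i) <= dl) -> (forall i, Rabs (w i) <= dl) ->
    Rabs (F (fun i => p i + v i, fun i => q i + w i) - F (p, q)) <= C * dl /\
    forall j, Rabs (dF j (fun i => p i + v i, fun i => q i + w i) - dF j (p, q)) <= C * dl;
  jet_bound : forall s (P u : 'I_n -> vec n -> R), 0 <= s <= s0 ->
    (forall i, TA s (P i) kap) -> (forall i, TA s (u i) kap) ->
    [/\ TA s (fun x => F (emb P u x)) C, forall i, TA s (fun x => dF i (emb P u x)) C &
        forall i j, TA s (fun x => ddF i j (emb P u x)) C];
  jet_hessian : forall i j s (P u : 'I_n -> vec n -> R) dl, 0 <= s <= s0 -> 0 <= dl <= kap ->
    (forall i, TA s (P i) dl) -> (forall i, TA s (u i) kap) ->
    TA s (fun x => ddF i j (emb P u x) - ddF i j (vzero n, fun i => x i + u i x)) (C * dl) }.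

Lemma jet_mono kap kap' s0 C F dF dq ddF : kap' <= kap -> jet kap s0 C F dF dq ddF -> jet kap' s0 C F dF dq ddF.
Proof.
move=> hk [J1 J2 J3 J4 J5 J6].
have up s (g : 'I_n -> vec n -> R) : (forall i, TA s (g i) kap') -> forall i, TA s (g i) kap by move=> h i; apply: TA_le (h i) hk.
have upp (p : vec n) : (forall i, Rabs (p i) <= kap') -> forall i, Rabs (p i) <= kap by move=> h i; apply: Rle_trans (h i) hk.
split.
- by move=> s P d u dl hs hd /up hP Hd /up; apply: J1 => //; lra.
- by move=> j s P d u dl hs hd /up hP Hd /up; apply: J2 => //; lra.
- by move=> p q v w dl hd /upp; apply: J3; lra.
- by move=> p q v w dl hd /upp; apply: J4; lra.
- by move=> s P u hs /up hP /up; apply: J5.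
- by move=> i j s P u dl hs hd hP /up; apply: J6 => //; lra.
Qed.

Lemma jet_comb kap s0 e C C' F dF dq ddF F' dF' dq' ddF' : 0 <= e ->
  jet kap s0 C F dF dq ddF -> jet kap s0 C' F' dF' dq' ddF' ->
  jet kap s0 (C + e * C') (fun x => F x + e * F' x) (fun i x => dF i x + e * dF' i x)
    (fun i x => dq i x + e * dq' i x) (fun i j x => ddF i j x + e * ddF' i j x).
Proof.
move=> e0 [J1 J2 J3 J4 J5 J6] [J1' J2' J3' J4' J5' J6'].
have comb s g g' D D' : TA s g D -> TA s g' D' -> TA s (fun x : vec n => g x + e * g' x) (D + e * D').
  move=> h h'; have := TA_add h (TA_scal e h'); rewrite Rabs_pos_eq //.
have combR a b D D' : Rabs a <= D -> Rabs b <= D' -> Rabs (a + e * b) <= D + e * D'.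
  move=> h h'; apply: Rle_trans (Rabs_triang _ _) _; apply: Rplus_le_compat => //.
  by rewrite Rabs_mult (Rabs_pos_eq e) //; apply: Rmult_le_compat_l.
have lin (a a' v : 'I_n -> R) : rsum (fun i => (a i + e * a' i) * v i) = rsum (fun i => a i * v i) + e * rsum (fun i => a' i * v i).
  by rewrite -rsum_scal -rsum_plus; apply: rsum_ext => i; ring.
split.
- move=> s P d u dl hs hd hP Hd hu.
  have h := comb _ _ _ _ _ (J1 s P d u dl hs hd hP Hd hu) (J1' s P d u dl hs hd hP Hd hu).
  apply: TA_le (TA_ext _ h) _ => [x|]; last by right; ring.
  rewrite (lin (fun i => dF i (emb P u x)) (fun i => dF' i (emb P u x))); ring.
- move=> j s P d u dl hs hd hP Hd hu.
  have h := comb _ _ _ _ _ (J2 j s P d u dl hs hd hP Hd hu) (J2' j s P d u dl hs hd hP Hd hu).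
  apply: TA_le (TA_ext _ h) _ => [x|]; last by right; ring.
  rewrite (lin (fun i => ddF j i (emb P u x)) (fun i => ddF' j i (emb P u x))); ring.
- move=> p q v w dl hd hp hv hw.
  have := combR _ _ _ _ (J3 p q v w dl hd hp hv hw) (J3' p q v w dl hd hp hv hw).
  rewrite (lin (fun i => dF i (p, q)) (fun i => dF' i (p, q))) (lin (fun i => dq i (p, q)) (fun i => dq' i (p, q))).
  have -> : (C + e * C') * dl ^ 2 = C * dl ^ 2 + e * (C' * dl ^ 2) by ring.
  by apply: Rle_trans; right; congr Rabs; ring.
- move=> p q v w dl hd hp hv hw.
  have [h1 h2] := J4 p q v w dl hd hp hv hw; have [h1' h2'] := J4' p q v w dl hd hp hv hw.
  have -> : (C + e * C') * dl = C * dl + e * (C' * dl) by ring.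
  split; first by apply: Rle_trans (combR _ _ _ _ h1 h1'); right; congr Rabs; ring.
  by move=> j; apply: Rle_trans (combR _ _ _ _ (h2 j) (h2' j)); right; congr Rabs; ring.
- move=> s P u hs hP hu; have [h1 h2 h3] := J5 s P u hs hP hu; have [h1' h2' h3'] := J5' s P u hs hP hu.
  by split=> [|i|i j]; apply: comb.
- move=> i j s P u dl hs hd hP hu.
  have h := comb _ _ _ _ _ (J6 i j s P u dl hs hd hP hu) (J6' i j s P u dl hs hd hP hu).
  by apply: TA_le (TA_ext _ h) _ => [x|]; [ring | right; ring].
Qed.

Lemma C11_lip F (a b v w : 'I_n -> R) (x y : vec n * vec n) K A d : 0 <= d <= 1 -> 0 <= K -> 0 <= A ->
  (forall i, Rabs (a i) <= A) -> (forall i, Rabs (b i) <= A) ->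
  (forall i, Rabs (v i) <= d) -> (forall i, Rabs (w i) <= d) ->
  Rabs (F y - F x - rsum (fun i => a i * v i) - rsum (fun i => b i * w i)) <= K * d ^ 2 ->
  Rabs (F y - F x) <= (2 * INR n * A + K) * d.
Proof.
move=> hd K0 A0 ha hb hv hw h.
have bnd (c z : 'I_n -> R) : (forall i, Rabs (c i) <= A) -> (forall i, Rabs (z i) <= d) -> Rabs (rsum (fun i => c i * z i)) <= INR n * (A * d).
  move=> hc hz; apply: Rle_trans (rsum_abs _) _; rewrite -rsum_const; apply: rsum_le => i.
  by rewrite Rabs_mult; apply: Rmult_le_compat => //; apply: Rabs_pos.
have h1 := bnd a v ha hv; have h2 := bnd b w hb hw.
have h3 : K * d ^ 2 <= K * d by apply: Rmult_le_compat_l => //; nra.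
move: h h1 h2; set S := rsum _; set S' := rsum _ => /Rabs_le_between h /Rabs_le_between h1 /Rabs_le_between h2.
apply/Rabs_le_between; lra.
Qed.

(** Two momentum derivatives reduce the radius to [r / 4], and the estimates there hold up to a
    quarter of it, hence [r / 16]. The condition [4 PI kap <= s] leaves the width [s / 2] for tori
    with [u] of norm at most [kap]. *)
Lemma HF_jet r s kap F B : 0 < r -> 0 < s -> 0 < kap <= 1 -> kap <= r / 16 -> 4 * PI * kap <= s ->
  HF r s F B -> exists C dF dq ddF, 0 <= C /\ jet kap (s / 2) C F dF dq ddF /\
    forall i j q, has_partial (fun p => dF i (p, q)) j (vzero n) (ddF i j (vzero n, q)).
Proof.
move=> r0 s0 hk hkr hks HB.
have wt_0 r' : 0 < r' -> forall a, 0 <= hwt (n := n) r' s a by move=> h a; apply: hwt0; lra.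
have B0 : 0 <= B by exact: (AN_ge0 (wt_0 r r0) HB).
have r2 : 0 < r / 2 by lra.
have r4 : 0 < r / 4 by lra.
have [C1 [C10 T1]] := HF_taylor n r0 s0.
have [dF [dq [HdF TF CF Bq]]] := T1 F B HB.
set B1 := 2 / r * B in HdF.
have [C2 [C20 T2]] := HF_taylor n r2 s0.
have [dd Hdd] := choiceE (fun j => T2 (dF j) B1 (HdF j)).
have B10 : 0 <= B1 by apply: Rmult_le_pos => //; apply: Rdiv_le_0_compat; lra.
have [dq2 Hdq2] := choiceE Hdd.
pose ddF j := dd j.
have Hddd i j : HF (r / 4) s (ddF i j) (2 / (r / 2) * B1).
  by have [h _ _ _] := Hdq2 i; have := h j; rewrite (_ : r / 2 / 2 = r / 4); last field.
set B2 := 2 / (r / 2) * B1 in Hddd.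
have B20 : 0 <= B2 by apply: Rmult_le_pos => //; apply: Rdiv_le_0_compat; lra.
have [Cl Hl] := choiceE (fun ij : 'I_n * 'I_n => HF_lip r4 s0 (Hddd ij.1 ij.2)).
pose SC := rsum (fun i => rsum (fun j => Cl (i, j))).
have SCge i j : Cl (i, j) <= SC.
  have h0 a b : 0 <= Cl (a, b) by have [] := Hl (a, b).
  apply: Rle_trans (rsum_ge_term (F := fun j => Cl (i, j)) j (fun b => h0 i b)) _.
  by apply: (rsum_ge_term (F := fun i => rsum (fun j => Cl (i, j)))) => a; apply: rsum_ge0.
have SC0 : 0 <= SC by apply: rsum_ge0 => a; apply: rsum_ge0 => b; have [] := Hl (a, b).
pose A1 := B1 + C1 * B; pose A2 := B2 + C2 * B1.
have CB : 0 <= C1 * B by apply: Rmult_le_pos.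
have CB1 : 0 <= C2 * B1 by apply: Rmult_le_pos.
have N0 := pos_INR n.
have NA1 : 0 <= 2 * INR n * A1 by apply: Rmult_le_pos; [lra | rewrite /A1; lra].
have NA2 : 0 <= 2 * INR n * A2 by apply: Rmult_le_pos; [lra | rewrite /A2; lra].
have q1 : 0 <= 4 / r ^ 2 * B by apply: Rmult_le_pos => //; apply: Rdiv_le_0_compat; [lra | apply: pow_lt].
have q2 : 0 <= 4 / (r / 2) ^ 2 * B1 by apply: Rmult_le_pos => //; apply: Rdiv_le_0_compat; [lra | apply: pow_lt].
pose C := 4 / r ^ 2 * B + 4 / (r / 2) ^ 2 * B1 + (2 * INR n * A1 + C1 * B) + (2 * INR n * A2 + C2 * B1) + SC + B + B1 + B2.
have kpos : 0 <= kap by lra.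
have hs2 s' : 0 <= s' <= s / 2 -> s' + 2 * PI * kap <= s by lra.
have up (s' a b : R) (g : 'I_n -> vec n -> R) : a <= b -> (forall i, TA s' (g i) a) -> forall i, TA s' (g i) b.
  by move=> hab h i; apply: TA_le (h i) hab.
have supF r' g D (x : vec n * vec n) : 0 < r' -> HF r' s g D -> (forall i, Rabs (x.1 i) <= r') -> Rabs (g x) <= D.
  by move=> hr hg hx; apply: (AN_sup _ hg hx) => a y hy; apply: hev_hwt => //; lra.
have C11_2 i (p q v w : vec n) dl : 0 <= dl <= kap -> (forall i, Rabs (p i) <= kap) ->
    (forall i, Rabs (v i) <= dl) -> (forall i, Rabs (w i) <= dl) ->
    Rabs (dF i (fun i => p i + v i, fun i => q i + w i) - dF i (p, q) - rsum (fun j => ddF i j (p, q) * v j)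
      - rsum (fun j => dq2 i j (p, q) * w j)) <= C2 * B1 * dl ^ 2.
  move=> hdl hp hv hw; have [_ _ h _] := Hdq2 i.
  apply: Rle_trans (h p q v w dl _ _ hv hw) _; [lra | | by right; ring].
  by move=> j; have := hp j; lra.
have C11_1 (p q v w : vec n) dl : 0 <= dl <= kap -> (forall i, Rabs (p i) <= kap) ->
    (forall i, Rabs (v i) <= dl) -> (forall i, Rabs (w i) <= dl) ->
    Rabs (F (fun i => p i + v i, fun i => q i + w i) - F (p, q) - rsum (fun j => dF j (p, q) * v j)
      - rsum (fun j => dq j (p, q) * w j)) <= C1 * B * dl ^ 2.
  move=> hdl hp hv hw.
  apply: Rle_trans (CF p q v w dl _ _ hv hw) _; [lra | | by right; ring].
  by move=> j; have := hp j; lra.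
exists C, dF, dq, ddF; split; first by rewrite /C; lra.
split; last first.
  move=> i j q; apply: (partial_p (kap := kap) (Kh := C2 * B1) _ CB1 (C11_2 i)); first lra.
  by move=> l; rewrite /vzero Rabs_R0.
have sq dl : 0 <= dl ^ 2 by apply: pow2_ge_0.
split.
- move=> s' P d u dl hs hd hP Hd hu.
  have h := TF s' P d u kap dl (proj1 hs) kpos _ (up _ _ _ _ _ hP) Hd hu (hs2 _ hs).
  apply: TA_le (h _ _) _; [lra | lra |].
  rewrite (_ : 4 / r ^ 2 * dl ^ 2 * B = 4 / r ^ 2 * B * dl ^ 2); last ring.
  by apply: Rmult_le_compat_r => //; rewrite /C; lra.
- move=> j s' P d u dl hs hd hP Hd hu; have [_ h0 _ _] := Hdq2 j.
  have h := h0 s' P d u kap dl (proj1 hs) kpos _ (up _ _ _ _ _ hP) Hd hu (hs2 _ hs).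
  apply: TA_le (h _ _) _; [lra | lra |].
  rewrite (_ : 4 / (r / 2) ^ 2 * dl ^ 2 * B1 = 4 / (r / 2) ^ 2 * B1 * dl ^ 2); last ring.
  by apply: Rmult_le_compat_r => //; rewrite /C; lra.
- move=> p q v w dl hdl hp hv hw; apply: Rle_trans (C11_1 p q v w dl hdl hp hv hw) _.
  by apply: Rmult_le_compat_r => //; rewrite /C; lra.
- move=> p q v w dl hdl hp hv hw.
  have hp4 i : Rabs (p i) <= r / 4 by have := hp i; lra.
  have hp2 i : Rabs (p i) <= r / 2 by have := hp i; lra.
  have hp8 i : Rabs (p i) <= r / 2 / 4 by have := hp i; lra.
  have dl1 : 0 <= dl <= 1 by lra.
  split.
    apply: (Rle_trans _ ((2 * INR n * A1 + C1 * B) * dl)); last by apply: Rmult_le_compat_r; [lra | rewrite /C; lra].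
    apply: (C11_lip dl1 CB _ _ _ hv hw (C11_1 p q v w dl hdl hp hv hw)); first by rewrite /A1; lra.
      by move=> i; have := supF (r / 2) (dF i) B1 (p, q) r2 (HdF i) hp2; rewrite /A1; lra.
    by move=> i; have := Bq i (p, q) hp4; rewrite /A1; lra.
  move=> i; apply: (Rle_trans _ ((2 * INR n * A2 + C2 * B1) * dl)); last by apply: Rmult_le_compat_r; [lra | rewrite /C; lra].
  apply: (C11_lip dl1 CB1 _ _ _ hv hw (C11_2 i p q v w dl hdl hp hv hw)); first by rewrite /A2; lra.
    by move=> j; have := supF (r / 4) (ddF i j) B2 (p, q) r4 (Hddd i j) hp4; rewrite /A2; lra.
  by move=> j; have [_ _ _ h] := Hdq2 i; have := h j (p, q) hp8; rewrite /A2; lra.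
- move=> s' P u hs hP hu.
  have sub r' g D : kap <= r' -> HF r' s g D -> TA s' (fun x => g (emb P u x)) D.
    move=> hr hg; apply: (HF_subst (proj1 hs) _ kpos hg (up _ _ _ _ hr hP) hu (hs2 _ hs)); lra.
  split.
  + by apply: TA_le (sub r F B _ HB) _; rewrite /C; lra.
  + by move=> i; apply: TA_le (sub (r / 2) (dF i) B1 _ (HdF i)) _; rewrite /C; lra.
  + by move=> i j; apply: TA_le (sub (r / 4) (ddF i j) B2 _ (Hddd i j)) _; rewrite /C; lra.
- move=> i j s' P u dl hs hd hP hu; have [_ h] := Hl (i, j).
  apply: TA_le (h s' P u kap dl (proj1 hs) kpos _ hP hu (hs2 _ hs)) _; first lra.
  by apply: Rmult_le_compat_r; [lra | have := SCge i j; rewrite /C; lra].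
Qed.

End Jets.

(** * Smallness conditions and conclusion *)

Lemma Rmin_pos5 a b c d e : 0 < a -> 0 < b -> 0 < c -> 0 < d -> 0 < e ->
  exists m, [/\ 0 < m, m <= a, m <= b, m <= c & m <= d /\ m <= e].
Proof.
move=> a0 b0 c0 d0 e0; exists (Rmin a (Rmin b (Rmin c (Rmin d e)))).
have := Rmin_l a (Rmin b (Rmin c (Rmin d e))); have := Rmin_r a (Rmin b (Rmin c (Rmin d e))).
have := Rmin_l b (Rmin c (Rmin d e)); have := Rmin_r b (Rmin c (Rmin d e)).
have := Rmin_l c (Rmin d e); have := Rmin_r c (Rmin d e).
have := Rmin_l d e; have := Rmin_r d e.
by split; [do 4 (apply: Rmin_glb_lt => //) | lra..].
Qed.

Section KamFamily.
Variables (n : nat) (w0 : vec n) (Fh Ff : vec n * vec n -> R).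
Variables (dFh dqh dFf dqf : 'I_n -> vec n * vec n -> R) (ddFh ddFf : 'I_n -> 'I_n -> vec n * vec n -> R).
Variables (kap1 S Ch Cf : R) (M L : 'I_n -> 'I_n -> R).
Let N := INR n.
Hypothesis N1 : 1 <= N.
Hypothesis kap1_01 : 0 < kap1 <= 1.
Hypothesis S0 : 0 < S.
Hypothesis Ch0 : 0 <= Ch.
Hypothesis Cf0 : 0 <= Cf.
Hypothesis Jh : jet kap1 S Ch Fh dFh dqh ddFh.
Hypothesis Jf : jet kap1 S Cf Ff dFf dqf ddFf.
Hypothesis HFh0 : forall q, Fh (vzero n, q) = Fh (vzero n, vzero n).
Hypothesis HdFh0 : forall q i, dFh i (vzero n, q) = w0 i.
Hypothesis HddFh0 : forall q i j, ddFh i j (vzero n, q) = M i j.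
Hypothesis HML : forall i j, mmul M L i j = del i j.
Hypothesis Hnr : forall k : 'I_n -> Z, 0 < knorm k -> kdot k w0 <> 0.
Hypothesis HBR : forall c sigma, 0 < c -> 0 < sigma -> exists lam0 (Q Ps : nat -> R),
  [/\ 1 <= lam0, forall j, 1 <= Q j, forall j, Q j <= lam0 * 2 ^ j,
      forall j, 0 <= Ps j /\ Q j * Ps j <= lam0 * 2 ^ j &
      (forall j (k : 'I_n -> Z), 0 < knorm k -> knorm k <= Q j -> / Rabs (kdot k w0) <= Ps j) /\
      forall J, sum_f_R0 (fun j => c / Q j) J <= sigma].

Let absM (A : 'I_n -> 'I_n -> R) := rsum (fun i => rsum (fun j => Rabs (A i j))).
(** Independent of [eps], which will be at most 1; this fixes every constant of the step before
    [eps] is chosen. *)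
Let C0 := 1 + Ch + Cf + absM M + absM L.

Let absM_ge A i j : Rabs (A i j) <= absM A.
Proof.
apply: Rle_trans (rsum_ge_term (F := fun j => Rabs (A i j)) j (fun b => Rabs_pos _)) _.
by apply: (rsum_ge_term (F := fun i => rsum (fun j => Rabs (A i j)))) => a; apply: rsum_ge0 => b; apply: Rabs_pos.
Qed.

Let absM0 A : 0 <= absM A.
Proof. by apply: rsum_ge0 => a; apply: rsum_ge0 => b; apply: Rabs_pos. Qed.

Let C01 : 1 <= C0.
Proof. by rewrite /C0; have := absM0 M; have := absM0 L; lra. Qed.

Let kap4 := / (2 * N ^ 2 * C0).
Let kap4_pos : 0 < kap4 <= 1.
Proof. exact: proj1 (kap4_bounds N1 C01). Qed.

Lemma kam_family : exists eps0 KA, [/\ 0 < eps0, 0 <= KA & forall eps, 0 <= eps < eps0 -> exists u P,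
  [/\ forall i x, Rabs (u i x) <= KA * eps, forall i x, Rabs (P i x) <= KA * eps,
      forall D : vec n -> Prop, (forall p : vec n, (forall i, Rabs (p i) <= KA * eps) -> D p) ->
        torus_embedding D (fun x i => P i x) (fun x i => x i + u i x) &
      invariant_quasi_periodic (fun p q => Fh (p, q) + eps * Ff (p, q)) w0 (fun x i => P i x) (fun x i => x i + u i x)]].
Proof.
(* The smallness condition of the step reads [kap * D1 + eps * Cf <= kap4]; each term receives
   half. *)
pose D1 := Ch + 3 * N ^ 2 * (C0 + 1).
have D10 : 0 < D1 by rewrite /D1; nra.
pose kap := Rmin kap1 (kap4 / (2 * D1)).
have [kk1 kk2] : kap <= kap1 /\ kap <= kap4 / (2 * D1) by split; [apply: Rmin_l | apply: Rmin_r].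
have kap_pos : 0 < kap by apply: Rmin_glb_lt; [lra | apply: Rdiv_lt_0_compat; lra].
have kap01 : 0 < kap <= 1 by lra.
have kapD : kap * D1 <= kap4 / 2.
  have -> : kap4 / 2 = kap4 / (2 * D1) * D1 by field; lra.
  by apply: Rmult_le_compat_r; lra.
have [[Cst1 _ _ _ _] _] := Cst_bounds N1 kap01 C01.
set cst := Cst n kap C0 in Cst1.
(* As [exp (- cc) <= 1 / cc] and [cst >= 1], both [exp (- cc)] and [cst * exp (- cc)] are at most
   [1 / 128]. *)
pose cc := 128 * cst.
have exp_cc : exp (- cc) <= / cc.
  rewrite exp_Ropp; apply: Rinv_le_contravar; first by rewrite /cc; lra.
  by have := exp_ineq1 cc ltac:(rewrite /cc; lra); lra.
have [lam0 [Q [Ps [lam01 Q1 Qlam HPs [HQk Hsum]]]]] := HBR (c := 3 * cc) (sigma := S / 2) ltac:(rewrite /cc; lra) ltac:(lra).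
have pi0 := PI_RGT_0.
(* [KA1 * eps] is [Asum] for the initial error [eps * lam0 * Cf], and the limit torus lies within
   [2 * Asum] of the unperturbed one. *)
pose KA1 := cst * lam0 ^ 3 * Cf; pose KA := 2 * KA1.
have KA10 : 0 <= KA1.
  by apply: Rmult_le_pos => //; apply: Rmult_le_pos; [lra | apply: pow_le; lra].
(* In order: [Asum <= 1 / 64]; [2 * Asum <= kap]; injectivity of [G]; contraction of [u]; the share
   [kap4 / 2] of [eps * Cf]. *)
have [m [m0 m1 m2 m3 [m4 m5]]] := @Rmin_pos5 (/ 32) kap (/ (2 * N)) (S / (8 * PI)) (kap4 / 2) ltac:(lra) kap_pos
  ltac:(by apply: Rinv_0_lt_compat; lra) ltac:(by apply: Rdiv_lt_0_compat; lra) ltac:(lra).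
pose den := KA + Cf + 1; have den0 : 0 < den by rewrite /den /KA; lra.
exists (m / den), KA; split; [exact: Rdiv_lt_0_compat | by rewrite /KA; lra | move=> eps [e0 eL]].
have edm : eps * den <= m.
  have -> : m = m / den * den by field; lra.
  by apply: Rmult_le_compat_r; lra.
have eKA : 0 <= eps * KA by apply: Rmult_le_pos; rewrite /KA; lra.
have eCf : 0 <= eps * Cf by apply: Rmult_le_pos.
have Em : eps * den = eps * KA + eps * Cf + eps by rewrite /den; ring.
have [eK [eC e1]] : KA * eps <= m /\ eps * Cf <= m /\ eps <= 1 by rewrite (Rmult_comm KA); lra.
pose H x := Fh x + eps * Ff x.
pose dH i x := dFh i x + eps * dFf i x; pose dq i x := dqh i x + eps * dqf i x.
pose ddH i j x := ddFh i j x + eps * ddFf i j x.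
have J : jet kap S (Ch + eps * Cf) H dH dq ddH.
  exact: jet_comb e0 (jet_mono kk1 Jh) (jet_mono kk1 Jf).
have CC0 : Ch + eps * Cf <= C0 by rewrite /C0; have := absM0 M; have := absM0 L; nra.
have sqr dl : 0 <= dl ^ 2 by apply: pow2_ge_0.
pose kap3 := Ch * kap + eps * Cf.
have kap30 : 0 <= kap3 <= 1.
  rewrite /kap3; have h1 : 0 <= Ch * kap by apply: Rmult_le_pos; lra.
  have h2 : Ch * kap <= kap * D1.
    rewrite Rmult_comm; apply: Rmult_le_compat_l; first lra.
    by rewrite /D1; have := pow2_ge_0 N; nra.
  lra.
have HT : forall s (P d u : 'I_n -> vec n -> R) dl, 0 <= s <= S -> 0 <= dl <= kap ->
  (forall i, TA s (P i) kap) -> (forall i, TA s (d i) dl) -> (forall i, TA s (u i) kap) ->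
  TA s (fun x => H (emb (fun i x => P i x + d i x) u x) - H (emb P u x) - rsum (fun i => dH i (emb P u x) * d i x)) (C0 * dl ^ 2).
  move=> s P d u dl h1 h2 h3 h4 h5; apply: TA_le (jet_taylor J h1 h2 h3 h4 h5) _.
  exact: Rmult_le_compat_r.
have HT' : forall j s (P d u : 'I_n -> vec n -> R) dl, 0 <= s <= S -> 0 <= dl <= kap ->
  (forall i, TA s (P i) kap) -> (forall i, TA s (d i) dl) -> (forall i, TA s (u i) kap) ->
  TA s (fun x => dH j (emb (fun i x => P i x + d i x) u x) - dH j (emb P u x) - rsum (fun i => ddH j i (emb P u x) * d i x)) (C0 * dl ^ 2).
  move=> j s P d u dl h1 h2 h3 h4 h5; apply: TA_le (jet_taylor1 J j h1 h2 h3 h4 h5) _.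
  exact: Rmult_le_compat_r.
have HM : forall i j s (P u : 'I_n -> vec n -> R), 0 <= s <= S ->
  (forall i, TA s (P i) kap) -> (forall i, TA s (u i) kap) -> TA s (fun x => ddH i j (emb P u x) - M i j) kap3.
  move=> i j s P u h1 h2 h3.
  have hk : 0 <= kap <= kap by lra.
  have g1 := jet_hessian (jet_mono kk1 Jh) i j h1 hk h2 h3.
  have [_ _ g2] := jet_bound (jet_mono kk1 Jf) h1 h2 h3.
  have g3 := TA_scal eps (g2 i j); rewrite Rabs_pos_eq // in g3.
  by apply: TA_ext (TA_add g1 g3) => x; rewrite HddFh0 /ddH; ring.
have HMs i j : Rabs (M i j) <= C0.
  by rewrite /C0; have := absM_ge M i j; have := absM0 L; lra.
have HL i j : Rabs (L i j) <= C0.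
  by rewrite /C0; have := absM_ge L i j; have := absM0 M; lra.
have Hsmall : kap3 + 3 * INR n ^ 2 * kap * (C0 + 1) <= / (2 * INR n ^ 2 * C0).
  rewrite -/N -/kap4 /kap3; have -> : Ch * kap + eps * Cf + 3 * N ^ 2 * kap * (C0 + 1) = kap * D1 + eps * Cf by rewrite /D1; ring.
  lra.
(* Both initial errors are at most [eps * Cf], while the invariant allows [er / lam0] for the energy
   and [er] for the velocity. *)
pose er := eps * lam0 * Cf.
have er0 : 0 <= er by apply: Rmult_le_pos => //; apply: Rmult_le_pos; lra.
have EA : Asum n kap C0 lam0 er = KA1 * eps by rewrite /Asum /er /KA1 /cst; ring.
have E2A : 2 * (KA1 * eps) = KA * eps by rewrite /KA; ring.
have z0 s (g : vec n -> R) (B : R) : 0 <= B -> (forall x, g x = 0) -> TA s g B.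
  by move=> B0 hg; apply: TA_le (TA_ext hg (TA_zero n s)) B0.
(* The unperturbed torus [p = 0], in the identical parametrization. *)
pose St0 : ('I_n -> vec n -> R) * ('I_n -> vec n -> R) * ('I_n -> 'I_n -> vec n -> R) :=
  (fun _ _ => 0, fun _ _ => 0, fun i j _ => del i j).
have A0 : 0 <= Asum n kap C0 lam0 er by rewrite EA; apply: Rmult_le_pos.
have inv0 : inv_at w0 H dH kap C0 Q lam0 cc S er 0 St0.
  have U0 : 0 <= Uj n kap C0 lam0 er 0 by rewrite /Uj /=; lra.
  have emb0 x : emb (fun _ _ => 0) (fun _ _ => 0) x = (vzero n, fun i => x i + 0) by [].
  have hS : 0 <= S <= S by lra.
  have hk : 0 <= kap by lra.
  have [b1 b2 _] := jet_bound (jet_mono kk1 Jf) hS (P := fun _ _ => 0) (u := fun _ _ => 0) (fun i => z0 _ _ _ hk (fun _ => erefl)) (fun i => z0 _ _ _ hk (fun _ => erefl)).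
  split.
  - by split=> [i|i|i j]; apply: z0 => // x /=; ring.
  - split.
      exists (Fh (vzero n, vzero n)); have h := TA_scal eps b1; rewrite Rabs_pos_eq // in h.
      apply: TA_le (TA_ext _ h) _ => [x|]; first by rewrite /H /= emb0 HFh0; ring.
      by rewrite /ej /lamj /er /=; right; field; lra.
    move=> i; have h := TA_scal eps (b2 i); rewrite Rabs_pos_eq // in h.
    apply: TA_le (TA_ext _ h) _ => [x|].
      by rewrite /= (rsum_dell (fun j => dH j (emb (fun _ _ => 0) (fun _ _ => 0) x)) i) /dH emb0 HdFh0; ring.
    rewrite /ej /er /= Rdiv_1_r; have := Rmult_le_compat_r _ _ _ eCf lam01; lra.
  - exists (fun _ _ _ => 0), 0, (fun _ => 0), (fun _ => 0), (fun _ _ => 0), 0; split.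
    + by split; [lra | move=> i; apply: grad_zero].
    + move=> i j x /=; rewrite -[RHS](mmul_dell (@del n) i j); apply: mmul_ext => // a b; ring.
    + exact: TA_zero.
    + exact: grad_zero.
    + by move=> i x /=; rewrite rsum_0; [ring | move=> l; ring].
have Hsj j : S / 2 <= sj Q cc S j.
  have E i : sj Q cc S i.+1 = S - sum_f_R0 (fun j => 3 * cc / Q j) i.
    by elim: i => [|i IH]; [rewrite /= /dlj /Rdiv; ring | rewrite tech5 [LHS]/= -/(sj Q cc S i.+1) IH /dlj /Rdiv; ring].
  by case: j => [|j]; [rewrite /=; lra | rewrite E; have := Hsum j; lra].
have xc1 : exp (- cc) <= / 128.
  by apply: Rle_trans exp_cc _; apply: Rinv_le_contravar; rewrite /cc; lra.
have xc2 : Cst n kap C0 * exp (- cc) <= / 32.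
  rewrite -/cst; apply: (Rle_trans _ (cst * / cc)); first by apply: Rmult_le_compat_l => //; lra.
  have -> : cst * / cc = / 128 by rewrite /cc; field; lra.
  lra.
have As1 : Asum n kap C0 lam0 er <= / 64 by rewrite EA; lra.
have As2 : 2 * Asum n kap C0 lam0 er <= kap by rewrite EA; lra.
have cc1 : 1 <= cc by rewrite /cc; lra.
have hSS : 0 < S <= S by lra.
have [Sq [Sq0 HSq]] := iteration N1 kap01 kap30 C01 HT HT' HM HMs HL HML Hsmall lam01 er0 cc1 Q1 Qlam
  (fun j => proj1 (HPs j)) (fun j => proj2 (HPs j)) Hnr HQk hSS Hsj xc1 xc2 As1 As2 inv0.
have down (s' s : R) g B : s' <= s -> TA s g B -> TA s' (g : vec n -> R) B by apply: TA_mono.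
set A := Asum n kap C0 lam0 er in A0 As1 As2.
have p4 j : 0 < 4 ^ j by apply: pow_lt; lra.
have Hb j : bounded_state (S / 2) kap (Sq j).1.1 (Sq j).1.2 (Sq j).2.
  have [[[b1 b2 b3] _ _] _] := HSq j.
  have Uk : Uj n kap C0 lam0 er j <= kap.
    have h : 0 <= (/ 2) ^ j by apply: pow_le; lra.
    by rewrite /Uj -/A; nra.
  by split=> [i|i|i l]; apply: TA_le _ Uk; [apply: down (b1 i) | apply: down (b2 i) | apply: down (b3 i l)].
have e4 j : ej er j <= er / 4 ^ j.
  apply: Rmult_le_compat_l => //; apply: Rinv_le_contravar => //; apply: pow_incr; lra.
have Hd j : defect H dH w0 (S / 2) (er / 4 ^ j) (er / 4 ^ j) (Sq j).1.1 (Sq j).1.2 (Sq j).2.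
  have [[_ [[c hc] h2] _] _] := HSq j; split.
    exists c; apply: TA_le (down _ _ _ _ (Hsj j) hc) _; apply: Rle_trans (e4 j).
    have l1 := lamj_ge1 lam01 j.
    have ej0 : 0 <= ej er j by apply: Rdiv_le_0_compat => //; apply: pow_lt; lra.
    rewrite -[X in _ <= X]Rmult_1_r; apply: Rmult_le_compat_l => //.
    by rewrite -Rinv_1; apply: Rinv_le_contravar; lra.
  by move=> i; apply: TA_le (down _ _ _ _ (Hsj j) (h2 i)) (e4 j).
have Hl j : lagrangian (S / 2) (Sq j).1.1 (Sq j).1.2 (Sq j).2.
  have [[_ _ [du [K [ze [W [dW [B [a1 a2 a3 a4 a5]]]]]]]] _] := HSq j.
  by exists du, K, ze, W, dW, B; split => //; apply: down a3.
have Hcl j := proj2 (HSq j).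
have Hlip : forall (p q v w : vec n) d, 0 <= d <= kap -> (forall i, Rabs (p i) <= kap) ->
  (forall i, Rabs (v i) <= d) -> (forall i, Rabs (w i) <= d) ->
  Rabs (H (fun i => p i + v i, fun i => q i + w i) - H (p, q)) <= (Ch + eps * Cf) * d /\
  forall j, Rabs (dH j (fun i => p i + v i, fun i => q i + w i) - dH j (p, q)) <= (Ch + eps * Cf) * d.
  exact: jet_lip J.
have S2 : 0 < S / 2 by lra.
have [ui [Pi [Gi [du [dP [K [[K0 hu hP hG] [gu gP] en vel [gdu sym]]]]]]]] :=
  torus_limit Hlip S2 A0 As2 Hb Hd Hl
    (fun j i => let: And3 h _ _ := Hcl j in down _ _ _ _ (Hsj j.+1) (h i))
    (fun j i => let: And3 _ h _ := Hcl j in down _ _ _ _ (Hsj j.+1) (h i))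
    (fun j i l => let: And3 _ _ h := Hcl j in down _ _ _ _ (Hsj j.+1) (h i l)).
rewrite Sq0 /= in hu hP hG; rewrite /A EA E2A in hu hP hG.
have {}hu i : TA (S / 2) (ui i) (KA * eps) by apply: TA_ext (hu i) => x; ring.
have {}hP i : TA (S / 2) (Pi i) (KA * eps) by apply: TA_ext (hP i) => x; ring.
have C110 : 0 <= Ch + eps * Cf by lra.
have s20 : 0 <= S / 2 by lra.
exists ui, Pi; split.
- by move=> i x; apply: (TA_sup s20 x (hu i)).
- by move=> i x; apply: (TA_sup s20 x (hP i)).
- move=> D HD; apply: (torus_embedded S2 hu hP K0 gu gdu _ HD).
  apply: (Rle_lt_trans _ (2 * PI / (S / 2) * (S / (8 * PI)))).
    by apply: Rmult_le_compat_l; [apply: Rlt_le; apply: Rdiv_lt_0_compat; lra | lra].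
  have -> : 2 * PI / (S / 2) * (S / (8 * PI)) = / 2 by field; lra.
  lra.
- by apply: (torus_invariant kap_pos C110 (jet_C11 J) S2 hP hG K0 gu gP en vel gdu sym); rewrite -?/N; lra.
Qed.

End KamFamily.

(** * Inversion of the Hessian *)

Module LinearAlgebra.
Import ssralg matrix mxalgebra.

(** Injectivity of [v -> M v] is row-freeness of the transpose. The module confines the imports of
    matrix algebra. *)
Lemma injective_inverse n (M : 'I_n -> 'I_n -> R) :
  (forall v : vec n, (forall i, rsum (fun j => M i j * v j) = 0) -> forall j, v j = 0) ->
  exists L, forall i j, mmul M L i j = del i j.
Proof.
move=> inj; pose A := (\matrix_(i < n, j < n) (M i j : R))%R.
have Au : A \in unitmx.
  rewrite -unitmx_tr -row_free_unit; apply: inj_row_free => v /matrixP hv.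
  have h0 j : v ord0 j = 0.
    apply: (inj (fun j => v ord0 j)) => i; have := hv ord0 i; rewrite !mxE => h; apply: (eq_trans _ h).
    by apply: eq_bigr => l _; rewrite !mxE; apply: Rmult_comm.
  by apply/matrixP => i j; rewrite (ord1 i) h0 mxE.
exists (fun i j => invmx A i j) => i j.
have /matrixP /(_ i j) := mulmxV Au; rewrite !mxE => h.
have -> : del i j = ((i == j)%:R)%R by rewrite /del; case: (i == j).
by rewrite -h; apply: eq_bigr => l _; rewrite mxE.
Qed.
End LinearAlgebra.

Lemma has_partial_local n (g g' : vec n -> R) i x l r : 0 < r ->
  (forall y, in_ball x r y -> g y = g' y) -> has_partial g i x l -> has_partial g' i x l.
Proof.
move=> r0 E H e e0; have [d Hd] := H e e0.
have dm : 0 < Rmin d r by apply: Rmin_glb_lt; [exact: cond_pos | ].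
exists (mkposreal _ dm) => t t0 /= ht.
have h1 := Rmin_l d r; have h2 := Rmin_r d r.
have B s : Rabs s < r -> in_ball x r (vadd x (vscal s (ebasis i))).
  move=> hs j; rewrite /vadd /vscal /ebasis (_ : _ - _ = s * (if j == i then 1 else 0)); last ring.
  by case: (j == i); rewrite ?Rmult_1_r // Rmult_0_r Rabs_R0.
rewrite -!E; [apply: Hd => //; lra | apply: B; rewrite Rabs_R0 // | apply: B; rewrite Rplus_0_l; lra].
Qed.

Theorem theorem1 (n : nat) (hn : (2 <= n)%nat)
  (D : vec n -> Prop) (h : vec n -> R) (f : vec n -> vec n -> R) (w0 : vec n) :
  is_domain D -> D (vzero n) ->
  (forall i : 'I_n, (nat_of_ord i = 0%nat -> w0 i = 1) /\
                    (nat_of_ord i <> 0%nat -> -1 <= w0 i <= 1)) ->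
  (forall i, has_partial h i (vzero n) (w0 i)) ->
  nondegenerate_at0 h ->
  analytic_near h (closure D) ->
  periodic_q f ->
  analytic2_near f (closure D) ->
  BR w0 ->
  exists eps0, 0 < eps0 /\
  exists P Q : R -> vec n -> vec n,
    (forall eps, 0 <= eps < eps0 ->
       torus_embedding D (P eps) (Q eps) /\
       invariant_quasi_periodic (fun p q => h p + eps * f p q) w0 (P eps) (Q eps)) /\
    (forall delta, 0 < delta -> exists eta, 0 < eta /\
       forall eps, 0 <= eps < eta -> eps < eps0 ->
         forall th i, Rabs (P eps th i) < delta /\ Rabs (Q eps th i - th i) < delta).
Proof.
move=> [Dopen _] D0 Hw Hgrad [rd [dh [M [rd0 [Hdh [HM inj]]]]]] han fper fan [nr [Psi [HPsi [Lb HI]]]].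
have n0 : (0 < n)%N by apply: leq_trans hn.
have N1 : 1 <= INR n by apply: (le_INR 1); apply/leP.
pose i0 := Ordinal n0; have w1 : w0 i0 = 1 by apply: (proj1 (Hw i0)).
have cl0 : closure D (vzero n) by move=> r r0; exists (vzero n); split => // i; rewrite Rminus_diag Rabs_R0.
have han0 : analytic_at h (vzero n) by case: han => U [_ [h1 h2]]; apply: h2; apply: h1.
have fan0 q : analytic2_at f (vzero n) q by case: fan => U [_ [h1 h2]]; apply: h2; apply: h1.
have [rf [s [Bf [rf0 s0 HFf]]]] := analytic_HF n0 fper fan0.
have [rh [Bh [rh0 HFh]]] := analytic_HF_p han0.
pose r := Rmin rf rh; have r0 : 0 < r by apply: Rmin_glb_lt.
have [r1 r2] : r <= rf /\ r <= rh by split; [apply: Rmin_l | apply: Rmin_r].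
have pi0 := PI_RGT_0.
have [kap [k0 k1 k2 k3 _]] := @Rmin_pos5 1 (r / 16) (s / (4 * PI)) 1 1 ltac:(lra) ltac:(lra) ltac:(by apply: Rdiv_lt_0_compat; lra) ltac:(lra) ltac:(lra).
have k01 : 0 < kap <= 1 by lra.
have ks : 4 * PI * kap <= s.
  have -> : s = 4 * PI * (s / (4 * PI)) by field; lra.
  by apply: Rmult_le_compat_l; lra.
have rr : 0 <= r <= rf /\ 0 <= r <= rh by lra.
have [Cf [dFf [dqf [ddFf [Cf0 [Jf _]]]]]] := HF_jet r0 s0 k01 k2 ks (HF_mono (proj1 rr) (Rle_refl s) HFf).
have [Ch [dFh [dqh [ddFh [Ch0 [Jh Hhess]]]]]] := HF_jet r0 s0 k01 k2 ks (HF_mono (proj2 rr) (Rle_refl s) (HFh s)).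
have zk j : Rabs (vzero n j) <= kap by rewrite /vzero Rabs_R0; lra.
have Hp (p q : vec n) i : (forall i, Rabs (p i) <= kap) -> has_partial h i p (dFh i (p, q)).
  by move=> hp; exact: (partial_p k0 Ch0 (jet_C11 Jh) q i hp).
have HdFh0 q i : dFh i (vzero n, q) = w0 i by exact: uniqueness_limite (Hp _ q i zk) (Hgrad i).
(* The Hessian of the expansion is the given [M] by uniqueness of derivatives; [dFh] and [dh] agree
   only near 0, hence the localization. *)
have HddFh0 q i j : ddFh i j (vzero n, q) = M i j.
  pose rm := Rmin rd kap; have rm0 : 0 < rm by apply: Rmin_glb_lt.
  have E y : in_ball (vzero n) rm y -> dFh i (y, q) = dh i y.
    move=> hy; have h1 := Rmin_l rd kap; have h2 := Rmin_r rd kap.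
    have hk l : Rabs (y l) <= kap by have := hy l; rewrite /vzero Rminus_0_r -/rm in h1 h2 *; lra.
    apply: uniqueness_limite (Hp y q i hk) (Hdh i y _).
    by move=> l; have := hy l; rewrite -/rm in h1 h2 *; lra.
  exact: uniqueness_limite (has_partial_local rm0 E (Hhess i j q)) (HM i j).
have [L HML] := LinearAlgebra.injective_inverse inj.
have HBR c sigma : 0 < c -> 0 < sigma -> exists lam0 (Q Ps : nat -> R),
  [/\ 1 <= lam0, forall j, 1 <= Q j, forall j, Q j <= lam0 * 2 ^ j,
      forall j, 0 <= Ps j /\ Q j * Ps j <= lam0 * 2 ^ j &
      (forall j (k : 'I_n -> Z), 0 < knorm k -> knorm k <= Q j -> / Rabs (kdot k w0) <= Ps j) /\
      forall J, sum_f_R0 (fun j => c / Q j) J <= sigma].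
  move=> c0 sg0; have [lam0 [Q [l1 Q1 Q2 Q3 Q4]]] := BR_sequence w1 HPsi HI c0 sg0.
  exists lam0, Q, (fun j => Psi (Q j)); split => //.
    by move=> j; split => //; have := Psi_ge1 w1 HPsi (Q1 j); lra.
  by split => // j k hk; apply: Psi_bound.
have s20 : 0 < s / 2 by lra.
have [e1 [KA [e10 KA0 Hkam]]] := kam_family N1 k01 s20 Ch0 Cf0 Jh Jf (fun _ => erefl) HdFh0 HddFh0 HML (nonresonant_kdot nr) HBR.
have [rD [rD0 HD]] := Dopen _ D0.
(* Keeps [KA * eps] below [rD], so that the torus stays in [D]. *)
pose e2 := Rmin e1 (rD / (KA + 1)).
have [e2l e2r] : e2 <= e1 /\ e2 <= rD / (KA + 1) by split; [apply: Rmin_l | apply: Rmin_r].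
have e20 : 0 < e2 by apply: Rmin_glb_lt => //; apply: Rdiv_lt_0_compat; lra.
have small eps b : 0 <= eps -> 0 < b -> eps < b / (KA + 1) -> KA * eps < b.
  move=> e0 b0 he; have : eps * (KA + 1) < b / (KA + 1) * (KA + 1) by apply: Rmult_lt_compat_r; lra.
  have -> : b / (KA + 1) * (KA + 1) = b by field; lra.
  lra.
(* Zero functions are the default outside the range of [eps], so that one family indexed by all
   reals can be chosen. *)
have [uP HuP] := choiceE (P := fun eps (z : ('I_n -> vec n -> R) * ('I_n -> vec n -> R)) => 0 <= eps < e2 ->
  [/\ forall i x, Rabs (z.1 i x) <= KA * eps, forall i x, Rabs (z.2 i x) <= KA * eps,
      torus_embedding D (fun x i => z.2 i x) (fun x i => x i + z.1 i x) &
      invariant_quasi_periodic (fun p q => h p + eps * f p q) w0 (fun x i => z.2 i x) (fun x i => x i + z.1 i x)])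
  ltac:(move=> eps; case: (excluded_middle_informative (0 <= eps < e2)) => he;
    [have [u [P [b1 b2 b3 b4]]] := Hkam eps ltac:(lra); exists (u, P) => _; split => //; apply: b3 => p hp; apply: HD => i;
     rewrite /vzero Rminus_0_r; apply: Rle_lt_trans (hp i) (small eps rD _ rD0 _); lra
    | by exists (fun _ _ => 0, fun _ _ => 0)]).
exists e2; split => //.
exists (fun eps x i => (uP eps).2 i x), (fun eps x i => x i + (uP eps).1 i x); split.
  by move=> eps he; have [_ _ h3 h4] := HuP eps he.
move=> delta d0; exists (delta / (KA + 1)); split; first by apply: Rdiv_lt_0_compat; lra.
move=> eps [he0 he1] he2 th i; have [b1 b2 _ _] := HuP eps (conj he0 he2).
have hs := small eps delta he0 d0 he1.
split; first exact: Rle_lt_trans (b2 i th) hs.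
rewrite (_ : _ - _ = (uP eps).1 i th); last ring.
exact: Rle_lt_trans (b1 i th) hs.
Qed.
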